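(* Let $f:M\to\mathbb{R}$ be a Morse-Bott function on a compact smooth manifold $M$ with connected critical submanifolds $C_1,\ldots,C_l$ ordered by height, i.e. such that $f(C_i)\le f(C_j)$ whenever $i\le j$, and let the Riemannian metric on $M$, the Morse-Smale functions $f_j:C_j\to\mathbb{R}$ and the Morse-Smale function $h=f+\varepsilon\sum_{j=1}^{l}\rho_jf_j:M\to\mathbb{R}$ be obtained from $f$ by the perturbation construction described in the context, with Morse-Smale-Witten boundary operators $\partial_*^{f_j}$ and $\partial_*^h$. If $\alpha$ is a non-zero element in $\ker\partial_*^h$, then the top part of $\alpha$ is a non-zero element in the kernel of $\partial_*^{f_j}$ for some $j$. That is, if $0\neq\alpha\in\ker\partial_n^h$ is written uniquely as $\alpha=\alpha_{j_1}+\cdots+\alpha_{j_r}$ with $j_1<\cdots<j_r$ and $\alpha_{j_i}\in C_{k_i}(f_{j_i})-\{0\}$, where $\lambda_{j_i}+k_i=n$, then $\alpha_{j_r}\in\ker\partial_{k_r}^{f_{j_r}}$, where $\lambda_{j_r}+k_r=n$.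
   Context: **Morse-Bott functions.** Manifolds are without boundary. Let $M$ be a compact smooth manifold of dimension $m$. A smooth $f:M\to\mathbb{R}$ is Morse-Bott if $\mathrm{Cr}(f)=\coprod_{j=1}^{l}C_j$ is a disjoint union of connected submanifolds and for every $p\in C_j$ the Hessian of $f$ at $p$ induces a non-degenerate bilinear form on the normal space $\nu_pC_j$; its index, constant on $C_j$, is the Morse-Bott index $\lambda_j$. By the Morse-Bott Lemma, around each $p\in C_j$ there is a chart of $M$ and a local splitting $\nu_*C_j=\nu_*^-C_j\oplus\nu_*^+C_j$ giving coordinates $(u,v,w)$, $u\in C_j$, $v\in\nu_*^-C_j$, $w\in\nu_*^+C_j$, in which $f=f(C_j)-|v|^2+|w|^2$. **Morse-Smale-Witten complex.** Let $g:N\to\mathbb{R}$ be a Morse function on a compact Riemannian manifold $N$ and let $\varphi_t$ be the flow of $-\nabla g$. For a critical point $p$ put $W^s(p)=\{x\mid\lim_{t\to\infty}\varphi_t(x)=p\}$ and $W^u(p)=\{x\mid\lim_{t\to-\infty}\varphi_t(x)=p\}$; the index of $p$ is $\dim W^u(p)$. $g$ is Morse-Smale if all stable and unstable manifolds intersect transversally. Gradient flow lines are flow lines of $-\nabla g$. For critical points $q,p$ with index of $q$ equal to index of $p$ plus one, there are finitely many gradient flow lines from $q$ to $p$. If $N$ is oriented and orientations of all unstable manifolds are chosen (which induces orientations of the stable manifolds), $n(q,p)\in\mathbb{Z}$ is the number of gradient flow lines from $q$ to $p$ counted with the signs determined by the orientations; in general $n(q,p)\in\mathbb{Z}_2$ is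 the number of such flow lines mod $2$. $C_k(g)$ is the free abelian group generated by the critical points of index $k$ (tensored with $\mathbb{Z}_2$ when $n(q,p)\in\mathbb{Z}_2$), and $\partial_k^g:C_k(g)\to C_{k-1}(g)$ is $\partial_k^g(q)=\sum_{p\in Cr_{k-1}(g)}n(q,p)\,p$, where $Cr_{k-1}(g)$ is the set of critical points of index $k-1$. Below, integer coefficients are used when $M$ and all the $C_j$ are oriented; otherwise $\mathbb{Z}_2$ coefficients are used throughout. In the case of integer coefficients the orientations of $C_j$ and of the unstable manifolds of $f_j$ are assumed to be chosen appropriately, i.e. suitably in relation to the orientations used for $h$. **Perturbation construction.** Write $\mathrm{var}(f,T)=\sup_Tf-\inf_Tf$. Choose tubular neighborhoods $T_j$ of $C_j$ with coordinates $(u,v,w)$ consistent with those of the Morse-Bott Lemma, small enough that: each $T_j$ is contained in the union of the domains of the Morse-Bott charts; $T_i\cap T_j=\emptyset$ for $i\ne j$; $f$ decreases by at least $3\max_j\mathrm{var}(f,T_j)$ along any gradient flow line from $T_i$ to $T_j$, $i\neq j$; and $\mathrm{var}(f,T_i)+\mathrm{var}(f,T_j)<\frac13|f(C_i)-f(C_j)|$ whenever $f(C_i)\ne f(C_j)$. Pick a Riemannian metric on $M$ for which the Morse-Bott charts are isometries with respect to the standard Euclidean metric on $\mathbb{R}^m$, and pick positive Morse functions $f_j:C_j\to\mathbb{R}$ that are Morse-Smale with respect to the restricted metric. Extend $f_j$ to $T_j$ to be constant in the $v,w$ coordinates. Let $\tilde T_j\subset T_j$ be a smaller tubular neighborhood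 of $C_j$ with the same coordinates, and let $\rho_j$ be a smooth nonincreasing bump function, constant in the $u$ coordinates, equal to $1$ on $\tilde T_j$ and $0$ outside $T_j$. Choose $\varepsilon>0$ so small that $\sup_{T_j-\tilde T_j}\varepsilon\|\nabla(\rho_jf_j)\|<\inf_{T_j-\tilde T_j}\|\nabla f\|$ for all $j$, and put $h=f+\varepsilon\sum_{j=1}^{l}\rho_jf_j$. Finally perturb the Riemannian metric outside $\bigcup_jT_j$ so that $h$ is Morse-Smale with respect to the perturbed metric, which is the metric used for $h$ (and, by restriction, for each $f_j$). The following conditions hold: (1) $\nabla f=\nabla h$ outside $\bigcup_jT_j$, and if $f(C_i)\le f(C_j)$ with $i\ne j$, there are no gradient flow lines of $h$ from $C_i$ to $C_j$. (2) The Morse-Bott charts are isometries between the metric on $M$ and the Euclidean metric. (3) In the coordinates $(u,v,w)$ on $T_j$, $f=f(C_j)-|v|^2+|w|^2$, $\rho_j$ depends only on $v,w$, and $f_j$ only on $u$; in particular $\nabla f\perp\nabla f_j$ on $T_j$. (4) $h=f+\varepsilon f_j$ on $\tilde T_j$. (5) $\nabla f$ dominates $\varepsilon\nabla(\rho_jf_j)$ on $T_j-\tilde T_j$ in the sense of the inequality above. (6) $h$ and all $f_j$ are Morse-Smale. (7) The critical points of $h$ are exactly the critical points of the $f_j$; a critical point of $f_j$ of index $k$ is a critical point of $h$ of index $\lambda_j+k$; hence $C_n(h)=\bigoplus_{\lambda_j+k=n}C_k(f_j)$ for $n=0,\ldots,m$. **Top part.** For $\alpha\in C_n(h)$, $\alpha_j$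 denotes the chain obtained from $\alpha$ by retaining only those critical points belonging to $C_j$. By (7), any $\alpha\ne0$ in $C_n(h)$ can be written uniquely as $\alpha=\alpha_{j_1}+\cdots+\alpha_{j_r}$ with $j_1<\cdots<j_r$ and $\alpha_{j_i}\in C_{k_i}(f_{j_i})-\{0\}$, $\lambda_{j_i}+k_i=n$. The chain $\alpha_{j_r}$ is called the top part of $\alpha$. *)

(* Defs.v *)
From HB Require Import structures.
From mathcomp Require Import all_boot all_order all_algebra.
From mathcomp Require Import boolp classical_sets functions cardinality fsbigop.
From mathcomp Require Import reals ereal topology normedtype derive.

Set Implicit Arguments.
Unset Strict Implicit.
Unset Printing Implicit Defensive.

Import Order.TTheory GRing.Theory Num.Theory.
Import numFieldNormedType.Exports.

Local Open Scope classical_set_scope.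
Local Open Scope ring_scope.

(** Points of R^m are row vectors and linear maps act on the right:
    v |-> v *m A. *)

Fixpoint Ck (R : realType) (V W : normedModType R) (k : nat)
    (U : set V) (F : V -> W) : Prop :=
  if k is k'.+1 then
    (forall x, U x -> differentiable F x) /\ (forall v, Ck k' U ('D_v F))
  else forall x, U x -> {for x, continuous F}.

Definition smooth_on (R : realType) (V W : normedModType R)
    (U : set V) (F : V -> W) : Prop := forall k, Ck k U F.

(** A chart is a homeomorphism from the open set [cdom] onto an open subset of
    R^m. [cmap] and [cinv] are total functions; their values are only
    meaningful on [cdom] and on [cimg]. *)
Record chart (R : realType) (m : nat) (T : topologicalType) := Chart {
  cdom : set T;
  cmap : T -> 'rV[R]_m;
  cinv : 'rV[R]_m -> T;
  cdom_open : open cdom;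
  cimg_open : open (cmap @` cdom);
  cmapK : forall x, cdom x -> cinv (cmap x) = x;
  cmap_continuous : forall x, cdom x -> {for x, continuous cmap};
  cinv_continuous : forall y, (cmap @` cdom) y -> {for y, continuous cinv} }.

Definition cimg (R : realType) (m : nat) (T : topologicalType)
  (phi : chart R m T) : set 'rV[R]_m := cmap phi @` cdom phi.

Definition chart_compatible (R : realType) (m : nat) (T : topologicalType)
    (phi psi : chart R m T) : Prop :=
  smooth_on (cmap phi @` (cdom phi `&` cdom psi)) (cmap psi \o cinv phi).

(** [chart_at x] is a preferred chart around [x]. It trivialises the tangent
    space: T_x M is the space 'rV_m of coordinates in the chart [chart_at x]. *)
Record manifold (R : realType) (m : nat) := Manifold {
  carrier :> topologicalType;
  carrier_hausdorff : hausdorff_space carrier;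
  carrier_second_countable : @second_countable carrier;
  atlas : set (chart R m carrier);
  chart_at : carrier -> chart R m carrier;
  chart_at_atlas : forall x, atlas (chart_at x);
  chart_at_dom : forall x, cdom (chart_at x) x;
  atlas_compatible : forall phi psi,
    atlas phi -> atlas psi -> chart_compatible phi psi }.

Section OneManifold.
Context {R : realType} {m : nat} {M : manifold R m}.
Implicit Types (x y p q : M) (W : set M) (phi : chart R m M) (g : M -> R).
Implicit Types (c : R -> M) (G : M -> 'M[R]_m).

(** Membership in the maximal atlas. *)
Definition smooth_chart phi : Prop :=
  forall psi, atlas psi -> chart_compatible phi psi /\ chart_compatible psi phi.

Definition smooth_fun g : Prop :=
  forall phi, atlas phi -> smooth_on (cimg phi) (g \o cinv phi).

Definition smooth_curve c : Prop :=
  continuous c /\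
  forall phi, atlas phi -> smooth_on (c @^-1` cdom phi) (cmap phi \o c).

(** Maps coordinates of a tangent vector at [x] in the chart [phi] to its
    coordinates in the preferred chart; row [i] is the vector d/dphi_i at [x]. *)
Definition chart_frame phi x : 'M[R]_m :=
  'J (cmap (chart_at x) \o cinv phi) (cmap phi x).

Definition velocity c t : 'rV[R]_m :=
  ((fun s : R => cmap (chart_at (c t)) (c s))^`())%classic t.

(** The row of partial derivatives, i.e. the covector dg_x. *)
Definition dfun g x : 'rV[R]_m :=
  \row_i 'D_(delta_mx 0 i) (g \o cinv (chart_at x)) (cmap (chart_at x) x).

Definition crit g : set M := [set x | dfun g x = 0].

(** Only meaningful at critical points, where it does not depend on the chart
    up to congruence. *)
Definition hess g x : 'M[R]_m :=
  \matrix_(i, j) 'D_(delta_mx 0 i)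
    ('D_(delta_mx 0 j) (g \o cinv (chart_at x))) (cmap (chart_at x) x).

(** The Gram matrix of [G] at [x] in the chart [phi]. *)
Definition chart_metric G phi x : 'M[R]_m :=
  chart_frame phi x *m G x *m (chart_frame phi x)^T.

Definition inner G x (v w : 'rV[R]_m) : R := (v *m G x *m w^T) 0 0.

Definition gnorm G x (v : 'rV[R]_m) : R := Num.sqrt (inner G x v v).

Definition riemannian G : Prop :=
  [/\ forall x, (G x)^T = G x,
      forall x v, v != 0 -> 0 < inner G x v v
    & forall phi, atlas phi ->
        smooth_on (cimg phi) (fun z => chart_metric G phi (cinv phi z))].

(** The vector v with <v, w> = dg_x(w) for all w. *)
Definition grad G g x : 'rV[R]_m := dfun g x *m invmx (G x).

Definition slice_chart W k phi : Prop :=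
  [/\ smooth_chart phi, (k <= m)%N &
      forall y, cdom phi y ->
        (W y <-> forall i : 'I_m, (k <= i)%N -> cmap phi y 0 i = 0)].

Definition submanifold W k : Prop :=
  forall x, W x -> exists phi, cdom phi x /\ slice_chart W k phi.

Definition tangent W x (v : 'rV[R]_m) : Prop :=
  exists c, [/\ smooth_curve c, forall t, W (c t), c 0 = x & velocity c 0 = v].

Definition frame W k x (B : 'M[R]_(k, m)) : Prop :=
  row_free B /\ forall v, tangent W x v <-> (v <= B)%MS.

(** [o k x B] says whether the k-frame [B] at [x] is positively oriented. The
    size [k] is an argument so that frames of size [k1 + k2 = k] need no cast. *)
Definition frame_sign := forall k, M -> 'M[R]_(k, m) -> bool.

(** An orientation of the k-dimensional submanifold [W]. The rows of
    [pid_mx k *m chart_frame phi y] are the first [k] coordinate vectors of the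
    slice chart [phi]. For [k = 0] this is a sign at each point. *)
Definition orientation W k (o : frame_sign) : Prop :=
  (forall x B (P : 'M[R]_k), W x -> frame W x B -> P \in unitmx ->
     o k x (P *m B) = o k x B (+) (\det P < 0)) /\
  (forall phi x, slice_chart W k phi -> W x -> cdom phi x ->
     \forall y \near x, W y ->
       o k y (pid_mx k *m chart_frame phi y) =
       o k x (pid_mx k *m chart_frame phi x)).

Definition grad_eq_at G g c t : Prop :=
  [/\ {for t, continuous c},
      derivable (fun s : R => cmap (chart_at (c t)) (c s)) t 1
    & velocity c t = - grad G g (c t)].

(** Only the half of the trajectory through [x] that matters is required; the
    values of [c] on the other half-line are irrelevant. *)
Definition Wu G g p : set M :=
  [set x | exists c, [/\ c 0 = x, forall t, t <= 0 -> grad_eq_at G g c t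
                       & c t @[t --> -oo] --> p]].

Definition Ws G g p : set M :=
  [set x | exists c, [/\ c 0 = x, forall t, 0 <= t -> grad_eq_at G g c t
                       & c t @[t --> +oo] --> p]].

Definition flow_curve G g c : Prop := forall t, grad_eq_at G g c t.

(** A flow line is an integral curve up to reparametrisation, i.e. an orbit. *)
Definition flow_lines G g q p : set (set M) :=
  [set L | exists c, [/\ flow_curve G g c, c t @[t --> -oo] --> q,
                         c t @[t --> +oo] --> p & L = range c]].

Definition index_is G g p k : Prop := crit g p /\ submanifold (Wu G g p) k.

Definition morse g : Prop :=
  smooth_fun g /\ forall p, crit g p -> hess g p \in unitmx.

Definition morse_smale G g : Prop :=
  morse g /\
  forall p q x, crit g p -> crit g q -> Wu G g q x -> Ws G g p x ->
    forall v : 'rV[R]_m, exists a b,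
      [/\ tangent (Wu G g q) x a, tangent (Ws G g p) x b & v = a + b].

(** Elements of C_k(g), as finitely supported coefficient functions. *)
Definition is_chain (K : nzRingType) G g k (a : M -> K) : Prop :=
  finite_set [set p | a p <> 0] /\ forall p, a p <> 0 -> index_is G g p k.

(** The coefficient at [p] of the image of [a] under the k-th boundary operator
    defined by the incidence numbers [nu q p]. *)
Definition boundary (K : nzRingType) G g (nu : M -> M -> K) k
    (a : M -> K) p : K :=
  if `[< exists k', k = k'.+1 /\ index_is G g p k' >] then
    \sum_(q \in [set q | index_is G g q k]) a q * nu q p
  else 0.

Definition nuF2 G g q p : 'F_2 := \sum_(L \in flow_lines G g q p) (1 : 'F_2).

(** Orientations of M and of all unstable manifolds ([ou]), and the orientations
    of the stable manifolds ([os]) that they induce through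
    T_p M = T_p W^s(p) (+) T_p W^u(p). *)
Record complex_orientation G g (oM : frame_sign) (ou os : M -> frame_sign)
    : Prop := ComplexOrientation {
  oM_orientation : orientation [set: M] m oM;
  ou_orientation : forall p k, index_is G g p k ->
    orientation (Wu G g p) k (ou p);
  os_orientation : forall p s k, index_is G g p k -> (s + k = m)%N ->
    orientation (Ws G g p) s (os p);
  os_induced : forall p s k (Bs : 'M[R]_(s, m)) (Bu : 'M[R]_(k, m)),
    index_is G g p k -> (s + k = m)%N ->
    frame (Ws G g p) p Bs -> frame (Wu G g p) p Bu ->
    oM (s + k)%N p (col_mx Bs Bu) = (os p s p Bs == ou p k p Bu) }.

(** At a point x of a flow line from q to p, let Bs be a basis of T_x W^s(p) and
    complete -grad g to a basis (-grad g, Bu) of T_x W^u(q). If both are positive,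
    the sign of the flow line is that of the basis (Bs, Bu) of T_x M. Bases of
    either sign are allowed because a positive one need not exist when
    dim W^s(p) = 0 or dim W^u(q) = 1. *)
Definition flow_positive G g (oM : frame_sign) (ou os : M -> frame_sign)
    q p (L : set M) : Prop :=
  exists x s k (Bs : 'M[R]_(s, m)) (Bu : 'M[R]_(k, m)),
    let Bq := col_mx (- grad G g x) Bu in
    [/\ L x, (s + k = m)%N, frame (Ws G g p) x Bs, frame (Wu G g q) x Bq
      & oM (s + k)%N x (col_mx Bs Bu) = (os p s x Bs == ou q (1 + k)%N x Bq)].

Definition flow_sign G g oM ou os q p (L : set M) : int :=
  if `[< flow_positive G g oM ou os q p L >] then 1 else -1.

Definition nuZ G g oM ou os q p : int :=
  \sum_(L \in flow_lines G g q p) flow_sign G g oM ou os q p L.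

End OneManifold.

Arguments frame_sign {R m} M.

Section TwoManifolds.
Context {R : realType} {d m : nat} {C : manifold R d} {M : manifold R m}.

Definition smooth_map_on (U : set C) (F : C -> M) : Prop :=
  (forall x, U x -> {for x, continuous F}) /\
  forall phi psi, atlas phi -> atlas psi ->
    smooth_on (cmap phi @` (U `&` cdom phi `&` F @^-1` cdom psi))
              (cmap psi \o F \o cinv phi).

Definition mdiff (F : C -> M) (x : C) : 'M[R]_(d, m) :=
  'J (cmap (chart_at (F x)) \o F \o cinv (chart_at x)) (cmap (chart_at x) x).

Definition embedding (iota : C -> M) : Prop :=
  [/\ smooth_map_on setT iota, injective iota,
      forall x, row_free (mdiff iota x)
    & forall U : set C, open U -> exists2 V : set M, open V & iota @^-1` V = U].

Definition pullback_metric (iota : C -> M) (G : M -> 'M[R]_m) (x : C)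
  : 'M[R]_d := mdiff iota x *m G (iota x) *m (mdiff iota x)^T.

(** Extension of a chain on [C] to [M] by zero along an injective [iota]. *)
Definition push (K : nzRingType) (iota : C -> M) (a : C -> K) (p : M) : K :=
  \sum_(x \in [set x | iota x = p]) a x.

End TwoManifolds.

Definition neg_index (R : realType) (m : nat) (H : 'M[R]_m) (k : nat) : Prop :=
  let negdef r (B : 'M[R]_(r, m)) := forall c : 'rV[R]_r, c != 0 ->
    ((c *m B) *m H *m (c *m B)^T) 0 0 < 0 in
  (exists B : 'M[R]_(k, m), negdef k B) /\
  forall r (B : 'M[R]_(r, m)), negdef r B -> (r <= k)%N.

(** Keep the coordinates with index in [a, b[, set the others to 0. *)
Definition block (R : realType) (m : nat) (a b : nat) (y : 'rV[R]_m)
  : 'rV[R]_m := \row_i (if (a <= i < b)%N then y 0 i else 0).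

Definition sqnorm (R : realType) (m : nat) (y : 'rV[R]_m) : R :=
  \sum_i y 0 i ^+ 2.

(** The radical condition says that the form induced by the Hessian on the
    normal space T_p M / T_p C_j is non-degenerate. *)
Record morse_bott (R : realType) (m l : nat) (M : manifold R m) (f : M -> R)
    (d : 'I_l -> nat) (C : forall j, manifold R (d j))
    (iota : forall j, C j -> M) (lam : 'I_l -> nat) : Prop := MorseBott {
  mb_smooth : smooth_fun f;
  mb_embedding : forall j, embedding (iota j);
  mb_nonempty : forall j, [set: C j] !=set0;
  mb_connected : forall j, connected [set: C j];
  mb_disjoint : forall i j (x : C i) (y : C j), iota i x = iota j y -> i = j;
  mb_crit : crit f = \bigcup_j range (iota j);
  mb_nondegenerate : forall j (x : C j) (v : 'rV[R]_m),
    v *m hess f (iota j x) = 0 -> (v <= mdiff (iota j) x)%MS;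
  mb_index : forall j (x : C j), neg_index (hess f (iota j x)) (lam j) }.

Definition ordered_by_height (R : realType) (m l : nat) (M : manifold R m)
    (f : M -> R) (d : 'I_l -> nat) (C : forall j, manifold R (d j))
    (iota : forall j, C j -> M) : Prop :=
  forall i j (x : C i) (y : C j), (i <= j)%N -> f (iota i x) <= f (iota j y).

Section Coordinates.
Context {R : realType} {m d : nat} {M : manifold R m} {C : manifold R d}.
Variables (f : M -> R) (iota : C -> M) (lam : nat).

(** The coordinates (u, v, w) near C are the first [d], the next [lam] and the
    remaining entries of the chart. *)
Definition upart (z : 'rV[R]_m) := block 0 d z.
Definition vpart (z : 'rV[R]_m) := block d (d + lam) z.
Definition wpart (z : 'rV[R]_m) := block (d + lam) m z.

Definition mb_chart (phi : chart R m M) : Prop :=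
  [/\ smooth_chart phi,
      forall y, cdom phi y ->
        (range iota y <-> vpart (cmap phi y) = 0 /\ wpart (cmap phi y) = 0)
    & forall y x, cdom phi y -> f y =
        f (iota x) - sqnorm (vpart (cmap phi y)) + sqnorm (wpart (cmap phi y))].

(** [T] is a tubular neighbourhood of C with projection [pi], with coordinates
    (u, v, w) given by a family [A] of Morse-Bott charts: u is the position of
    the foot point [pi y], and v and w are linear fibre coordinates on the
    negative and positive normal bundles. *)
Record tube (A : set (chart R m M)) (pi : M -> C) (T : set M) : Prop := Tube {
  tube_charts : forall phi, A phi -> mb_chart phi;
  tube_open : open T;
  tube_core : range iota `<=` T;
  tube_cover : T `<=` \bigcup_(phi in A) cdom phi;
  tube_smooth : smooth_map_on T pi;
  tube_retract : forall x, pi (iota x) = x;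
  tube_foot : forall phi y, A phi -> T y -> cdom phi y ->
    cdom phi (iota (pi y)) /\ cmap phi (iota (pi y)) = upart (cmap phi y);
  tube_linear : forall phi psi x, A phi -> A psi ->
    exists P Q : 'M[R]_m, forall y, T y -> cdom phi y -> cdom psi y ->
      pi y = x ->
      vpart (cmap psi y) = vpart (cmap phi y) *m P /\
      wpart (cmap psi y) = wpart (cmap phi y) *m Q;
  tube_star : forall phi y (s : R), A phi -> T y -> cdom phi y ->
    0 <= s <= 1 -> exists z, [/\ T z, cdom phi z & cmap phi z =
      upart (cmap phi y) + s *: (vpart (cmap phi y) + wpart (cmap phi y))] }.

Record bump (A : set (chart R m M)) (T Tt : set M) (rho : M -> R)
    : Prop := Bump {
  bump_smooth : smooth_fun rho;
  bump_range : forall y, 0 <= rho y <= 1;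
  bump_one : forall y, Tt y -> rho y = 1;
  bump_zero : forall y, ~ T y -> rho y = 0;
  bump_const_u : forall phi y z, A phi -> T y -> T z ->
    cdom phi y -> cdom phi z ->
    vpart (cmap phi y) = vpart (cmap phi z) ->
    wpart (cmap phi y) = wpart (cmap phi z) -> rho y = rho z;
  bump_nonincreasing : forall phi y z (s : R), A phi -> T y -> T z ->
    cdom phi y -> cdom phi z -> 0 <= s <= 1 ->
    cmap phi z =
      upart (cmap phi y) + s *: (vpart (cmap phi y) + wpart (cmap phi y)) ->
    rho y <= rho z }.

(** The basis d/dv of the negative normal space at a point of C. *)
Definition vframe (phi : chart R m M) (x : C) : 'M[R]_(lam, m) :=
  (\matrix_(i < lam, a < m) ((a == d + i :> nat)%N)%:R)
    *m chart_frame phi (iota x).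

(** The negative normal space at x is spanned by any [vframe phi x], so it
    suffices to prescribe the sign of the frames [P *m vframe phi x]. *)
Definition nu_orientation (A : set (chart R m M))
    (o : C -> 'M[R]_(lam, m) -> bool) : Prop :=
  forall phi x, A phi -> cdom phi (iota x) ->
    (forall P : 'M[R]_lam, P \in unitmx ->
       o x (P *m vframe phi x) = o x (vframe phi x) (+) (\det P < 0)) /\
    (\forall y \near x, o y (vframe phi y) = o x (vframe phi x)).

End Coordinates.

Definition var (R : realType) (M : Type) (f : M -> R) (T : set M) : R :=
  sup (f @` T) - inf (f @` T).

Unset Implicit Arguments.

Section Perturbation.
Context {R : realType} {m l : nat} {M : manifold R m}.
Context {d : 'I_l -> nat} {C : forall j, manifold R (d j)}.
Variables (f : M -> R).
Variables (iota : forall j, C j -> M) (lam : 'I_l -> nat).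
Variables (A : 'I_l -> set (chart R m M)) (T Tt : 'I_l -> set M).
Variables (pi : forall j, M -> C j).
Variables (fC : forall j, C j -> R) (rho : 'I_l -> M -> R) (eps : R).
Variables (G0 G : M -> 'M[R]_m).

(** [fC j] extended to [T j] constantly in v, w, and cut off by [rho j]. *)
Definition bumped j (y : M) : R := rho j y * fC j (pi j y).

Definition perturbed (y : M) : R := f y + eps * \sum_j bumped j y.

(** [G0] is the metric picked first, and [G] the one obtained from it by the
    final perturbation outside the tubes. The extended suprema and infima make
    [pc_dominate] hold when [T j] equals [Tt j]. *)
Record perturbation : Prop := PerturbationConstruction {
  pc_tube : forall j, tube f (iota j) (lam j) (A j) (pi j) (T j);
  pc_disjoint : forall i j, i != j -> T i `&` T j = set0;
  pc_drop : forall i j (c : R -> M) (s t : R), i != j ->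
    flow_curve G0 f c -> s <= t -> T i (c s) -> T j (c t) ->
    3 * \big[Num.max/0]_k var f (T k) <= f (c s) - f (c t);
  pc_var : forall i j (x : C i) (y : C j), f (iota i x) != f (iota j y) ->
    var f (T i) + var f (T j) < 3^-1 * `|f (iota i x) - f (iota j y)|;
  pc_metric0 : riemannian G0;
  pc_isometry : forall j phi y, A j phi -> cdom phi y ->
    chart_metric G0 phi y = 1%:M;
  pc_positive : forall j x, 0 < fC j x;
  pc_fC : forall j, morse_smale (pullback_metric (iota j) G0) (fC j);
  pc_subtube : forall j, tube f (iota j) (lam j) (A j) (pi j) (Tt j) /\
                         Tt j `<=` T j;
  pc_bump : forall j, bump (d := d j) (lam j) (A j) (T j) (Tt j) (rho j);
  pc_eps : 0 < eps;
  pc_dominate : forall j, (ereal_sup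
      [set (eps * gnorm G0 y (grad G0 (bumped j) y))%:E | y in T j `\` Tt j] <
      ereal_inf [set (gnorm G0 y (grad G0 f y))%:E | y in T j `\` Tt j])%E;
  pc_metric : riemannian G;
  pc_metric_eq : forall j y, T j y -> G y = G0 y;
  pc_morse_smale : morse_smale G perturbed }.

Let h := perturbed.
Let Gc j : C j -> 'M[R]_(d j) := pullback_metric (iota j) G.

(** Cr(h) is the union of the Cr(f_j), and
    C_n(h) is the direct sum of the C_k(f_j) with lam_j + k = n. *)
Definition index_shift : Prop :=
  crit h = \bigcup_j (iota j @` crit (fC j)) /\
  forall j (x : C j) n, crit (fC j) x ->
    (index_is G h (iota j x) n <->
     exists2 k, index_is (Gc j) (fC j) x k & (lam j + k)%N = n).

(** T_q W^u(q; h) = T_q W^u(q; f_j) (+) nu^-_q C_j as oriented vector spaces, for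
    some orientation of each negative normal bundle nu^- C_j. *)
Definition suitable_orientations (ou : M -> frame_sign M)
    (ouC : forall j, C j -> frame_sign (C j)) : Prop :=
  forall j, exists2 o : C j -> 'M[R]_(lam j, m) -> bool,
    nu_orientation (iota j) (A j) o &
    forall x k (B : 'M[R]_(k, d j)) phi,
      index_is (Gc j) (fC j) x k -> frame (Wu (Gc j) (fC j) x) x B ->
      A j phi -> cdom phi (iota j x) ->
      let V := vframe (iota j) (lam j) phi x in
      ou (iota j x) (k + lam j)%N (iota j x)
         (col_mx (B *m mdiff (iota j) x) V) = (ouC j x k x B == o x V).

(** The part alpha_j of a chain on M is [a \o iota j]. *)
Definition top_at {K : nzRingType} (a : M -> K) (j : 'I_l) : Prop :=
  (exists x, a (iota j x) <> 0) /\
  forall i, (exists x, a (iota i x) <> 0) -> (i <= j)%N.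

(** Both forms of the conclusion, for the incidence numbers [nu] of h and [nuC]
    of the f_j: the top part of a non-zero cycle is a non-zero cycle; and the
    last term of any decomposition alpha_{j_1} + ... + alpha_{j_r} is one. *)
Definition top_part_in_kernel {K : nzRingType} (nu : M -> M -> K)
    (nuC : forall j, C j -> C j -> K) : Prop :=
  forall n (a : M -> K), is_chain G h n a -> (exists p, a p <> 0) ->
    (forall p, boundary G h nu n a p = 0) ->
  (exists j, top_at a j /\ exists k,
     [/\ (lam j + k = n)%N, is_chain (Gc j) (fC j) k (a \o iota j)
       & forall x, boundary (Gc j) (fC j) (nuC j) k (a \o iota j) x = 0]) /\
  (forall r (js : 'I_r.+1 -> 'I_l) (ks : 'I_r.+1 -> nat)
      (as_ : forall i, C (js i) -> K),
    (forall i i' : 'I_r.+1, (i < i')%N -> (js i < js i')%N) ->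
    (forall i, [/\ (lam (js i) + ks i = n)%N,
                   is_chain (Gc (js i)) (fC (js i)) (ks i) (as_ i)
                 & exists x, as_ i x <> 0]) ->
    (forall p, a p = \sum_i push (iota (js i)) (as_ i) p) ->
    forall x, boundary (Gc (js ord_max)) (fC (js ord_max))
      (nuC (js ord_max)) (ks ord_max) (as_ ord_max) x = 0).

End Perturbation.

(* Main.v *)
Require Import Defs.
From HB Require Import structures.
From mathcomp Require Import all_boot all_order all_algebra.
From mathcomp Require Import boolp classical_sets functions cardinality fsbigop.
From mathcomp Require Import reals ereal topology normedtype landau derive.
From mathcomp Require Import exp trigo ftc measure lebesgue_measure lebesgue_integral sequences.
From mathcomp Require Import ring lra.
From mathcomp Require Import spectral complex.
From mathcomp Require Import perm.
Set Implicit Arguments.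
Unset Strict Implicit.
Unset Printing Implicit Defensive.

Import Order.TTheory GRing.Theory Num.Theory.
Import numFieldNormedType.Exports.

Local Open Scope classical_set_scope.
Local Open Scope ring_scope.

(** Why the theorem is true. Along a flow line of h the function f does not
    increase: outside the tubes grad h = grad f, between T_j and the smaller tube
    grad f dominates the perturbation, and in the smaller tube, in coordinates
    (u, v, w), grad f and grad h - grad f are orthogonal ([lyapunov]). Hence no
    flow line of h leads from C_i to C_j with i < j, and a flow line from C_j to
    itself keeps f constant, so that it consists of critical points of f and lies
    in C_j ([flow_curve_core]). There h = f + eps f_j, and the flow lines of h
    between critical points of C_j are exactly the flow lines of f_j, run at speed
    eps ([flow_lines_core]). So if j is the highest level on which a cycle alpha
    of h does not vanish, the coefficient of the boundary of alpha at a critical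
    point p of f_j only receives contributions from alpha_j, and these are the
    coefficients of the boundary of alpha_j for f_j ([boundary_top], [top_part]).

    With coefficients in F_2 nothing remains to be shown. With integer
    coefficients the flow lines must also be counted with the same signs
    ([flow_positive_core]). Let W and V be the positive and negative normal
    bundles of C_j. Along the stable manifold of p for f_j the tangent space of
    the stable manifold of p for h is the sum of the tangent space of the former
    and of W ([Ws_frame]): in the tube the flow of h is the product of the flow
    of f_j and of linear flows on the fibres, so that fibre vectors in W shrink
    along a trajectory that stays over a trajectory of f_j ([fibre_disc]).
    Likewise V is added to the unstable manifolds ([Wu_frame]). Consider the
    product of the signs of bases (S), (S, W), (S, U), (S, W, U, V) and (V) of
    the stable manifolds for f_j and h, of C_j, of M and of V, where S is a basis
    of the tangent space of the stable manifold of p in C_j and U completes it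
    to a basis of the tangent space of C_j. It does not depend on the bases
    ([rho_indep]), it is
    locally constant ([rho_locally]), and at p itself it is positive, because
    the orientations of stable manifolds are induced from those of the unstable
    ones ([rho_critical]); hence it is positive along the whole stable manifold
    ([Ws_constant]). The same holds on the unstable manifold of q for the product
    of the signs of (Q), (Q, V) and (V) ([tau_critical], [tau_locally]).
    Multiplying both products at one point of a flow line from q to p gives the
    equality of the two signs of the flow line ([sign_push]).

    Local constancy makes sense only if stable manifolds are submanifolds along
    the trajectory, which is the stable manifold theorem, proved in the form
    needed: the stable set has a slice chart near p, and the flow carries it
    backward along the trajectory ([stable_slice_at], [Ws_slice]). As the metric
    is Euclidean in suitable charts near C_j, the gradient field has a smooth
    flow in such a chart ([flow_Ck]), whose time-one map is hyperbolic at p; the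
    local stable manifold of a hyperbolic map is a graph, obtained by Perron's
    method as the set of initial points of bounded orbits
    ([stable_orbit_exists]). Flows and graphs are shown to be C^k by induction
    on k: their derivatives are given by the same construction for the tangent
    field and the tangent map, which satisfy the same hypotheses
    ([flow_linearisation], [section_linearisation]). *)

(** * Maps of class C^k *)

Section Calculus.
Context {R : realType}.
Implicit Types V W : normedModType R.

Lemma open_near V (U : set V) x : open U -> U x -> \forall y \near x, U y.
Proof. by move=> oU Ux; exact: open_nbhs_nbhs. Qed.

Lemma CkS V W k (U : set V) (F : V -> W) :
  Ck k.+1 U F <->
  (forall x, U x -> differentiable F x) /\ (forall v, Ck k U ('D_v F)).
Proof. by []. Qed.

Lemma Ck_sub V W k (U U' : set V) (F : V -> W) :
  U' `<=` U -> Ck k U F -> Ck k U' F.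
Proof.
elim: k F => [|k IH] F sub /= H; first by move=> x /sub /H.
by case: H => H1 H2; split=> [x /sub /H1//|v]; exact: IH.
Qed.

Lemma diff_of_eps V W (F : V -> W) (L : {linear V -> W}) x : continuous L ->
  (forall e, 0 < e -> \forall h \near (0 : V),
     `|F (h + x) - F x - L h| <= e * `|h|) ->
  differentiable F x /\ 'd F x = L :> (V -> W).
Proof.
move=> cL H.
have E : F \o shift x = cst (F x) + L +o_ (0 : V) id.
  apply/eqaddoP => e e0; near=> h.
  rewrite /= !fctE /= opprD addrA.
  by near: h; exact: H.
have D := diff_unique cL E.
split=> //; apply/diff_locallyP; split; first by rewrite D.
by rewrite {1}E D.
Unshelve. all: by end_near. Qed.

Lemma diff_eps V W (F : V -> W) x : differentiable F x ->
  forall e, 0 < e -> \forall h \near (0 : V),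
    `|F (h + x) - F x - 'd F x h| <= e * `|h|.
Proof.
move=> /diff_locallyP[_ /eqaddoP H] e e0; have := H _ e0.
apply: filter_app; near=> h.
by rewrite /= !fctE /= opprD addrA.
Unshelve. all: by end_near. Qed.

Lemma near_eq_differentiable V W (F G : V -> W) x :
  (\forall y \near x, F y = G y) -> differentiable F x -> differentiable G x.
Proof.
move=> FG dF.
have [] // := @diff_of_eps V W G ('d F x) x; first exact: diff_continuous.
move=> e e0; have := diff_eps dF e0; apply: filter_app.
have FGx := nbhs_singleton FG.
have : \forall h \near (0 : V), F (h + x) = G (h + x).
  have C : (fun h : V => h + x) @ (0 : V) --> x.
    by rewrite -[X in _ --> X]add0r; apply: cvgD; [exact: cvg_id|exact: cvg_cst].
  exact: C _ FG.
by apply: filter_app; near=> h => -> ; rewrite FGx.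
Unshelve. all: by end_near. Qed.

Lemma Ck_ext V W k (U : set V) (F G : V -> W) :
  open U -> (forall x, U x -> F x = G x) -> Ck k U F -> Ck k U G.
Proof.
move=> oU; elim: k F G => [|k IH] F G FG /=.
  move=> H x Ux; have := H x Ux.
  rewrite /prop_for /continuous_at -(FG x Ux); apply: cvg_trans.
  apply: near_eq_cvg; exact: (filterS FG (open_near oU Ux)).
have nFG x : U x -> \forall y \near x, F y = G y.
  by move=> Ux; exact: (filterS FG (open_near oU Ux)).
move=> [H1 H2]; split=> [x Ux|v].
  exact: near_eq_differentiable (nFG x Ux) (H1 x Ux).
by apply: IH (H2 v) => x Ux; apply: near_eq_derive; exact: nFG.
Qed.

Lemma Ck_differentiable V W k (U : set V) (F : V -> W) x :
  Ck k.+1 U F -> U x -> differentiable F x.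
Proof. by case=> H _; exact: H. Qed.

Lemma Ck_S V W k (U : set V) (F : V -> W) : Ck k.+1 U F -> Ck k U F.
Proof.
elim: k F => [|k IH] F /= [H1 H2].
  by move=> x Ux; apply: differentiable_continuous; exact: H1.
by split=> // v; apply: IH; exact: H2.
Qed.

Lemma Ck_continuous V W k (U : set V) (F : V -> W) x :
  Ck k U F -> U x -> {for x, continuous F}.
Proof. by elim: k => [|k IH] H Ux; [exact: H|apply: IH => //; exact: Ck_S]. Qed.

(** Being of class C^k is defined with all directional derivatives on the same open
    set, so it may be checked on a neighbourhood of each point. *)
Lemma Ck_locally V W k (U : set V) (F : V -> W) :
  (forall x, U x -> exists U' : set V, [/\ open U', U' x & Ck k U' F]) ->
  Ck k U F.
Proof.
elim: k F => [|k IH] F H.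
  by move=> x /H[U' [_ U'x H']]; exact: (Ck_continuous H').
split=> [x /H[U' [_ U'x [H' _]]]|v]; first exact: H'.
by apply: IH => x /H[U' [oU' U'x [_ H']]]; exists U'; split=> //; exact: H'.
Qed.

Lemma Ck_cst V W k (U : set V) (a : W) : Ck k U (fun _ => a).
Proof.
elim: k a => [|k IH] a /=; first by move=> x _; exact: cst_continuous.
split=> [x _|v]; first exact: differentiable_cst.
rewrite (_ : 'D_v _ = fun=> 0) //; apply/funext => x.
exact: derive_cst.
Qed.

Lemma Ck_add V W k (U : set V) (F G : V -> W) : open U ->
  Ck k U F -> Ck k U G -> Ck k U (fun x => F x + G x).
Proof.
move=> oU; elim: k F G => [|k IH] F G /=.
  by move=> HF HG x Ux; apply: cvgD; [exact: HF|exact: HG].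
move=> [F1 F2] [G1 G2]; split=> [x Ux|v].
  by apply: (@differentiableD _ _ _ F G); [exact: F1|exact: G1].
apply: Ck_ext (IH _ _ (F2 v) (G2 v)) => // x Ux.
by rewrite (@deriveD _ _ _ F G) //; apply: diff_derivable; [exact: F1|exact: G1].
Qed.

Lemma Ck_linear V W (W' : normedModType R) k (U : set V) (F : V -> W)
    (L : {linear W -> W'}) : open U -> continuous L ->
  Ck k U F -> Ck k U (fun x => L (F x)).
Proof.
move=> oU cL; elim: k F => [|k IH] F /=.
  by move=> HF x Ux; apply: (@continuous_comp _ _ _ F L);
    [exact: HF|exact: cL].
move=> [F1 F2]; have dL y : differentiable L y by exact: linear_differentiable.
split=> [x Ux|v].
  by apply: (@differentiable_comp _ _ _ _ F L) => //; exact: F1.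
apply: Ck_ext (IH _ (F2 v)) => // x Ux.
have dF := F1 x Ux.
rewrite [RHS](@deriveE _ _ _ (L \o F)); last exact: differentiable_comp.
by rewrite diff_comp //= diff_lin // deriveE.
Qed.

Lemma Ck_lin V W k (U : set V) (L : {linear V -> W}) :
  continuous L -> Ck k U L.
Proof.
move=> cL; apply: (@Ck_sub _ _ _ setT) => //.
case: k => [|k]; first by move=> x _; exact: cL.
split=> [x _|v]; first exact: linear_differentiable.
rewrite (_ : 'D_v L = fun=> L v); first exact: Ck_cst.
apply/funext => x; rewrite deriveE; last exact: linear_differentiable.
by rewrite diff_lin.
Qed.

Lemma differentiable_mulr V (a b : V -> R) x v :
  differentiable a x -> differentiable b x ->
  differentiable (fun y => a y * b y) x /\
  'D_v (fun y => a y * b y) x = a x * 'D_v b x + 'D_v a x * b x.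
Proof.
move=> da db; split; first exact: (@differentiableM _ _ a b).
rewrite (@deriveM _ _ a b); [|exact: diff_derivable|exact: diff_derivable].
by rewrite /GRing.scale /= [b x * _]mulrC.
Qed.

Lemma Ck_mul V k (U : set V) (a b : V -> R) : open U ->
  Ck k U a -> Ck k U b -> Ck k U (fun x => a x * b x).
Proof.
move=> oU; elim: k a b => [|k IH] a b.
  move=> Ha Hb x Ux; have h := @cvgM R V (nbhs x) _ a b _ _ (Ha x Ux) (Hb x Ux).
  exact: h.
move=> Ha Hb; have Ha' := Ck_S Ha; have Hb' := Ck_S Hb.
move: Ha Hb => /CkS[a1 a2] /CkS[b1 b2].
split=> [x Ux|v]; first by case: (differentiable_mulr 0 (a1 x Ux) (b1 x Ux)).
apply: (@Ck_ext _ _ _ _ (fun x => a x * 'D_v b x + 'D_v a x * b x)) => //.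
  by move=> x Ux; case: (differentiable_mulr v (a1 x Ux) (b1 x Ux)).
by apply: Ck_add => //; apply: IH.
Qed.

Lemma Ck_sum V W k (U : set V) (I : eqType) (r : seq I) (F : I -> V -> W) : open U ->
  (forall i, Ck k U (F i)) -> Ck k U (fun x => \sum_(i <- r) F i x).
Proof.
move=> oU H; elim: r => [|i r IH].
  by apply: (@Ck_ext _ _ _ _ (fun=> 0)); [|move=> x _; rewrite big_nil|exact: Ck_cst].
apply: (@Ck_ext _ _ _ _ (fun x => F i x + \sum_(j <- r) F j x)) => //.
  by move=> x _; rewrite big_cons.
exact: Ck_add.
Qed.

Section Entry.
Variables (p q : nat) (i : 'I_p) (j : 'I_q).

Definition entry (A : 'M[R]_(p, q)) : R := A i j.

Lemma entry_linear : linear entry.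
Proof. by move=> a A B; rewrite /entry !mxE. Qed.
HB.instance Definition _ := GRing.isLinear.Build _ _ _ _ entry entry_linear.

Lemma entry_continuous : continuous entry.
Proof. exact: coord_continuous. Qed.

End Entry.

Lemma Ck_entry V p q k (U : set V) (F : V -> 'M[R]_(p, q)) i j : open U ->
  Ck k U F -> Ck k U (fun x => F x i j).
Proof.
by move=> oU; apply: (@Ck_linear _ _ _ _ _ _ (entry i j)) => //; exact: entry_continuous.
Qed.

Section Scalel.
Variables (W : normedModType R) (w : W).
Definition scalel (a : R) : W := a *: w.
Lemma scalel_linear : linear scalel.
Proof. by move=> a x y; rewrite /scalel scalerDl scalerA. Qed.
HB.instance Definition _ := GRing.isLinear.Build _ _ _ _ scalel scalel_linear.
End Scalel.

Lemma Ck_mx V p q k (U : set V) (F : V -> 'M[R]_(p, q)) : open U ->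
  (forall i j, Ck k U (fun x => F x i j)) -> Ck k U F.
Proof.
move=> oU H; apply: (@Ck_ext _ _ _ _ (fun x =>
    \sum_i \sum_j F x i j *: (delta_mx i j : 'M[R]_(p, q)))) => //.
  by move=> x _; rewrite [RHS]matrix_sum_delta.
apply: Ck_sum => // i; apply: Ck_sum => // j.
apply: (@Ck_linear _ _ _ _ _ (fun x => F x i j) (scalel (delta_mx i j))) => //.
exact: scalel_continuous.
Qed.

Lemma derive_coords n W (G : 'rV[R]_n -> W) y w : differentiable G y ->
  'D_w G y = \sum_i w 0 i *: 'D_(delta_mx 0 i) G y.
Proof.
move=> dG; rewrite deriveE // {1}[w]row_sum_delta linear_sum.
by apply: eq_bigr => i _; rewrite linearZ /= deriveE.
Qed.

Lemma derive_chain V W (W' : normedModType R) (F : V -> W) (G : W -> W') x v :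
  differentiable F x -> differentiable G (F x) ->
  'D_v (G \o F) x = 'D_('D_v F x) G (F x).
Proof.
move=> dF dG; rewrite deriveE; last exact: differentiable_comp.
by rewrite diff_comp //= !deriveE.
Qed.

(** By the chain rule the derivative of G \o F is a sum of products of partial
    derivatives of G along F with components of the derivative of F, all of which
    are one degree less smooth. *)
Lemma Ck_comp_scalar V n k (U : set V) (U' : set 'rV[R]_n)
    (F : V -> 'rV[R]_n) (G : 'rV[R]_n -> R) : open U ->
  Ck k U F -> (forall x, U x -> U' (F x)) -> Ck k U' G -> Ck k U (G \o F).
Proof.
move=> oU; elim: k F G => [|k IH] F G.
  move=> HF FU HG x Ux; apply: continuous_comp; first exact: HF.
  by apply: HG; exact: FU.
move=> HF FU HG; have HF' := Ck_S HF; move: HF HG => /CkS[F1 F2] /CkS[G1 G2].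
split=> [x Ux|v].
  by apply: differentiable_comp; [exact: F1|apply: G1; exact: FU].
apply: (@Ck_ext _ _ _ _ (fun x =>
   \sum_i 'D_v F x 0 i * ('D_(delta_mx 0 i) G \o F) x)) => //.
  move=> x Ux; have dG := G1 _ (FU _ Ux).
  by rewrite (derive_chain v (F1 x Ux) dG) derive_coords.
apply: Ck_sum => // i; apply: Ck_mul => //; first exact: Ck_entry.
exact: IH.
Qed.

Lemma Ck_comp V n p q k (U : set V) (U' : set 'rV[R]_n)
    (F : V -> 'rV[R]_n) (G : 'rV[R]_n -> 'M[R]_(p, q)) : open U -> open U' ->
  Ck k U F -> (forall x, U x -> U' (F x)) -> Ck k U' G -> Ck k U (G \o F).
Proof.
move=> oU oU' HF FU HG; apply: Ck_mx => // i j.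
apply: (@Ck_comp_scalar _ _ _ _ _ F (fun y => G y i j) oU HF FU).
exact: Ck_entry.
Qed.

Lemma smooth_on_differentiable V W (U : set V) (F : V -> W) x :
  smooth_on U F -> U x -> differentiable F x.
Proof. by move=> /(_ 1%N); exact: Ck_differentiable. Qed.

Lemma smooth_on_derive V W (U : set V) (F : V -> W) v :
  smooth_on U F -> smooth_on U ('D_v F).
Proof. by move=> H k; case/CkS: (H k.+1). Qed.

Lemma mx_linear_continuous p q W (L : {linear 'M[R]_(p, q) -> W}) : continuous L.
Proof.
have H : Ck 0 setT (fun A => L A).
  apply: (@Ck_ext _ _ _ _ (fun A : 'M[R]_(p, q) =>
    \sum_i \sum_j A i j *: L (delta_mx i j))); first exact: openT.
    move=> A _; rewrite [in RHS](matrix_sum_delta A) linear_sum.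
    apply: eq_bigr => i _; rewrite linear_sum.
    by apply: eq_bigr => j _; rewrite linearZ.
  apply: Ck_sum => [|i]; first exact: openT.
  apply: Ck_sum => [|j]; first exact: openT.
  have oT : open [set: 'M[R]_(p, q)] by exact: openT.
  have := @Ck_linear _ _ _ 0 setT (@entry p q i j) (scalel (L (delta_mx i j))) oT.
  by apply=> [|A _]; [exact: scalel_continuous|exact: entry_continuous].
by move=> A; exact: H.
Qed.

Lemma Ck_mxlinear V p q W k (U : set V) (F : V -> 'M[R]_(p, q))
    (L : {linear 'M[R]_(p, q) -> W}) : open U ->
  Ck k U F -> Ck k U (fun x => L (F x)).
Proof. by move=> oU; apply: Ck_linear => //; exact: mx_linear_continuous. Qed.

Lemma Ck_mulmxr V p q r k (U : set V) (F : V -> 'M[R]_(p, q)) (B : 'M[R]_(q, r)) :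
  open U -> Ck k U F -> Ck k U (fun x => F x *m B).
Proof. exact: (@Ck_mxlinear V p q _ k U F (mulmxr B)). Qed.

Lemma Ck_mulmxl V p q r k (U : set V) (F : V -> 'M[R]_(p, q)) (B : 'M[R]_(r, p)) :
  open U -> Ck k U F -> Ck k U (fun x => B *m F x).
Proof. exact: (@Ck_mxlinear V p q _ k U F (mulmx B)). Qed.

Lemma Ck_opp V W k (U : set V) (F : V -> W) : open U ->
  Ck k U F -> Ck k U (fun x => - F x).
Proof.
move=> oU H; apply: (@Ck_linear _ _ _ _ _ F (@GRing.opp W)) => //.
exact: opp_continuous.
Qed.

Lemma Ck_scale V W k (U : set V) (F : V -> W) (a : R) : open U ->
  Ck k U F -> Ck k U (fun x => a *: F x).
Proof.
move=> oU H; apply: (@Ck_linear _ _ _ _ _ F ( *:%R a)) => //.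
exact: scaler_continuous.
Qed.

Lemma Ck_id V k (U : set V) : Ck k U (fun x : V => x).
Proof. by apply: (@Ck_lin _ _ _ _ idfun) => x; exact: cvg_id. Qed.

Lemma differentiable_mx V p q (F : V -> 'M[R]_(p, q)) x :
  (forall i j, differentiable (fun y => F y i j) x) -> differentiable F x.
Proof.
move=> H; apply: (@near_eq_differentiable _ _ (fun y =>
    \sum_i \sum_j F y i j *: (delta_mx i j : 'M[R]_(p, q)))).
  by near=> y; rewrite [RHS]matrix_sum_delta.
have -> : (fun y => \sum_i \sum_j F y i j *: (delta_mx i j : 'M[R]_(p, q))) =
  \sum_i \sum_j (fun y => F y i j *: (delta_mx i j : 'M[R]_(p, q))).
  apply/funext => y; rewrite fct_sumE; apply: eq_bigr => i _.
  by rewrite fct_sumE.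
apply: differentiable_sum => i; apply: differentiable_sum => j.
exact: differentiableZl.
Unshelve. all: by end_near. Qed.

End Calculus.

(** * Mean value estimates *)

Section Estimates.
Context {R : realType}.
Implicit Types V W : normedModType R.

Lemma mx_norm_le p q (A : 'M[R]_(p, q)) (r : R) : 0 <= r ->
  `|A| <= r <-> forall i j, `|A i j| <= r.
Proof.
move=> r0; rewrite [leLHS]/Num.Def.normr /= mx_normrE.
split=> [H i j|H]; last by apply: bigmax_le => // -[i j] _; exact: H.
exact: le_trans (le_bigmax _ (fun ij : 'I_p * 'I_q => `|A ij.1 ij.2|) (i, j)) H.
Qed.

Lemma mx_norm_ge p q (A : 'M[R]_(p, q)) i j : `|A i j| <= `|A|.
Proof. by have /(mx_norm_le _ (normr_ge0 A)) := lexx `|A|; apply. Qed.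

Lemma is_derive_entry V p q (F : V -> 'M[R]_(p, q)) x v dF i j :
  is_derive x v F dF -> is_derive x v (fun y => F y i j) (dF i j).
Proof.
move=> [dv <-]; apply: DeriveDef; first by move/derivable_mxP: dv; apply.
by rewrite derive_mx // mxE.
Qed.

Lemma is_derive_mx V p q (F : V -> 'M[R]_(p, q)) x v (dF : 'M[R]_(p, q)) :
  (forall i j, is_derive x v (fun y => F y i j) (dF i j)) -> is_derive x v F dF.
Proof.
move=> H; have dv : derivable F x v by apply/derivable_mxP => i j; case: (H i j).
apply: DeriveDef => //; rewrite derive_mx //; apply/matrixP => i j.
by rewrite mxE; case: (H i j).
Qed.

Lemma is_derive_curve_comp V W (c : R -> V) (F : V -> W) (t : R) dc :
  is_derive t (1 : R) c dc -> differentiable F (c t) ->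
  is_derive t (1 : R) (F \o c) ('D_dc F (c t)).
Proof.
move=> [/derivable1_diffP dvc <-] dF; apply: DeriveDef; last exact: derive_chain.
by apply/derivable1_diffP; exact: differentiable_comp.
Qed.

Lemma is_derive_line V (x v : V) (t : R) : is_derive t (1 : R) (fun s : R => x + s *: v) v.
Proof.
have -> : (fun s : R => x + s *: v) = cst x + (fun s : R => s *: v) by [].
have H : is_derive t (1 : R) (fun s : R => s *: v) v.
  have d : differentiable (fun s : R => s *: v) t by exact: differentiableZl.
  apply: DeriveDef; first exact: diff_derivable.
  by rewrite deriveE // (@diffZl _ _ _ id) // diff_val scale1r.
by apply: is_derive_eq; rewrite add0r.
Qed.

Lemma is_derive_along_line V W (F : V -> W) (x v : V) (t : R) :
  differentiable F (x + t *: v) ->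
  is_derive t (1 : R) (fun s : R => F (x + s *: v)) ('D_v F (x + t *: v)).
Proof. exact: (is_derive_curve_comp (is_derive_line x v t)). Qed.

Lemma is_derive_continuous W (F : R -> W) (t : R) dF :
  is_derive t (1 : R) F dF -> {for t, continuous F}.
Proof. by case=> /derivable1_diffP/differentiable_continuous. Qed.

(** Integrating a bound on the derivative, one coordinate at a time. *)
Lemma mean_value_le p q (c dc : R -> 'M[R]_(p, q)) (a b K : R) : a <= b ->
  (forall t, a <= t <= b -> is_derive t (1 : R) c (dc t)) ->
  (forall t, a <= t <= b -> `|dc t| <= K) ->
  `|c b - c a| <= K * (b - a).
Proof.
move=> ab Hc HK.
have K0 : 0 <= K by apply: le_trans (HK a _) => //; rewrite lexx ab.
apply/mx_norm_le; first by rewrite mulr_ge0 // subr_ge0.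
move=> i j; rewrite !mxE.
have [||t tab ->] := @MVT_segment R (fun t => c t i j) (fun t => dc t i j) a b ab.
- move=> t /itvP tab; apply: is_derive_entry; apply: Hc; by rewrite !tab.
- apply: continuous_in_subspaceT => t; rewrite inE /= in_itv /= => tab.
  exact: (is_derive_continuous (is_derive_entry i j (Hc t tab))).
rewrite normrM [`|b - a|]ger0_norm ?subr_ge0 // ler_wpM2r ?subr_ge0 //.
by apply: le_trans (mx_norm_ge _ _ _) (HK t _); rewrite in_itv in tab.
Qed.

Definition convex_set V (K : set V) := forall x y (t : R),
  K x -> K y -> 0 <= t <= 1 -> K (x + t *: (y - x)).

Lemma compact_norm_bounded (T : topologicalType) W (K : set T) (F : T -> W) :
  compact K -> (forall x, K x -> {for x, continuous F}) ->
  exists2 M : R, 0 < M & forall x, K x -> `|F x| <= M.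
Proof.
move=> cK cF; have [->|/set0P K0] := eqVneq K set0; first by exists 1.
have cn : {within K, continuous (fun x => `|F x|)}.
  apply: continuous_in_subspaceT => x; rewrite inE => Kx.
  apply: (@continuous_comp _ _ _ F (@Num.norm R W)); first exact: cF.
  exact: norm_continuous.
have [x Kx H] := @compact_EVT_max _ R _ K K0 cK cn.
exists (`|F x| + 1); first by rewrite ltr_wpDl.
move=> y Ky; have := H y (mem_set Ky); move=> /le_trans; apply.
by rewrite lerDl.
Qed.

Lemma sum_const_ord n (z : R) : \sum_(i < n) z = n%:R * z.
Proof. by rewrite sumr_const card_ord mulr_natl. Qed.

Lemma derive_bound n p q (G : 'rV[R]_n -> 'M[R]_(p, q)) y w (M : R) : 0 <= M ->
  differentiable G y -> (forall i, `|'D_(delta_mx 0 i) G y| <= M) ->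
  `|'D_w G y| <= n%:R * M * `|w|.
Proof.
move=> M0 dG H; rewrite derive_coords //.
apply: (le_trans (ler_norm_sum _ _ _)).
apply: (@le_trans _ _ (\sum_(i < n) M * `|w|)); last first.
  by rewrite sum_const_ord mulrA.
apply: ler_sum => i _; rewrite normrZ mulrC ler_pM //; exact: mx_norm_ge.
Qed.

Lemma deriveMdir V W (G : V -> W) y w (a : R) : differentiable G y ->
  'D_(a *: w) G y = a *: 'D_w G y.
Proof. by move=> dG; rewrite !deriveE // linearZ. Qed.

Lemma deriveDdir V W (G : V -> W) y w w' : differentiable G y ->
  'D_(w + w') G y = 'D_w G y + 'D_w' G y.
Proof. by move=> dG; rewrite !deriveE // linearD. Qed.

Lemma lipschitz_on_convex n p q (G : 'rV[R]_n -> 'M[R]_(p, q)) (K : set 'rV[R]_n)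
    (M : R) : convex_set K ->
  (forall x, K x -> differentiable G x) ->
  (forall x v, K x -> `|'D_v G x| <= M * `|v|) ->
  forall x y, K x -> K y -> `|G y - G x| <= M * `|y - x|.
Proof.
move=> cK dG bG x y Kx Ky; pose v := y - x.
have H1 (t : R) (t01 : 0 <= t <= 1) : is_derive t (1 : R) (fun t => G (x + t *: v))
    ('D_v G (x + t *: v)).
  by apply: is_derive_along_line; apply: dG; exact: cK.
have H2 (t : R) (t01 : 0 <= t <= 1) : `|'D_v G (x + t *: v)| <= M * `|v|.
  by apply: bG; exact: cK.
have := mean_value_le ler01 H1 H2.
have -> : x + 1 *: v = y by rewrite scale1r addrC subrK.
by rewrite scale0r addr0 subr0 mulr1.
Qed.

(** The partial derivatives of order one and two are bounded on K by compactness;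
    the other estimates follow by integrating along segments of K. *)
Lemma C2_bounds n p q (G : 'rV[R]_n -> 'M[R]_(p, q)) (U K : set 'rV[R]_n) :
  open U -> compact K -> convex_set K -> K `<=` U -> Ck 2 U G ->
  exists2 M : R, 0 < M & [/\ forall x v, K x -> `|'D_v G x| <= M * `|v|,
    forall x y, K x -> K y -> `|G y - G x| <= M * `|y - x|,
    forall x y v, K x -> K y -> `|'D_v G y - 'D_v G x| <= M * `|y - x| * `|v| &
    forall x y, K x -> K y ->
      `|G y - G x - 'D_(y - x) G x| <= M * `|y - x| ^+ 2].
Proof.
move=> oU cK vK KU GC2; have /CkS[dG GD] := GC2.
pose e (i : 'I_n) : 'rV[R]_n := delta_mx 0 i.
have H1 : exists2 M : R, 0 < M & forall i x, K x -> `|'D_(e i) G x| <= M.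
  have H i : exists2 M : R, 0 < M & forall x, K x -> `|'D_(e i) G x| <= M.
    by apply: compact_norm_bounded cK _ => x /KU; exact: (Ck_continuous (GD _)).
  have /choice[M HM] : forall i, exists M : R, 0 < M /\ forall x, K x -> `|'D_(e i) G x| <= M.
    by move=> i; have [M ? ?] := H i; exists M.
  exists (1 + \sum_i M i).
    by rewrite ltr_wpDr // sumr_ge0 // => i _; have [/ltW] := HM i.
  move=> i x Kx; have [_ /(_ x Kx)] := HM i; move=> /le_trans; apply.
  rewrite (bigD1 i) //= addrCA lerDl addr_ge0 // sumr_ge0 // => j _.
  by have [/ltW] := HM j.
have H2 : exists2 M : R, 0 < M & forall i j x, K x -> `|'D_(e i) ('D_(e j) G) x| <= M.
  have H i j : exists2 M : R, 0 < M & forall x, K x -> `|'D_(e i) ('D_(e j) G) x| <= M.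
    apply: compact_norm_bounded cK _ => x /KU; have /CkS[_ +] := GD (e j).
    by move=> /(_ (e i)); exact: Ck_continuous.
  have /choice[M HM] : forall ij : 'I_n * 'I_n, exists M : R, 0 < M /\
      forall x, K x -> `|'D_(e ij.1) ('D_(e ij.2) G) x| <= M.
    by move=> [i j]; have [M ? ?] := H i j; exists M.
  exists (1 + \sum_ij M ij).
    by rewrite ltr_wpDr // sumr_ge0 // => i _; have [/ltW] := HM i.
  move=> i j x Kx; have [_ /(_ x Kx)] := HM (i, j); move=> /le_trans; apply.
  rewrite (bigD1 (i, j)) //= addrCA lerDl addr_ge0 // sumr_ge0 // => k _.
  by have [/ltW] := HM k.
have [M1 M10 b1] := H1; have [M2 M20 b2] := H2.
have B1 x v : K x -> `|'D_v G x| <= n%:R * M1 * `|v|.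
  move=> Kx; apply: derive_bound; [exact: ltW|exact: dG (KU x Kx)|].
  by move=> i; exact: b1.
have dDG v x : U x -> differentiable ('D_v G) x.
  by move=> Ux; have /CkS[+ _] := GD v; apply.
have B2 j x v : K x -> `|'D_v ('D_(e j) G) x| <= n%:R * M2 * `|v|.
  move=> Kx; apply: derive_bound; [exact: ltW|exact: dDG (KU x Kx)|].
  by move=> i; exact: b2.
have B3 x y v : K x -> K y ->
    `|'D_v G y - 'D_v G x| <= n%:R * (n%:R * M2) * `|y - x| * `|v|.
  move=> Kx Ky; rewrite !derive_coords; [|exact: dG (KU _ _)..].
  rewrite -sumrB; apply: (le_trans (ler_norm_sum _ _ _)).
  apply: (@le_trans _ _ (\sum_(i < n) (n%:R * M2 * `|y - x| * `|v|))); last first.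
    by rewrite sum_const_ord !mulrA.
  apply: ler_sum => i _; rewrite -scalerBr normrZ mulrC ler_pM //.
    exact: (@lipschitz_on_convex _ _ _ ('D_(e i) G) K _ vK
      (fun z Kz => dDG _ z (KU z Kz)) (B2 i) x y Kx Ky).
  exact: mx_norm_ge.
pose M := 1 + n%:R * M1 + n%:R * (n%:R * M2).
have M0 : 0 < M.
  by rewrite /M -addrA ltr_wpDr // addr_ge0 // !mulr_ge0 // ltW.
have Mle1 : n%:R * M1 <= M.
  by rewrite /M addrAC lerDr addr_ge0 // !mulr_ge0 // ltW.
have Mle2 : n%:R * (n%:R * M2) <= M.
  by rewrite /M lerDr addr_ge0 // !mulr_ge0 // ltW.
have C1 x v : K x -> `|'D_v G x| <= M * `|v|.
  by move=> /B1 /le_trans; apply; rewrite ler_wpM2r.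
have C3 x y v : K x -> K y -> `|'D_v G y - 'D_v G x| <= M * `|y - x| * `|v|.
  by move=> Kx Ky; apply: le_trans (B3 _ _ _ Kx Ky) _; rewrite !ler_wpM2r.
exists M => //; split=> //.
  exact: (lipschitz_on_convex vK (fun z Kz => dG z (KU z Kz)) C1).
move=> x y Kx Ky; pose v := y - x.
have D1 (t : R) (t01 : 0 <= t <= 1) :
    is_derive t (1 : R) (fun t => G (x + t *: v) - t *: 'D_v G x)
    ('D_v G (x + t *: v) - 'D_v G x).
  apply: is_deriveB.
    by apply: is_derive_along_line; apply: dG; apply: KU; exact: vK.
  have := is_derive_line 0 ('D_v G x) t.
  by under eq_fun do rewrite add0r.
have D2 (t : R) (t01 : 0 <= t <= 1) :
    `|'D_v G (x + t *: v) - 'D_v G x| <= M * `|v| ^+ 2.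
  apply: le_trans (C3 _ _ _ Kx (vK x y t Kx Ky t01)) _.
  have tn : `|t| <= 1 by case/andP: t01 => t0 t1; rewrite ger0_norm.
  rewrite addrC addKr normrZ expr2 [leRHS]mulrA ler_wpM2r //.
  by rewrite ler_wpM2l ?(ltW M0) // ler_piMl.
have := mean_value_le ler01 D1 D2.
have -> : x + 1 *: v = y by rewrite scale1r addrC subrK.
by rewrite !scale0r addr0 !subr0 mulr1 scale1r -/v addrAC.
Qed.

End Estimates.

(** * Global flows of Lipschitz vector fields *)

Section OneVariable.
Context {R : realType}.

Lemma continuous_epsP (V W : normedModType R) (F : V -> W) x :
  {for x, continuous F} <->
  forall e, 0 < e -> exists2 d : R, 0 < d & forall y, `|x - y| < d -> `|F x - F y| <= e.
Proof.
split=> [/cvgrPdist_le H e /H /nbhs_ballP[d d0 Hd]|H].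
  by exists d => // y xy; apply: Hd; rewrite -ball_normE.
apply/cvgrPdist_le => e /H[d d0 Hd]; apply/nbhs_ballP; exists d => // y.
by rewrite -ball_normE => /Hd.
Qed.

Lemma is_derive_comp_shift (W : normedModType R) (c : R -> W) (s t : R) dc :
  is_derive (t + s) (1 : R) c dc -> is_derive t (1 : R) (fun u => c (u + s)) dc.
Proof.
move=> [/derivable1_diffP dvc <-].
have H := is_derive_curve_comp (is_derive_shift t (1 : R) s) dvc.
exact: H.
Qed.

Lemma is_derive_comp_scale (W : normedModType R) (c : R -> W) (a t : R) dc :
  is_derive (a * t) (1 : R) c dc -> is_derive t (1 : R) (fun u => c (a * u)) (a *: dc).
Proof.
move=> [/derivable1_diffP dvc <-].
have d : is_derive t (1 : R) (fun s : R => a * s) a.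
  have := is_derive_line 0 a t; under eq_fun do rewrite add0r /GRing.scale /= mulrC.
  by [].
have H := is_derive_curve_comp d dvc.
apply: is_derive_eq H _; rewrite -[X in derive _ _ X]mulr1.
exact: (@deriveMdir _ _ _ c (a * t) 1 a).
Qed.

Lemma is_derive_mono (u du : R -> R) (a b : R) : a <= b ->
  (forall t, a <= t <= b -> is_derive t (1 : R) u (du t)) ->
  (forall t, a <= t <= b -> 0 <= du t) -> u a <= u b.
Proof.
move=> ab Hu Hd.
have [||t tab E] := @MVT_segment R u du a b ab.
- by move=> t /itvP tab; apply: Hu; rewrite !tab.
- apply: continuous_in_subspaceT => t; rewrite inE /= in_itv /= => tab.
  exact: (is_derive_continuous (Hu t tab)).
rewrite -subr_ge0 E mulr_ge0 ?subr_ge0 //; apply: Hd.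
by rewrite in_itv in tab.
Qed.

Lemma is_derive_comp_opp (W : normedModType R) (c : R -> W) (t : R) dc :
  is_derive (- t) (1 : R) c dc -> is_derive t (1 : R) (fun s => c (- s)) (- dc).
Proof.
move=> [/derivable1_diffP dvc <-].
have dN : is_derive t (1 : R) (fun s : R => - s) (- 1) by apply: is_deriveNid.
have H := is_derive_curve_comp dN dvc.
apply: is_derive_eq H _; rewrite -[X in derive _ _ X]mulr1.
by rewrite (@deriveMdir _ _ _ c (- t) 1 (-1)) // scaleN1r.
Qed.

Lemma local_primitive (f : R -> R) (K : R) : continuous f ->
  exists F : R -> R, forall t, - K < t < K -> is_derive t (1 : R) F (f t).
Proof.
move=> cf.
exists (fun x => (\int[lebesgue_measure]_(t in [set` `[- K, x]]) (f t))%R).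
move=> t /andP[t1 t2].
have i : (@lebesgue_measure R).-integrable `[- K, K] (EFin \o f).
  apply: continuous_compact_integrable; first exact: segment_compact.
  by apply: continuous_subspaceT => x; exact: cf.
have [d E] := continuous_FTC1_closed t2 i t1 (cf t).
apply: DeriveDef; first exact: d.
by rewrite -derive1E; exact: E.
Qed.

Lemma is_derive0_eq (F : R -> R) (a b : R) : a <= b ->
  (forall t, a <= t <= b -> is_derive t (1 : R) F 0) -> F a = F b.
Proof.
move=> ab H; apply/eqP; rewrite eq_le; apply/andP; split.
  by apply: (@is_derive_mono _ (fun=> 0)).
rewrite -lerN2; apply: (@is_derive_mono (fun x => - F x) (fun=> 0)) => // t tab.
have h := H t tab.
have : is_derive t (1 : R) (- F) (- 0) by exact: is_deriveN.
by rewrite oppr0.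
Qed.

Lemma primitive (f : R -> R) : continuous f ->
  exists F : R -> R, F 0 = 0 /\ forall t, is_derive t (1 : R) F (f t).
Proof.
move=> cf.
have /choice[P HP] : forall n : nat, exists F : R -> R,
    F 0 = 0 /\ forall t : R, - n.+1%:R < t < n.+1%:R -> is_derive t (1 : R) F (f t).
  move=> n; have [F HF] := local_primitive n.+1%:R cf.
  exists (F - cst (F 0)); split=> [|t tn]; first by rewrite !fctE subrr.
  by have h := HF t tn; apply: is_derive_eq; rewrite subr0.
have agree n m (t : R) : - n.+1%:R < t < n.+1%:R -> - m.+1%:R < t < m.+1%:R -> P n t = P m t.
  move=> tn tm; pose D := P n - P m.
  have dD (s : R) : `|s| <= `|t| -> is_derive s (1 : R) D 0.
    move=> st.
    have sn : - n.+1%:R < s < n.+1%:R.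
      by rewrite -ltr_norml; apply: le_lt_trans st _; rewrite ltr_norml.
    have sm : - m.+1%:R < s < m.+1%:R.
      by rewrite -ltr_norml; apply: le_lt_trans st _; rewrite ltr_norml.
    have h1 := (HP n).2 s sn; have h2 := (HP m).2 s sm.
    by apply: is_derive_eq; rewrite subrr.
  have D0 : D 0 = 0 by rewrite /D !fctE (HP n).1 (HP m).1 subrr.
  suff : D t = 0 by move/eqP; rewrite subr_eq0 => /eqP.
  rewrite -D0; have [t0|t0] := leP 0 t.
    apply/esym/is_derive0_eq => // s /andP[s0 st]; apply: dD.
    by rewrite !ger0_norm.
  apply/is_derive0_eq; first exact: ltW.
  by move=> s /andP[s0 st]; apply: dD; rewrite !ler0_norm ?lerN2 // ltW.
pose idx (t : R) := Num.truncn `|t|.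
have idxP (t : R) : - (idx t).+1%:R < t < (idx t).+1%:R.
  by rewrite -ltr_norml; have /andP[] := truncn_itv (normr_ge0 t).
exists (fun t => P (idx t) t); split; first exact: (HP _).1.
move=> t; have tn := idxP t.
apply: (@near_eq_is_derive _ _ _ (P (idx t))); last exact: (HP _).2.
have : \forall s \near t, - (idx t).+1%:R < s < (idx t).+1%:R.
  have /andP[t1 t2] := tn.
  near=> s; apply/andP; split; near: s.
    exact: lt_nbhsr.
  exact: lt_nbhsl.
apply: filterS => s sn; apply: agree => //; exact: idxP.
Unshelve. all: by end_near. Qed.

Lemma primitive_rV N (f : R -> 'rV[R]_N) : continuous f ->
  exists F : R -> 'rV[R]_N, F 0 = 0 /\ forall t, is_derive t (1 : R) F (f t).
Proof.
move=> cf.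
have /choice[P HP] : forall i : 'I_N, exists F : R -> R,
    F 0 = 0 /\ forall t, is_derive t (1 : R) F (f t 0 i).
  move=> i; apply: primitive => t.
  apply: (@continuous_comp _ _ _ f (fun A : 'rV[R]_N => A 0 i)); first exact: cf.
  exact: coord_continuous.
exists (fun t => \row_i P i t); split.
  by apply/rowP => i; rewrite !mxE (HP i).1.
move=> t; apply: is_derive_mx => i j; rewrite (ord1 i).
rewrite (_ : (fun y => _) = P j); last by apply/funext => y; rewrite mxE.
exact: (HP j).2.
Qed.

Lemma is_derive_expM (a t : R) :
  is_derive t (1 : R) (fun s => expR (a * s)) (a * expR (a * t)).
Proof.
have d : is_derive t (1 : R) (fun s : R => a * s) a.
  have := is_derive_line 0 a t; under eq_fun do rewrite add0r /GRing.scale /= mulrC.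
  by [].
have h := is_derive_expR (a * t).
have e : differentiable (@expR R) (a * t) by apply/derivable1_diffP; case: h.
apply: is_derive_eq (is_derive_curve_comp d e) _.
rewrite -[X in derive _ _ X](mulr1 a) (@deriveMdir _ _ _ (@expR R) (a * t) 1 a) //.
by case: h => _ ->.
Qed.

Lemma weighted_primitive_bound_ge0 p q (c dc : R -> 'M[R]_(p, q)) (C L : R) :
  0 < L -> 0 <= C -> c 0 = 0 -> (forall t, is_derive t (1 : R) c (dc t)) ->
  (forall t, `|dc t| <= C * expR (L * `|t|)) ->
  forall t, 0 <= t -> `|c t| <= C / L * expR (L * t).
Proof.
move=> L0 C0 c0 Hc Hd t t0.
have CL0 : 0 <= C / L by rewrite divr_ge0 // ltW.
apply/mx_norm_le; first by rewrite mulr_ge0 // expR_ge0.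
move=> i j.
have H (s : R) : s = 1 \/ s = -1 -> s * c t i j <= C / L * expR (L * t).
  move=> s1; rewrite -subr_ge0.
  have := @is_derive_mono (fun t => C / L * expR (L * t) - s * c t i j)
    (fun t => C * expR (L * t) - s * dc t i j) 0 t t0.
  rewrite c0 mxE !mulr0 subr0 expR0 mulr1 => h.
  apply: (le_trans CL0); apply: h => u /andP[u0 ut].
    have h1 := is_derive_expM L u; have h2 := is_derive_entry i j (Hc u).
    have E1 : is_derive u (1 : R) (fun t => C / L * expR (L * t)) (C * expR (L * u)).
      have : is_derive u (1 : R) ((C / L) *: (fun t => expR (L * t)))
        ((C / L) *: (L * expR (L * u))) by exact: is_deriveZ.
      by rewrite /GRing.scale /= mulrA divfK // gt_eqF.
    have E2 : is_derive u (1 : R) (fun t => s * c t i j) (s * dc u i j).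
      have : is_derive u (1 : R) (s *: (fun t => c t i j)) (s *: (dc u i j)).
        exact: is_deriveZ.
      by [].
    exact: is_deriveB.
  rewrite subr_ge0; apply: (@le_trans _ _ `|dc u|).
    apply: le_trans (ler_norm _) _; rewrite normrM.
    have -> : `|s| = 1 by case: s1 => ->; rewrite ?normrN normr1.
    by rewrite mul1r mx_norm_ge.
  by have := Hd u; rewrite (ger0_norm u0).
rewrite ler_norml; apply/andP; split.
  by have := H (-1) (or_intror erefl); rewrite mulN1r lerNl.
by have := H 1 (or_introl erefl); rewrite mul1r.
Qed.

(** The weight exp (L |t|) is chosen so that integrating divides the constant by
    L: this is what makes the integral operator of Picard a contraction. *)
Lemma weighted_primitive_bound p q (c dc : R -> 'M[R]_(p, q)) (C L : R) :
  0 < L -> 0 <= C -> c 0 = 0 -> (forall t, is_derive t (1 : R) c (dc t)) ->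
  (forall t, `|dc t| <= C * expR (L * `|t|)) ->
  forall t, `|c t| <= C / L * expR (L * `|t|).
Proof.
move=> L0 C0 c0 Hc Hd t; have [t0|t0] := leP 0 t.
  by rewrite (ger0_norm t0); exact: (weighted_primitive_bound_ge0 L0 C0 c0 Hc Hd).
rewrite (ltr0_norm t0).
have := @weighted_primitive_bound_ge0 _ _ (fun s => c (- s)) (fun s => - dc (- s)) C L L0 C0.
rewrite oppr0 => /(_ c0) H; have := H _ _ (- t); rewrite opprK; apply.
- by move=> s; exact: is_derive_comp_opp.
- by move=> s; rewrite normrN; have := Hd (- s); rewrite normrN.
- by rewrite oppr_ge0 ltW.
Qed.

(** The explicit rate shows that the limit of the Picard iterates is uniform on
    bounded intervals. *)
Lemma geometric_cvg p q (u : nat -> 'M[R]_(p, q)) (A k : R) :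
  0 <= A -> 0 <= k < 1 -> (forall n, `|u n.+1 - u n| <= A * k ^+ n) ->
  exists l, forall n, `|u n - l| <= A * k ^+ n / (1 - k).
Proof.
move=> A0 /andP[k0 k1] Hu.
have k10 : 0 < 1 - k by rewrite subr_gt0.
have step n m : `|u (n + m)%N - u n| <= A * k ^+ n / (1 - k).
  have : `|u (n + m)%N - u n| <= A * k ^+ n * (1 - k ^+ m) / (1 - k).
    elim: m => [|m IH].
      by rewrite addn0 subrr normr0 expr0 subrr mulr0 mul0r.
    have -> : u (n + m.+1)%N - u n = (u (n + m).+1 - u (n + m)%N) + (u (n + m)%N - u n).
      by rewrite addnS addrA subrK.
    apply: le_trans (ler_normD _ _) _.
    apply: le_trans (lerD (Hu _) IH) _.
    rewrite exprD exprS le_eqVlt; apply/orP; left; apply/eqP.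
    by field; rewrite gt_eqF.
  move/le_trans; apply; rewrite ler_wpM2r ?invr_ge0 ?(ltW k10) //.
  rewrite ler_piMr //.
    by rewrite mulr_ge0 // exprn_ge0.
  by rewrite gerBl exprn_ge0.
have cz : (fun n => A * k ^+ n / (1 - k)) @ \oo --> (0 : R).
  have -> : (fun n => A * k ^+ n / (1 - k)) = (fun n => (A / (1 - k)) * k ^+ n).
    by apply/funext => n; rewrite mulrAC.
  rewrite -[X in _ --> X](mulr0 (A / (1 - k))); apply: cvgMr.
  by apply: cvg_expr; rewrite ger0_norm.
have cu : cvgn u.
  apply/cauchy_cvgP/cauchy_exP => e e0.
  have /cvgrPdist_lt /(_ e e0) [n _ Hn] := cz.
  exists (u n); exists n => //= m nm; rewrite -ball_normE /= distrC.
  have := step n (m - n)%N; rewrite subnKC // => /le_lt_trans; apply.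
  have := Hn n (leqnn n); rewrite sub0r normrN => /(le_lt_trans _); apply.
  exact: ler_norm.
exists (lim (u @ \oo)) => n.
have : (fun m => `|u n - u m|) @ \oo --> `|u n - lim (u @ \oo)|.
  by apply: cvg_norm; apply: cvgB; [exact: cvg_cst|exact: cu].
move/cvgr_to_le; apply; near=> m.
have nm : (n <= m)%N by near: m; exists n.
by have := step n (m - n)%N; rewrite subnKC // distrC.
Unshelve. all: by end_near. Qed.

End OneVariable.

Section Flow.
Context {R : realType} {N : nat}.
Implicit Types (X : 'rV[R]_N -> 'rV[R]_N) (z : 'rV[R]_N).

Definition lipschitz_field X (L : R) := forall x y, `|X x - X y| <= L * `|x - y|.

Definition flow_of X (phi : R -> 'rV[R]_N -> 'rV[R]_N) :=
  (forall z, phi 0 z = z) /\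
  forall z t, is_derive t (1 : R) (phi ^~ z) (X (phi t z)).

Lemma lipschitz_field_continuous X L : lipschitz_field X L -> continuous X.
Proof.
move=> HL x; apply/continuous_epsP => e e0.
pose d := e / (`|L| + 1).
have L1 : 0 < `|L| + 1 by rewrite ltr_wpDl.
have d0 : 0 < d by rewrite divr_gt0.
exists d => // y xy; apply: le_trans (HL _ _) _.
apply: (@le_trans _ _ ((`|L| + 1) * `|x - y|)).
  by rewrite ler_wpM2r // (le_trans (ler_norm L)) // lerDl ler01.
by rewrite -ler_pdivlMl // mulrC ltW.
Qed.

(** Picard iteration in the norm weighted by [expR (- 2 L |t|)], for which the
    integral operator is a contraction of ratio 1/2 on the whole line. *)
Lemma picard_curve X L z : 0 < L -> lipschitz_field X L ->
  exists c : R -> 'rV[R]_N, c 0 = z /\ forall t, is_derive t (1 : R) c (X (c t)).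
Proof.
move=> L0 HL; have cX := lipschitz_field_continuous HL.
have HP (c : R -> 'rV[R]_N) : exists F : R -> 'rV[R]_N, continuous c ->
    F 0 = z /\ forall t, is_derive t (1 : R) F (X (c t)).
  have [cc|] := pselect (continuous c); last by exists (fun=> 0).
  have cXc : continuous (X \o c).
    by move=> t; apply: continuous_comp; [exact: cc|exact: cX].
  have [F [F0 HF]] := primitive_rV cXc.
  exists (fun t => z + F t) => _; rewrite F0 addr0; split=> // t.
  have h := HF t; have : is_derive t (1 : R) (cst z + F) (0 + X (c t)).
    exact: is_deriveD.
  by rewrite add0r.
have [P PP] := choice HP.
pose u := fix u n := if n is n'.+1 then P (u n') else cst z.
have cu n : continuous (u n).
  elim: n => [|n IH]; first by move=> t; exact: cst_continuous.
  move=> t; have [_ H] := PP _ IH; exact: (is_derive_continuous (H t)).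
have u0 n : u n 0 = z by case: n => [//|n]; have [] := PP _ (cu n).
have du n t : is_derive t (1 : R) (u n.+1) (X (u n t)).
  by have [_] := PP _ (cu n); apply.
(* Successive iterates differ by at most A w(t) / 2^n. *)
pose w (t : R) := expR (2 * L * `|t|).
have w1 t : 1 <= w t by rewrite /w -expR0 ler_expR !mulr_ge0 // ltW.
have L2 : 0 < 2 * L by rewrite mulr_gt0.
have [A A0 HA] : exists2 A, 0 <= A & `|X z| <= A * (2 * L).
  by exists (`|X z| / (2 * L)); rewrite ?divr_ge0 ?(ltW L2) // divfK ?gt_eqF.
have key (c d dc dd : R -> 'rV[R]_N) (B : R) : 0 <= B -> c 0 = d 0 ->
    (forall t, is_derive t (1 : R) c (dc t)) -> (forall t, is_derive t (1 : R) d (dd t)) ->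
    (forall t, `|dc t - dd t| <= B * (2 * L) * w t) -> forall t, `|c t - d t| <= B * w t.
  move=> B0 cd0 Hc Hd Hb t.
  have -> : B = B * (2 * L) / (2 * L) by rewrite mulfK ?gt_eqF.
  apply: (@weighted_primitive_bound _ _ _ (c - d) (dc - dd) (B * (2 * L)) (2 * L) L2) => //.
  - by rewrite mulr_ge0 // ltW.
  - by rewrite !fctE cd0 subrr.
have step n t : `|u n.+1 t - u n t| <= A * w t * 2^-1 ^+ n.
  elim: n t => [|n IH] t.
    rewrite expr0 mulr1.
    apply: (key _ _ (fun t => X (u 0%N t)) (fun=> 0) A) => // s.
    by rewrite subr0 (le_trans HA) // ler_peMr // mulr_ge0 // ltW.
  rewrite mulrAC exprS [2^-1 * _]mulrC mulrA.
  apply: (key _ _ (fun t => X (u n.+1 t)) (fun t => X (u n t))) => //.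
  - by rewrite !mulr_ge0 ?exprn_ge0 ?invr_ge0.
  - by rewrite !u0.
  move=> s; apply: le_trans (HL _ _) _.
  rewrite mulrA divfK // [_ * L]mulrC -mulrA ler_wpM2l ?(ltW L0) //.
  by rewrite mulrAC; exact: IH.
have /choice[c Hc] : forall t, exists l, forall n, `|u n t - l| <= A * w t * 2 * 2^-1 ^+ n.
  move=> t; have [|||l Hl] := @geometric_cvg _ _ _ (fun n => u n t) (A * w t) 2^-1.
  - by rewrite mulr_ge0 // expR_ge0.
  - by rewrite invr_ge0 ler0n /= invf_lt1 // ltr1n.
  - by move=> n; exact: step.
  exists l => n; have := Hl n; rewrite (_ : 1 - 2^-1 = 2^-1 :> R); last by field.
  by rewrite invrK mulrAC.
have small (B e : R) : 0 < B -> 0 < e -> exists n, B * 2^-1 ^+ n <= e.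
  move=> B0 e0; have eB : 0 < e / B by rewrite divr_gt0.
  have /cvgrPdist_lt /(_ _ eB) [n _ Hn] : (fun n => (2^-1 : R) ^+ n) @ \oo --> (0:R).
    by apply: cvg_expr; rewrite ger0_norm ?invr_ge0 // invf_lt1 // ltr1n.
  exists n; have := Hn n (leqnn n); rewrite sub0r normrN => /(le_lt_trans (ler_norm _)).
  by rewrite ltr_pdivlMr // mulrC => /ltW.
have cc : continuous c.
  move=> t; apply/continuous_epsP => e e0.
  pose B := A * w (`|t| + 1) * 2 + 1.
  have B0 : 0 < B by rewrite ltr_wpDl // !mulr_ge0 // expR_ge0.
  have [|n Hn] := small B (e / 3) B0; first by rewrite divr_gt0.
  have close s : `|s| <= `|t| + 1 -> `|u n s - c s| <= e / 3.
    move=> st; apply: le_trans (Hc s n) _.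
    apply: (@le_trans _ _ (B * 2^-1 ^+ n)).
      rewrite ler_wpM2r ?exprn_ge0 ?invr_ge0 // /B ler_wpDr // ler_wpM2r // ler_wpM2l //.
      rewrite /w ler_expR ler_wpM2l ?(ltW L2) //.
      by rewrite [leRHS]ger0_norm // addr_ge0.
    exact: Hn.
  have /continuous_epsP/(_ (e / 3)) [] := cu n t; first by rewrite divr_gt0.
  move=> d d0 Hd; exists (Num.min d 1); first by rewrite lt_min d0 ltr01.
  move=> s; rewrite lt_min => /andP[sd s1].
  have -> : c t - c s = - (u n t - c t) + (u n t - u n s) + (u n s - c s).
    by rewrite opprB [c t - _ + _]addrA subrK addrA subrK.
  have -> : e = e / 3 + e / 3 + e / 3 by field.
  apply: le_trans (ler_normD _ _) _; apply: lerD.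
    apply: le_trans (ler_normD _ _) _; apply: lerD.
      by rewrite normrN; apply: close; rewrite lerDl.
    exact: Hd.
  apply: close; rewrite -[s](subrK t) addrC.
  apply: le_trans (ler_normD _ _) _; rewrite lerD2l.
  by rewrite distrC ltW.
have [P0 HPc] := PP _ cc.
have E t : c t = P c t.
  apply/eqP; rewrite -subr_eq0 -normr_eq0; apply/eqP/le_anti; rewrite normr_ge0 andbT.
  apply/ler_addgt0Pr => e e0; rewrite add0r.
  pose B := A * w t * 2 + 1.
  have B0 : 0 < B by rewrite ltr_wpDl // !mulr_ge0 // expR_ge0.
  have [|n En] := small B (e / 2) B0; first by rewrite divr_gt0.
  have -> : c t - P c t = - (u n.+1 t - c t) + (u n.+1 t - P c t).
    by rewrite opprB addrA subrK.
  apply: le_trans (ler_normD _ _) _; rewrite normrN.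
  have -> : e = e / 2 + e / 2 by field.
  apply: lerD.
    apply: le_trans (Hc _ _) _; apply: le_trans En.
    apply: (@le_trans _ _ (B * 2^-1 ^+ n.+1)).
      by rewrite ler_wpM2r ?exprn_ge0 ?invr_ge0 // /B lerDl.
    rewrite ler_wpM2l ?(ltW B0) // exprS ler_piMl ?exprn_ge0 ?invr_ge0 //.
    by rewrite invf_le1 // ler1n.
  apply: le_trans En; apply: (@le_trans _ _ (A * 2 * 2^-1 ^+ n * w t)); last first.
    rewrite mulrAC [A * 2 * _]mulrAC ler_wpM2r ?exprn_ge0 ?invr_ge0 //.
    by rewrite /B lerDl.
  apply: (key _ _ (fun t => X (u n t)) (fun t => X (c t))) => //.
  - by rewrite !mulr_ge0 // exprn_ge0 // invr_ge0.
  - by rewrite u0 P0.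
  move=> s; apply: le_trans (HL _ _) _.
  rewrite [leRHS]mulrAC [leRHS]mulrC [2 * L]mulrC -!mulrA ler_wpM2l ?(ltW L0) //.
  apply: le_trans (Hc _ _) _.
  have w0 : 0 <= w s by exact: expR_ge0.
  have k0 : 0 <= 2^-1 ^+ n :> R by rewrite exprn_ge0 ?invr_ge0.
  have : 0 <= A * w s * 2^-1 ^+ n by rewrite !mulr_ge0.
  by move: (w s) (2^-1 ^+ n) => ws k; nra.
exists c; split; first by rewrite E.
move=> t; rewrite (_ : c = P c); first by rewrite -E; exact: HPc.
exact/funext.
Qed.

Lemma flow_exists X L : 0 < L -> lipschitz_field X L -> exists phi, flow_of X phi.
Proof.
move=> L0 HL; have /choice[c Hc] z := picard_curve z L0 HL.
exists (fun t z => c z t); split=> z; first by have [] := Hc z.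
by move=> t; have [_] := Hc z; apply.
Qed.

(** The norm is a maximum of coordinates and not differentiable, so the estimate
    goes through the sum of the squares of the N coordinates; this is where the
    factors N come from. *)
Definition gronwall_const (L a : R) : R :=
  N.+1%:R * expR ((2 * N%:R * (L + 1) + 1) * a).

Lemma gronwall (e de : R -> 'rV[R]_N) (L a eta : R) : 0 <= L -> 0 <= a -> 0 <= eta ->
  (forall t, 0 <= t <= a -> is_derive t (1 : R) e (de t)) ->
  (forall t, 0 <= t <= a -> `|de t| <= L * `|e t| + eta) ->
  forall t, 0 <= t <= a -> `|e t| <= gronwall_const L a * (`|e 0| + eta).
Proof.
move=> L0 a0 eta0 He Hd t /andP[t0 ta].
pose B := 2 * N%:R * (L + 1) + 1.
have B0 : 0 <= B by rewrite addr_ge0 // !mulr_ge0 // addr_ge0.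
(* The quantity (q + eta^2) exp (- B t) is nonincreasing. *)
pose q s := \sum_i (e s 0 i) ^+ 2.
have qle s i : (e s 0 i) ^+ 2 <= q s.
  by rewrite /q (bigD1 i) //= lerDl sumr_ge0 // => j _; exact: sqr_ge0.
have q0 s : 0 <= q s by apply: sumr_ge0 => i _; exact: sqr_ge0.
have qn s : `|e s| ^+ 2 <= q s.
  rewrite -(@ler_sqrt _ _ (q s)) // sqrtr_sqr normr_id.
  apply/mx_norm_le; first exact: sqrtr_ge0.
  by move=> i j; rewrite (ord1 i) -sqrtr_sqr ler_sqrt.
have qN s : q s <= N%:R * `|e s| ^+ 2.
  rewrite -sum_const_ord ler_sum // => i _.
  by rewrite -[leLHS]real_normK ?num_real // lerXn2r ?nnegrE // mx_norm_ge.
pose dq s := \sum_i 2 * e s 0 i * de s 0 i.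
have Hq s : 0 <= s <= a -> is_derive s (1 : R) q (dq s).
  move=> sa; have h := He s sa.
  have hi i : is_derive s (1 : R) (fun s => (e s 0 i) ^+ 2) (2 * e s 0 i * de s 0 i).
    have h1 := is_derive_entry 0 i h.
    have : is_derive s (1 : R) ((fun s => e s 0 i) ^+ 2)
      ((2%:R * e s 0 i ^+ 1) *: de s 0 i) by exact: is_deriveX.
    by rewrite expr1.
  have := @is_derive_sum R _ _ N (fun i s => (e s 0 i) ^+ 2) s 1 _ hi.
  by rewrite /q; under [X in is_derive _ _ X]eq_fun do rewrite fct_sumE.
have dqle s : 0 <= s <= a -> dq s <= B * (q s + eta ^+ 2).
  move=> sa; have h1 := Hd s sa.
  apply: (@le_trans _ _ (\sum_(i < N) (2 * `|e s| * (L * `|e s| + eta)))).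
    apply: ler_sum => i _; rewrite -!mulrA ler_wpM2l //.
    apply: le_trans (ler_norm _) _; rewrite normrM ler_pM //; first exact: mx_norm_ge.
    by apply: le_trans h1; exact: mx_norm_ge.
  rewrite sum_const_ord.
  have := qn s; set x := `|e s| => xq; have x0 : 0 <= x by exact: normr_ge0.
  have N0 : 0 <= N%:R :> R by [].
  apply: (@le_trans _ _ (2 * N%:R * (L + 1) * (q s + eta ^+ 2))); last first.
    by rewrite ler_wpM2r ?addr_ge0 ?sqr_ge0 // /B lerDl.
  rewrite [N%:R * _]mulrC -!mulrA [N%:R * _]mulrC !mulrA ler_wpM2r //.
  have : 0 <= (x - eta) ^+ 2 by exact: sqr_ge0.
  by move: (q s) (q0 s) xq => qs; nra.
have H : (q t + eta ^+ 2) * expR (- B * t) <= (q 0 + eta ^+ 2).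
  have := @is_derive_mono _ (fun s => - ((q s + eta ^+ 2) * expR (- B * s)))
    (fun s => - ((q s + eta ^+ 2) * (- B * expR (- B * s)) + dq s * expR (- B * s))) 0 t t0.
  rewrite mulr0 expR0 mulr1 lerN2; apply=> s /andP[s0 st].
    have sa : 0 <= s <= a by rewrite s0 (le_trans st).
    have h1 := Hq s sa; have h2 := is_derive_expM (- B) s.
    have h3 : is_derive s (1 : R) (q + cst (eta ^+ 2)) (dq s + 0) by exact: is_deriveD.
    have : is_derive s (1 : R) (- ((q + cst (eta ^+ 2)) * (fun s => expR (- B * s))))
      (- ((q + cst (eta ^+ 2)) s *: (- B * expR (- B * s)) + expR (- B * s) *: (dq s + 0))).
      by apply: is_deriveN; exact: is_deriveM.
    by rewrite addr0 !fctE /GRing.scale /= [expR _ * dq s]mulrC.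
  have sa : 0 <= s <= a by rewrite s0 (le_trans st).
  have := dqle s sa; have := expR_ge0 (- B * s); move: (expR _) => E E0 h.
  rewrite oppr_ge0 mulrA -mulrDl; apply: mulr_le0_ge0 => //.
  by rewrite mulrN addrC subr_le0 mulrC.
have H2 : q t <= (q 0 + eta ^+ 2) * expR (B * a).
  apply: (@le_trans _ _ ((q 0 + eta ^+ 2) * expR (B * t))); last first.
    by rewrite ler_wpM2l ?addr_ge0 ?sqr_ge0 // ler_expR ler_wpM2l.
  rewrite -ler_pdivrMr ?expR_gt0 // -expRN -mulNr.
  by apply: le_trans H; rewrite ler_wpM2r ?expR_ge0 // lerDl sqr_ge0.
have e1 : 1 <= expR (B * a) by rewrite -expR0 ler_expR mulr_ge0.
have K0 : 0 <= gronwall_const L a * (`|e 0| + eta).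
  by rewrite !mulr_ge0 ?addr_ge0 ?expR_ge0.
rewrite -(@ler_pXn2r _ 2) ?nnegrE //.
apply: le_trans (qn t) _; apply: le_trans H2 _.
have := qN 0; rewrite /gronwall_const -/B; move: (q 0) (q0 0) (expR (B * a)) e1 => q0' q00 E E1 h.
have N0 : 0 <= N%:R :> R by [].
have x0 : 0 <= `|e 0| by exact: normr_ge0.
move: (`|e 0|) x0 h => x x0 h.
apply: (@le_trans _ _ (N.+1%:R * (x + eta) ^+ 2 * E)).
  rewrite ler_wpM2r ?(le_trans ler01) //.
  have -> : N.+1%:R = N%:R + 1 :> R by rewrite -natr1.
  move: (N%:R : R) N0 h => n n0 h.
  have h1 : 0 <= n * (x * eta) by rewrite !mulr_ge0.
  have h2 : 0 <= n * eta ^+ 2 by rewrite mulr_ge0 ?sqr_ge0.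
  have h3 : 0 <= x * eta by rewrite mulr_ge0.
  have h4 : 0 <= x ^+ 2 by exact: sqr_ge0.
  have -> : (n + 1) * (x + eta) ^+ 2 = n * x ^+ 2 + 2 * (n * (x * eta)) +
    n * eta ^+ 2 + x ^+ 2 + 2 * (x * eta) + eta ^+ 2 by ring.
  lra.
have M1 : 1 <= N.+1%:R :> R by rewrite ler1n.
have -> : (N.+1%:R * E * (x + eta)) ^+ 2 = N.+1%:R * (x + eta) ^+ 2 * E * (N.+1%:R * E).
  by ring.
have S0 : 0 <= N.+1%:R * (x + eta) ^+ 2 * E.
  by rewrite mulr_ge0 ?(le_trans ler01 E1) // mulr_ge0 // sqr_ge0.
by rewrite ler_peMr //; have := ler_pM ler01 ler01 M1 E1; rewrite mulr1.
Qed.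

Lemma curves_unique X L (c d : R -> 'rV[R]_N) (a : R) : 0 <= L -> 
  lipschitz_field X L -> 0 <= a -> c 0 = d 0 ->
  (forall t, 0 <= t <= a -> is_derive t (1 : R) c (X (c t))) ->
  (forall t, 0 <= t <= a -> is_derive t (1 : R) d (X (d t))) ->
  forall t, 0 <= t <= a -> c t = d t.
Proof.
move=> L0 HL a0 cd0 Hc Hd t ta.
have := @gronwall (c - d) (fun t => X (c t) - X (d t)) L a 0 L0 a0 (lexx 0).
rewrite !fctE cd0 subrr normr0 addr0 mulr0 => H.
apply/eqP; rewrite -subr_eq0 -normr_eq0; apply/eqP/le_anti; rewrite normr_ge0 andbT.
apply: H ta => s sa.
  by have h1 := Hc s sa; have h2 := Hd s sa; exact: is_deriveB.
by rewrite addr0; exact: HL.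
Qed.

Lemma flow_lipschitz X L phi (a : R) : 0 <= L -> lipschitz_field X L ->
  flow_of X phi -> 0 <= a -> forall t x y, 0 <= t <= a ->
  `|phi t x - phi t y| <= gronwall_const L a * `|x - y|.
Proof.
move=> L0 HL [phi0 Hphi] a0 t x y ta.
have := @gronwall (phi^~ x - phi^~ y) (fun t => X (phi t x) - X (phi t y)) L a 0 L0 a0 (lexx 0).
rewrite !fctE !phi0 addr0; apply=> // s sa.
by rewrite addr0; exact: HL.
Qed.

Lemma flow_semigroup X L phi (s t : R) z : 0 <= L -> lipschitz_field X L ->
  flow_of X phi -> 0 <= t -> phi (t + s) z = phi t (phi s z).
Proof.
move=> L0 HL [phi0 Hphi] t0.
apply: (@curves_unique X L (fun t => phi (t + s) z) (fun t => phi t (phi s z)) t) => //.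
- by rewrite add0r phi0.
- by move=> u _; have h := Hphi z (u + s); exact: is_derive_comp_shift.
- by rewrite t0 lexx.
Qed.

End Flow.

(** * Smoothness of flows *)

Section RowVectors.
Context {R : realType}.

Lemma Ck_compf (V : normedModType R) n p q k (U : set V) (U' : set 'rV[R]_n)
    (F : V -> 'rV[R]_n) (G : 'rV[R]_n -> 'M[R]_(p, q)) : open U -> open U' ->
  Ck k U F -> (forall x, U x -> U' (F x)) -> Ck k U' G -> Ck k U (fun x => G (F x)).
Proof. exact: Ck_comp. Qed.

Lemma is_derive_mxlinear (V W : normedModType R) p q (F : V -> 'M[R]_(p, q))
    (L : {linear 'M[R]_(p, q) -> W}) x v dF :
  is_derive x v F dF -> is_derive x v (fun y => L (F y)) (L dF).
Proof.
have cL := @mx_linear_continuous _ _ _ _ L.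
move=> [dv <-]; move: (dv) => /derivable1P/derivable1_diffP d1.
have d2 : differentiable (fun h : R => L (F (h *: v + x))) 0.
  by apply: (@differentiable_comp _ _ _ _ _ L) => //; exact: linear_differentiable.
apply: DeriveDef; first by apply/derivable1P/derivable1_diffP.
have [dE|] := pselect (differentiable F x).
  rewrite (@deriveE _ _ _ (L \o F)); last by apply: differentiable_comp => //; exact: linear_differentiable.
  by rewrite diff_comp // ?diff_lin //=; [rewrite deriveE|exact: linear_differentiable].
move=> _; apply: cvg_lim => //.
have -> : (fun h : R => h^-1 *: (L (F (h *: v + x)) - L (F x))) =
    L \o (fun h : R => h^-1 *: (F (h *: v + x) - F x)).
  apply/funext => h /=; have LZ (k : R) u : L (k *: u) = k *: L u by exact: linearZ.
  have LB u u' : L (u - u') = L u - L u' by exact: linearB.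
  by rewrite LZ LB.
apply: (@cvg_comp _ _ _ _ L); last exact: cL.
exact: dv.
Qed.

Lemma deriveNdir (V W : normedModType R) (F : V -> W) x w : differentiable F x ->
  'D_(- w) F x = - 'D_w F x.
Proof. by move=> dF; rewrite !deriveE // linearN. Qed.

Lemma norm_delta_le n (i : 'I_n) : `|delta_mx 0 i : 'rV[R]_n| <= 1.
Proof.
by apply/mx_norm_le => // p q; rewrite mxE; case: (_ && _); rewrite ?normr1 ?normr0.
Qed.

Lemma norm_row_mx_le n1 n2 (x : 'rV[R]_n1) (y : 'rV[R]_n2) (r : R) :
  (`|row_mx x y| <= r) = (`|x| <= r) && (`|y| <= r).
Proof.
have [r0|r0] := leP 0 r; last first.
  have neg p q (A : 'M[R]_(p, q)) : (`|A| <= r) = false.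
    by apply/negbTE; rewrite -ltNge (lt_le_trans r0).
  by rewrite !neg.
apply/idP/andP => [/(mx_norm_le _ r0) H|[/(mx_norm_le _ r0) Hx /(mx_norm_le _ r0) Hy]].
  split; apply/mx_norm_le => // i j.
    by have := H i (lshift _ j); rewrite row_mxEl.
  by have := H i (rshift _ j); rewrite row_mxEr.
apply/mx_norm_le => // i j; rewrite -(splitK j).
by case: (fintype.split j) => k /=; rewrite ?row_mxEl ?row_mxEr.
Qed.

Lemma norm_row_mx n1 n2 (x : 'rV[R]_n1) (y : 'rV[R]_n2) :
  `|row_mx x y| = Num.max `|x| `|y|.
Proof.
apply/le_anti; rewrite norm_row_mx_le !le_max !lexx orbT /=.
by rewrite ge_max -norm_row_mx_le lexx.
Qed.

Lemma norm_row_mx_lt n1 n2 (x : 'rV[R]_n1) (y : 'rV[R]_n2) (r : R) :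
  (`|row_mx x y| < r) = (`|x| < r) && (`|y| < r).
Proof. by rewrite norm_row_mx gt_max. Qed.

Lemma norm_lsubmx n1 n2 (w : 'rV[R]_(n1 + n2)) : `|lsubmx w| <= `|w|.
Proof. by rewrite -[in leRHS](hsubmxK w) norm_row_mx le_max lexx. Qed.

Lemma norm_rsubmx n1 n2 (w : 'rV[R]_(n1 + n2)) : `|rsubmx w| <= `|w|.
Proof. by rewrite -[in leRHS](hsubmxK w) norm_row_mx le_max lexx orbT. Qed.

(** Nearest-point projection onto the closed ball of radius [r], which is a cube
    for the max norm. *)
Definition clampv n (c : 'rV[R]_n) (r : R) (x : 'rV[R]_n) : 'rV[R]_n :=
  \row_i Num.max (c 0 i - r) (Num.min (c 0 i + r) (x 0 i)).

Lemma clampv_lipschitz n (c : 'rV[R]_n) r x y :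
  `|clampv c r x - clampv c r y| <= `|x - y|.
Proof.
apply/mx_norm_le => // i j; rewrite !mxE.
apply: le_trans (mx_norm_ge (x - y) 0 j); rewrite !mxE.
move: (c 0 j) (x 0 j) (y 0 j) => cc u v.
by repeat match goal with |- context[Num.min ?p ?q] => case: (leP p q) => ? end;
repeat match goal with |- context[Num.max ?p ?q] => case: (leP p q) => ? end; rewrite ler_norml; apply/andP; split;
  (have := ler_norm (u - v); have := ler_norm (v - u); rewrite (distrC v u); lra).
Qed.

Lemma clampv_ball n (c : 'rV[R]_n) r x : 0 <= r -> `|clampv c r x - c| <= r.
Proof.
move=> r0; apply/mx_norm_le => // i j; rewrite !mxE (ord1 i).
rewrite ler_norml.
by repeat match goal with |- context[Num.min ?p ?q] => case: (leP p q) => ? end;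
repeat match goal with |- context[Num.max ?p ?q] => case: (leP p q) => ? end; apply/andP; split; lra.
Qed.

Lemma clampv_id n (c : 'rV[R]_n) r x : 0 <= r -> `|x - c| <= r -> clampv c r x = x.
Proof.
move=> r0 /(mx_norm_le _ r0) H; apply/rowP => i; rewrite !mxE.
have := H 0 i; rewrite !mxE ler_norml => /andP[h1 h2].
by repeat match goal with |- context[Num.min ?p ?q] => case: (leP p q) => ? end;
repeat match goal with |- context[Num.max ?p ?q] => case: (leP p q) => ? end; lra.
Qed.

Lemma clampv0_norm n r (x : 'rV[R]_n) : 0 <= r -> `|clampv 0 r x| <= `|x|.
Proof.
move=> r0; have := clampv_lipschitz 0 r x 0; rewrite subr0.
by rewrite [clampv 0 r 0]clampv_id ?subr0 ?normr0.
Qed.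

Definition cball n (c : 'rV[R]_n) (r : R) := [set x : 'rV[R]_n | `|x - c| <= r].

Lemma cball_compact n (c : 'rV[R]_n) r : 0 < r -> compact (cball c r).
Proof.
move=> r0; have -> : cball c r = closed_ball c r.
  by rewrite closed_ballE //; apply/seteqP; split=> x; rewrite /cball /closed_ball_ /= distrC.
apply: bounded_closed_compact; last exact: closed_ball_closed.
exists (`|c| + r); split; first exact: num_real.
move=> M HM x; rewrite closed_ballE // /closed_ball_ /= => xc.
rewrite (le_trans _ (ltW HM)) // -[x](subrK c) addrC.
by apply: le_trans (ler_normD _ _) _; rewrite lerD2l distrC.
Qed.

Lemma cball_convex n (c : 'rV[R]_n) r : convex_set (cball c r).
Proof.
move=> x y t; rewrite /cball /= => hx hy /andP[t0 t1].
have -> : x + t *: (y - x) - c = (1 - t) *: (x - c) + t *: (y - c).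
  by apply/rowP => i; rewrite !mxE; ring.
apply: le_trans (ler_normD _ _) _; rewrite !normrZ !ger0_norm ?subr_ge0 //.
have := ler_wpM2l t0 hy; have h : 0 <= 1 - t by rewrite subr_ge0.
have := ler_wpM2l h hx; lra.
Qed.

Lemma oball_open n (c : 'rV[R]_n) r : open [set x | `|x - c| < r].
Proof.
have -> : [set x | `|x - c| < r] = ball c r.
  by apply/seteqP; split=> x; rewrite -ball_normE /= distrC.
exact: ball_open.
Qed.

Lemma derive_of_quadratic (V W : normedModType R) (F : V -> W) x w (D : W) (C r : R) :
  differentiable F x -> 0 < r ->
  (forall h : R, `|h| <= r -> `|F (x + h *: w) - F x - h *: D| <= C * h ^+ 2) ->
  'D_w F x = D.
Proof.
move=> dF r0 H; rewrite deriveE //.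
apply/eqP; rewrite -subr_eq0 -normr_eq0; apply/eqP/le_anti; rewrite normr_ge0 andbT.
apply/ler_addgt0Pr => e e0; rewrite add0r.
pose e1 := e / (2 * (`|w| + 1)).
have w1 : 0 < `|w| + 1 by rewrite ltr_wpDl.
have e10 : 0 < e1 by rewrite divr_gt0 // mulr_gt0.
have /nbhs_ballP[d d0 Hd] := diff_eps dF e10.
pose C1 := `|C| + 1.
have C10 : 0 < C1 by rewrite ltr_wpDl.
pose h := Num.min (Num.min r (d / (2 * (`|w| + 1)))) (e / (2 * C1)).
have h0 : 0 < h by rewrite !lt_min r0 !divr_gt0 // mulr_gt0.
have hr : h <= r by rewrite /h !ge_min lexx.
have hd : h <= d / (2 * (`|w| + 1)) by rewrite /h !ge_min lexx orbT.
have he : h <= e / (2 * C1) by rewrite /h !ge_min lexx orbT.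
have hn : `|h| = h by rewrite ger0_norm // ltW.
have Hh := H h; rewrite hn hr in Hh; have {}Hh := Hh isT.
have hw : `|h *: w| < d.
  rewrite normrZ hn; apply: (@le_lt_trans _ _ (d / (2 * (`|w| + 1)) * `|w|)).
    by rewrite ler_wpM2r.
  rewrite -mulrA gtr_pMr // mulrC ltr_pdivrMr ?mulr_gt0 // mul1r.
  by have := normr_ge0 w; lra.
have Hw : `|F (h *: w + x) - F x - 'd F x (h *: w)| <= e1 * `|h *: w|.
  by apply: Hd; rewrite -ball_normE /= sub0r normrN.
have key : h * `|'d F x w - D| <= h * e.
  rewrite -[X in X * `|_|]hn -normrZ scalerBr.
  have -> : h *: 'd F x w - h *: D = (F (x + h *: w) - F x - h *: D) -
      (F (h *: w + x) - F x - 'd F x (h *: w)).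
    have -> : 'd F x (h *: w) = h *: 'd F x w by exact: linearZ.
    rewrite [h *: w + x]addrC; move: (F _ - F x) => A.
    by move: (h *: D) => B; rewrite opprB [RHS]addrC addrA subrK.
  apply: le_trans (ler_normB _ _) _.
  apply: le_trans (lerD Hh Hw) _.
  have A1 : C * h ^+ 2 <= h * (e / 2).
    apply: (@le_trans _ _ (C1 * h ^+ 2)).
      by rewrite ler_wpM2r ?sqr_ge0 // /C1 (le_trans (ler_norm C)) // lerDl.
    rewrite expr2 mulrCA ler_wpM2l ?(ltW h0) // mulrC -ler_pdivlMr //.
    by apply: le_trans he _; rewrite invfM mulrA.
  have A2 : e1 * `|h *: w| <= h * (e / 2).
    rewrite normrZ hn mulrCA ler_wpM2l ?(ltW h0) //.
    have -> : e1 * `|w| = e / 2 * (`|w| / (`|w| + 1)).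
      by rewrite /e1; field; rewrite gt_eqF.
    by rewrite ler_piMr ?divr_ge0 ?(ltW e0) // ler_pdivrMr // mul1r lerDl.
  by apply: le_trans (lerD A1 A2) _; rewrite -mulrDr -splitr.
by rewrite ler_pM2l in key.
Qed.

End RowVectors.

Section Variation.
Context {R : realType} {N : nat}.
Variables (X : 'rV[R]_N -> 'rV[R]_N) (L : R) (phi : R -> 'rV[R]_N -> 'rV[R]_N).
Variables (z0 : 'rV[R]_N) (r0 a : R).
Hypothesis L0 : 0 < L.
Hypothesis lipX : lipschitz_field X L.
Hypothesis flowX : flow_of X phi.
Hypothesis X_C2 : Ck 2 [set x | `|x - z0| < r0] X.
Hypothesis a0 : 0 <= a.

Definition stays (n : nat) (psi : R -> 'rV[R]_n -> 'rV[R]_n) (c : 'rV[R]_n) (r b : R) :=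
  [set z | forall t, 0 <= t <= b -> `|psi t z - c| < r].

Let G := gronwall_const (N := N) L a.

Lemma gronwall_const_ge0 n (L' b : R) : 0 <= gronwall_const (N := n) L' b.
Proof. by rewrite mulr_ge0 // expR_ge0. Qed.

Let flow_lip := flow_lipschitz (ltW L0) lipX flowX a0.

(** The trajectory of z is compact, hence stays at a positive distance from the
    boundary of the ball, and nearby trajectories remain close to it. *)
Lemma stays_margin z : stays phi z0 r0 a z ->
  exists r r1, [/\ 0 < r, 0 < r1, r1 < r0 & forall z', `|z' - z| <= r ->
    forall t, 0 <= t <= a -> `|phi t z' - z0| <= r1].
Proof.
move=> Hz.
have [t0 t0a Ht0] : exists2 t0, 0 <= t0 <= a &
    forall t, 0 <= t <= a -> `|phi t z - z0| <= `|phi t0 z - z0|.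
  have [|t0 t0a H] := @EVT_max _ (fun t => `|phi t z - z0|) 0 a a0.
    apply: continuous_subspaceT => t.
    apply: (@continuous_comp _ _ _ (fun t => phi t z - z0) (@Num.norm R _)).
      apply: (@cvgB _ _ _ _ _ (phi^~ z) (cst z0)); last exact: cvg_cst.
      exact: (is_derive_continuous (flowX.2 z t)).
    exact: norm_continuous.
  by exists t0; [rewrite in_itv in t0a|move=> t ta; apply: H; rewrite in_itv].
have := Hz _ t0a; set s := `|_| in Ht0 * => sr0.
have G0 : 0 <= G by exact: gronwall_const_ge0.
have s0 : 0 <= s by exact: normr_ge0.
have rs0 : 0 < (r0 - s) / 2 by rewrite divr_gt0 // subr_gt0.
exists ((r0 - s) / 2 / (G + 1)), ((r0 + s) / 2); split.
- by rewrite divr_gt0 // ltr_wpDl.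
- by rewrite divr_gt0 // (lt_le_trans (le_lt_trans s0 sr0)) // lerDl.
- by rewrite ltr_pdivrMr //; lra.
move=> z' zz' t ta.
have -> : phi t z' - z0 = (phi t z' - phi t z) + (phi t z - z0) by rewrite addrA subrK.
apply: le_trans (ler_normD _ _) _.
have h1 := Ht0 t ta.
have h2 : `|phi t z' - phi t z| <= (r0 - s) / 2.
  apply: le_trans (flow_lip _ _ ta) _.
  apply: (@le_trans _ _ ((G + 1) * `|z' - z|)).
    by rewrite ler_wpM2r // lerDl.
  by rewrite -ler_pdivlMl ?ltr_wpDl // mulrC.
by apply: le_trans (lerD h2 h1) _; lra.
Qed.

Lemma stays_open : open (stays phi z0 r0 a).
Proof.
move=> z /stays_margin[r [r1 [rp _ r10 H]]]; apply/nbhs_ballP; exists r => // z'.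
rewrite -ball_normE /= distrC => /ltW zz' t ta.
exact: le_lt_trans (H z' zz' t ta) r10.
Qed.

(** The error satisfies the linearised equation up to a quadratic remainder, which
    Gronwall's estimate integrates. *)
Lemma variation_estimate z : stays phi z0 r0 a z ->
  exists C r, 0 < r /\ forall z' v (V : R -> 'rV[R]_N), `|z' - z| <= r -> `|v| <= r ->
    V 0 = v ->
    (forall t, 0 <= t <= a -> is_derive t (1 : R) V ('D_(V t) X (phi t z'))) ->
    `|phi a (z' + v) - phi a z' - V a| <= C * `|v| ^+ 2.
Proof.
move=> /stays_margin[r [r1 [rp r1p r10 H]]].
have sub : cball z0 r1 `<=` [set x | `|x - z0| < r0].
  by move=> x; rewrite /cball /= => /le_lt_trans; apply.
have [M M0 [M1 M2 M3 M4]] := C2_bounds (@oball_open _ _ z0 r0) (@cball_compact _ _ z0 r1 r1p)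
  (@cball_convex _ _ z0 r1) sub X_C2.
exists (gronwall_const (N := N) M a * (M * G ^+ 2)), (r / 2).
split=> [|z' v V zz' vr V0 HV]; first by rewrite divr_gt0.
pose e t := phi t (z' + v) - phi t z' - V t.
have in1 t : 0 <= t <= a -> cball z0 r1 (phi t z').
  by apply: H; apply: le_trans zz' _; lra.
have in2 t : 0 <= t <= a -> cball z0 r1 (phi t (z' + v)).
  apply: H; have -> : z' + v - z = (z' - z) + v by rewrite addrAC.
  by apply: le_trans (ler_normD _ _) _; apply: le_trans (lerD zz' vr) _; lra.
have eta0 : 0 <= M * G ^+ 2 * `|v| ^+ 2.
  by rewrite mulr_ge0 ?sqr_ge0 // mulr_ge0 ?sqr_ge0 // ltW.
have := @gronwall _ _ e (fun t => X (phi t (z' + v)) - X (phi t z') - 'D_(V t) X (phi t z'))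
  M a (M * G ^+ 2 * `|v| ^+ 2) (ltW M0) a0 eta0.
have -> : e 0 = 0 by rewrite /e !flowX.1 V0 [z' + v]addrC addrK subrr.
rewrite normr0 add0r => GR.
have aa : 0 <= a <= a by rewrite a0 lexx.
rewrite -[leRHS]mulrA; apply: GR aa => t ta.
  have h1 := flowX.2 (z' + v) t; have h2 := flowX.2 z' t; have h3 := HV t ta.
  have h4 := is_deriveB h1 h2.
  exact: is_deriveB.
set x := phi t z'; set y := phi t (z' + v).
have xr0 : `|x - z0| < r0 by apply: sub; exact: in1.
have dX : differentiable X x by have /CkS[+ _] := X_C2; apply.
have -> : X y - X x - 'D_(V t) X x = (X y - X x - 'D_(y - x) X x) + 'D_(e t) X x.
  rewrite /e -/x -/y -[in RHS](addrA) ['D_(y - x - _) _ _]deriveDdir //.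
  by rewrite addKr deriveNdir.
apply: le_trans (ler_normD _ _) _; rewrite addrC lerD //.
  by apply: M1; exact: in1.
apply: le_trans (M4 _ _ (in1 t ta) (in2 t ta)) _.
rewrite -mulrA ler_wpM2l ?(ltW M0) // -exprMn lerXn2r ?nnegrE ?mulr_ge0 ?gronwall_const_ge0 //.
by apply: le_trans (flow_lip _ _ ta) _; rewrite [z' + v]addrC addrK.
Qed.

End Variation.

(** The linearised system (x, v)' = (X x, DX x v), truncated so as to be globally
    Lipschitz; near [(z0, 0)] the truncation is invisible. *)
Section TangentField.
Context {R : realType} {N : nat}.
Variables (X : 'rV[R]_N -> 'rV[R]_N) (z0 : 'rV[R]_N) (r : R).

Definition tangent_field (w : 'rV[R]_(N + N)) : 'rV[R]_(N + N) :=
  row_mx (X (lsubmx w)) ('D_(clampv 0 r (rsubmx w)) X (clampv z0 r (lsubmx w))).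

Lemma tangent_field_lipschitz (L r0 : R) : 0 < L -> lipschitz_field X L ->
  0 < r -> r < r0 -> Ck 2 [set x | `|x - z0| < r0] X ->
  exists2 L', 0 < L' & lipschitz_field tangent_field L'.
Proof.
move=> L0 lipX r_gt0 rr0 XC2.
have sub : cball z0 r `<=` [set x | `|x - z0| < r0].
  by move=> x; rewrite /cball /= => /le_lt_trans; apply.
have [M M0 [M1 M2 M3 M4]] := C2_bounds (@oball_open _ _ z0 r0) (@cball_compact _ _ z0 r r_gt0)
  (@cball_convex _ _ z0 r) sub XC2.
have M' : 0 <= M * r by rewrite mulr_ge0 // ltW.
exists (L + M + M * r) => [|w w'].
  by rewrite ltr_wpDr // addr_gt0.
have cin x : cball z0 r (clampv z0 r x) by apply: clampv_ball; exact: ltW.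
have dX x : cball z0 r x -> differentiable X x.
  by move=> /sub xr; have /CkS[+ _] := XC2; apply.
have hl : `|lsubmx w - lsubmx w'| <= `|w - w'|.
  by rewrite -linearB; exact: norm_lsubmx.
have hr : `|rsubmx w - rsubmx w'| <= `|w - w'|.
  by rewrite -linearB; exact: norm_rsubmx.
rewrite /tangent_field opp_row_mx add_row_mx norm_row_mx_le; apply/andP; split.
  apply: le_trans (lipX _ _) _.
  apply: ler_pM => //; first exact: ltW.
  by rewrite -addrA lerDl addr_ge0 // ltW.
set v := clampv 0 r (rsubmx w); set v' := clampv 0 r (rsubmx w').
set x := clampv z0 r (lsubmx w); set x' := clampv z0 r (lsubmx w').
have -> : 'D_v X x - 'D_v' X x' = 'D_(v - v') X x + ('D_v' X x - 'D_v' X x').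
  have dXx : differentiable X x by apply: dX; exact: cin.
  rewrite (deriveDdir _ _ dXx) (deriveNdir _ dXx).
  by rewrite addrA subrK.
apply: le_trans (ler_normD _ _) _.
have h1 : `|'D_(v - v') X x| <= M * `|w - w'|.
  apply: le_trans (M1 _ _ (cin _)) _; rewrite ler_wpM2l ?(ltW M0) //.
  exact: le_trans (clampv_lipschitz _ _ _ _) hr.
have h2 : `|'D_v' X x - 'D_v' X x'| <= M * r * `|w - w'|.
  apply: le_trans (M3 _ _ _ (cin _) (cin _)) _.
  rewrite [leRHS]mulrAC; apply: ler_pM => //.
  - by rewrite mulr_ge0 // ltW.
  - rewrite ler_wpM2l ?(ltW M0) //.
    exact: le_trans (clampv_lipschitz _ _ _ _) hl.
  by rewrite -[v']subr0; apply: clampv_ball; exact: ltW.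
by apply: le_trans (lerD h1 h2) _; rewrite -mulrDl ler_wpM2r // -addrA lerDr ltW.
Qed.

Lemma tangent_field_smooth : smooth_on [set x | `|x - z0| < r] X ->
  smooth_on [set w | `|w - row_mx z0 0| < r] tangent_field.
Proof.
move=> XS k; have oU := @oball_open _ _ (row_mx z0 0 : 'rV[R]_(N + N)) r.
set U := [set w | _] in oU *.
have inU w : U w -> `|lsubmx w - z0| < r /\ `|rsubmx w| < r.
  rewrite /U /= => wr; have -> : lsubmx w - z0 = lsubmx (w - row_mx z0 0).
    by rewrite linearB /= row_mxKl.
  have -> : rsubmx w = rsubmx (w - row_mx z0 0).
    by rewrite linearB /= row_mxKr subr0.
  by split; apply: le_lt_trans wr; [exact: norm_lsubmx|exact: norm_rsubmx].
have oB := @oball_open _ _ z0 r.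
have Cl : Ck k U (fun w : 'rV[R]_(N + N) => lsubmx w).
  exact: (@Ck_mxlinear _ _ _ _ _ _ U id lsubmx oU (Ck_id _ _)).
have Cr : Ck k U (fun w : 'rV[R]_(N + N) => rsubmx w).
  exact: (@Ck_mxlinear _ _ _ _ _ _ U id rsubmx oU (Ck_id _ _)).
apply: (@Ck_ext _ _ _ _ _ (fun w => row_mx (X (lsubmx w))
    (\sum_i rsubmx w 0 i *: 'D_(delta_mx 0 i) X (lsubmx w)))) => //.
  move=> w /inU[h1 h2]; have r0 : 0 <= r by exact: le_trans (normr_ge0 _) (ltW h1).
  rewrite /tangent_field (clampv_id r0 (ltW h1)) clampv_id ?subr0 // ?ltW //.
  by rewrite derive_coords //; exact: smooth_on_differentiable XS _.
apply: Ck_mx => // i j; rewrite (ord1 i).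
rewrite -(splitK j); case: (fintype.split j) => l /=.
  apply: (@Ck_ext _ _ _ _ _ (fun w => X (lsubmx w) 0 l)) => //.
    by move=> w _; rewrite row_mxEl.
  apply: Ck_entry => //.
  apply: (@Ck_compf _ _ _ _ _ _ U [set x | `|x - z0| < r] (fun w => lsubmx w) X) => //.
  by move=> w /inU[].
apply: (@Ck_ext _ _ _ _ _ (fun w =>
    \sum_i rsubmx w 0 i * ('D_(delta_mx 0 i) X (lsubmx w)) 0 l)) => //.
  by move=> w _; rewrite row_mxEr summxE; apply: eq_bigr => q _; rewrite [RHS]mxE.
apply: Ck_sum => // q; apply: Ck_mul => //; first exact: Ck_entry.
apply: Ck_entry => //.
apply: (@Ck_compf _ _ _ _ _ _ U [set x | `|x - z0| < r] (fun w => lsubmx w)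
  ('D_(delta_mx 0 q) X)) => //; first by move=> w /inU[].
by apply: smooth_on_derive.
Qed.

End TangentField.

Section FlowSmooth.
Context {R : realType}.

Lemma smooth_field_C2 N (X : 'rV[R]_N -> 'rV[R]_N) z0 (r0 : R) :
  smooth_on [set x | `|x - z0| < r0] X -> Ck 2 [set x | `|x - z0| < r0] X.
Proof. by apply. Qed.

Lemma linear_curve_bound N (X : 'rV[R]_N -> 'rV[R]_N) (V dV : R -> 'rV[R]_N) (M a : R) :
  0 <= M -> 0 <= a -> (forall t, 0 <= t <= a -> is_derive t (1 : R) V (dV t)) ->
  (forall t, 0 <= t <= a -> `|dV t| <= M * `|V t|) ->
  forall t, 0 <= t <= a -> `|V t| <= gronwall_const (N := N) M a * `|V 0|.
Proof.
move=> M0 a0 HV Hd t ta.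
have := @gronwall _ _ V dV M a 0 M0 a0 (lexx 0) HV; rewrite addr0; apply=> // s sa.
by rewrite addr0; exact: Hd.
Qed.

(** The derivative of the flow is the matrix solution of the linearised equation,
    which the flow of the tangent field computes from small initial vectors. *)
Lemma flow_linearisation N (X : 'rV[R]_N -> 'rV[R]_N) (L : R) phi z0 (r0 a : R) z :
  0 < L -> lipschitz_field X L -> flow_of X phi ->
  smooth_on [set x | `|x - z0| < r0] X -> 0 <= a -> stays phi z0 r0 a z ->
  exists (r rho r2 L2 : R) psi, [/\ 0 < r, 0 < rho, 0 < L2 &
  [/\ smooth_on [set w | `|w - row_mx z0 0| < r2] (tangent_field X z0 r2),
      lipschitz_field (tangent_field X z0 r2) L2,
      flow_of (tangent_field X z0 r2) psi &
   [/\ forall z' v, `|z' - z| <= r -> `|v| <= rho ->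
        stays psi (row_mx z0 0) r2 a (row_mx z' v),
      forall z', `|z' - z| <= r -> differentiable (phi a) z' &
      forall z' w, `|z' - z| <= r -> 'D_w (phi a) z' =
        w *m \matrix_(i, j) (rho^-1 * rsubmx (psi a (row_mx z' (rho *: delta_mx 0 i))) 0 j)]]].
Proof.
move=> L0 lipX flowX XS a0 Hz; have XC2 := smooth_field_C2 XS.
have [r [r1 [rp r1p r10 Hr]]] := stays_margin L0 lipX flowX a0 Hz.
have [C [rv [rvp Hv]]] := variation_estimate L0 lipX flowX XC2 a0 Hz.
pose r2 := (r1 + r0) / 2.
have r12 : r1 < r2 by rewrite /r2; lra.
have r20 : r2 < r0 by rewrite /r2; lra.
have r2p : 0 < r2 by exact: lt_trans r12.
have [L2 L20 lip2] := tangent_field_lipschitz L0 lipX r2p r20 XC2.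
have [psi flow2] := flow_exists L20 lip2.
have sub : cball z0 r2 `<=` [set x | `|x - z0| < r0].
  by move=> x; rewrite /cball /= => /le_lt_trans; apply.
have [M M0 [M1 _ _ _]] := C2_bounds (@oball_open _ _ z0 r0) (@cball_compact _ _ z0 r2 r2p)
  (@cball_convex _ _ z0 r2) sub XC2.
pose G := gronwall_const (N := N) M a.
have G0 : 0 <= G by exact: gronwall_const_ge0.
pose rho := r2 / (2 * (G + 1)).
have G1 : 0 < G + 1 by rewrite ltr_wpDl.
have rhop : 0 < rho by rewrite divr_gt0 // mulr_gt0.
have P1 z' v t : 0 <= t <= a -> lsubmx (psi t (row_mx z' v)) = phi t z'.
  move=> ta.
  apply: (@curves_unique _ _ X L (fun t => lsubmx (psi t (row_mx z' v))) (phi^~ z') a) ta => //.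
  - exact: ltW.
  - by rewrite flow2.1 flowX.1 row_mxKl.
  - move=> s _.
    have := is_derive_mxlinear (@lsubmx R 1 N N) (flow2.2 (row_mx z' v) s).
    by rewrite /= /tangent_field row_mxKl.
  - by move=> s _; exact: flowX.2.
have P2 z' v t : `|z' - z| <= r -> 0 <= t <= a ->
    is_derive t (1 : R) (fun t => rsubmx (psi t (row_mx z' v)))
      ('D_(clampv 0 r2 (rsubmx (psi t (row_mx z' v)))) X (phi t z')).
  move=> zz' ta.
  have := is_derive_mxlinear (@rsubmx R 1 N N) (flow2.2 (row_mx z' v) t).
  rewrite /= /tangent_field row_mxKr P1 // (@clampv_id _ _ _ _ (phi t z')) //; first exact: ltW.
  exact: le_trans (Hr z' zz' t ta) (ltW r12).
have in2 z' t : `|z' - z| <= r -> 0 <= t <= a -> cball z0 r2 (phi t z').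
  by move=> zz' ta; exact: le_trans (Hr z' zz' t ta) (ltW r12).
have P3 z' v t : `|z' - z| <= r -> `|v| <= rho -> 0 <= t <= a ->
    `|rsubmx (psi t (row_mx z' v))| < r2.
  move=> zz' vr ta.
  have := @linear_curve_bound N X (fun t => rsubmx (psi t (row_mx z' v))) _ M a (ltW M0) a0
    (fun t ta => P2 z' v t zz' ta).
  rewrite -/G => H; apply: (@le_lt_trans _ _ (G * `|v|)).
    have -> : `|v| = `|rsubmx (psi 0 (row_mx z' v))| by rewrite flow2.1 row_mxKr.
    apply: H ta => s sa.
    apply: le_trans (M1 _ _ (in2 z' s zz' sa)) _; rewrite ler_wpM2l ?(ltW M0) //.
    by apply: clampv0_norm; exact: ltW.
  apply: (@le_lt_trans _ _ ((G + 1) * rho)).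
    by apply: ler_pM => //; rewrite lerDl.
  have -> : (G + 1) * rho = r2 / 2 by rewrite /rho; field; rewrite gt_eqF.
  by rewrite ltr_pdivrMr //; lra.
have P4 z' v t : `|z' - z| <= r -> `|v| <= rho -> 0 <= t <= a ->
    is_derive t (1 : R) (fun t => rsubmx (psi t (row_mx z' v)))
      ('D_(rsubmx (psi t (row_mx z' v))) X (phi t z')).
  move=> zz' vr ta; have := P2 z' v t zz' ta.
  by rewrite clampv_id ?subr0 ?(ltW r2p) // ltW // P3.
pose A t z' : 'M[R]_N :=
  \matrix_(i, j) (rho^-1 * rsubmx (psi t (row_mx z' (rho *: delta_mx 0 i))) 0 j).
have rowsmall i : `|rho *: delta_mx 0 i : 'rV[R]_N| <= rho.
  rewrite normrZ ger0_norm ?(ltW rhop) // ler_piMr ?(ltW rhop) //.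
  exact: norm_delta_le.
have dX x : cball z0 r2 x -> differentiable X x.
  by move=> /sub xr; have /CkS[+ _] := XC2; apply.
have AE w t z' : w *m A t z' =
    \sum_i (w 0 i * rho^-1) *: rsubmx (psi t (row_mx z' (rho *: delta_mx 0 i))).
  apply/rowP => j; rewrite mxE summxE; apply: eq_bigr => i _.
  by rewrite /A [in LHS]mxE [in RHS]mxE mulrA.
have P5 z' w t : `|z' - z| <= r -> 0 <= t <= a ->
    is_derive t (1 : R) (fun t => w *m A t z') ('D_(w *m A t z') X (phi t z')).
  move=> zz' ta; have dx := dX _ (in2 z' t zz' ta).
  rewrite AE.
  have -> : 'D_(\sum_i (w 0 i * rho^-1) *: rsubmx (psi t (row_mx z' (rho *: delta_mx 0 i))))
       X (phi t z') = \sum_i (w 0 i * rho^-1) *: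
       'D_(rsubmx (psi t (row_mx z' (rho *: delta_mx 0 i)))) X (phi t z').
    rewrite deriveE // linear_sum; apply: eq_bigr => i _; rewrite deriveE //.
    exact: linearZ.
  rewrite (_ : (fun t => w *m A t z') = \sum_i (fun t => (w 0 i * rho^-1) *:
    rsubmx (psi t (row_mx z' (rho *: delta_mx 0 i))))); last first.
    by apply/funext => s; rewrite AE fct_sumE.
  apply: is_derive_sum => i.
  apply: (@is_deriveZ _ _ _ (fun t => rsubmx (psi t (row_mx z' (rho *: delta_mx 0 i))))).
  exact: P4.
have A0 z' : A 0 z' = 1%:M.
  apply/matrixP => i j; rewrite mxE flow2.1 row_mxKr !mxE.
  by rewrite mulKf ?(gt_eqF rhop) // eqxx eq_sym.
pose rr := Num.min r rv.
have rr0 : 0 < rr by rewrite lt_min rp rvp.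
have est z' w : `|z' - z| <= rr -> `|w| <= rv ->
    `|phi a (z' + w) - phi a z' - w *m A a z'| <= C * `|w| ^+ 2.
  rewrite le_min => /andP[h1 h2] wr.
  apply: (Hv z' w (fun t => w *m A t z')) => //; first by rewrite A0 mulmx1.
  by move=> t ta; exact: P5.
have dphi z' : `|z' - z| <= rr -> differentiable (phi a) z' /\
    'd (phi a) z' = mulmxr (A a z') :> (_ -> _).
  move=> h; apply: diff_of_eps; first exact: mx_linear_continuous.
  move=> e e0.
  pose d := Num.min rv (e / (`|C| + 1)).
  have C1 : 0 < `|C| + 1 by rewrite ltr_wpDl.
  have d0 : 0 < d by rewrite lt_min rvp divr_gt0.
  apply/nbhs_ballP; exists d => // w; rewrite -ball_normE /= sub0r normrN.
  rewrite lt_min => /andP[w1 w2].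
  rewrite [w + z']addrC; apply: le_trans (est z' w h (ltW w1)) _.
  rewrite expr2 mulrA ler_wpM2r //.
  apply: (@le_trans _ _ ((`|C| + 1) * `|w|)).
    by rewrite ler_wpM2r // (le_trans (ler_norm C)) // lerDl.
  by rewrite -ler_pdivlMl // mulrC ltW.
exists rr, rho, r2, L2, psi; split=> //; split=> //.
  by apply: tangent_field_smooth => k; apply: Ck_sub (XS k) => x /= /lt_trans; apply.
split=> [z' v h vr t ta|z' h|z' w h].
- have hr : `|z' - z| <= r by move: h; rewrite le_min => /andP[].
  rewrite -[psi t _]hsubmxK opp_row_mx add_row_mx norm_row_mx_lt subr0 P3 // andbT.
  by rewrite P1 //; apply: le_lt_trans (Hr z' hr t ta) r12.
- by have [] := dphi z' h.
have [d1 d2] := dphi z' h.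
by rewrite deriveE // d2.
Qed.

(** Induction on k, for all fields at once: the derivative of the flow is a part of
    the flow of the tangent field, which is C^k by induction. *)
Lemma flow_Ck k N (X : 'rV[R]_N -> 'rV[R]_N) (L : R) phi z0 (r0 a : R) :
  0 < L -> lipschitz_field X L -> flow_of X phi ->
  smooth_on [set x | `|x - z0| < r0] X -> 0 <= a ->
  Ck k (stays phi z0 r0 a) (phi a).
Proof.
elim: k N X L phi z0 r0 => [|k IH] N X L phi z0 r0 L0 lipX flowX XS a0.
  move=> z Hz.
  have [r [rho [r2 [L2 [psi [rp _ _ [_ _ _ [_ H _]]]]]]]] :=
    flow_linearisation L0 lipX flowX XS a0 Hz.
  by apply: differentiable_continuous; apply: H; rewrite subrr normr0 ltW.
apply: Ck_locally => z Hz.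
have [r [rho [r2 [L2 [psi [rp rhop L20 [XS2 lip2 flow2 [Hst Hd HD]]]]]]]] :=
  flow_linearisation L0 lipX flowX XS a0 Hz.
have oB := @oball_open _ _ z r.
exists [set x | `|x - z| < r]; split=> //=; first by rewrite subrr normr0.
apply/CkS; split=> [x /ltW xr|v]; first exact: Hd.
pose A z' : 'M[R]_N :=
  \matrix_(i, j) (rho^-1 * rsubmx (psi a (row_mx z' (rho *: delta_mx 0 i))) 0 j).
apply: (@Ck_ext _ _ _ _ _ (fun z' => v *m A z')) => //.
  by move=> x /ltW xr; rewrite HD.
apply: Ck_mulmxl => //; apply: Ck_mx => // i j.
apply: (@Ck_ext _ _ _ _ _ (fun z' =>
   rho^-1 *: (rsubmx (psi a (row_mx z' (rho *: delta_mx 0 i))) 0 j : R^o))) => //.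
  by move=> x _; rewrite /A [RHS]mxE.
apply: Ck_scale => //; apply: Ck_entry => //.
apply: Ck_mxlinear => //.
have oS := stays_open L20 lip2 flow2 a0.
apply: (@Ck_compf _ _ _ _ _ _ _ _ (fun z' => row_mx z' (rho *: delta_mx 0 i)) (psi a)
   oB (@oS (row_mx z0 0) r2) _ _ (IH _ _ _ _ _ _ L20 lip2 flow2 XS2 a0)).
  apply: Ck_mx => // p q; rewrite (ord1 p) -(splitK q); case: (fintype.split q) => l /=.
    apply: (@Ck_ext _ _ _ _ _ (fun x : 'rV[R]_N => x 0 l)) => //.
      by move=> x _; rewrite row_mxEl.
    by apply: Ck_entry => //; exact: Ck_id.
  apply: (@Ck_ext _ _ _ _ _ (fun x : 'rV[R]_N => (rho *: delta_mx 0 i : 'rV[R]_N) 0 l)) => //.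
    by move=> x _; rewrite row_mxEr.
  exact: Ck_cst.
move=> x /ltW xr; apply: Hst => //.
rewrite normrZ ger0_norm ?(ltW rhop) // ler_piMr ?(ltW rhop) //.
exact: norm_delta_le.
Qed.

(** The derivative of the flow at z is any solution of the linearised equation
    along the trajectory of z, so that it can be read off where the equation is
    solved explicitly. *)
Lemma flow_derivative N (X : 'rV[R]_N -> 'rV[R]_N) (L : R) phi z0 (r0 a : R) z w V :
  0 < L -> lipschitz_field X L -> flow_of X phi ->
  smooth_on [set x | `|x - z0| < r0] X -> 0 <= a -> stays phi z0 r0 a z ->
  V 0 = w -> (forall t, 0 <= t <= a -> is_derive t (1 : R) V ('D_(V t) X (phi t z))) ->
  'D_w (phi a) z = V a.
Proof.
move=> L0 lipX flowX XS a0 Hz V0 HV.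
have [C [r [rp H]]] := variation_estimate L0 lipX flowX (smooth_field_C2 XS) a0 Hz.
have w1 : 0 < `|w| + 1 by rewrite ltr_wpDl.
apply: (@derive_of_quadratic _ _ _ _ _ _ _ (C * `|w| ^+ 2) (r / (`|w| + 1))).
- exact: (Ck_differentiable (flow_Ck 1 L0 lipX flowX XS a0)).
- by rewrite divr_gt0.
move=> h hr.
have dX t : 0 <= t <= a -> differentiable X (phi t z).
  by move=> ta; apply: smooth_on_differentiable XS _; exact: Hz.
have -> : C * `|w| ^+ 2 * h ^+ 2 = C * `|h *: w| ^+ 2.
  by rewrite normrZ exprMn real_normK ?num_real // -mulrA [_ * h ^+ 2]mulrC.
apply: (H z (h *: w) (fun t => h *: V t)).
- by rewrite subrr normr0 ltW.
- rewrite normrZ; apply: (@le_trans _ _ (r / (`|w| + 1) * `|w|)).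
    by rewrite ler_wpM2r.
  by rewrite -mulrA ler_piMr ?(ltW rp) // mulrC ler_pdivrMr // mul1r lerDl.
- by rewrite V0.
move=> t ta; rewrite deriveMdir; last exact: dX.
apply: (@is_deriveZ _ _ _ V); exact: HV.
Qed.

End FlowSmooth.

(** * The stable manifold of a hyperbolic map *)

Section StableManifold.
Context {R : realType}.

Lemma is_derive_chain (V W W' : normedModType R) (F : V -> W) (G : W -> W') x v dF :
  differentiable F x -> is_derive x v F dF -> differentiable G (F x) ->
  is_derive x v (fun y => G (F y)) ('D_dF G (F x)).
Proof.
move=> d1 [_ <-] d2; apply: DeriveDef; last exact: (derive_chain v d1 d2).
exact: diff_derivable (differentiable_comp d1 d2).
Qed.

Definition box N (r : 'I_N -> R) := [set x : 'rV[R]_N | forall i, `|x 0 i| <= r i].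
Definition obox N (r : 'I_N -> R) := [set x : 'rV[R]_N | forall i, `|x 0 i| < r i].

Lemma obox_box N (r : 'I_N -> R) : obox r `<=` box r.
Proof. by move=> x H i; exact: ltW. Qed.

Lemma obox_open N (r : 'I_N -> R) : open (obox r).
Proof.
move=> x Hx.
pose d := \big[Num.min/1]_i (r i - `|x 0 i|).
have d0 : 0 < d.
  rewrite /d; elim/big_ind: _ => // [a b a0 b0|i _]; first by rewrite lt_min a0 b0.
  by rewrite subr_gt0.
apply/nbhs_ballP; exists d => // y; rewrite -ball_normE /= distrC => xy i.
have di : d <= r i - `|x 0 i| by rewrite /d (bigD1 i) //= ge_min lexx.
rewrite -[y](subrK x) mxE addrC; apply: le_lt_trans (ler_normD _ _) _.
rewrite -ltrBrDl; apply: lt_le_trans di; apply: le_lt_trans xy.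
exact: mx_norm_ge.
Qed.

Lemma box_compact N (r : 'I_N -> R) : compact (box r).
Proof.
have -> : box r = [set v : 'rV[R]_N | forall i, `[- r i, r i]%classic (v ord0 i)].
  by apply/seteqP; split=> x H i; have := H i; rewrite /= in_itv /= ler_norml.
by apply: (@rV_compact _ _ (fun i => `[- r i, r i]%classic)) => i; exact: segment_compact.
Qed.

Lemma box_convex N (r : 'I_N -> R) : convex_set (box r).
Proof.
move=> x y t hx hy /andP[t0 t1] i.
have -> : (x + t *: (y - x)) 0 i = (1 - t) * x 0 i + t * y 0 i.
  by rewrite !mxE; ring.
have h : 0 <= 1 - t by rewrite subr_ge0.
apply: le_trans (ler_normD _ _) _; rewrite !normrM (ger0_norm h) (ger0_norm t0).
have := ler_wpM2l t0 (hy i); have := ler_wpM2l h (hx i); lra.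
Qed.

(** A map close, on a box, to a diagonal map with eigenvalues [lam i] below 1 in
    the directions [st] and above 1 in the others. The side lengths of the box
    are independent so that the hypotheses pass to the tangent map, whose fibre
    directions need a much thinner box. *)
Record hyperbolic_map N (Phi : 'rV[R]_N -> 'rV[R]_N) (U : set 'rV[R]_N)
    (st : pred 'I_N) (lam r : 'I_N -> R) (ep kap : R) : Prop := HyperbolicMap {
  hm_ep : 0 <= ep;
  hm_kap : 0 <= kap < 1;
  hm_lam : forall i, 0 < lam i;
  hm_st : forall i, st i -> lam i + ep <= kap;
  hm_un : forall i, ~~ st i -> 1 + ep <= kap * lam i;
  hm_r : forall i, 0 < r i;
  hm_open : open U;
  hm_sub : box r `<=` U;
  hm_smooth : smooth_on U Phi;
  hm_small : forall x i, box r x -> `|Phi x 0 i - lam i * x 0 i| <= ep * r i;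
  hm_deriv : forall x v i, box r x ->
    `|'D_v Phi x 0 i - lam i * v 0 i| <= ep * `|v| }.

Lemma geometric_small (a b C k : R) : 0 <= k < 1 ->
  (forall n, a <= b + C * k ^+ n) -> a <= b.
Proof.
move=> /andP[k0 k1] H; rewrite -subr_le0; apply/ler_addgt0Pr => e e0; rewrite add0r.
have : (fun n => C * k ^+ n) @ \oo --> (0 : R).
  rewrite -[X in _ --> X](mulr0 C); apply: cvgMr.
  by apply: cvg_expr; rewrite ger0_norm.
move=> /cvgrPdist_lt /(_ e e0) [n _ /(_ n (leqnn n))].
rewrite /= sub0r normrN => h; rewrite lerBlDl; apply: le_trans (H n) _.
by rewrite lerD2l; exact: le_trans (ler_norm _) (ltW h).
Qed.

Section OneMap.
Variables (N : nat) (Phi : 'rV[R]_N -> 'rV[R]_N) (U : set 'rV[R]_N).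
Variables (st : pred 'I_N) (lam r : 'I_N -> R) (ep kap : R).
Hypothesis HM : hyperbolic_map Phi U st lam r ep kap.

Let ep0 := hm_ep HM.
Let kap1 := hm_kap HM.
Let k0 : 0 <= kap. Proof. by case/andP: kap1. Qed.
Let k1 : kap < 1. Proof. by case/andP: kap1. Qed.

Lemma hm_nonlinear_lip x y i : box r x -> box r y ->
  `|(Phi y 0 i - lam i * y 0 i) - (Phi x 0 i - lam i * x 0 i)| <= ep * `|y - x|.
Proof.
move=> Bx By; pose v := y - x.
have dPhi z : box r z -> differentiable Phi z.
  by move=> /(hm_sub HM); exact: smooth_on_differentiable (hm_smooth HM).
have D1 (t : R) (t01 : 0 <= t <= 1) :
    is_derive t (1 : R) (fun t => (Phi (x + t *: v) 0 i - lam i * (x + t *: v) 0 i)%:M : 'M[R]_1)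
    (('D_v Phi (x + t *: v) 0 i - lam i * v 0 i)%:M : 'M[R]_1).
  apply: is_derive_mx => p q; rewrite (ord1 p) (ord1 q) mxE eqxx mulr1n.
  rewrite (_ : (fun y => _) = (fun t => Phi (x + t *: v) 0 i - lam i * (x + t *: v) 0 i)); last first.
    by apply/funext => s; rewrite mxE eqxx mulr1n.
  have h1 := is_derive_entry 0 i (is_derive_along_line (dPhi _ (box_convex Bx By t01))).
  have h2 := is_derive_entry 0 i (is_derive_line x v t).
  have h3 : is_derive t (1 : R) (lam i *: (fun t => (x + t *: v) 0 i)) (lam i *: v 0 i).
    exact: is_deriveZ.
  exact: is_deriveB.
have D2 (t : R) (t01 : 0 <= t <= 1) :
    `|('D_v Phi (x + t *: v) 0 i - lam i * v 0 i)%:M : 'M[R]_1| <= ep * `|v|.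
  apply/mx_norm_le; first by rewrite mulr_ge0.
  move=> p q; rewrite mxE (ord1 p) (ord1 q) eqxx mulr1n; apply: (hm_deriv HM).
  exact: box_convex.
have := mean_value_le ler01 D1 D2.
have -> : x + 1 *: v = y by rewrite scale1r addrC subrK.
rewrite scale0r addr0 subr0 mulr1 => H.
by apply: le_trans H; have := mx_norm_ge
  ((Phi y 0 i - lam i * y 0 i)%:M - (Phi x 0 i - lam i * x 0 i)%:M : 'M[R]_1) 0 0;
  rewrite !mxE !mulr1n.
Qed.

(** If B is the claimed bound, each use of the inequalities improves the estimate
    B + D by the factor kap in D; iterating removes D. *)
Lemma hyperbolic_bound (e : nat -> 'rV[R]_N) (E b D : R) : 0 <= E -> 0 <= b ->
  (forall n, `|e n| <= D) ->
  (forall i, st i -> `|e 0%N 0 i| <= E) ->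
  (forall n i, st i -> `|e n.+1 0 i| <= kap * `|e n| + b) ->
  (forall n i, ~~ st i -> `|e n 0 i| <= kap * Num.max `|e n.+1| `|e n| + b) ->
  forall n, `|e n| <= E + b / (1 - kap).
Proof.
move=> E0 b0 HD He Hs Hu n.
have k10 : 0 < 1 - kap by rewrite subr_gt0.
set B := E + b / (1 - kap).
have B0 : 0 <= B by rewrite addr_ge0 // divr_ge0 // ltW.
have D0 : 0 <= D by exact: le_trans (normr_ge0 _) (HD 0%N).
have Bb : kap * B + b <= B.
  have EB : B = kap * B + b + E * (1 - kap) by rewrite /B; field; rewrite gt_eqF.
  by rewrite [leRHS]EB lerDl mulr_ge0 // ltW.
suff H m n' : `|e n'| <= B + D * kap ^+ m by exact: geometric_small kap1 (H ^~ n).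
elim: m n' {n} => [|m IH] n; first by rewrite expr0 mulr1 (le_trans (HD n)) // lerDr.
have Dm : 0 <= D * kap ^+ m by rewrite mulr_ge0 // exprn_ge0.
have Dm1 : 0 <= D * kap ^+ m.+1 by rewrite mulr_ge0 // exprn_ge0.
have step X : X <= B + D * kap ^+ m -> kap * X + b <= B + D * kap ^+ m.+1.
  move=> XB; apply: (@le_trans _ _ (kap * B + b + D * kap ^+ m.+1)); last by rewrite lerD2r.
  rewrite addrAC lerD2r exprS mulrCA -mulrDr ler_wpM2l //.
apply/mx_norm_le; first by rewrite addr_ge0.
move=> q i; rewrite (ord1 q); have [si|si] := boolP (st i).
  case: n => [|n].
    by apply: le_trans (He i si) _; rewrite /B -addrA lerDl addr_ge0 // divr_ge0 // ltW.
  by apply: le_trans (Hs n i si) _; exact: step.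
apply: le_trans (Hu n i si) _; apply: step.
by rewrite ge_max !IH.
Qed.

Definition bounded_orbit (x : nat -> 'rV[R]_N) :=
  (forall n, box r (x n)) /\ forall n, x n.+1 = Phi (x n).

Lemma box_norm x : box r x -> `|x| <= \sum_i r i.
Proof.
move=> Bx; have r0 i : 0 <= r i by exact: ltW (hm_r HM i).
apply/mx_norm_le; first by rewrite sumr_ge0.
move=> q i; rewrite (ord1 q); apply: le_trans (Bx i) _.
by rewrite (bigD1 i) //= lerDl sumr_ge0.
Qed.

Lemma orbit_stable_bound (x y : nat -> 'rV[R]_N) (E : R) : 0 <= E ->
  bounded_orbit x -> bounded_orbit y ->
  (forall i, st i -> `|x 0%N 0 i - y 0%N 0 i| <= E) -> forall n, `|x n - y n| <= E.
Proof.
move=> E0 [Bx Ox] [By Oy] H n.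
rewrite -[E]addr0 -[0](mul0r (1 - kap)^-1).
apply: (@hyperbolic_bound (fun n => x n - y n) E 0 (\sum_i r i + \sum_i r i)) => // {n}.
- move=> n; apply: le_trans (ler_normB _ _) _.
  by apply: lerD; exact: box_norm.
- by move=> i si; rewrite !mxE; exact: H.
- move=> n i si; rewrite addr0 Ox Oy.
  have -> : (Phi (x n) - Phi (y n)) 0 i = lam i * (x n - y n) 0 i +
     ((Phi (x n) 0 i - lam i * x n 0 i) - (Phi (y n) 0 i - lam i * y n 0 i)).
    by rewrite !mxE; ring.
  apply: le_trans (ler_normD _ _) _; rewrite normrM (gtr0_norm (hm_lam HM i)).
  have h1 := @hm_nonlinear_lip (y n) (x n) i (By n) (Bx n).
  have h2 := mx_norm_ge (x n - y n) 0 i.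
  have h3 := ler_wpM2l (ltW (hm_lam HM i)) h2.
  apply: le_trans (lerD h3 h1) _; rewrite -mulrDl ler_wpM2r //; exact: (hm_st HM).
move=> n i si; rewrite addr0; have l0 := hm_lam HM i.
set m := Num.max _ _.
have m1 : `|x n.+1 - y n.+1| <= m by rewrite le_max lexx.
have m2 : `|x n - y n| <= m by rewrite le_max lexx orbT.
have m0 : 0 <= m by exact: le_trans (normr_ge0 _) m2.
rewrite -(ler_pM2l l0) -[X in X * `|_|](gtr0_norm l0) -normrM.
have -> : lam i * (x n - y n) 0 i = (x n.+1 - y n.+1) 0 i -
     ((Phi (x n) 0 i - lam i * x n 0 i) - (Phi (y n) 0 i - lam i * y n 0 i)).
  by rewrite Ox Oy !mxE; ring.
apply: le_trans (ler_normB _ _) _.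
have h1 := @hm_nonlinear_lip (y n) (x n) i (By n) (Bx n).
have h2 := mx_norm_ge (x n.+1 - y n.+1) 0 i.
apply: (@le_trans _ _ ((1 + ep) * m)).
  rewrite mulrDl mul1r; apply: lerD; first exact: le_trans h2 m1.
  by apply: le_trans h1 _; rewrite ler_wpM2l.
by rewrite mulrA [lam i * kap]mulrC ler_wpM2r //; exact: (hm_un HM).
Qed.

Lemma orbit_cvg0 (x : nat -> 'rV[R]_N) : Phi 0 = 0 -> bounded_orbit x ->
  forall n, `|x n| <= (\sum_i r i) * kap ^+ n.
Proof.
move=> P0 [Bx Ox].
have r0 i : 0 <= r i by exact: ltW (hm_r HM i).
have S0 : 0 <= \sum_i r i by rewrite sumr_ge0.
have B0 : box r 0 by move=> i; rewrite mxE normr0.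
suff H m : forall n, (m <= n)%N -> `|x n| <= (\sum_i r i) * kap ^+ m by move=> n; exact: H.
elim: m => [|m IH] n mn; first by rewrite expr0 mulr1; exact: box_norm.
have Z : bounded_orbit (fun=> 0) by split.
have Y : bounded_orbit (fun n => x (n + m.+1)%N) by split=> k; [exact: Bx|exact: Ox].
have E0 : 0 <= (\sum_i r i) * kap ^+ m.+1 by rewrite mulr_ge0 // exprn_ge0.
have := @orbit_stable_bound _ _ _ E0 Y Z _ (n - m.+1)%N.
rewrite subr0 subnK //; apply=> i si; rewrite add0n mxE subr0 Ox.
have -> : Phi (x m) 0 i = lam i * x m 0 i + ((Phi (x m) 0 i - lam i * x m 0 i) -
     (Phi 0 0 i - lam i * (0 : 'rV[R]_N) 0 i)).
  by rewrite P0 !mxE; ring.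
have h1 := @hm_nonlinear_lip 0 (x m) i B0 (Bx m); rewrite subr0 in h1.
apply: le_trans (ler_normD _ _) _; rewrite normrM (gtr0_norm (hm_lam HM i)).
have h3 := ler_wpM2l (ltW (hm_lam HM i)) (mx_norm_ge (x m) 0 i).
apply: le_trans (lerD h3 h1) _; rewrite -mulrDl exprS mulrCA.
by apply: ler_pM; rewrite ?addr_ge0 ?(ltW (hm_lam HM i)) ?(hm_st HM) ?IH.
Qed.

(** The Perron operator: its fixed points are the bounded orbits with stable
    initial coordinates [xi]. *)
Definition perron (xi : 'rV[R]_N) (x : nat -> 'rV[R]_N) (n : nat) : 'rV[R]_N :=
  \row_i if st i then (if n is n'.+1 then Phi (x n') 0 i else xi 0 i)
         else (lam i)^-1 * (x n.+1 0 i - (Phi (x n) 0 i - lam i * x n 0 i)).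

Lemma perron_box xi x : box r xi -> (forall n, box r (x n)) ->
  forall n, box r (perron xi x n).
Proof.
move=> Bxi Bx n i; rewrite mxE; have l0 := hm_lam HM i; have r0 := ltW (hm_r HM i).
have [si|si] := boolP (st i).
  case: n => [//|n].
  have -> : Phi (x n) 0 i = lam i * x n 0 i + (Phi (x n) 0 i - lam i * x n 0 i) by ring.
  apply: le_trans (ler_normD _ _) _; rewrite normrM (gtr0_norm l0).
  have h1 := hm_small HM i (Bx n); have h2 := ler_wpM2l (ltW l0) (Bx n i).
  apply: le_trans (lerD h2 h1) _; rewrite -mulrDl ler_piMl //.
  exact: le_trans (hm_st HM si) (ltW k1).
rewrite normrM normfV (gtr0_norm l0) -(ler_pM2l l0) mulVKf ?gt_eqF //.
apply: le_trans (ler_normB _ _) _.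
apply: le_trans (lerD (Bx n.+1 i) (hm_small HM i (Bx n))) _.
rewrite -[X in X + _]mul1r -mulrDl ler_wpM2r // (le_trans (hm_un HM si)) //.
by rewrite ler_piMl ?(ltW k1) // ltW.
Qed.

Lemma perron_contract xi x y (D : R) : (forall n, box r (x n)) -> (forall n, box r (y n)) ->
  (forall n, `|x n - y n| <= D) -> forall n, `|perron xi x n - perron xi y n| <= kap * D.
Proof.
move=> Bx By H n; have D0 : 0 <= D by exact: le_trans (normr_ge0 _) (H 0%N).
have kD : 0 <= kap * D by rewrite mulr_ge0.
apply/mx_norm_le => // q i; rewrite !mxE; have l0 := hm_lam HM i.
have [si|si] := boolP (st i).
  case: n => [|n]; first by rewrite subrr normr0.
  have -> : Phi (x n) 0 i - Phi (y n) 0 i = lam i * (x n - y n) 0 i +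
     ((Phi (x n) 0 i - lam i * x n 0 i) - (Phi (y n) 0 i - lam i * y n 0 i)).
    by rewrite !mxE; ring.
  apply: le_trans (ler_normD _ _) _; rewrite normrM (gtr0_norm l0).
  have h1 := @hm_nonlinear_lip (y n) (x n) i (By n) (Bx n).
  have h2 := mx_norm_ge (x n - y n) 0 i.
  have h3 := ler_wpM2l (ltW l0) h2.
  apply: le_trans (lerD h3 h1) _; rewrite -mulrDl.
  by apply: ler_pM; rewrite ?addr_ge0 ?(ltW l0) ?(hm_st HM).
rewrite -mulrBr normrM normfV (gtr0_norm l0) -(ler_pM2l l0) mulVKf ?gt_eqF //.
have -> : x n.+1 0 i - (Phi (x n) 0 i - lam i * x n 0 i) -
   (y n.+1 0 i - (Phi (y n) 0 i - lam i * y n 0 i)) = (x n.+1 - y n.+1) 0 i -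
     ((Phi (x n) 0 i - lam i * x n 0 i) - (Phi (y n) 0 i - lam i * y n 0 i)).
  by rewrite !mxE; ring.
apply: le_trans (ler_normB _ _) _.
have h1 := @hm_nonlinear_lip (y n) (x n) i (By n) (Bx n).
have h2 := mx_norm_ge (x n.+1 - y n.+1) 0 i.
apply: (@le_trans _ _ ((1 + ep) * D)).
  rewrite mulrDl mul1r; apply: lerD; first exact: le_trans h2 (H _).
  by apply: le_trans h1 _; rewrite ler_wpM2l.
by rewrite mulrA [lam i * kap]mulrC ler_wpM2r //; exact: (hm_un HM).
Qed.

Lemma stable_orbit_exists xi : box r xi ->
  exists x, bounded_orbit x /\ forall i, st i -> x 0%N 0 i = xi 0 i.
Proof.
move=> Bxi.
have r0 i : 0 <= r i by exact: ltW (hm_r HM i).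
set S := \sum_i r i.
have S0 : 0 <= S by rewrite sumr_ge0.
pose X := fix X k := if k is k'.+1 then perron xi (X k') else (fun=> 0).
have BX k n : box r (X k n).
  elim: k n => [|k IH] n; first by move=> i; rewrite mxE normr0.
  exact: perron_box.
have step k n : `|X k.+1 n - X k n| <= S * kap ^+ k.
  elim: k n => [|k IH] n; first by rewrite subr0 expr0 mulr1; exact: box_norm (BX 1%N n).
  rewrite exprS mulrCA; exact: (perron_contract xi (BX k.+1) (BX k) IH n).
have /choice[x Hx] : forall n, exists l, forall k, `|X k n - l| <= S * kap ^+ k / (1 - kap).
  by move=> n; apply: geometric_cvg.
have {}Hx k n : `|X k n - x n| <= S / (1 - kap) * kap ^+ k by rewrite mulrAC; exact: Hx.
have Bx n : box r (x n).
  move=> i; apply: (@geometric_small _ _ (S / (1 - kap)) kap kap1) => k.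
  have -> : x n 0 i = X k n 0 i - (X k n - x n) 0 i by rewrite !mxE; ring.
  apply: le_trans (ler_normB _ _) _; apply: lerD; first exact: BX.
  exact: le_trans (mx_norm_ge _ _ _) (Hx k n).
have fx n : x n = perron xi x n.
  apply/eqP; rewrite -subr_eq0 -normr_eq0; apply/eqP/le_anti; rewrite normr_ge0 andbT.
  apply: (@geometric_small _ _ (2 * (S / (1 - kap))) kap kap1) => k; rewrite add0r.
  have -> : x n - perron xi x n = - (X k.+1 n - x n) + (perron xi (X k) n - perron xi x n).
    by rewrite opprB addrA subrK.
  apply: le_trans (ler_normD _ _) _; rewrite normrN.
  have Sk : 0 <= S / (1 - kap) * kap ^+ k.
    by rewrite mulr_ge0 ?exprn_ge0 // divr_ge0 // subr_ge0 ltW.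
  have h1 := Hx k.+1 n.
  have h2 := @perron_contract xi (X k) x _ (BX k) Bx (Hx k) n.
  apply: le_trans (lerD h1 h2) _.
  have h3 : kap * (S / (1 - kap) * kap ^+ k) <= S / (1 - kap) * kap ^+ k.
    by rewrite ler_piMl // ltW.
  rewrite exprS [S / (1 - kap) * (kap * _)]mulrCA -[leRHS]mulrA.
  by move: h3; set z := S / (1 - kap) * kap ^+ k; lra.
exists x; split; [split=> // n|].
  apply/rowP => i; have [si|si] := boolP (st i); first by rewrite fx mxE si.
  have l0 := hm_lam HM i.
  have := congr1 (fun A : 'rV[R]_N => lam i * A 0 i) (fx n).
  rewrite /= [perron _ _ _ _ _]mxE (negbTE si) mulVKf ?gt_eqF // => h.
  by apply/eqP; rewrite -subr_eq0; apply/eqP; move: h; lra.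
by move=> i si; rewrite fx mxE si.
Qed.

End OneMap.

(** Smooth dependence of the orbit on its stable coordinates, by passing to the
    tangent map (x, v) |-> (Phi x, DPhi x v), which is again hyperbolic. *)
Section TangentMap.
Variables (N : nat) (Phi : 'rV[R]_N -> 'rV[R]_N).

Definition dup_pred (st : pred 'I_N) : pred 'I_(N + N) :=
  fun i => match fintype.split i with inl j => st j | inr j => st j end.
Definition dup_fun (f g : 'I_N -> R) (i : 'I_(N + N)) : R :=
  match fintype.split i with inl j => f j | inr j => g j end.

Lemma dup_predl st j : dup_pred st (lshift N j) = st j.
Proof. by rewrite /dup_pred (unsplitK (inl j)). Qed.
Lemma dup_predr st j : dup_pred st (rshift N j) = st j.
Proof. by rewrite /dup_pred (unsplitK (inr j)). Qed.
Lemma dup_funl f g j : dup_fun f g (lshift N j) = f j.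
Proof. by rewrite /dup_fun (unsplitK (inl j)). Qed.
Lemma dup_funr f g j : dup_fun f g (rshift N j) = g j.
Proof. by rewrite /dup_fun (unsplitK (inr j)). Qed.

Lemma ord_split_ind (P : 'I_(N + N) -> Prop) :
  (forall j, P (lshift N j)) -> (forall j, P (rshift N j)) -> forall i, P i.
Proof. by move=> Hl Hr i; rewrite -(splitK i); case: (fintype.split i). Qed.

Definition tangent_map (w : 'rV[R]_(N + N)) : 'rV[R]_(N + N) :=
  row_mx (Phi (lsubmx w)) ('D_(rsubmx w) Phi (lsubmx w)).

Lemma box_dup (r s : 'I_N -> R) (w : 'rV[R]_(N + N)) :
  box (dup_fun r s) w <-> box r (lsubmx w) /\ box s (rsubmx w).
Proof.
split=> [H|[H1 H2]].
  split=> j; rewrite mxE.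
    by have := H (lshift N j); rewrite dup_funl.
  by have := H (rshift N j); rewrite dup_funr.
apply: ord_split_ind => j; rewrite ?dup_funl ?dup_funr.
  by have := H1 j; rewrite mxE.
by have := H2 j; rewrite mxE.
Qed.

(** The fibre side rho of the box is taken so small that the second derivative of
    Phi, multiplied by rho, fits into half of the spectral gap. *)
Lemma tangent_map_hyperbolic U st lam r ep kap :
  hyperbolic_map Phi U st lam r ep kap ->
  exists rho U' ep' kap', 0 < rho /\ hyperbolic_map tangent_map U'
    (dup_pred st) (dup_fun lam lam) (dup_fun r (fun=> rho)) ep' kap'.
Proof.
move=> HM; have cb := @box_compact _ r; have vb := @box_convex _ r.
have oU := hm_open HM; have sub := hm_sub HM; have sm := hm_smooth HM.
have /choice[M HMb] : forall j : 'I_N, exists M : R, 0 < M /\ forall x v, box r x ->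
    `|'D_v ('D_(delta_mx 0 j) Phi) x| <= M * `|v|.
  move=> j; have C2 : Ck 2 U ('D_(delta_mx 0 j) Phi) by have /CkS[_] := sm 3%N; apply.
  by have [M M0 [H _ _ _]] := C2_bounds oU cb vb sub C2; exists M.
pose S := \sum_j M j.
have S0 : 0 <= S by apply: sumr_ge0 => j _; have [/ltW] := HMb j.
have /andP[k0 k1] := hm_kap HM.
(* Half of the gap 1 - kap is given up. *)
pose dl := (1 - kap) / 2.
have dl0 : 0 < dl by rewrite divr_gt0 // subr_gt0.
pose rho := dl / (S + 1).
have S1 : 0 < S + 1 by rewrite ltr_wpDl.
have rho0 : 0 < rho by rewrite divr_gt0.
have dPhi x : U x -> differentiable Phi x by exact: smooth_on_differentiable sm.
have ddPhi v x : U x -> differentiable ('D_v Phi) x.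
  by apply: smooth_on_differentiable; exact: smooth_on_derive.
have ep0 := hm_ep HM.
have oU' : open [set w : 'rV[R]_(N + N) | U (lsubmx w)].
  apply: (@open_comp _ _ (fun w : 'rV[R]_(N + N) => lsubmx w) U) => // w _.
  exact: (@mx_linear_continuous _ _ _ _ (@lsubmx R 1 N N)).
have smT : smooth_on [set w | U (lsubmx w)] tangent_map.
  move=> k.
  have Cl : Ck k [set w | U (lsubmx w)] (fun w : 'rV[R]_(N + N) => lsubmx w).
    exact: (@Ck_mxlinear _ _ _ _ _ _ _ id lsubmx oU' (Ck_id _ _)).
  have Cr : Ck k [set w | U (lsubmx w)] (fun w : 'rV[R]_(N + N) => rsubmx w).
    exact: (@Ck_mxlinear _ _ _ _ _ _ _ id rsubmx oU' (Ck_id _ _)).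
  apply: Ck_mx => // i; rewrite (ord1 i); apply: ord_split_ind => l.
    apply: (@Ck_ext _ _ _ _ _ (fun w => Phi (lsubmx w) 0 l)) => //.
      by move=> w _; rewrite row_mxEl.
    apply: Ck_entry => //.
    exact: (@Ck_compf _ _ _ _ _ _ _ U (fun w => lsubmx w) Phi oU' oU Cl).
  apply: (@Ck_ext _ _ _ _ _ (fun w =>
      \sum_i rsubmx w 0 i * ('D_(delta_mx 0 i) Phi (lsubmx w)) 0 l)) => //.
    move=> w Uw; rewrite row_mxEr derive_coords; last exact: dPhi.
    by rewrite summxE; apply: eq_bigr => q _; rewrite [RHS]mxE.
  apply: Ck_sum => // q; apply: Ck_mul => //; first exact: Ck_entry.
  apply: Ck_entry => //.
  apply: (@Ck_compf _ _ _ _ _ _ _ U (fun w => lsubmx w) ('D_(delta_mx 0 q) Phi) oU' oU Cl) => //.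
  by apply: smooth_on_derive.
exists rho, [set w | U (lsubmx w)], (ep + dl), (kap + dl); split => //; split.
- by rewrite addr_ge0 // ltW.
- by rewrite addr_ge0 ?(ltW dl0) //= /dl; lra.
- by apply: ord_split_ind => j; rewrite ?dup_funl ?dup_funr; exact: (hm_lam HM).
- by apply: ord_split_ind => j; rewrite ?dup_predl ?dup_predr ?dup_funl ?dup_funr => sj;
    have := hm_st HM sj; lra.
- have H j : ~~ st j -> 1 + (ep + dl) <= (kap + dl) * lam j.
    move=> uj; have h := hm_un HM uj; have l0 := hm_lam HM j.
    have l1 : 1 <= lam j.
      have h1 : 1 <= kap * lam j by apply: le_trans h; rewrite lerDl.
      by apply: le_trans h1 _; rewrite ler_piMl ?(ltW k1) // ltW.
    have := ler_wpM2l (ltW dl0) l1; rewrite mulrDl; lra.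
  by apply: ord_split_ind => j; rewrite ?dup_predl ?dup_predr ?dup_funl ?dup_funr; exact: H.
- by apply: ord_split_ind => j; rewrite ?dup_funl ?dup_funr //; exact: (hm_r HM).
- exact: oU'.
- by move=> w /box_dup[/sub].
- exact: smT.
- move=> w i /box_dup[B1 B2]; move: i; apply: ord_split_ind => j.
    rewrite !dup_funl /tangent_map row_mxEl.
    have := hm_small HM j B1; rewrite mxE => /le_trans; apply.
    by rewrite ler_wpM2r ?(ltW (hm_r HM j)) // lerDl ltW.
  rewrite !dup_funr /tangent_map row_mxEr.
  have := hm_deriv HM (rsubmx w) j B1; rewrite [rsubmx w 0 j]mxE => /le_trans; apply.
  apply: ler_pM => //; first by rewrite lerDl ltW.
  by apply/mx_norm_le; [exact: ltW|move=> q p; rewrite (ord1 q)].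
move=> w v i /box_dup[B1 B2].
have UB := sub _ B1.
set x := lsubmx w in B1 UB *; set y := rsubmx w in B2 *.
set a := lsubmx v; set b := rsubmx v.
have av : `|a| <= `|v| by exact: norm_lsubmx.
have bv : `|b| <= `|v| by exact: norm_rsubmx.
have dl1 : is_derive w v (fun w : 'rV[R]_(N + N) => lsubmx w) a.
  exact: (is_derive_mxlinear (@lsubmx R 1 N N) (is_derive_id w v)).
have dr1 : is_derive w v (fun w : 'rV[R]_(N + N) => rsubmx w) b.
  exact: (is_derive_mxlinear (@rsubmx R 1 N N) (is_derive_id w v)).
have dT : differentiable tangent_map w by exact: smooth_on_differentiable smT _.
have E j : ('D_v tangent_map w) 0 j = 'D_v (fun u => tangent_map u 0 j) w.
  by rewrite derive_mx ?mxE //; exact: diff_derivable.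
have epv : ep * `|v| <= (ep + dl) * `|v| by rewrite ler_wpM2r // lerDl ltW.
rewrite {}E; move: i; apply: ord_split_ind => j.
  rewrite dup_funl (_ : (fun u => _) = (fun u => Phi (lsubmx u) 0 j)); last first.
    by apply/funext => u; rewrite row_mxEl.
  have dl2 : differentiable (fun w : 'rV[R]_(N + N) => lsubmx w) w.
    exact: (@linear_differentiable _ _ _ (@lsubmx R 1 N N)) (@mx_linear_continuous _ _ _ _ _).
  have h2 := is_derive_entry 0 j (is_derive_chain dl2 dl1 (dPhi _ UB)).
  rewrite (@derive_val _ _ _ _ _ _ _ h2).
  have := hm_deriv HM a j B1; rewrite [a 0 j]mxE => /le_trans; apply.
  by apply: le_trans epv; rewrite ler_wpM2l.
rewrite dup_funr.
pose c (q : 'I_N) (u : 'rV[R]_(N + N)) : R := 'D_(delta_mx 0 q) Phi (lsubmx u) 0 j.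
pose dc (q : 'I_N) : R := 'D_a ('D_(delta_mx 0 q) Phi) x 0 j.
have hc q : is_derive w v (c q) (dc q).
  have dl2 : differentiable (fun w : 'rV[R]_(N + N) => lsubmx w) w.
    exact: (@linear_differentiable _ _ _ (@lsubmx R 1 N N)) (@mx_linear_continuous _ _ _ _ _).
  have h2 := is_derive_chain dl2 dl1 (ddPhi (delta_mx 0 q) _ UB).
  exact: is_derive_entry h2.
have hs : is_derive w v (fun u => \sum_q rsubmx u 0 q * c q u)
    (\sum_q (y 0 q * dc q + c q w * b 0 q)).
  rewrite (_ : (fun u => _) = \sum_q (fun u => rsubmx u 0 q * c q u)); last first.
    by apply/funext => u; rewrite fct_sumE.
  apply: is_derive_sum => q.
  have h1 := is_derive_entry 0 q dr1.
  exact: (is_deriveM h1 (hc q)).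
have -> : 'D_v (fun u => tangent_map u 0 (rshift N j)) w =
    \sum_q (y 0 q * dc q + c q w * b 0 q).
  rewrite -(@derive_val _ _ _ _ _ _ _ hs).
  apply: near_eq_derive; apply: filterS (open_near oU' (UB : [set w | U (lsubmx w)] w)) => u Uu.
  rewrite row_mxEr derive_coords; last exact: dPhi.
  by rewrite summxE; apply: eq_bigr => q _; rewrite [LHS]mxE.
have -> : \sum_q (y 0 q * dc q + c q w * b 0 q) - lam j * v 0 (rshift N j) =
    ('D_b Phi x 0 j - lam j * b 0 j) + \sum_q y 0 q * dc q.
  rewrite big_split /= derive_coords; last exact: dPhi.
  have -> : (\sum_i b 0 i *: 'D_(delta_mx 0 i) Phi x) 0 j = \sum_q c q w * b 0 q.
    by rewrite summxE; apply: eq_bigr => q _; rewrite [LHS]mxE mulrC.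
  by rewrite [b 0 j]mxE; ring.
apply: le_trans (ler_normD _ _) _; rewrite mulrDl; apply: lerD.
  by apply: le_trans (hm_deriv HM b j B1) _; rewrite ler_wpM2l.
apply: le_trans (ler_norm_sum _ _ _) _.
apply: (@le_trans _ _ (\sum_q rho * (M q * `|v|))).
  apply: ler_sum => q _; rewrite normrM; apply: ler_pM; [by []|by []|exact: B2|].
  apply: le_trans (mx_norm_ge _ _ _) _; have [M0 H] := HMb q.
  by apply: le_trans (H _ _ B1) _; rewrite ler_wpM2l // ltW.
rewrite -mulr_sumr -mulr_suml -/S mulrA ler_wpM2r //.
by rewrite /rho -mulrA ler_piMr ?(ltW dl0) // mulrC ler_pdivrMr // mul1r lerDl.
Qed.

End TangentMap.

Definition stable_section N (Phi : 'rV[R]_N -> 'rV[R]_N) (st : pred 'I_N)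
    (r : 'I_N -> R) (orb : 'rV[R]_N -> nat -> 'rV[R]_N) :=
  forall xi, box r xi -> bounded_orbit Phi r (orb xi) /\
    forall i, st i -> orb xi 0%N 0 i = xi 0 i.

Lemma stable_section_exists N (Phi : 'rV[R]_N -> 'rV[R]_N) U st lam r ep kap :
  hyperbolic_map Phi U st lam r ep kap -> exists orb, stable_section Phi st r orb.
Proof.
move=> HM.
have /choice[orb H] : forall xi, exists x, box r xi -> bounded_orbit Phi r x /\
    forall i, st i -> x 0%N 0 i = xi 0 i.
  move=> xi; have [Bxi|nB] := pselect (box r xi); last by exists (fun=> 0).
  by have [x Hx] := stable_orbit_exists HM Bxi; exists x.
by exists orb.
Qed.

Lemma bounded_orbit_unique N (Phi : 'rV[R]_N -> 'rV[R]_N) U st lam r ep kap x y :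
  hyperbolic_map Phi U st lam r ep kap ->
  bounded_orbit Phi r x -> bounded_orbit Phi r y ->
  (forall i, st i -> x 0%N 0 i = y 0%N 0 i) -> forall n, x n = y n.
Proof.
move=> HM Hx Hy E n; apply/eqP; rewrite -subr_eq0 -normr_le0.
apply: (orbit_stable_bound HM (lexx 0) Hx Hy) => i si.
by rewrite E // subrr normr0.
Qed.

(** Tangent orbits with given stable fibre coordinates are linear in these, and by
    hyperbolicity they approximate the difference of two orbits to second order. *)
Lemma section_linearisation N (Phi : 'rV[R]_N -> 'rV[R]_N) U st lam r ep kap orb :
  hyperbolic_map Phi U st lam r ep kap -> stable_section Phi st r orb ->
  exists rho U' ep' kap' orb2, [/\ 0 < rho,
    hyperbolic_map (tangent_map Phi) U'
      (dup_pred st) (dup_fun lam lam) (dup_fun r (fun=> rho)) ep' kap',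
    stable_section (tangent_map Phi) (dup_pred st) (dup_fun r (fun=> rho)) orb2 &
   forall xi, obox r xi -> differentiable (orb ^~ 0%N) xi /\ forall w,
     'D_w (orb ^~ 0%N) xi = w *m \matrix_(i, j) ((rho / 2)^-1 *
       rsubmx (orb2 (row_mx xi ((rho / 2) *: delta_mx 0 i)) 0%N) 0 j)].
Proof.
move=> HM Horb.
have [rho [U' [ep' [kap' [rho0 HM2]]]]] := tangent_map_hyperbolic HM.
have [orb2 Horb2] := stable_section_exists HM2.
exists rho, U', ep', kap', orb2; split=> // xi Oxi; have Bxi := obox_box Oxi.
pose s := rho / 2.
have s0 : 0 < s by rewrite divr_gt0.
have [[Bx Ox] Sx] := Horb xi Bxi.
pose w0 i := row_mx xi (s *: delta_mx 0 i) : 'rV[R]_(N + N).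
have Bw i : box (dup_fun r (fun=> rho)) (w0 i).
  apply/box_dup; rewrite row_mxKl row_mxKr; split=> // j.
  rewrite mxE normrM (gtr0_norm s0); apply: (@le_trans _ _ (s * 1)).
    by rewrite ler_wpM2l ?(ltW s0) // (le_trans (mx_norm_ge _ _ _) (norm_delta_le _)).
  by rewrite mulr1 /s; lra.
have L1 i n : lsubmx (orb2 (w0 i) n) = orb xi n.
  have [[B2 O2] S2] := Horb2 _ (Bw i).
  apply: (@bounded_orbit_unique _ Phi U st lam r ep kap (fun n => lsubmx (orb2 (w0 i) n))) => //.
    split=> k; first by have /box_dup[] := B2 k.
    by rewrite O2 row_mxKl.
  move=> j sj; rewrite mxE S2 ?dup_predl // row_mxEl.
  by rewrite Sx.
pose V i n := rsubmx (orb2 (w0 i) n).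
have V1 i n : V i n.+1 = 'D_(V i n) Phi (orb xi n).
  have [[B2 O2] S2] := Horb2 _ (Bw i).
  by rewrite /V O2 row_mxKr L1.
have V0 i j : st j -> V i 0%N 0 j = s * (j == i)%:R.
  have [[B2 O2] S2] := Horb2 _ (Bw i).
  by move=> sj; rewrite /V mxE S2 ?dup_predr // row_mxEr !mxE eqxx.
have Vb i n : `|V i n| <= rho.
  have [[B2 O2] S2] := Horb2 _ (Bw i).
  have /box_dup[_ H] := B2 n; apply/mx_norm_le; first exact: ltW.
  by move=> p q; rewrite (ord1 p); exact: H.
(* The fibre parts V i are tangent orbits over the orbit of xi with stable initial
   value s e_i; A n is the candidate for the derivative of the n-th orbit point. *)
pose A n : 'M[R]_N := \matrix_(i, j) (s^-1 * V i n 0 j).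
have AE w n : w *m A n = \sum_i (w 0 i * s^-1) *: V i n.
  apply/rowP => j; rewrite mxE summxE; apply: eq_bigr => i _.
  by rewrite /A [in LHS]mxE [in RHS]mxE mulrA.
have dPhi x : box r x -> differentiable Phi x.
  by move=> /(hm_sub HM); exact: smooth_on_differentiable (hm_smooth HM).
have W1 w n : w *m A n.+1 = 'D_(w *m A n) Phi (orb xi n).
  have dx := dPhi _ (Bx n).
  rewrite !AE deriveE // linear_sum; apply: eq_bigr => i _.
  by rewrite V1 deriveE //; apply/esym; exact: linearZ.
have W0 (w : 'rV[R]_N) j : st j -> (w *m A 0%N) 0 j = w 0 j.
  move=> sj; rewrite AE summxE (bigD1 j) //= big1 ?addr0 => [|i ij].
    by rewrite mxE V0 // eqxx mulr1 -mulrA mulVf ?mulr1 // gt_eqF.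
  by rewrite mxE V0 // eq_sym (negbTE ij) !mulr0.
have Wb (w : 'rV[R]_N) n : `|w *m A n| <= \sum_i `|w 0 i * s^-1| * rho.
  rewrite AE; apply: le_trans (ler_norm_sum _ _ _) _; apply: ler_sum => i _.
  by rewrite normrZ ler_wpM2l.
have C2 : Ck 2 U Phi by exact: (hm_smooth HM).
have [M M0 [_ _ _ M4]] := C2_bounds (hm_open HM) (@box_compact _ r) (@box_convex _ r)
  (hm_sub HM) C2.
have /andP[k0 k1] := hm_kap HM.
have k10 : 0 < 1 - kap by rewrite subr_gt0.
have est (w : 'rV[R]_N) : box r (xi + w) ->
    `|orb (xi + w) 0%N - orb xi 0%N - w *m A 0%N| <= M / (1 - kap) * `|w| ^+ 2.
  move=> Bxw; have [[By Oy] Sy] := Horb _ Bxw.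
  set x := orb xi in Bx Ox Sx W1 *; set y := orb (xi + w) in By Oy Sy *.
  (* e is an orbit of the tangent map up to an error of order |w|^2 and has vanishing
     stable initial coordinates, so that hyperbolicity makes e itself of that order. *)
  pose e n := y n - x n - w *m A n.
  have yx n : `|y n - x n| <= `|w|.
    apply: (orbit_stable_bound HM) => // i si.
    by rewrite Sy // Sx // mxE [xi 0 i + _]addrC addrK mx_norm_ge.
  have b0 : 0 <= M * `|w| ^+ 2 by rewrite mulr_ge0 ?sqr_ge0 // ltW.
  pose bn n := Phi (y n) - Phi (x n) - 'D_(y n - x n) Phi (x n).
  have bnb n : `|bn n| <= M * `|w| ^+ 2.
    apply: le_trans (M4 _ _ (Bx n) (By n)) _; rewrite ler_wpM2l ?(ltW M0) //.
    by rewrite lerXn2r ?nnegrE.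
  have eS n : e n.+1 = 'D_(e n) Phi (x n) + bn n.
    have dx := dPhi _ (Bx n).
    rewrite /e /bn Oy Ox W1 deriveDdir // deriveNdir //.
    move: (Phi (y n) - Phi (x n)) ('D_(y n - x n) _ _) ('D_(w *m A n) _ _) => P D Q.
    by rewrite [RHS]addrC addrA subrK.
  rewrite mulrAC -[leRHS]add0r.
  apply: (hyperbolic_bound HM (e := e) (D := \sum_i r i + \sum_i r i +
      \sum_i `|w 0 i * s^-1| * rho)) => //.
  - move=> n; apply: le_trans (ler_normB _ _) _; apply: lerD; last exact: Wb.
    by apply: le_trans (ler_normB _ _) _; apply: lerD; exact: (box_norm HM).
  - move=> i si; rewrite /e mxE [(y _ - x _) _ _]mxE [(- x _) _ _]mxE.
    by rewrite [(- (w *m _)) _ _]mxE W0 // Sy // Sx // mxE [xi 0 i + _]addrC addrK subrr normr0.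
  - move=> n i si.
    have -> : e n.+1 0 i = lam i * e n 0 i + ('D_(e n) Phi (x n) 0 i - lam i * e n 0 i) + bn n 0 i.
      by rewrite eS mxE; ring.
    apply: le_trans (ler_normD _ _) _; apply: lerD; last first.
      exact: le_trans (mx_norm_ge _ _ _) (bnb n).
    apply: le_trans (ler_normD _ _) _; rewrite normrM (gtr0_norm (hm_lam HM i)).
    have h3 := ler_wpM2l (ltW (hm_lam HM i)) (mx_norm_ge (e n) 0 i).
    apply: le_trans (lerD h3 (hm_deriv HM (e n) i (Bx n))) _.
    by rewrite -mulrDl ler_wpM2r // (hm_st HM).
  move=> n i si; have l0 := hm_lam HM i.
  set m := Num.max _ _.
  have m1 : `|e n.+1| <= m by rewrite le_max lexx.
  have m2 : `|e n| <= m by rewrite le_max lexx orbT.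
  have m0 : 0 <= m by exact: le_trans (normr_ge0 _) m2.
  have l1 : 1 <= lam i.
    have h1 : 1 <= kap * lam i by apply: le_trans (hm_un HM si); rewrite lerDl (hm_ep HM).
    by apply: le_trans h1 _; rewrite ler_piMl ?(ltW k1) // ltW.
  rewrite -(ler_pM2l l0) -[X in X * `|_|](gtr0_norm l0) -normrM.
  have -> : lam i * e n 0 i = e n.+1 0 i - ('D_(e n) Phi (x n) 0 i - lam i * e n 0 i) - bn n 0 i.
    by rewrite eS [('D_(e n) Phi (x n) + bn n) 0 i]mxE; ring.
  apply: le_trans (ler_normB _ _) _; rewrite mulrDr; apply: lerD; last first.
    apply: le_trans (mx_norm_ge _ _ _) _; apply: le_trans (bnb n) _.
    by rewrite ler_peMl.
  apply: le_trans (ler_normB _ _) _.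
  apply: (@le_trans _ _ ((1 + ep) * m)).
    rewrite mulrDl mul1r; apply: lerD; first exact: le_trans (mx_norm_ge _ _ _) m1.
    by apply: le_trans (hm_deriv HM (e n) i (Bx n)) _; rewrite ler_wpM2l ?(hm_ep HM).
  by rewrite mulrA [lam i * kap]mulrC ler_wpM2r //; exact: (hm_un HM).
have /nbhs_ballP[d1 d10 Hd1] : nbhs xi (obox r) by exact: obox_open.
have [||d2 d3] := @diff_of_eps R _ _ (orb ^~ 0%N) (mulmxr (A 0%N)) xi.
- exact: mx_linear_continuous.
- move=> e e0.
  pose C := M / (1 - kap).
  have C0 : 0 < C by rewrite divr_gt0.
  apply/nbhs_ballP; exists (Num.min d1 (e / C)).
    by rewrite /= lt_min d10 divr_gt0.
  move=> w; rewrite -ball_normE /= sub0r normrN lt_min => /andP[w1 w2].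
  rewrite [w + xi]addrC; apply: le_trans (est w _) _.
    apply: obox_box; apply: Hd1.
    by rewrite -ball_normE /= opprD addrA subrr sub0r normrN.
  by rewrite expr2 mulrA ler_wpM2r // -ler_pdivlMl // mulrC ltW.
by split=> // w; rewrite deriveE // d3.
Qed.

(** Induction on k, for all hyperbolic maps at once: the derivative of the section
    is the fibre part of the section of the tangent map. *)
Lemma stable_section_Ck k N (Phi : 'rV[R]_N -> 'rV[R]_N) U st lam r ep kap orb :
  hyperbolic_map Phi U st lam r ep kap -> stable_section Phi st r orb ->
  Ck k (obox r) (orb ^~ 0%N).
Proof.
elim: k N Phi U st lam r ep kap orb => [|k IH] N Phi U st lam r ep kap orb HM Horb.
  have [rho [U' [ep' [kap' [orb2 [_ _ _ H]]]]]] := section_linearisation HM Horb.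
  by move=> xi /H[d _]; exact: differentiable_continuous.
have [rho [U' [ep' [kap' [orb2 [rho0 HM2 Horb2 H]]]]]] := section_linearisation HM Horb.
have oB := @obox_open _ r.
apply/CkS; split=> [xi /H[]//|v].
pose A xi : 'M[R]_N := \matrix_(i, j) ((rho / 2)^-1 *
       rsubmx (orb2 (row_mx xi ((rho / 2) *: delta_mx 0 i)) 0%N) 0 j).
apply: (@Ck_ext _ _ _ _ _ (fun xi => v *m A xi)) => //.
  by move=> x /H[_ ->].
apply: Ck_mulmxl => //; apply: Ck_mx => // i j.
apply: (@Ck_ext _ _ _ _ _ (fun xi => (rho / 2)^-1 *:
   (rsubmx (orb2 (row_mx xi ((rho / 2) *: delta_mx 0 i)) 0%N) 0 j : R^o))) => //.
  by move=> x _; rewrite /A [RHS]mxE.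
apply: Ck_scale => //; apply: Ck_entry => //.
apply: Ck_mxlinear => //.
have r20 : 0 < rho / 2 by rewrite divr_gt0.
apply: (@Ck_compf _ _ _ _ _ _ _ _ (fun xi => row_mx xi ((rho / 2) *: delta_mx 0 i))
   (orb2 ^~ 0%N) oB (@obox_open _ _) _ _ (IH _ _ _ _ _ _ _ _ _ HM2 Horb2)).
  apply: Ck_mx => // p; rewrite (ord1 p); apply: ord_split_ind => l.
    apply: (@Ck_ext _ _ _ _ _ (fun x : 'rV[R]_N => x 0 l)) => //.
      by move=> x _; rewrite row_mxEl.
    by apply: Ck_entry => //; exact: Ck_id.
  apply: (@Ck_ext _ _ _ _ _ (fun x : 'rV[R]_N => ((rho / 2) *: delta_mx 0 i : 'rV[R]_N) 0 l)) => //.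
    by move=> x _; rewrite row_mxEr.
  exact: Ck_cst.
move=> x Ox; apply: ord_split_ind => l; rewrite ?dup_funl ?dup_funr ?row_mxEl ?row_mxEr.
  exact: Ox.
rewrite mxE normrM (gtr0_norm r20); apply: (@le_lt_trans _ _ (rho / 2 * 1)).
  by rewrite ler_wpM2l ?(ltW r20) // (le_trans (mx_norm_ge _ _ _) (norm_delta_le _)).
by rewrite mulr1; lra.
Qed.

End StableManifold.

(** * Local flows and the local stable manifold of a vector field *)

Lemma entryB (R : realType) p q (A B : 'M[R]_(p, q)) i j : (A - B) i j = A i j - B i j.
Proof. by rewrite !mxE. Qed.

Section LocalField.
Context {R : realType} {N : nat}.

(** Composed with the projection onto a small ball the field becomes globally
    Lipschitz and bounded, and therefore has a global flow. *)
Lemma local_field (Y : 'rV[R]_N -> 'rV[R]_N) (U : set 'rV[R]_N) z0 (r0 : R) :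
  open U -> U z0 -> smooth_on U Y -> 0 < r0 ->
  exists (r1 K L : R) (Y' : 'rV[R]_N -> 'rV[R]_N) phi,
   [/\ 0 < r1, r1 <= r0, 0 < K & 0 < L] /\
   [/\ [set x | `|x - z0| < r1] `<=` U, lipschitz_field Y' L,
       forall x, `|Y' x| <= K, forall x, `|x - z0| < r1 -> Y' x = Y x &
       flow_of Y' phi].
Proof.
move=> oU Uz sY r00.
have /nbhs_ballP[d d0 Hd] : nbhs z0 U by exact: oU.
have {}d0 : 0 < d by exact: d0.
pose r1 := Num.min (d / 2) r0.
have r10 : 0 < r1 by rewrite lt_min r00 divr_gt0.
have sub : cball z0 r1 `<=` U.
  move=> x; rewrite /cball /= /r1 le_min => /andP[h _]; apply: Hd.
  by rewrite -ball_normE /= distrC; apply: le_lt_trans h _; rewrite ltr_pdivrMr //; lra.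
have [M M0 [M1 M2 M3 M4]] := C2_bounds oU (@cball_compact _ _ z0 r1 r10)
  (@cball_convex _ _ z0 r1) sub (sY 2%N).
pose Y' x := Y (clampv z0 r1 x).
have cin x : cball z0 r1 (clampv z0 r1 x) by apply: clampv_ball; exact: ltW.
have lip : lipschitz_field Y' M.
  move=> x y; rewrite distrC; apply: le_trans (M2 _ _ (cin _) (cin _)) _.
  by rewrite ler_wpM2l ?(ltW M0) // distrC; exact: clampv_lipschitz.
have [phi Hphi] := flow_exists M0 lip.
have [K K0 HK] := compact_norm_bounded (@cball_compact _ _ z0 r1 r10)
  (fun x Kx => Ck_continuous (sY 0%N) (sub x Kx)).
exists r1, K, M, Y', phi; split; split=> //.
- by rewrite /r1 ge_min lexx orbT.
- by move=> x /ltW; exact: sub.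
- by move=> x; apply: HK; exact: cin.
- by move=> x /ltW h; rewrite /Y' clampv_id // ltW.
Qed.

Lemma smooth_on_ext (V W : normedModType R) (U U' : set V) (F G : V -> W) :
  open U' -> U' `<=` U -> (forall x, U' x -> F x = G x) -> smooth_on U G -> smooth_on U' F.
Proof.
move=> oU' sub FG sG k; apply: (@Ck_ext _ _ _ _ _ G) => // [x Ux|]; first by rewrite FG.
exact: Ck_sub (sG k).
Qed.

Lemma flow_displacement (Y : 'rV[R]_N -> 'rV[R]_N) phi (K t : R) z : flow_of Y phi ->
  (forall x, `|Y x| <= K) -> 0 <= t -> `|phi t z - z| <= K * t.
Proof.
move=> [p0 Hp] HK t0.
have := @mean_value_le _ _ _ (phi^~ z) (fun t => Y (phi t z)) 0 t K t0.
by rewrite p0 subr0; apply=> s _; exact: HK.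
Qed.

Lemma flow_opp (Y : 'rV[R]_N -> 'rV[R]_N) phi : flow_of Y phi ->
  flow_of (fun x => - Y x) (fun t => phi (- t)).
Proof.
move=> [p0 Hp]; split=> [z|z t]; first by rewrite oppr0.
exact: (is_derive_comp_opp (Hp z (- t))).
Qed.

Lemma lipschitz_opp (Y : 'rV[R]_N -> 'rV[R]_N) L : lipschitz_field Y L ->
  lipschitz_field (fun x => - Y x) L.
Proof. by move=> H x y; rewrite -opprD normrN; exact: H. Qed.

(** The truncated field is bounded, so that for a short time trajectories starting in
    the small ball do not leave the larger one, in which it equals Y. *)
Lemma local_flow (Y : 'rV[R]_N -> 'rV[R]_N) (U : set 'rV[R]_N) z0 :
  open U -> U z0 -> smooth_on U Y ->
  exists (tau r r1 : R) phi, [/\ 0 < tau, 0 < r & r < r1] /\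
   [/\ [set x | `|x - z0| < r1] `<=` U,
       forall z, phi 0 z = z,
       forall z t, `|t| <= tau -> `|z - z0| < r -> `|phi t z - z0| < r1 /\
         is_derive t (1 : R) (phi ^~ z) (Y (phi t z)),
       forall t, `|t| <= tau -> smooth_on [set z | `|z - z0| < r] (phi t) &
       (forall s t z, phi (s + t) z = phi s (phi t z)) /\
       forall (c : R -> 'rV[R]_N) a, 0 <= a -> (forall t, 0 <= t <= a ->
           `|c t - z0| < r1 /\ is_derive t (1 : R) c (Y (c t))) ->
         forall t, 0 <= t <= a -> c t = phi t (c 0)].
Proof.
move=> oU Uz sY.
have [r1 [K [L [Y' [phi [[r10 _ K0 L0] [sub lip HK E Hphi]]]]]]] :=
  local_field oU Uz sY ltr01.
pose tau := r1 / (2 * K); pose r := r1 / 2.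
have tau0 : 0 < tau by rewrite divr_gt0 // mulr_gt0.
have r0 : 0 < r by rewrite divr_gt0.
have rr1 : r < r1 by rewrite /r; lra.
have sY' : smooth_on [set x | `|x - z0| < r1] Y'.
  exact: (@smooth_on_ext _ _ U _ Y' Y (@oball_open _ _ z0 r1) sub E sY).
have disp z t : `|t| <= tau -> `|phi t z - z| <= r1 / 2.
  move=> tt; apply: (@le_trans _ _ (K * `|t|)); last first.
    by rewrite mulrC -ler_pdivlMr // (le_trans tt) // /tau invfM mulrA.
  have [t0|t0] := leP 0 t.
    by rewrite (ger0_norm t0); exact: (flow_displacement z Hphi HK t0).
  rewrite (ltr0_norm t0).
  have := @flow_displacement _ _ K (- t) z (flow_opp Hphi).
  by rewrite opprK; apply=> [x|]; [rewrite normrN|rewrite oppr_ge0 ltW].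
have st z t : `|t| <= tau -> `|z - z0| < r -> `|phi t z - z0| < r1.
  move=> tt zz; have -> : phi t z - z0 = (phi t z - z) + (z - z0) by rewrite addrA subrK.
  apply: le_lt_trans (ler_normD _ _) _; have := disp z t tt; move: zz; rewrite /r; lra.
exists tau, r, r1, phi; split; split=> //.
- exact: Hphi.1.
- move=> z t tt zz; have h := st z t tt zz; split=> //.
  by rewrite -E //; exact: Hphi.2.
- move=> t tt k; have [t0|t0] := leP 0 t.
    apply: Ck_sub (flow_Ck k L0 lip Hphi sY' t0) => z /= zz s /andP[s0 st'].
    by apply: st => //; rewrite ger0_norm // (le_trans st') // -(ger0_norm t0).
  have nt : 0 <= - t by rewrite oppr_ge0 ltW.
  have sN : smooth_on [set x | `|x - z0| < r1] (fun x => - Y' x).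
    by move=> l; apply: Ck_opp; [exact: oball_open|exact: sY'].
  have := flow_Ck k L0 (lipschitz_opp lip) (flow_opp Hphi) sN nt.
  rewrite opprK; apply: Ck_sub => z /= zz s /andP[s0 st'].
  by apply: st => //; rewrite normrN ger0_norm // (le_trans st') // -(ltr0_norm t0).
split=> [s t z|c a a0 Hc t ta].
  have [s0|s0] := leP 0 s; first exact: (flow_semigroup _ _ (ltW L0) lip Hphi).
  have := flow_semigroup (- t) z (ltW L0) (lipschitz_opp lip) (flow_opp Hphi) (_ : 0 <= - s).
  by rewrite oppr_ge0 (ltW s0) opprD !opprK; apply.
apply: (@curves_unique _ _ Y' L c (phi ^~ (c 0)) a (ltW L0) lip a0) => //.
- by rewrite Hphi.1.
- by move=> u /Hc[h1 h2]; rewrite E.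
- by move=> u _; exact: Hphi.2.
Qed.

(** Finitely many positive numbers other than 1 stay away from 1. *)
Lemma spectral_gap (st : pred 'I_N) (lam : 'I_N -> R) :
  (forall i, 0 < lam i) -> (forall i, st i -> lam i < 1) -> (forall i, ~~ st i -> 1 < lam i) ->
  exists ep kap : R, [/\ 0 < ep, 0 <= kap < 1, forall i, st i -> lam i + ep <= kap &
    forall i, ~~ st i -> 1 + ep <= kap * lam i].
Proof.
move=> l0 Hs Hu.
pose m i := if st i then lam i else (lam i)^-1.
have m1 i : m i < 1.
  rewrite /m; case: ifPn => [/Hs//|/Hu h]; rewrite invf_lt1 //; exact: l0.
pose k0 := \big[Num.max/2^-1]_i m i.
have k01 : k0 < 1.
  rewrite /k0; elim/big_ind: _ => [|x y x1 y1|i _]; last exact: m1.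
    by rewrite invf_lt1 // ltr1n.
  by rewrite gt_max x1 y1.
have k00 : 0 < k0.
  have : 2^-1 <= k0 by rewrite /k0; elim/big_rec: _ => // i x _ h; rewrite le_max h orbT.
  by apply: lt_le_trans; rewrite invr_gt0.
have mk i : m i <= k0 by rewrite /k0 (bigD1 i) //= le_max lexx.
exists ((1 - k0) / 2), ((1 + k0) / 2); split.
- by rewrite divr_gt0 // subr_gt0.
- by rewrite divr_ge0 ?addr_ge0 ?(ltW k00) //= ltr_pdivrMr //; lra.
- by move=> i si; have := mk i; rewrite /m si; lra.
move=> i ui; have := mk i; rewrite /m (negbTE ui) => h.
have h2 : k0^-1 <= lam i.
  rewrite -(invrK (lam i)) lef_pV2 ?posrE ?invr_gt0 //; exact: l0.
apply: (@le_trans _ _ ((1 + k0) / 2 * k0^-1)); last first.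
  by rewrite ler_wpM2l // divr_ge0 // addr_ge0 // ltW.
rewrite ler_pdivlMr //.
have : 0 <= (1 - k0) ^+ 2 by exact: sqr_ge0.
by rewrite expr2; lra.
Qed.

(** Hyperbolicity of the time-one map turns the stable manifold theorem for maps
    into one for fields. The stable manifold is the fixed-point set of g, which
    sends a point to the point of the stable manifold with the same stable
    coordinates. *)
Lemma local_stable_manifold (Y : 'rV[R]_N -> 'rV[R]_N) (U : set 'rV[R]_N)
    (mu : 'I_N -> R) (r0 : R) :
  open U -> U 0 -> smooth_on U Y -> Y 0 = 0 -> 0 < r0 ->
  (forall v i, 'D_v Y 0 0 i = - (mu i * v 0 i)) -> (forall i, mu i != 0) ->
  exists (rho : R) (g : 'rV[R]_N -> 'rV[R]_N), [/\ 0 < rho, rho <= r0 &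
   [/\ smooth_on (obox (fun=> rho)) g,
      forall x i, obox (fun=> rho) x -> 0 < mu i -> g x 0 i = x 0 i,
      forall x y, obox (fun=> rho) x -> obox (fun=> rho) y ->
        (forall i, 0 < mu i -> x 0 i = y 0 i) -> g x = g y,
      forall x, obox (fun=> rho) x -> g x = x -> exists c : R -> 'rV[R]_N,
        [/\ c 0 = x, forall t, 0 <= t -> `|c t| < r0 /\ U (c t) /\ is_derive t (1 : R) c (Y (c t)) &
            c t @[t --> +oo] --> (0 : 'rV[R]_N)] &
      forall c : R -> 'rV[R]_N, obox (fun=> rho) (c 0) ->
        (forall t, 0 <= t -> `|c t| <= rho /\ is_derive t (1 : R) c (Y (c t))) ->
        g (c 0) = c 0]].
Proof.
move=> oU U0 sY Y0 r00 DY mu0.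
have [r1 [K [L [Y' [phi [[r10 r1r0 K0 L0] [sub lip HK E Hphi]]]]]]] :=
  local_field oU U0 sY r00.
have sY' : smooth_on [set x : 'rV[R]_N | `|x - 0| < r1] Y'.
  exact: (@smooth_on_ext _ _ U _ Y' Y (@oball_open _ _ 0 r1) sub E sY).
have z0 : `|0 - 0 : 'rV[R]_N| < r1 by rewrite subr0 normr0.
have Y'0 : Y' 0 = 0 by rewrite E.
have phi00 t : 0 <= t -> phi t 0 = 0.
  move=> t0; apply/esym; apply: (@curves_unique _ _ Y' L (cst 0) (phi ^~ 0) t (ltW L0) lip t0).
  - by rewrite Hphi.1.
  - by move=> s _; rewrite Y'0; exact: is_derive_cst.
  - by move=> s _; exact: Hphi.2.
  - by rewrite t0 lexx.
pose st : pred 'I_N := fun i => 0 < mu i.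
pose lam i := expR (- mu i).
have [ep [kap [ep0 kap1 Hst Hun]]] : exists ep kap : R,
    [/\ 0 < ep, 0 <= kap < 1, forall i, st i -> lam i + ep <= kap &
    forall i, ~~ st i -> 1 + ep <= kap * lam i].
  apply: spectral_gap => i; first exact: expR_gt0.
    by rewrite /st /lam expR_lt1 oppr_lt0.
  by rewrite /st /lam expR_gt1 -leNgt oppr_gt0 lt_neqAle mu0.
pose Phi := phi 1.
pose O := stays phi 0 r1 1.
have oO : open O by exact: (stays_open L0 lip Hphi ler01).
have O0 : O 0 by move=> t /andP[t0 _]; rewrite phi00.
have sPhi : smooth_on O Phi by move=> k; exact: (flow_Ck k L0 lip Hphi sY' ler01).
have DPhi v i : 'D_v Phi 0 0 i = lam i * v 0 i.
  have -> : 'D_v Phi 0 = \row_i (expR (- mu i * 1) * v 0 i).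
    apply: (flow_derivative (V := fun t => \row_i (expR (- mu i * t) * v 0 i))
       L0 lip Hphi sY' ler01 O0).
      by apply/rowP => j; rewrite mxE mulr0 expR0 mul1r.
    move=> t /andP[t0 _]; rewrite phi00 //; apply: is_derive_mx => p q; rewrite (ord1 p).
    have -> : 'D_(\row_i (expR (- mu i * t) * v 0 i)) Y' 0 =
              'D_(\row_i (expR (- mu i * t) * v 0 i)) Y 0.
      apply: near_eq_derive; apply: filterS (open_near (@oball_open _ _ 0 r1) z0) => x.
      exact: E.
    rewrite DY mxE (_ : (fun y => _) = v 0 q *: (fun t => expR (- mu q * t))); last first.
      by apply/funext => s; rewrite mxE mulrC.
    have h := is_derive_expM (- mu q) t.
    have := is_deriveZ (v 0 q) h; rewrite /GRing.scale /= => h'.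
    by apply: is_derive_eq h' _; ring.
  by rewrite mxE mulr1.
have /nbhs_ballP[d d0 Hd] : nbhs (0 : 'rV[R]_N) O by exact: oO.
have {}d0 : 0 < d by exact: d0.
pose d' := d / 2.
have d'0 : 0 < d' by rewrite divr_gt0.
have subO : cball 0 d' `<=` O.
  move=> x; rewrite /cball /= => h; apply: Hd.
  by rewrite -ball_normE /= distrC; apply: le_lt_trans h _; rewrite /d' ltr_pdivrMr //; lra.
have [M M0 [M1 M2 M3 M4]] := C2_bounds oO (@cball_compact _ _ 0 d' d'0)
  (@cball_convex _ _ 0 d') subO (sPhi 2%N).
pose G := gronwall_const (N := N) L 1.
have G0 : 0 <= G by exact: gronwall_const_ge0.
have G1 : 0 < G + 1 by rewrite ltr_wpDl.
(* The first two bounds make Phi hyperbolic on the box; the last one keeps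
   trajectories between integer times in the region where Y' = Y. *)
pose rho := Num.min (Num.min d' (ep / M)) (r1 / (2 * (G + 1))).
have rho0 : 0 < rho by rewrite !lt_min d'0 !divr_gt0 // mulr_gt0.
have rho1 : rho <= d' by rewrite /rho !ge_min lexx.
have rho2 : M * rho <= ep.
  by rewrite mulrC -ler_pdivlMr // /rho !ge_min lexx orbT.
have rho3 : (G + 1) * rho <= r1 / 2.
  rewrite mulrC -ler_pdivlMr // /rho !ge_min; apply/orP; right.
  by rewrite invfM mulrA.
have rhor1 : rho < r1.
  apply: (@le_lt_trans _ _ ((G + 1) * rho)); last by apply: le_lt_trans rho3 _; lra.
  by rewrite ler_peMl ?(ltW rho0) // lerDr.
have boxn (x : 'rV[R]_N) : box (fun=> rho) x -> `|x| <= rho.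
  by move=> H; apply/mx_norm_le; [exact: ltW|move=> p q; rewrite (ord1 p)].
have nbox (x : 'rV[R]_N) : `|x| <= rho -> box (fun=> rho) x.
  by move=> H i; exact: le_trans (mx_norm_ge _ _ _) H.
have boxc (x : 'rV[R]_N) : box (fun=> rho) x -> cball 0 d' x.
  by move=> /boxn h; rewrite /cball /= subr0 (le_trans h).
have Phi0 : Phi 0 = 0 by exact: phi00.
have c0 : cball 0 d' (0 : 'rV[R]_N) by rewrite /cball /= subr0 normr0 ltW.
have HM : hyperbolic_map Phi O st lam (fun=> rho) ep kap.
  split=> //.
  - exact: ltW.
  - by move=> i; exact: expR_gt0.
  - by move=> x /boxc/subO.
  - move=> x i Bx.
    have := M4 0 x c0 (boxc x Bx); rewrite Phi0 !subr0 => h.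
    have -> : Phi x 0 i - lam i * x 0 i = (Phi x - 'D_x Phi 0) 0 i.
      by rewrite entryB -(DPhi x i).
    apply: le_trans (mx_norm_ge _ _ _) _; apply: le_trans h _.
    rewrite expr2 mulrA; apply: ler_pM => //; first by rewrite mulr_ge0 // ltW.
      by apply: le_trans rho2; rewrite ler_wpM2l ?(ltW M0) // boxn.
    exact: boxn.
  move=> x v i Bx.
  have := M3 0 x v c0 (boxc x Bx); rewrite !subr0 => h.
  have -> : 'D_v Phi x 0 i - lam i * v 0 i = ('D_v Phi x - 'D_v Phi 0) 0 i.
    by rewrite entryB -(DPhi v i).
  apply: le_trans (mx_norm_ge _ _ _) _; apply: le_trans h _.
  by rewrite ler_wpM2r // (le_trans _ rho2) // ler_wpM2l ?(ltW M0) // boxn.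
have [orb Horb] := stable_section_exists HM.
have un (x y : nat -> 'rV[R]_N) := @bounded_orbit_unique _ _ _ _ _ _ _ _ _ x y HM.
have phiS n x : phi n.+1%:R x = Phi (phi n%:R x).
  by rewrite -natr1 addrC; exact: (flow_semigroup _ _ (ltW L0) lip Hphi ler01).
have frac (t : R) : 0 <= t -> exists n : nat, n%:R <= t <= n%:R + 1.
  move=> t0; exists (Num.truncn t); have /andP[h1 h2] := truncn_itv t0.
  by rewrite h1 /= natr1 ltW.
have between (t : R) n x : n%:R <= t <= n%:R + 1 -> `|phi t x| <= G * `|phi n%:R x|.
  move=> /andP[h1 h2].
  have -> : phi t x = phi (t - n%:R) (phi n%:R x).
    rewrite -(flow_semigroup _ _ (ltW L0) lip Hphi) ?subrK //.
    by rewrite subr_ge0.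
  have tn : 0 <= t - n%:R <= 1 by apply/andP; split; lra.
  have := flow_lipschitz (ltW L0) lip Hphi ler01 (phi n%:R x) 0 tn.
  by rewrite subr0 phi00 ?subr0 //; case/andP: tn.
exists rho, (fun x => orb x 0%N); split=> //; first exact: le_trans (ltW rhor1) r1r0.
split.
- move=> k; exact: (stable_section_Ck k HM Horb).
- by move=> x i /obox_box Bx si; have [_] := Horb x Bx; apply.
- move=> x y /obox_box Bx /obox_box By xy.
  have [Ox Sx] := Horb x Bx; have [Oy Sy] := Horb y By.
  by apply: un => // i si; rewrite Sx // Sy // xy.
- move=> x /obox_box Bx Ex; have [[Bo Oo] So] := Horb x Bx.
  have En n : phi n%:R x = orb x n.
    elim: n => [|n IH]; first by rewrite Hphi.1 Ex.
    by rewrite phiS IH Oo.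
  have bnd t : 0 <= t -> `|phi t x| < r1.
    move=> /frac[n tn]; apply: le_lt_trans (between t n x tn) _.
    rewrite En; apply: (@le_lt_trans _ _ ((G + 1) * rho)).
      by apply: ler_pM => //; [rewrite lerDl|exact: boxn].
    by apply: le_lt_trans rho3 _; lra.
  exists (phi ^~ x); split; first exact: Hphi.1.
    move=> t t0; have b := bnd t t0; have b' : `|phi t x - 0| < r1 by rewrite subr0.
    split; first exact: lt_le_trans b r1r0.
    by split; [exact: sub|rewrite -E //; exact: Hphi.2].
  have cv := orbit_cvg0 HM Phi0 (conj Bo Oo).
  have SS0 : 0 <= \sum_(i < N) rho by rewrite sumr_ge0 // => i _; exact: ltW.
  apply/cvgrPdist_le => e e0.
  have /cvgrPdist_lt /(_ e e0) [n _ Hn] : (fun n => G * (\sum_(i < N) rho) * kap ^+ n) @ \oo --> (0 : R).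
    rewrite -[X in _ --> X](mulr0 (G * (\sum_(i < N) rho))); apply: cvgMr.
    by case/andP: kap1 => k0 k1; apply: cvg_expr; rewrite ger0_norm.
  exists n.+1%:R; split; first exact: num_real.
  move=> t nt; rewrite sub0r normrN.
  have t0 : 0 <= t by apply: le_trans (ltW nt).
  have [k tk] := frac t t0.
  have nk : (n <= k)%N.
    rewrite -(ler_nat R); have /andP[_ h] := tk.
    by have := le_lt_trans h; rewrite -natr1 in nt; lra.
  apply: le_trans (between t k x tk) _; rewrite En.
  have := Hn k nk; rewrite sub0r normrN => /ltW; apply: le_trans.
  rewrite ger0_norm; last by rewrite !mulr_ge0 // exprn_ge0 //; case/andP: kap1.
  by rewrite -mulrA ler_wpM2l.
move=> c Oc Hc; have Bc := obox_box Oc; have [[Bo Oo] So] := Horb _ Bc.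
have Ec t : 0 <= t -> c t = phi t (c 0).
  move=> t0; apply: (@curves_unique _ _ Y' L c (phi ^~ (c 0)) t (ltW L0) lip t0).
  - by rewrite Hphi.1.
  - move=> s /andP[s0 _]; have [h1 h2] := Hc s s0; rewrite E // subr0.
    exact: le_lt_trans h1 rhor1.
  - by move=> s _; exact: Hphi.2.
  - by rewrite t0 lexx.
have OB : bounded_orbit Phi (fun=> rho) (fun n => c n%:R).
  split=> n; first by apply: nbox; have [] := Hc n%:R (ler0n _ n).
  rewrite (Ec n.+1%:R (ler0n _ _)) (Ec n%:R (ler0n _ _)); exact: phiS.
by have := un _ _ (conj Bo Oo) OB _ 0%N; apply => i si; rewrite So.
Qed.

End LocalField.

(** * Charts and tangent vectors *)

Lemma is_deriveP (R : realType) (W : normedModType R) (F : R -> W) (t : R) v :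
  is_derive t (1 : R) F v <->
  (fun h : R => h^-1 *: (F (h + t) - F t)) @ 0^' --> v.
Proof.
have e : (fun h : R => h^-1 *: ((F \o shift t) (h *: (1 : R)) - F t)) =
         (fun h : R => h^-1 *: (F (h + t) - F t)).
  by apply/funext => h; rewrite /= [h *: _]mulr1.
split=> [[d <-]|c]; first by rewrite -e; exact: d.
have d : derivable F t 1.
  by rewrite /derivable e; apply/cvg_ex; exists v.
by apply: DeriveDef => //; rewrite /derive e; exact: cvg_lim.
Qed.

Lemma mul_jacobian (R : realType) n k (F : 'rV[R]_n -> 'rV[R]_k) z v :
  differentiable F z -> v *m 'J F z = 'D_v F z.
Proof. by move=> dF; rewrite deriveE // /jacobian mul_rV_lin1. Qed.

Lemma rV_mul_eq (R : realType) n k (P Q : 'M[R]_(n, k)) :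
  (forall v : 'rV[R]_n, v *m P = v *m Q) -> P = Q.
Proof. by move=> h; apply/row_matrixP => i; rewrite !rowE. Qed.

Lemma jacobian_comp (R : realType) n k l (F : 'rV[R]_n -> 'rV[R]_k)
    (H : 'rV[R]_k -> 'rV[R]_l) z :
  differentiable F z -> differentiable H (F z) ->
  'J (H \o F) z = 'J F z *m 'J H (F z).
Proof.
move=> dF dH; apply: rV_mul_eq => v.
rewrite (mul_jacobian _ (differentiable_comp dF dH)) (derive_chain _ dF dH) mulmxA.
by rewrite (mul_jacobian v dF) (mul_jacobian _ dH).
Qed.

Lemma jacobian_ext (R : realType) n k (F H : 'rV[R]_n -> 'rV[R]_k) z :
  (\forall y \near z, F y = H y) -> differentiable F z -> 'J F z = 'J H z.
Proof.
move=> e dF; have dH := near_eq_differentiable e dF.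
apply: rV_mul_eq => v; transitivity ('D_v F z); first exact: mul_jacobian.
by rewrite (near_eq_derive v e); apply/esym; exact: mul_jacobian.
Qed.

#[local] Opaque jacobian derive.

Section Charts.
Context {R : realType} {m : nat} {M : manifold R m}.
Implicit Types (x y p : M) (phi psi chi : chart R m M) (g : M -> R) (c : R -> M).

Lemma cimg_cmap phi x : cdom phi x -> cimg phi (cmap phi x).
Proof. by exists x. Qed.

Lemma cimg_cdom phi z : cimg phi z -> cdom phi (cinv phi z).
Proof. by case=> x dx <-; rewrite cmapK. Qed.

Lemma cinvK phi z : cimg phi z -> cmap phi (cinv phi z) = z.
Proof. by case=> x dx <-; rewrite cmapK. Qed.

Lemma cdom_near phi x : cdom phi x -> \forall y \near x, cdom phi y.
Proof. by move=> dx; apply: open_nbhs_nbhs; split=> //; exact: cdom_open. Qed.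

Lemma cimg_near phi z : cimg phi z -> \forall y \near z, cimg phi y.
Proof. exact: open_near (@cimg_open _ _ _ phi). Qed.

Lemma atlas_smooth_chart phi : atlas phi -> smooth_chart phi.
Proof. by move=> a psi b; split; exact: atlas_compatible. Qed.

Lemma chart_at_smooth x : smooth_chart (chart_at x).
Proof. exact: atlas_smooth_chart (@chart_at_atlas _ _ _ x). Qed.

Definition overlap phi psi := cmap phi @` (cdom phi `&` cdom psi).

Lemma overlapE phi psi z : overlap phi psi z <-> cimg phi z /\ cdom psi (cinv phi z).
Proof.
split; first by case=> x [dx dy] <-; rewrite cmapK //; split=> //; exact: cimg_cmap.
by case=> iz dz; exists (cinv phi z); [split=> //; exact: cimg_cdom|exact: cinvK].
Qed.

Lemma preimage_cinv_open phi (U : set M) : open U ->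
  open [set z | cimg phi z /\ U (cinv phi z)].
Proof.
move=> oU; rewrite openE => z [iz Uz]; rewrite /interior; near=> y; split.
  by near: y; exact: cimg_near.
near: y; apply: (@cinv_continuous _ _ _ phi z iz); exact: open_nbhs_nbhs.
Unshelve. all: by end_near. Qed.

Lemma overlap_open phi psi : open (overlap phi psi).
Proof.
rewrite (_ : overlap phi psi = [set z | cimg phi z /\ cdom psi (cinv phi z)]).
  by apply: preimage_cinv_open; exact: cdom_open.
by apply/seteqP; split=> z /overlapE.
Qed.

Lemma overlap_near phi psi x : cdom phi x -> cdom psi x ->
  \forall z \near cmap phi x, overlap phi psi z.
Proof.
move=> d1 d2; have o : overlap phi psi (cmap phi x) by exists x.
by apply: open_nbhs_nbhs; split=> //; exact: overlap_open.
Qed.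

(** Compatibility with the atlas, chart by chart, suffices: near any point one
    factors through the preferred chart there. *)
Lemma smooth_charts_compatible phi psi :
  smooth_chart phi -> smooth_chart psi -> smooth_on (overlap phi psi) (cmap psi \o cinv phi).
Proof.
move=> sp sq k; apply: Ck_locally => _ [x [dx dy] <-].
have ha := @chart_at_atlas _ _ _ x; set a := chart_at x in ha.
have da : cdom a x by exact: chart_at_dom.
exists (overlap phi a `&` overlap phi psi); split.
- by apply: openI; exact: overlap_open.
- by split; exists x.
apply: (@Ck_ext _ _ _ _ _ ((cmap psi \o cinv a) \o (cmap a \o cinv phi))).
- by apply: openI; exact: overlap_open.
- by move=> z [/overlapE [iz dz] _] /=; rewrite cmapK.
apply: (@Ck_comp _ _ _ _ _ _ _ (overlap a psi)).
- by apply: openI; exact: overlap_open.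
- exact: overlap_open.
- by apply: (@Ck_sub _ _ _ _ (overlap phi a)); [move=> z []|exact: (sp a ha).1].
- by move=> z [/overlapE [iz dz] /overlapE [_ dz']] /=; exists (cinv phi z).
- exact: (sq a ha).2.
Qed.

Lemma smooth_fun_chart g phi : smooth_fun g -> smooth_chart phi ->
  smooth_on (cimg phi) (g \o cinv phi).
Proof.
move=> sg sp k; apply: Ck_locally => _ [x dx <-].
have ha := @chart_at_atlas _ _ _ x; set a := chart_at x in ha.
have da : cdom a x by exact: chart_at_dom.
exists (overlap phi a); split; [exact: overlap_open|by exists x|].
apply: (@Ck_ext _ _ _ _ _ ((g \o cinv a) \o (cmap a \o cinv phi))).
- exact: overlap_open.
- by move=> z /overlapE [iz dz] /=; rewrite cmapK.
apply: (@Ck_comp_scalar _ _ _ _ _ (cimg a)).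
- exact: overlap_open.
- exact: (sp a ha).1.
- by move=> z /overlapE [iz dz] /=; exact: cimg_cmap.
- exact: sg.
Qed.

Definition transition phi psi x : 'M[R]_m := 'J (cmap psi \o cinv phi) (cmap phi x).

Lemma transition_differentiable phi psi x : smooth_chart phi -> smooth_chart psi ->
  cdom phi x -> cdom psi x -> differentiable (cmap psi \o cinv phi) (cmap phi x).
Proof.
move=> sp sq dx dy.
by apply: (smooth_on_differentiable (smooth_charts_compatible sp sq)); exists x.
Qed.

Lemma transition_comp phi psi chi x :
  smooth_chart phi -> smooth_chart psi -> smooth_chart chi ->
  cdom phi x -> cdom psi x -> cdom chi x ->
  transition phi chi x = transition phi psi x *m transition psi chi x.
Proof.
move=> s1 s2 s3 d1 d2 d3; rewrite /transition.
have D12 := transition_differentiable s1 s2 d1 d2.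
have D13 := transition_differentiable s1 s3 d1 d3.
have D23 := transition_differentiable s2 s3 d2 d3.
have e : (cmap psi \o cinv phi) (cmap phi x) = cmap psi x by rewrite /= cmapK.
have D23' : differentiable (cmap chi \o cinv psi) ((cmap psi \o cinv phi) (cmap phi x)).
  by rewrite e.
have := jacobian_comp D12 D23'; rewrite e => <-.
apply: jacobian_ext => //.
apply: filterS (overlap_near d1 d2) => z /overlapE [iz dz] /=.
by rewrite cmapK.
Qed.

Lemma transition_id phi x : smooth_chart phi -> cdom phi x -> transition phi phi x = 1%:M.
Proof.
move=> sp dx; apply: rV_mul_eq => v.
rewrite mul_jacobian ?mulmx1; last exact: transition_differentiable.
rewrite (@near_eq_derive _ _ _ _ id) ?derive_id //.
by apply: filterS (cimg_near (cimg_cmap dx)) => z iz /=; rewrite cinvK.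
Qed.

Lemma chart_frame_transition phi x : chart_frame phi x = transition phi (chart_at x) x.
Proof. by []. Qed.

Lemma chart_frame_comp phi psi x : smooth_chart phi -> smooth_chart psi ->
  cdom phi x -> cdom psi x -> chart_frame phi x = transition phi psi x *m chart_frame psi x.
Proof.
by move=> *; apply: transition_comp => //; [exact: chart_at_smooth|exact: chart_at_dom].
Qed.

Lemma transition_inv phi psi x : smooth_chart phi -> smooth_chart psi ->
  cdom phi x -> cdom psi x -> transition phi psi x *m transition psi phi x = 1%:M.
Proof. by move=> *; rewrite -transition_comp // transition_id. Qed.

Lemma transition_unit phi psi x : smooth_chart phi -> smooth_chart psi ->
  cdom phi x -> cdom psi x -> transition phi psi x \in unitmx.
Proof. by move=> s1 s2 d1 d2; exact: (mulmx1_unit (transition_inv s1 s2 d1 d2)).1. Qed.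

Lemma chart_frame_unit phi x : smooth_chart phi -> cdom phi x -> chart_frame phi x \in unitmx.
Proof.
by move=> *; apply: transition_unit => //; [exact: chart_at_smooth|exact: chart_at_dom].
Qed.

Lemma transition_continuous phi psi x i j : smooth_chart phi -> smooth_chart psi ->
  cdom phi x -> cdom psi x -> {for x, continuous (fun y => transition phi psi y i j)}.
Proof.
move=> s1 s2 d1 d2.
have S := smooth_charts_compatible s1 s2.
have o : overlap phi psi (cmap phi x) by exists x.
pose F z := 'D_(delta_mx 0 i) (cmap psi \o cinv phi) z.
have cF : {for cmap phi x, continuous (fun z => F z 0 j)}.
  apply: (@Ck_continuous _ _ _ 0 (overlap phi psi)) => //.
  apply: Ck_entry; first exact: overlap_open.
  exact: (smooth_on_derive (delta_mx 0 i) S 0%N).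
have c1 : {for x, continuous (fun y => F (cmap phi y) 0 j)}.
  by apply: (@continuous_comp _ _ _ (cmap phi) (fun z => F z 0 j)) => //; exact: cmap_continuous.
have e y : cdom phi y -> cdom psi y -> F (cmap phi y) 0 j = transition phi psi y i j.
  move=> dy dy'; rewrite /F -mul_jacobian; last exact: transition_differentiable.
  by rewrite -rowE mxE.
have ex := e x d1 d2; move: c1; rewrite /prop_for /continuous_at ex => c1.
apply: cvg_trans c1; apply: near_eq_cvg.
by near=> y; apply: e; near: y; exact: cdom_near.
Unshelve. all: by end_near. Qed.

Lemma curve_in_chart c (t : R) phi : {for t, continuous c} -> cdom phi (c t) ->
  \forall s \near t, cdom phi (c s).
Proof. by move=> cc dt; apply: cc; exact: cdom_near. Qed.

Lemma curve_change phi psi c (t : R) v : smooth_chart phi -> smooth_chart psi ->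
  cdom phi (c t) -> cdom psi (c t) -> {for t, continuous c} ->
  is_derive t (1 : R) (fun s => cmap phi (c s)) v ->
  is_derive t (1 : R) (fun s => cmap psi (c s)) (v *m transition phi psi (c t)).
Proof.
move=> s1 s2 d1 d2 cc D.
have T := transition_differentiable s1 s2 d1 d2.
rewrite mul_jacobian //.
apply: near_eq_is_derive (is_derive_curve_comp D T).
by near=> s; rewrite /= cmapK //; near: s; exact: curve_in_chart.
Unshelve. all: by end_near. Qed.

Lemma cinv_curve_continuous phi (z : R -> 'rV[R]_m) (t : R) : {for t, continuous z} ->
  cimg phi (z t) -> {for t, continuous (fun s => cinv phi (z s))}.
Proof. by move=> cz i; apply: (@continuous_comp _ _ _ z (cinv phi)) => //; exact: cinv_continuous. Qed.

Definition drow n (F : 'rV[R]_n -> R) z : 'rV[R]_n := \row_i 'D_(delta_mx 0 i) F z.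

Lemma drowE n (F : 'rV[R]_n -> R) z v : differentiable F z ->
  'D_v F z = (v *m (drow F z)^T) 0 0.
Proof.
move=> dF; rewrite derive_coords // mxE; apply: eq_bigr => i _.
by rewrite !mxE.
Qed.

Lemma drow_eq n (F : 'rV[R]_n -> R) z (a : 'rV[R]_n) : 
  (forall v, 'D_v F z = (v *m a^T) 0 0) -> drow F z = a.
Proof.
move=> h; apply/rowP => i; rewrite mxE h -rowE; by rewrite !mxE.
Qed.

Lemma drow_ext n (F H : 'rV[R]_n -> R) z : (\forall y \near z, F y = H y) ->
  drow F z = drow H z.
Proof. by move=> e; apply/rowP => i; rewrite !mxE; exact: near_eq_derive. Qed.

Lemma drow_change g phi psi x : smooth_fun g -> smooth_chart phi -> smooth_chart psi ->
  cdom phi x -> cdom psi x -> drow (g \o cinv phi) (cmap phi x) =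
    drow (g \o cinv psi) (cmap psi x) *m (transition phi psi x)^T.
Proof.
move=> sg s1 s2 d1 d2; apply: drow_eq => v.
have D := transition_differentiable s1 s2 d1 d2.
have Dg : differentiable (g \o cinv psi) (cmap psi x).
  exact: smooth_on_differentiable (smooth_fun_chart sg s2) (cimg_cmap d2).
have e : (cmap psi \o cinv phi) (cmap phi x) = cmap psi x by rewrite /= cmapK.
transitivity ('D_v ((g \o cinv psi) \o (cmap psi \o cinv phi)) (cmap phi x)).
  apply: near_eq_derive; apply: filterS (overlap_near d1 d2) => z /overlapE[iz dz] /=.
  by rewrite cmapK.
rewrite derive_chain //; last by rewrite e.
by rewrite e drowE // -mul_jacobian // trmx_mul trmxK mulmxA.
Qed.

Lemma dfun_chart g phi x : smooth_fun g -> smooth_chart phi -> cdom phi x ->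
  drow (g \o cinv phi) (cmap phi x) = dfun g x *m (chart_frame phi x)^T.
Proof.
move=> sg sp dx; rewrite (@drow_change _ _ (chart_at x)) //; first exact: chart_at_smooth.
exact: chart_at_dom.
Qed.

Lemma derive_along g c (t : R) phi v : smooth_fun g -> smooth_chart phi ->
  cdom phi (c t) -> {for t, continuous c} ->
  is_derive t (1 : R) (fun s => cmap phi (c s)) v ->
  is_derive t (1 : R) (fun s => g (c s))
    ((v *m (drow (g \o cinv phi) (cmap phi (c t)))^T) 0 0).
Proof.
move=> sg sp d cc D.
have Dg : differentiable (g \o cinv phi) (cmap phi (c t)).
  exact: smooth_on_differentiable (smooth_fun_chart sg sp) (cimg_cmap d).
rewrite -drowE //.
apply: near_eq_is_derive (is_derive_curve_comp D Dg).
by near=> s; rewrite /= cmapK //; near: s; exact: curve_in_chart.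
Unshelve. all: by end_near. Qed.

End Charts.

(** * Gradient curves *)

Lemma is_derive_glue (R : realType) (W : normedModType R) (F H : R -> W) (t : R) v :
  F t = H t -> is_derive t (1 : R) F v -> is_derive t (1 : R) H v ->
  is_derive t (1 : R) (fun s => if s <= t then F s else H s) v.
Proof.
move=> e /is_deriveP dF /is_deriveP dH; apply/is_deriveP/cvgrPdist_lt => ep ep0.
move/cvgrPdist_lt: dF => /(_ ep ep0) dF; move/cvgrPdist_lt: dH => /(_ ep ep0) dH.
near=> h; rewrite lexx.
case: ifP => _; first by near: h.
by rewrite e; near: h.
Unshelve. all: by end_near. Qed.

Lemma continuous_glue (R : realType) (T : topologicalType) (F H : R -> T) (t : R) :
  F t = H t -> {for t, continuous F} -> {for t, continuous H} ->
  {for t, continuous (fun s : R => if s <= t then F s else H s)}.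
Proof.
move=> e cF cH; rewrite /prop_for /continuous_at lexx => A hA.
have hF : \forall s \near t, A (F s) by exact: cF.
have hH : \forall s \near t, A (H s) by apply: cH; rewrite -e.
by apply: filterS2 hF hH => s hs1 hs2 /=; case: ifP.
Qed.

Lemma drowN (R : realType) n (F : 'rV[R]_n -> R) z : differentiable F z ->
  drow (fun y => - F y) z = - drow F z.
Proof.
move=> dF; apply/rowP => i; rewrite !mxE.
by rewrite (deriveN (f := F)) //; exact: diff_derivable.
Qed.

Lemma cvg_shift_pinfty (R : realType) (T : topologicalType) (c : R -> T) (a : R) (p : T) :
  c t @[t --> +oo] --> p -> c (t + a) @[t --> +oo] --> p.
Proof.
move=> h A /h [r [_ Hr]]; exists (r - a); split; first exact: num_real.
by move=> t; rewrite ltrBlDr => /Hr.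
Qed.

Section Gradient.
Context {R : realType} {m : nat} {M : manifold R m}.
Implicit Types (x y p : M) (phi psi : chart R m M) (g : M -> R) (c : R -> M).
Implicit Types (G : M -> 'M[R]_m).

(** In a chart in which the metric is Euclidean the gradient is the row of
    partial derivatives. *)
Definition flat G phi :=
  smooth_chart phi /\ forall y, cdom phi y -> chart_metric G phi y = 1%:M.

Lemma flat_metric_inv G phi x : flat G phi -> cdom phi x ->
  invmx (G x) = (chart_frame phi x)^T *m chart_frame phi x.
Proof.
move=> [sp fl] dx; have := fl x dx; rewrite /chart_metric.
have Fu := chart_frame_unit sp dx; set F := chart_frame phi x in Fu *.
move=> e.
have e2 : G x *m (F^T *m F) = 1%:M.
  have := congr1 (fun A => invmx F *m A *m F) e.
  by rewrite mulmx1 mulVmx // !mulmxA mulVmx // mul1mx => ->.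
have [Gu _] := mulmx1_unit e2.
by rewrite -[RHS](mulKmx Gu) e2 mulmx1.
Qed.

Lemma grad_flat G g phi x : smooth_fun g -> flat G phi -> cdom phi x ->
  grad G g x = drow (g \o cinv phi) (cmap phi x) *m chart_frame phi x.
Proof.
move=> sg fl dx; rewrite /grad (flat_metric_inv fl dx) mulmxA.
by rewrite -(dfun_chart sg fl.1 dx).
Qed.

Definition gfield g phi (z : 'rV[R]_m) := - drow (g \o cinv phi) z.

Lemma gfield_smooth g phi : smooth_fun g -> smooth_chart phi ->
  smooth_on (cimg phi) (gfield g phi).
Proof.
move=> sg sp k; apply: Ck_opp; first exact: cimg_open.
apply: Ck_mx => [|i j]; first exact: cimg_open.
apply: (@Ck_ext _ _ _ _ _ ('D_(delta_mx 0 j) (g \o cinv phi))).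
- exact: cimg_open.
- by move=> z _; rewrite mxE.
- exact: (smooth_on_derive _ (smooth_fun_chart sg sp)).
Qed.

Lemma grad_eqP G g c t : grad_eq_at G g c t <-> {for t, continuous c} /\
  is_derive t (1 : R) (fun s => cmap (chart_at (c t)) (c s)) (- grad G g (c t)).
Proof.
split=> [[h1 h2 h3]|[h1 h2]]; split=> //.
- by rewrite -h3 /velocity derive1E; exact: derivableP.
- by rewrite /velocity derive1E (@derive_val _ _ _ _ _ _ _ h2).
Qed.

Lemma grad_eq_flat G g phi c t : smooth_fun g -> flat G phi -> cdom phi (c t) ->
  grad_eq_at G g c t <-> {for t, continuous c} /\
    is_derive t (1 : R) (fun s => cmap phi (c s)) (gfield g phi (cmap phi (c t))).
Proof.
move=> sg fl d; set a := chart_at (c t).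
have sa : smooth_chart a by exact: chart_at_smooth.
have da : cdom a (c t) by exact: chart_at_dom.
have e : - grad G g (c t) = gfield g phi (cmap phi (c t)) *m transition phi a (c t).
  by rewrite (grad_flat sg fl d) /gfield mulNmx.
split=> [/grad_eqP|] [h1 h2]; [split=> //|apply/grad_eqP; split=> //].
  have := curve_change sa fl.1 da d h1 h2.
  by rewrite e -mulmxA transition_inv ?mulmx1 //; case: fl.
rewrite e; exact: curve_change fl.1 sa d da h1 h2.
Qed.

Lemma grad_eq_cinv G g phi (z : R -> 'rV[R]_m) t : smooth_fun g -> flat G phi ->
  cimg phi (z t) -> is_derive t (1 : R) z (gfield g phi (z t)) ->
  grad_eq_at G g (fun s => cinv phi (z s)) t.
Proof.
move=> sg fl i D; have cz := is_derive_continuous D.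
apply/(grad_eq_flat sg fl); first exact: cimg_cdom.
split; first exact: cinv_curve_continuous.
rewrite cinvK //; apply: near_eq_is_derive D.
near=> s; rewrite /= cinvK //; near: s.
have h := cimg_near i; exact: (cz _ h).
Unshelve. all: by end_near. Qed.

Lemma grad_eq_near G g c c' (t : R) : (\forall s \near t, c s = c' s) ->
  grad_eq_at G g c t -> grad_eq_at G g c' t.
Proof.
move=> e /grad_eqP [h1 h2]; have et : c t = c' t by exact: nbhs_singleton e.
apply/grad_eqP; split.
  rewrite /prop_for /continuous_at -et; apply: cvg_trans h1; apply: near_eq_cvg.
  by apply: filterS e => s.
rewrite -et; apply: near_eq_is_derive h2.
by apply: filterS e => s ->.
Qed.

Lemma grad_eq_shift G g c (a t : R) : grad_eq_at G g c (t + a) ->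
  grad_eq_at G g (fun s => c (s + a)) t.
Proof.
move=> /grad_eqP [h1 h2]; apply/grad_eqP; split.
  apply: (@continuous_comp _ _ _ (fun s => s + a) c) => //.
  by apply: continuousD; [exact: cvg_id|exact: cvg_cst].
exact: (is_derive_comp_shift (c := fun s => cmap (chart_at (c (t + a))) (c s))).
Qed.

Lemma smooth_funN g : smooth_fun g -> smooth_fun (fun x => - g x).
Proof. by move=> sg phi a k; apply: Ck_opp; [exact: cimg_open|exact: sg]. Qed.

Lemma dfun_drow g x : dfun g x = drow (g \o cinv (chart_at x)) (cmap (chart_at x) x).
Proof. by []. Qed.

Lemma chart_differentiable g phi x : smooth_fun g -> smooth_chart phi -> cdom phi x ->
  differentiable (g \o cinv phi) (cmap phi x).
Proof.
by move=> sg sp d; exact: smooth_on_differentiable (smooth_fun_chart sg sp) (cimg_cmap d).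
Qed.

Lemma dfunN g x : smooth_fun g -> dfun (fun y => - g y) x = - dfun g x.
Proof.
move=> sg; rewrite !dfun_drow; apply: drowN.
by apply: chart_differentiable => //; [exact: chart_at_smooth|exact: chart_at_dom].
Qed.

Lemma grad_eq_opp G g c (t : R) : smooth_fun g -> grad_eq_at G g c (- t) ->
  grad_eq_at G (fun x => - g x) (fun s => c (- s)) t.
Proof.
move=> sg /grad_eqP [h1 h2]; apply/grad_eqP; split.
  apply: (@continuous_comp _ _ _ (fun s : R => - s) c) => //.
  by apply: continuousN; exact: cvg_id.
rewrite /grad dfunN // mulNmx.
exact: (is_derive_comp_opp (c := fun s => cmap (chart_at (c (- t))) (c s))).
Qed.

(** One-sided derivatives suffice: both pieces have the same velocity at t,
    determined by the field. *)
Lemma grad_eq_glue G g c1 c2 (t : R) : c1 t = c2 t ->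
  grad_eq_at G g c1 t -> grad_eq_at G g c2 t ->
  grad_eq_at G g (fun s : R => if s <= t then c1 s else c2 s) t.
Proof.
move=> e /grad_eqP [a1 b1] /grad_eqP [a2 b2]; apply/grad_eqP; rewrite lexx; split.
  exact: continuous_glue.
rewrite (_ : (fun s => cmap _ _) = (fun s : R => if s <= t then cmap (chart_at (c1 t)) (c1 s)
   else cmap (chart_at (c1 t)) (c2 s))); last by apply/funext => s; case: ifP.
by apply: is_derive_glue => //; rewrite e.
Qed.

Lemma grad_eq_cst G g p t : crit g p -> grad_eq_at G g (fun=> p) t.
Proof.
move=> cp; apply/grad_eqP; split; first exact: cvg_cst.
rewrite /grad cp mul0mx oppr0; exact: is_derive_cst.
Qed.

Lemma Ws_self G g p : crit g p -> Ws G g p p.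
Proof.
move=> cp; exists (fun=> p); split=> // [t _|]; [exact: grad_eq_cst|exact: cvg_cst].
Qed.

Lemma Wu_opp G g p : smooth_fun g -> Ws G (fun x => - g x) p = Wu G g p.
Proof.
move=> sg; have gN : (fun x => - - g x) = g by apply/funext => x; rewrite opprK.
apply/seteqP; split=> x [c [c0 ceq cl]]; exists (fun t => c (- t)); split.
- by rewrite oppr0.
- move=> t t0; have := ceq (- t); rewrite oppr_ge0 => /(_ t0).
  by move=> /(grad_eq_opp (smooth_funN sg)); rewrite gN.
- by apply/cvgNy_compNP; rewrite (_ : _ \o _ = c) //; apply/funext => t /=; rewrite opprK.
- by rewrite oppr0.
- move=> t t0; have := ceq (- t); rewrite oppr_le0 => /(_ t0).
  exact: grad_eq_opp.
- exact: (cvgNy_compNP c (nbhs p)).1 cl.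
Qed.

(** The given trajectory is continued by one that converges to p. *)
Lemma Ws_backward G g p c (a b : R) : a <= b ->
  (forall t, a <= t <= b -> grad_eq_at G g c t) -> Ws G g p (c b) -> Ws G g p (c a).
Proof.
move=> ab ceq [w [w0 weq wl]].
pose w' s := if s <= b - a then c (s + a) else w (s + - (b - a)).
have e : c (b - a + a) = w (b - a + - (b - a)) by rewrite subrK subrr w0.
exists w'; split.
- by rewrite /w' subr_ge0 ab add0r.
- move=> t t0; have [lt|gt|eq] := ltgtP t (b - a).
  + apply: (@grad_eq_near _ _ (fun s => c (s + a))); last first.
      by apply: grad_eq_shift; apply: ceq; apply/andP; split; lra.
    near=> s; rewrite /w' ifT //; apply: ltW; near: s; exact: lt_nbhsl.
  + apply: (@grad_eq_near _ _ (fun s => w (s + - (b - a)))); last first.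
      by apply: grad_eq_shift; apply: weq; lra.
    near=> s; rewrite /w' ifF //; apply/negbTE; rewrite -ltNge; near: s; exact: lt_nbhsr.
  + rewrite eq; apply: grad_eq_glue => //; apply: grad_eq_shift.
      by rewrite subrK; apply: ceq; rewrite ab lexx.
    by rewrite subrr; apply: weq.
- apply: (@cvg_trans _ ((fun s => w (s + - (b - a))) @ +oo)).
    apply: near_eq_cvg; near=> s; rewrite /w' ifF //; apply/negbTE; rewrite -ltNge.
    by near: s; apply: nbhs_pinfty_gt; exact: num_real.
  exact: cvg_shift_pinfty.
Unshelve. all: by end_near. Qed.

Lemma Ws_forward G g p c : (forall t, 0 <= t -> grad_eq_at G g c t) ->
  c t @[t --> +oo] --> p -> forall t, 0 <= t -> Ws G g p (c t).
Proof.
move=> ceq cl t t0; exists (fun s => c (s + t)); split.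
- by rewrite add0r.
- by move=> s s0; apply: grad_eq_shift; apply: ceq; rewrite addr_ge0.
- exact: cvg_shift_pinfty.
Qed.

End Gradient.

(** * Submanifolds, frames and orientations *)

Section Trigonometric.
Context {R : realType}.

Lemma real_differentiable (F : R -> R) (t df : R) v : is_derive t (1 : R) F df ->
  differentiable F t /\ 'D_v F t = v * df.
Proof.
move=> D; have dF : differentiable F t by apply/derivable1_diffP; exact: ex_derive.
split=> //; have := @deriveMdir _ _ _ F t (1 : R) v dF.
by rewrite (@derive_val _ _ _ _ _ _ _ D) [v *: 1]mulr1 => ->.
Qed.

Lemma is_derive_cos_scale (a b t : R) :
  is_derive t (1 : R) (fun s => b * cos (a * s)) (- (a * b * sin (a * t))).
Proof.
have h := is_derive_comp_scale (is_derive_cos (a * t)).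
apply: is_derive_eq (is_deriveZ b h) _.
by rewrite /GRing.scale /=; ring.
Qed.

Lemma is_derive_sin_scale (a b t : R) :
  is_derive t (1 : R) (fun s => b * sin (a * s)) (a * b * cos (a * t)).
Proof.
have h := is_derive_comp_scale (is_derive_sin (a * t)).
apply: is_derive_eq (is_deriveZ b h) _.
by rewrite /GRing.scale /=; ring.
Qed.

Lemma Ck_sin_cos k (a : R) : forall b : R,
  Ck k [set: R] (fun s : R => b * sin (a * s)) /\
  Ck k [set: R] (fun s : R => b * cos (a * s)).
Proof.
elim: k => [|k IH] b.
  split=> t _.
    exact: is_derive_continuous (is_derive_sin_scale a b t).
  exact: is_derive_continuous (is_derive_cos_scale a b t).
split; apply/CkS; split=> [t _|v].
- by have [] := real_differentiable 0 (is_derive_sin_scale a b t).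
- apply: (@Ck_ext _ _ _ _ _ (fun s => (v * (a * b)) * cos (a * s))); first exact: openT.
    move=> t _; have [_ ->] := real_differentiable v (is_derive_sin_scale a b t); ring.
  exact: (IH _).2.
- by have [] := real_differentiable 0 (is_derive_cos_scale a b t).
- apply: (@Ck_ext _ _ _ _ _ (fun s => (- (v * (a * b))) * sin (a * s))); first exact: openT.
    move=> t _; have [_ ->] := real_differentiable v (is_derive_cos_scale a b t); ring.
  exact: (IH _).1.
Qed.

End Trigonometric.

Section DetContinuous.
Context {R : realType} {X : topologicalType}.

Lemma det_continuous n (P : X -> 'M[R]_n) x :
  (forall i j, {for x, continuous (fun y => P y i j)}) ->
  {for x, continuous (fun y => \det (P y))}.
Proof.
move=> cP; apply: (@cvg_big R _ +%R 0 xpredT) => [|s _].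
  exact: add_continuous.
apply: cvgM; first exact: cvg_cst.
apply: (@cvg_big R _ *%R 1 xpredT) => [|i _]; first exact: mul_continuous.
exact: cP.
Qed.

Lemma mulmx_entry_continuous n k l (P : X -> 'M[R]_(n, k)) (Q : X -> 'M[R]_(k, l)) x :
  (forall i j, {for x, continuous (fun y => P y i j)}) ->
  (forall i j, {for x, continuous (fun y => Q y i j)}) ->
  forall i j, {for x, continuous (fun y => (P y *m Q y) i j)}.
Proof.
move=> cP cQ i j.
rewrite (_ : (fun y => _) = (fun y => \sum_l P y i l * Q y l j)); last first.
  by apply/funext => y; rewrite mxE.
rewrite /prop_for /continuous_at.
apply: (@cvg_big R _ +%R 0 xpredT) => [|s _]; first exact: add_continuous.
by apply: cvgM; [exact: cP|exact: cQ].
Qed.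

Lemma det_sign_near n (P : X -> 'M[R]_n) x :
  (forall i j, {for x, continuous (fun y => P y i j)}) -> P x \in unitmx ->
  \forall y \near x, (\det (P y) < 0) = (\det (P x) < 0).
Proof.
move=> /det_continuous cd; rewrite unitmxE unitfE => d0.
have [neg|pos] := ltP (\det (P x)) 0.
  have : \forall y \near x, \det (P y) < 0.
    apply: (cd [set a | a < 0]); exact: lt_nbhsl.
  by apply: filterS => y ->.
have {}pos : 0 < \det (P x) by rewrite lt_neqAle eq_sym d0.
have : \forall y \near x, 0 < \det (P y).
  apply: (cd [set a | 0 < a]); exact: lt_nbhsr.
by apply: filterS => y h; rewrite ltNge ltW.
Qed.

End DetContinuous.

Section Slices.
Context {R : realType} {m : nat} {M : manifold R m}.
Implicit Types (x y p : M) (phi psi : chart R m M) (c : R -> M) (W : set M).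

Lemma smooth_curve_derive c t phi : smooth_curve c -> smooth_chart phi -> cdom phi (c t) ->
  is_derive t (1 : R) (fun s => cmap phi (c s)) (velocity c t *m transition (chart_at (c t)) phi (c t)).
Proof.
move=> [cc sc] sp dp; set a := chart_at (c t).
have ha : atlas a by exact: chart_at_atlas.
have sa : smooth_chart a by exact: chart_at_smooth.
have da : cdom a (c t) by exact: chart_at_dom.
apply: curve_change => //; first exact: cc.
have D := smooth_on_differentiable (sc a ha) da.
rewrite /velocity derive1E; apply: derivableP; exact: diff_derivable.
Qed.

(** Every smooth curve required here is a line in a chart traversed as a
    sine, so that it exists for all times and stays near its centre. *)
Lemma line_tangent W phi x v (r : R) : smooth_chart phi -> cdom phi x -> 0 < r ->
  (forall s : R, `|s| < r -> cimg phi (cmap phi x + s *: v) /\ W (cinv phi (cmap phi x + s *: v))) ->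
  tangent W x (v *m chart_frame phi x).
Proof.
move=> sp dx r0 H; set z0 := cmap phi x in H *.
pose d := r / 2; have d0 : 0 < d by rewrite divr_gt0.
have dr : d < r by rewrite /d ltr_pdivrMr //; lra.
pose u (t : R) := d * sin (d^-1 * t).
have ub t : `|u t| < r.
  rewrite /u normrM (gtr0_norm d0); apply: le_lt_trans dr.
  by rewrite ler_piMr ?(ltW d0) // sin_max.
pose z t := z0 + u t *: v.
have iz t : cimg phi (z t) by have [] := H _ (ub t).
pose c t := cinv phi (z t).
have u0 : u 0 = 0 by rewrite /u mulr0 sin0 mulr0.
have c0 : c 0 = x by rewrite /c /z u0 scale0r addr0 /z0 cmapK.
have zk k : Ck k [set: R] z.
  apply: Ck_add; [exact: openT|exact: Ck_cst|].
  apply: (Ck_linear (L := @scalel R _ v)); first exact: openT.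
    by move=> t; apply: cvgZr_tmp; exact: cvg_id.
  exact: (Ck_sin_cos k d^-1 d).1.
have cc : continuous c.
  move=> t; apply: cinv_curve_continuous => //; exact: (zk 0%N).
have dz : is_derive (0 : R) (1 : R) z v.
  have D := is_derive_sin_scale d^-1 d 0.
  rewrite mulr0 cos0 mulr1 mulVf ?gt_eqF // in D.
  have L := is_derive_line z0 v (u 0).
  have dL : differentiable (fun a : R => z0 + a *: v) (u 0).
    by apply/derivable1_diffP; exact: ex_derive.
  have := is_derive_curve_comp (c := u) D dL.
  by rewrite (@derive_val _ _ _ _ _ _ _ L).
exists c; split=> //.
- split=> // psi ha k; have sq := atlas_smooth_chart ha.
  have oc : open (c @^-1` cdom psi).
    by apply: open_comp => [t _|]; [exact: cc|exact: cdom_open].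
  apply: (@Ck_ext _ _ _ _ _ ((cmap psi \o cinv phi) \o z)) => //.
  apply: (@Ck_comp _ _ _ _ _ _ _ (overlap phi psi)) => //.
  + exact: overlap_open.
  + by apply: Ck_sub (zk k).
  + by move=> t dt; apply/overlapE.
  + exact: smooth_charts_compatible.
- by move=> t; have [] := H _ (ub t).
have dphi : is_derive (0 : R) (1 : R) (fun s => cmap phi (c s)) v.
  by rewrite (_ : (fun s => _) = z) //; apply/funext => t; rewrite /c cinvK.
have dc : cdom phi (c 0) by rewrite c0.
have := curve_change sp (chart_at_smooth (c 0)) dc (chart_at_dom (c 0)) (cc 0) dphi.
rewrite /velocity derive1E => D; rewrite (@derive_val _ _ _ _ _ _ _ D).
by rewrite chart_frame_transition c0.
Qed.

Lemma slice_derive W k phi c (t : R) v : slice_chart W k phi -> cdom phi (c t) ->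
  {for t, continuous c} -> (\forall s \near t, W (c s)) ->
  is_derive t (1 : R) (fun s => cmap phi (c s)) v ->
  forall i : 'I_m, (k <= i)%N -> v 0 i = 0.
Proof.
move=> [sp km sl] dt cc Wc D i ki.
have Di := is_derive_entry 0 i D.
have D0 : is_derive t (1 : R) (fun s => cmap phi (c s) 0 i) 0.
  apply: (near_eq_is_derive _ (is_derive_cst (0 : R) t (1 : R))).
  near=> s; apply/esym; rewrite /cst.
  have dc : cdom phi (c s) by near: s; exact: curve_in_chart.
  by apply: (sl _ dc).1 => //; near: s.
by rewrite -(@derive_val _ _ _ _ _ _ _ Di) (@derive_val _ _ _ _ _ _ _ D0).
Unshelve. all: by end_near. Qed.

Lemma sub_pid_mx k (v : 'rV[R]_m) : (k <= m)%N -> (forall i : 'I_m, (k <= i)%N -> v 0 i = 0) ->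
  (v <= (pid_mx k : 'M[R]_(k, m)))%MS.
Proof.
move=> km h; suff -> : v = v *m (pid_mx k : 'M_(m, k)) *m (pid_mx k : 'M_(k, m)).
  exact: submxMl.
rewrite -mulmxA mul_pid_mx !minnn.
apply/rowP => i; rewrite mxE (bigD1 i) //= big1 => [|j ji].
  by rewrite mxE eqxx /=; case: ltnP => [_|/h ->]; rewrite ?mulr1 ?mul0r addr0.
by rewrite mxE val_eqE (negbTE ji) mulr0.
Qed.

Lemma pid_mx_vanish k (w : 'rV[R]_k) (i : 'I_m) : (k <= i)%N ->
  (w *m (pid_mx k : 'M[R]_(k, m))) 0 i = 0.
Proof.
move=> ki; rewrite mxE big1 // => j _; rewrite mxE.
by rewrite ltn_eqF ?mulr0 // (leq_trans (ltn_ord j)).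
Qed.

Lemma curve_slice_span W k phi c (t : R) v : slice_chart W k phi -> cdom phi (c t) ->
  {for t, continuous c} -> (\forall s \near t, W (c s)) ->
  is_derive t (1 : R) (fun s => cmap (chart_at (c t)) (c s)) v ->
  (v <= (pid_mx k : 'M_(k, m)) *m chart_frame phi (c t))%MS.
Proof.
move=> sl dt cc Wc D; have [sp km _] := sl.
have sa : smooth_chart (chart_at (c t)) by exact: chart_at_smooth.
have da : cdom (chart_at (c t)) (c t) by exact: chart_at_dom.
have D' := curve_change sa sp da dt cc D.
have := sub_pid_mx km (slice_derive sl dt cc Wc D').
move=> /(submxMr (chart_frame phi (c t))).
by rewrite -mulmxA transition_inv // mulmx1.
Qed.

(** In a slice chart the curves in W have velocities in the span of the first k
    coordinate vectors, and coordinate lines realise all of them. *)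
Lemma slice_frame W k phi x : slice_chart W k phi -> W x -> cdom phi x ->
  frame W x (pid_mx k *m chart_frame phi x : 'M_(k, m)).
Proof.
move=> sl Wx dx; have [sp km slE] := sl.
have Fu := chart_frame_unit sp dx; split.
  by rewrite /row_free mxrankMfree ?row_free_unit // rank_pid_mx.
move=> v; split.
  move=> [c [sc Wc c0 <-]]; have dc : cdom phi (c 0) by rewrite c0.
  have da := chart_at_dom (c 0).
  have := smooth_curve_derive sc (chart_at_smooth (c 0)) da.
  rewrite transition_id ?mulmx1 //; last exact: chart_at_smooth.
  move=> D; have := curve_slice_span sl dc (sc.1 0) _ D; rewrite c0; apply.
  by apply: filterE.
move=> /submxP[w ->]; rewrite mulmxA; set u := w *m _.
have uk (i : 'I_m) : (k <= i)%N -> u 0 i = 0 by exact: pid_mx_vanish.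
have : \forall s \near (0 : R), cimg phi (cmap phi x + s *: u).
  have cl : {for (0 : R), continuous (fun s : R => cmap phi x + s *: u)}.
    exact: is_derive_continuous (is_derive_line (cmap phi x) u 0).
  apply: cl; rewrite scale0r addr0; apply: cimg_near; exact: cimg_cmap.
move=> /nbhs_ballP [r r0 Hr]; have {}r0 : 0 < r by exact: r0.
apply: (line_tangent sp dx r0) => s sr.
have is_ : cimg phi (cmap phi x + s *: u).
  by apply: Hr; rewrite -ball_normE /= sub0r normrN.
split=> //; apply/(slE _ (cimg_cdom is_)) => i ki; rewrite cinvK //.
by rewrite mxE (slE _ dx).1 // mxE uk // mulr0 addr0.
Qed.

Lemma frame_le W k l x (B : 'M[R]_(k, m)) (B' : 'M[R]_(l, m)) :
  frame W x B -> (forall i, tangent W x (row i B')) -> (B' <= B)%MS.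
Proof. by move=> [_ h] H; apply/row_subP => i; apply/h. Qed.

Lemma frame_row W k x (B : 'M[R]_(k, m)) i : frame W x B -> tangent W x (row i B).
Proof. by move=> [_ h]; apply/h; exact: row_sub. Qed.

Lemma frame_dim W k l x (B : 'M[R]_(k, m)) (B' : 'M[R]_(l, m)) :
  frame W x B -> frame W x B' -> k = l.
Proof.
move=> F F'; have h1 : (B' <= B)%MS by apply: (frame_le F) => i; exact: frame_row.
have h2 : (B <= B')%MS by apply: (frame_le F') => i; exact: frame_row.
move: F.1 F'.1; rewrite /row_free => /eqP <- /eqP <-.
by apply/eqP; rewrite eqn_leq !mxrankS.
Qed.

Lemma frame_change W k x (B B' : 'M[R]_(k, m)) :
  frame W x B -> frame W x B' -> exists2 P : 'M[R]_k, P \in unitmx & B' = P *m B.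
Proof.
move=> F F'; have /submxP[P eP] : (B' <= B)%MS.
  by apply: (frame_le F) => i; exact: frame_row.
exists P => //; rewrite -row_free_unit /row_free -(mxrankMfree P F.1) -eP.
exact: F'.1.
Qed.

Lemma frame_mul W k x (B : 'M[R]_(k, m)) (P : 'M[R]_k) :
  P \in unitmx -> frame W x B -> frame W x (P *m B).
Proof.
move=> Pu [Bf h]; split; first by rewrite /row_free mxrankMfree // mxrank_unit.
by move=> v; rewrite (eqmxMfull B) ?row_full_unit.
Qed.

Lemma frame_of_dim W k x (B B' : 'M[R]_(k, m)) : frame W x B -> row_free B' ->
  (forall i, tangent W x (row i B')) -> frame W x B'.
Proof.
move=> F f' H; have h := frame_le F H.
have e : (B' == B)%MS.
  by rewrite -(geq_leqif (mxrank_leqif_eq h)) (eqP f') (eqP F.1).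
split=> // v; rewrite (eqmxP e); exact: F.2.
Qed.

(** An orientation is constant along any continuous family of frames: in a slice
    chart such a family differs from the coordinate frame by a continuous family
    of invertible matrices. *)
Lemma orientation_transport (X : topologicalType) W k (o : frame_sign M) psi phi
    (S : set X) (j : X -> M) (x0 : X) (N : X -> 'M[R]_(k, m)) :
  orientation W k o -> slice_chart W k psi -> smooth_chart phi ->
  cdom psi (j x0) -> cdom phi (j x0) -> {for x0, continuous j} -> S x0 ->
  (forall y : X, S y -> W (j y)) ->
  (forall i l, {for x0, continuous (fun y : X => N y i l)}) ->
  (\forall z \near x0, S z -> frame W (j z) (N z *m chart_frame phi (j z))) ->
  \forall z \near x0, S z -> o k (j z) (N z *m chart_frame phi (j z)) =
                             o k (j x0) (N x0 *m chart_frame phi (j x0)).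
Proof.
move=> [oP oC] sl sp dpsi dphi cj S0 SW cN HN; have [sq km _] := sl.
pose P (y : X) := N y *m transition phi psi (j y) *m (pid_mx k : 'M[R]_(m, k)).
have cP i l : {for x0, continuous (fun y : X => P y i l)}.
  apply: mulmx_entry_continuous; last by move=> ? ?; exact: cst_continuous.
  apply: mulmx_entry_continuous => // a b.
  apply: (@continuous_comp _ _ _ j (fun y : M => transition phi psi y a b)) => //.
  exact: transition_continuous.
have key (y : X) : S y -> cdom psi (j y) -> cdom phi (j y) ->
    frame W (j y) (N y *m chart_frame phi (j y)) ->
    P y \in unitmx /\ N y *m chart_frame phi (j y) = P y *m (pid_mx k *m chart_frame psi (j y)).
  move=> Sy d1 d2 F; have [Q Qu eQ] := frame_change (slice_frame sl (SW _ Sy) d1) F.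
  have Cu := chart_frame_unit sq d1.
  suff -> : P y = Q by [].
  have : N y *m transition phi psi (j y) = Q *m pid_mx k.
    apply: (can_inj (mulmxK Cu)); rewrite -[RHS]mulmxA -eQ -mulmxA.
    by rewrite -chart_frame_comp.
  rewrite /P => ->; rewrite -mulmxA mul_pid_mx !minnn (minn_idPr km).
  by rewrite pid_mx_1 mulmx1.
have H0 : frame W (j x0) (N x0 *m chart_frame phi (j x0)) by exact: (nbhs_singleton HN).
have [U0 E0] := key x0 S0 dpsi dphi H0.
have sgn := det_sign_near cP U0.
clearbody P.
have oc : \forall z \near x0, W (j z) ->
    o k (j z) (pid_mx k *m chart_frame psi (j z)) = o k (j x0) (pid_mx k *m chart_frame psi (j x0)).
  exact: (cj _ (oC psi (j x0) sl (SW _ S0) dpsi)).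
near=> y => Sy.
have d1 : cdom psi (j y) by near: y; exact: (cj _ (cdom_near dpsi)).
have d2 : cdom phi (j y) by near: y; exact: (cj _ (cdom_near dphi)).
have Fy : frame W (j y) (N y *m chart_frame phi (j y)) by move: Sy; near: y.
have [Uy Ey] := key y Sy d1 d2 Fy.
rewrite Ey E0 (oP _ _ _ (SW _ Sy) (slice_frame sl (SW _ Sy) d1) Uy).
rewrite (oP _ _ _ (SW _ S0) (slice_frame sl (SW _ S0) dpsi) U0).
have -> : (\det (P y) < 0) = (\det (P x0) < 0) by near: y.
have -> // : o k (j y) (pid_mx k *m chart_frame psi (j y)) =
  o k (j x0) (pid_mx k *m chart_frame psi (j x0)).
by move: (SW _ Sy); near: y.
Unshelve. all: by end_near. Qed.

End Slices.

(** * The Hessian *)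

(** The spectral theorem holds for Hermitian matrices over R[i]; as H and its
    eigenvalues are real, a similarity over R[i] yields one over R. *)
Lemma symmetric_diagonalizable (R : realType) n (H : 'M[R]_n) : H^T = H ->
  exists (P : 'M[R]_n) (d : 'rV[R]_n), P \in unitmx /\ P *m H = diag_mx d *m P.
Proof.
move=> sH; pose f := real_complex R; pose A := map_mx f H.
have fr a : f a \is Num.real by apply/complex_realP; exists a.
have Ar : A \is a (mxOver Num.real) by apply/mxOverP => i j; rewrite mxE.
have As : A \is symmetricmx by apply/is_hermitianmxP; rewrite expr0 scale1r map_mx_id // /A map_trmx sH.
have Ah := realsym_hermsym As Ar.
have dr := hermitian_spectral_diag_real Ah.
have /orthomx_spectralP eA := hermitian_normalmx Ah.
have Pu := spectral_unit A.
set P := spectralmx A in eA Pu; set sp := spectral_diag A in eA dr.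
have sim : similar_in unitmx A (diag_mx sp).
  exists P => //; apply/(simmxP Pu).
  by rewrite {1}eA !mulmxA mulmxV // mul1mx.
have spr : diag_mx sp \is a (mxOver Num.real).
  apply/mxOverP => i j; rewrite mxE; case: eqP => _; rewrite ?mulr0n ?mulr1n ?rpred0 //.
  exact: (mxOverP dr).
have [Q /andP[Qr Qu] sQ] := real_similar sim Ar spr.
have e := simmxP Qu sQ.
have toR k l (B : 'M[R[i]]_(k, l)) : B \is a (mxOver Num.real) -> exists B', B = map_mx f B'.
  move=> Br; exists (map_mx (@complex.Re R) B); apply/matrixP => i j; rewrite !mxE.
  by have /complex_realP[x ->] := mxOverP Br i j.
have [Q' eQ] := toR _ _ _ Qr; have [d ed] := toR _ _ _ dr.
exists Q', d; split; first by rewrite -(map_unitmx f) -eQ.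
apply: (map_mx_inj (f := f)); rewrite !map_mxM /= -eQ map_diag_mx -ed; exact: e.
Qed.

(** The eigenvectors of positive eigenvalues come first, so that the stable
    directions become the leading coordinates, as slice charts require. *)
Definition sorted_diagonal (R : realType) n (H P : 'M[R]_n) (mu : 'I_n -> R) (s : nat) :=
   [/\ P \in unitmx, (s <= n)%N, forall i, (0 < mu i) = (i < s)%N, forall i, mu i != 0 &
       forall (v : 'rV[R]_n) i, (v *m P *m H *m invmx P) 0 i = mu i * v 0 i].

Lemma symmetric_diagonalizable_sorted (R : realType) n (H : 'M[R]_n) : H^T = H ->
  H \in unitmx -> exists (P : 'M[R]_n) (mu : 'I_n -> R) (s : nat), sorted_diagonal H P mu s.
Proof.
move=> sH Hu; have [P [d [Pu e]]] := symmetric_diagonalizable sH.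
have dn i : d 0 i != 0.
  have : diag_mx d \in unitmx.
    have -> : diag_mx d = P *m H *m invmx P by rewrite e mulmxK.
    by rewrite !unitmx_mul Pu Hu unitmx_inv.
  rewrite unitmxE det_diag unitfE; apply: contraNneq => di.
  by rewrite (bigD1 i) //= di mul0r.
pose a : pred 'I_n := fun i => 0 < d 0 i.
pose l := seq.filter a (enum 'I_n) ++ seq.filter (predC a) (enum 'I_n).
have pl : perm_eq l (enum 'I_n) by rewrite /l perm_filterC.
have sl : size l = n by rewrite (perm_size pl) size_enum_ord.
have ul : uniq l by rewrite (perm_uniq pl) enum_uniq.
pose s := count a (enum 'I_n).
have sf : size (seq.filter a (enum 'I_n)) = s by rewrite size_filter.
pose F (i : 'I_n) := nth i l i.
have Fi : injective F.
  move=> i j; rewrite /F (set_nth_default j) ?sl // => /eqP.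
  by rewrite nth_uniq ?sl // => /eqP /val_inj.
pose sg := perm Fi.
exists (perm_mx sg *m P), (fun i => d 0 (sg i)), s; split.
- by rewrite unitmx_mul unitmx_perm.
- by have := count_size a (enum 'I_n); rewrite size_enum_ord.
- move=> i; rewrite permE /F /l nth_cat sf; case: ltnP => h.
    have : nth i [seq x <- enum 'I_n | a x] i \in [seq x <- enum 'I_n | a x].
      by apply: mem_nth; rewrite sf.
    by rewrite mem_filter => /andP[].
  have : nth i [seq x <- enum 'I_n | predC a x] (i - s) \in [seq x <- enum 'I_n | predC a x].
    apply: mem_nth; have : (i < size l)%N by rewrite sl.
    by rewrite /l size_cat sf ltn_subLR.
  by rewrite mem_filter => /andP[/negbTE].
- by move=> i; exact: dn.
move=> v i.
have -> : v *m (perm_mx sg *m P) *m H *m invmx (perm_mx sg *m P) =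
   v *m (perm_mx sg *m diag_mx d *m invmx (perm_mx sg)).
  have pu := unitmx_perm R sg.
  have -> : invmx (perm_mx sg *m P) = invmx P *m invmx (perm_mx sg).
    have U : perm_mx sg *m P \in unitmx by rewrite unitmx_mul pu.
    rewrite -[RHS](mulKmx U) !mulmxA -(mulmxA _ P) mulmxV // mulmx1.
    by rewrite -!mulmxA mulmxV // mulmx1.
  by rewrite -!mulmxA; congr (_ *m (_ *m _)); rewrite !mulmxA e mulmxK.
have -> : perm_mx sg *m diag_mx d = diag_mx (\row_i d 0 (sg i)) *m perm_mx sg.
  apply/matrixP => k j; rewrite mul_mx_diag mul_diag_mx !mxE.
  by case: eqP => [->|_]; rewrite ?mul1r ?mulr1 ?mul0r ?mulr0.
by rewrite mulmxK ?unitmx_perm // mul_mx_diag !mxE mulrC.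
Qed.

Lemma continuous_near_le (R : realType) (V : normedModType R) (F : V -> R) z (ep : R) :
  {for z, continuous F} -> 0 < ep -> \forall y \near z, `|F y - F z| <= ep.
Proof.
by move=> /cvgrPdist_le cF ep0; apply: filterS (cF ep ep0) => y; rewrite distrC.
Qed.

Section Schwarz.
Context {R : realType} {n : nat}.
Implicit Types (F : 'rV[R]_n -> R) (u v z : 'rV[R]_n).

(** The second difference quotient is estimated by integrating the second derivative
    over a parallelogram, first in the direction v and then in the direction u. *)
Lemma second_difference F (U : set 'rV[R]_n) z u v (ep : R) : open U -> U z ->
  smooth_on U F -> 0 < ep -> exists2 d, 0 < d & forall t : R, 0 < t < d ->
   `|F (z + t *: u + t *: v) - F (z + t *: u) - (F (z + t *: v) - F z)
     - t * t * 'D_v ('D_u F) z| <= ep * t * t.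
Proof.
move=> oU Uz sF ep0.
pose a := 'D_v ('D_u F) z.
have sDu := smooth_on_derive u sF.
have sDvu := smooth_on_derive v sDu.
have cD : {for z, continuous ('D_v ('D_u F))} := Ck_continuous (sDvu 0%N) Uz.
have near1 : \forall y \near z, U y /\ `|'D_v ('D_u F) y - a| <= ep.
  near=> y; split; first by near: y; apply: open_nbhs_nbhs.
  near: y; exact: continuous_near_le cD ep0.
move: near1 => /nbhs_ballP [r r0 Hr]; have {}r0 : 0 < r by exact: r0.
pose N := `|u| + `|v| + 1; have N0 : 0 < N by rewrite ltr_wpDl // addr_ge0.
exists (r / N); first by rewrite divr_gt0.
move=> t /andP[t0 tr].
have inb s1 s2 : 0 <= s1 <= t -> 0 <= s2 <= t -> U (z + s1 *: u + s2 *: v) /\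
    `|'D_v ('D_u F) (z + s1 *: u + s2 *: v) - a| <= ep.
  move=> /andP[s10 s1t] /andP[s20 s2t]; apply: Hr; rewrite -ball_normE /=.
  rewrite -addrA opprD addNKr normrN; apply: (@le_lt_trans _ _ (t * N)); last first.
    by rewrite -ltr_pdivlMr.
  apply: le_trans (ler_normD _ _) _; rewrite !normrZ (ger0_norm s10) (ger0_norm s20).
  rewrite /N !mulrDr mulr1; apply: ler_wpDr; first exact: ltW.
  by apply: lerD; rewrite ler_wpM2r.
have Ft s1 s2 : 0 <= s1 <= t -> 0 <= s2 <= t -> differentiable F (z + s1 *: u + s2 *: v).
  by move=> h1 h2; apply: (smooth_on_differentiable sF); have [] := inb _ _ h1 h2.
pose k s := ((F (z + s *: u + t *: v) - F (z + s *: u)) - s * t * a)%:M : 'M[R]_1.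
pose dk s := (('D_u F (z + s *: u + t *: v) - 'D_u F (z + s *: u)) - t * a)%:M : 'M[R]_1.
have tt : 0 <= t <= t by rewrite lexx ltW.
have t00 : 0 <= (0 : R) <= t by rewrite lexx ltW.
have N1 (b : R) : `|b%:M : 'M[R]_1| = `|b|.
  apply/eqP; rewrite eq_le; apply/andP; split.
    apply/mx_norm_le => // i j; by rewrite !ord1 mxE.
  by have := mx_norm_ge (b%:M : 'M[R]_1) 0 0; rewrite mxE.
have is1 (f : R -> R) s df : is_derive s (1 : R) f df ->
    is_derive s (1 : R) (fun s => (f s)%:M : 'M[R]_1) (df%:M).
  move=> D; apply: is_derive_mx => i j; rewrite !ord1.
  rewrite (_ : (fun y => _) = f) ?mxE //; apply/funext => y; by rewrite mxE.
have kd s : 0 <= s <= t -> is_derive s (1 : R) k (dk s).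
  move=> hs; apply: is1.
  have D1 : is_derive s (1 : R) (fun s => F (z + s *: u + t *: v)) ('D_u F (z + s *: u + t *: v)).
    have -> : (fun s => F (z + s *: u + t *: v)) = (fun s => F ((z + t *: v) + s *: u)).
      by apply/funext => y; rewrite addrAC.
    rewrite (addrAC z (s *: u) (t *: v)); apply: is_derive_along_line.
    by rewrite addrAC; exact: Ft.
  have D2 : is_derive s (1 : R) (fun s => F (z + s *: u)) ('D_u F (z + s *: u)).
    apply: is_derive_along_line; have := Ft s 0 hs t00; by rewrite scale0r addr0.
  have D3 : is_derive s (1 : R) (fun s : R => s * t * a) (t * a).
    have := is_deriveZ (t * a) (is_derive_id s (1 : R)).
    rewrite /GRing.scale /= mulr1; congr (is_derive _ _ _ _).
    by apply/funext => y; rewrite /= /GRing.scale /=; ring.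
  exact: is_deriveB (is_deriveB D1 D2) D3.
have dkb s : 0 <= s <= t -> `|dk s| <= ep * t.
  move=> hs; rewrite N1.
  pose q w := ('D_u F (z + s *: u + w *: v) - w * a)%:M : 'M[R]_1.
  pose dq w := ('D_v ('D_u F) (z + s *: u + w *: v) - a)%:M : 'M[R]_1.
  have qd w : 0 <= w <= t -> is_derive w (1 : R) q (dq w).
    move=> hw; apply: is1; apply: is_deriveB.
      apply: is_derive_along_line; apply: (smooth_on_differentiable sDu).
      by have [] := inb _ _ hs hw.
    have := is_deriveZ a (is_derive_id w (1 : R)).
    rewrite /GRing.scale /= mulr1; congr (is_derive _ _ _ _).
    by apply/funext => y; rewrite /= /GRing.scale /=; ring.
  have qb w : 0 <= w <= t -> `|dq w| <= ep by move=> hw; rewrite N1; have [] := inb _ _ hs hw.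
  have := mean_value_le (ltW t0) qd qb.
  rewrite /q -raddfB /= N1 scale0r addr0 mul0r !subr0; apply: le_trans.
  by rewrite le_eqVlt; apply/orP; left; apply/eqP; congr `|_|; ring.
have := mean_value_le (ltW t0) kd dkb.
rewrite /k -raddfB /= N1 !scale0r addr0 !mul0r !subr0; apply: le_trans.
by rewrite le_eqVlt; apply/orP; left; apply/eqP; congr `|_|; rewrite -/a; ring.
Unshelve. all: by end_near. Qed.

(** Schwarz: the second difference is symmetric in u and v. *)
Lemma derive_symmetric F (U : set 'rV[R]_n) z u v : open U -> U z ->
  smooth_on U F -> 'D_v ('D_u F) z = 'D_u ('D_v F) z.
Proof.
move=> oU Uz sF; apply/eqP; rewrite -subr_eq0 -normr_le0; apply/ler_addgt0Pl => ep ep0.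
rewrite addr0.
have e2 : 0 < ep / 2 by rewrite divr_gt0.
have [d1 d10 H1] := second_difference u v oU Uz sF e2.
have [d2 d20 H2] := second_difference v u oU Uz sF e2.
pose t := Num.min d1 d2 / 2.
have m0 : 0 < Num.min d1 d2 by rewrite lt_min d10.
have t0 : 0 < t by rewrite divr_gt0.
have tm : t < Num.min d1 d2 by rewrite /t ltr_pdivrMr //; lra.
move: tm; rewrite lt_min => /andP[t1 t2].
have h1 := H1 t; rewrite t0 t1 in h1; have {}h1 := h1 isT.
have h2 := H2 t; rewrite t0 t2 in h2; have {}h2 := h2 isT.
rewrite (addrAC z (t *: v)) in h2.
set a := 'D_v _ z in h1 *; set b := 'D_u _ z in h2 *.
have tt : 0 < t * t by rewrite mulr_gt0.
rewrite -(ler_pM2l tt) -{1}(gtr0_norm tt) -normrM.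
set A := F (z + t *: u + t *: v) in h1 h2.
set B := F (z + t *: u) in h1 h2; set C := F (z + t *: v) in h1 h2.
have -> : t * t * (a - b) = (A - C - (B - F z) - t * t * b) - (A - B - (C - F z) - t * t * a) by ring.
apply: le_trans (ler_normB _ _) _; apply: le_trans (lerD h2 h1) _.
by rewrite le_eqVlt; apply/orP; left; apply/eqP; field.
Qed.

Definition hessm F z : 'M[R]_n := \matrix_(i, j) 'D_(delta_mx 0 i) ('D_(delta_mx 0 j) F) z.

Lemma hessm_sym F (U : set 'rV[R]_n) z : open U -> U z -> smooth_on U F ->
  (hessm F z)^T = hessm F z.
Proof. move=> oU Uz sF; apply/matrixP => i j; by rewrite [LHS]mxE [LHS]mxE [RHS]mxE; exact: (derive_symmetric _ _ oU Uz sF). Qed.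

Lemma derive_drow F (U : set 'rV[R]_n) z v : open U -> U z -> smooth_on U F ->
  differentiable (drow F) z /\ 'D_v (drow F) z = v *m hessm F z.
Proof.
move=> oU Uz sF.
have Dj j : differentiable ('D_(delta_mx 0 j) F) z.
  exact: (smooth_on_differentiable (smooth_on_derive _ sF)).
have E j : is_derive z v ('D_(delta_mx 0 j) F) ((v *m hessm F z) 0 j).
  have -> : (v *m hessm F z) 0 j = 'D_v ('D_(delta_mx 0 j) F) z.
    rewrite derive_coords // mxE; apply: eq_bigr => i _; by rewrite mxE.
  by apply: derivableP; exact: diff_derivable.
have ent j : (fun y => drow F y 0 j) = 'D_(delta_mx 0 j) F by apply/funext => y; rewrite mxE.
split; first by apply: differentiable_mx => i j; rewrite (ord1 i) ent.
have D : is_derive z v (drow F) (v *m hessm F z).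
  by apply: is_derive_mx => i j; rewrite (ord1 i) ent.
by rewrite (@derive_val _ _ _ _ _ _ _ D).
Qed.

End Schwarz.

(** * Stable manifolds of gradient flows *)

Section Topology.
Context {R : realType}.

Lemma open_preimage_on (S T : topologicalType) (U : set S) (F : S -> T) (O : set T) :
  open U -> (forall x, U x -> {for x, continuous F}) -> open O ->
  open [set x | U x /\ O (F x)].
Proof.
move=> oU cF oO; rewrite openE => x [Ux Ox]; rewrite /interior.
have h1 : \forall y \near x, U y by apply: open_nbhs_nbhs.
have h2 : \forall y \near x, O (F y) by apply: (cF x Ux); apply: open_nbhs_nbhs.
by apply: filterS2 h1 h2.
Qed.

Lemma first_exit (T : topologicalType) (c : R -> T) (B : set T) (a : R) :
  open B -> (forall t : R, 0 <= t <= a -> {for t, continuous c}) -> B (c 0) -> 0 <= a ->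
  ~ B (c a) -> exists2 s : R, 0 < s <= a & ~ B (c s) /\ forall t : R, 0 <= t < s -> B (c t).
Proof.
move=> oB cc B0 a0 Ba.
pose S := [set t : R | 0 <= t /\ ~ B (c t)].
have hS : has_inf S by split; [exists a|exists 0 => t []].
have s0 : 0 <= inf S by apply: lb_le_inf; [exists a|move=> t []].
have sa : inf S <= a by apply: ge_inf; [exact: hS.2|].
have lt t : 0 <= t < inf S -> B (c t).
  move=> /andP[t0 ts]; apply: contrapT => nB.
  have : inf S <= t by apply: ge_inf; [exact: hS.2|].
  by rewrite leNgt ts.
have nB : ~ B (c (inf S)).
  move=> BS; have cs : {for inf S, continuous c} by apply: cc; rewrite s0.
  have : \forall t \near inf S, B (c t) by apply: cs; apply: open_nbhs_nbhs.
  move=> /nbhs_ballP[e e0 He]; have {}e0 : 0 < e by exact: e0.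
  have [t [t0 nBt] tS] := inf_adherent e0 hS.
  have h : inf S <= t by apply: ge_inf; [exact: hS.2|].
  by apply: nBt; apply: He; rewrite -ball_normE /= distrC ger0_norm; lra.
exists (inf S) => //; rewrite sa andbT lt_neqAle s0 andbT.
by apply/eqP => e; apply: nB; rewrite -e.
Qed.

Lemma mulmx_norm_le n k (v : 'rV[R]_n) (A : 'M[R]_(n, k)) :
  `|v *m A| <= n%:R * `|A| * `|v|.
Proof.
apply/mx_norm_le; first by rewrite !mulr_ge0.
move=> i j; rewrite mxE; apply: le_trans (ler_norm_sum _ _ _) _.
rewrite -mulrA -(sum_const_ord n (`|A| * `|v|)); apply: ler_sum => l _.
by rewrite normrM mulrC ler_pM // mx_norm_ge.
Qed.

Lemma mulmx_norm_bound n k (A : 'M[R]_(n, k)) : exists2 K : R, 0 < K &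
  forall v : 'rV[R]_n, `|v *m A| <= K * `|v|.
Proof.
exists (n%:R * `|A| + 1); first by rewrite ltr_wpDl // mulr_ge0.
move=> v; apply: le_trans (mulmx_norm_le _ _) _; by rewrite ler_wpM2r // lerDl.
Qed.

(** The infimum of the times at which P holds is 0, since P descends from times just
    after it to times just before it. *)
Lemma backward_induction (P : R -> Prop) : (exists2 t, 0 <= t & P t) ->
  (forall t0, 0 <= t0 -> exists2 a, 0 < a & forall s s', 0 <= s -> s <= s' ->
     `|s - t0| < a -> `|s' - t0| < a -> P s' -> P s) -> P 0.
Proof.
move=> [t t0 Pt] step; pose S := [set s : R | 0 <= s /\ P s].
have hS : has_inf S by split; [exists t|exists 0 => s []].
have s0 : 0 <= inf S by apply: lb_le_inf; [exists t|move=> s []].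
have [a a0 H] := step _ s0.
have [s' [s'0 Ps'] s'S] := inf_adherent a0 hS.
have ge x : S x -> inf S <= x by move=> Sx; apply: ge_inf; [exact: hS.2|].
have s'ge := ge s' (conj s'0 Ps').
pose s := Num.max 0 (inf S - a / 2).
have ms : s <= inf S by rewrite /s ge_max s0 /= gerBl divr_ge0 // ltW.
have s_ge0 : 0 <= s by rewrite /s le_max lexx.
have sl : inf S - a / 2 <= s by rewrite /s le_max lexx orbT.
have Ps : P s.
  apply: (H s s') => //; first exact: le_trans s'ge.
    by rewrite distrC ger0_norm; lra.
  by rewrite ger0_norm; lra.
have := ge s (conj s_ge0 Ps); rewrite {1}/s; move: Ps; rewrite /s.
by case: (leP 0 (inf S - a / 2)) => // h Ps h'; lra.
Qed.

End Topology.

Section StableManifold.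
Context {R : realType} {m : nat} {M : manifold R m}.
Implicit Types (x y p : M) (phi psi chi : chart R m M) (g f : M -> R) (c : R -> M).
Implicit Types (G : M -> 'M[R]_m).

(** Composing a chart with a diffeomorphism between open sets of R^m gives a chart of
    the maximal atlas; restrictions of charts are the case A = B = id. *)
Lemma chart_change phi (V V' : set 'rV[R]_m) (A B : 'rV[R]_m -> 'rV[R]_m) :
  smooth_chart phi -> open V -> V `<=` cimg phi -> open V' ->
  smooth_on V A -> smooth_on V' B ->
  (forall z, V z -> V' (A z) /\ B (A z) = z) ->
  (forall w, V' w -> V (B w) /\ A (B w) = w) ->
  exists chi : chart R m M, [/\ smooth_chart chi,
    forall y, cdom chi y <-> cdom phi y /\ V (cmap phi y) &
    forall y, cmap chi y = A (cmap phi y)].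
Proof.
move=> sp oV sV oV' sA sB AB BA.
pose D := [set y | cdom phi y /\ V (cmap phi y)].
have oD : open D.
  apply: open_preimage_on => //; first exact: cdom_open.
  exact: cmap_continuous.
have eI : (A \o cmap phi) @` D = V'.
  apply/seteqP; split=> w; first by case=> y [dy Vy] <- /=; case: (AB _ Vy).
  move=> /BA[VB e]; have i := sV _ VB; exists (cinv phi (B w)); last by rewrite /= cinvK.
  by split; [exact: cimg_cdom|rewrite cinvK].
have oI : open ((A \o cmap phi) @` D) by rewrite eI.
have K y : D y -> (cinv phi \o B) ((A \o cmap phi) y) = y.
  by move=> [dy Vy] /=; rewrite (AB _ Vy).2 cmapK.
have c1 y : D y -> {for y, continuous (A \o cmap phi)}.
  move=> [dy Vy]; apply: continuous_comp; first exact: cmap_continuous.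
  exact: (Ck_continuous (sA 0%N) Vy).
have c2 w : ((A \o cmap phi) @` D) w -> {for w, continuous (cinv phi \o B)}.
  rewrite eI => Vw; apply: continuous_comp; first exact: (Ck_continuous (sB 0%N) Vw).
  by apply: cinv_continuous; apply: sV; case: (BA _ Vw).
pose chi := Chart oD oI K c1 c2.
exists chi; split=> // psi ha; have sq := atlas_smooth_chart ha.
split=> k.
- have o := @overlap_open _ _ _ chi psi.
  apply: (@Ck_ext _ _ _ _ _ ((cmap psi \o cinv phi) \o B)) => //.
  have sub w : overlap chi psi w -> V' w.
    by move=> /overlapE[[y [dy Vy] <-] _] /=; case: (AB _ Vy).
  apply: (@Ck_comp _ _ _ _ _ _ _ (overlap phi psi)) => //.
  + exact: overlap_open.
  + by apply: Ck_sub (sB k).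
  + move=> w /[dup] /sub /BA[VB _] /overlapE[_ dw]; apply/overlapE; split=> //.
    exact: sV.
  + exact: smooth_charts_compatible.
- have o := @overlap_open _ _ _ psi chi.
  apply: (@Ck_ext _ _ _ _ _ (A \o (cmap phi \o cinv psi))) => //.
  apply: (@Ck_comp _ _ _ _ _ _ _ V) => //.
  + apply: Ck_sub (smooth_charts_compatible sq sp k) => w /overlapE[i [d1 _]].
    by apply/overlapE.
  + by move=> w /overlapE[i [d1 d2]].
Qed.

Lemma smooth_fun_continuous g : smooth_fun g -> continuous g.
Proof.
move=> sg x; have dx := chart_at_dom x; set a := chart_at x in dx *.
have sa : smooth_chart a by exact: chart_at_smooth.
have c1 : {for x, continuous ((g \o cinv a) \o cmap a)}.
  apply: continuous_comp; first exact: cmap_continuous.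
  exact: (Ck_continuous (smooth_fun_chart sg sa 0%N) (cimg_cmap dx)).
move: c1; rewrite /prop_for /continuous_at /= cmapK // => c1.
apply: cvg_trans c1; apply: near_eq_cvg.
by apply: filterS (cdom_near dx) => y dy /=; rewrite cmapK.
Qed.

(** The second derivative of the change of charts only enters multiplied by the
    differential of g, which vanishes at p. *)
Lemma hess_chart g phi p : smooth_fun g -> smooth_chart phi -> cdom phi p -> crit g p ->
  hessm (g \o cinv phi) (cmap phi p) =
    chart_frame phi p *m hess g p *m (chart_frame phi p)^T.
Proof.
move=> sg sp dp cp; set a := chart_at p; set z := cmap phi p.
have sa : smooth_chart a by exact: chart_at_smooth.
have da : cdom a p by exact: chart_at_dom.
have oI := @cimg_open _ _ _ phi; have Iz : cimg phi z by exact: cimg_cmap.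
have oa := @cimg_open _ _ _ a; have Ia : cimg a (cmap a p) by exact: cimg_cmap.
have sF := smooth_fun_chart sg sp; have sH := smooth_fun_chart sg sa.
pose th := cmap a \o cinv phi.
have thz : th z = cmap a p by rewrite /th /= /z cmapK.
have Dth : differentiable th z by exact: transition_differentiable.
apply: rV_mul_eq => v.
have [_ <-] := derive_drow v oI Iz sF.
pose J k j (w : 'rV[R]_m) := 'D_(delta_mx 0 k) th w 0 j.
pose N w j := drow (g \o cinv a) (th w) 0 j.
have So : overlap phi a z by exists p.
have sth := smooth_charts_compatible sp sa.
have dJ k j : differentiable (J k j) z.
  have o := @overlap_open _ _ _ phi a.
  have s1 : smooth_on (overlap phi a) (J k j).
    by move=> q; apply: Ck_entry => //; exact: (smooth_on_derive _ sth).
  exact: (smooth_on_differentiable s1).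
have [Da Ea] := derive_drow ('D_v th z) oa Ia sH.
have Da' : differentiable (drow (g \o cinv a)) (th z) by rewrite thz.
have DN : is_derive z v (fun w => drow (g \o cinv a) (th w)) ('D_v th z *m hess g p).
  rewrite -Ea -thz -derive_chain //; apply: derivableP; apply: diff_derivable.
  exact: differentiable_comp.
have dN j : differentiable (fun w => N w j) z.
  have o := @overlap_open _ _ _ phi a.
  have s1 : smooth_on (overlap phi a) (fun w => N w j).
    move=> q; apply: (@Ck_comp_scalar _ _ _ _ _ (cimg a) th (fun w => drow (g \o cinv a) w 0 j)) => //.
      by move=> w /overlapE[i d]; exact: cimg_cmap.
    apply: (@Ck_ext _ _ _ _ _ ('D_(delta_mx 0 j) (g \o cinv a))) => //.
      by move=> w _; rewrite mxE.
    exact: (smooth_on_derive _ sH).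
  exact: (smooth_on_differentiable s1).
have N0 j : N z j = 0.
  rewrite /N thz; have : dfun g p = 0 by exact: cp.
  by rewrite dfun_drow => ->; rewrite mxE.
have E k : is_derive z v (fun w => drow (g \o cinv phi) w 0 k)
    (\sum_j ('D_v th z *m hess g p) 0 j * J k j z).
  apply: (@near_eq_is_derive _ _ _ (fun w => \sum_j N w j * J k j w)).
    near=> w.
    have /overlapE[iw dw] : overlap phi a w by near: w; exact: overlap_near.
    have dw' := cimg_cdom iw.
    have := drow_change sg sp sa dw' dw; rewrite cinvK // => ->.
    rewrite mxE; apply: eq_bigr => j _; rewrite [X in _ = _ * X]mxE; congr (_ * _).
    rewrite /J -(@mul_jacobian _ _ _ th); last by rewrite -(cinvK iw); exact: transition_differentiable.
    by rewrite -rowE mxE /transition cinvK.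
  have dP j : is_derive z v (fun w => N w j * J k j w)
      (('D_v th z *m hess g p) 0 j * J k j z).
    have [dp' ep'] := differentiable_mulr v (dN j) (dJ k j).
    apply: DeriveDef; first exact: diff_derivable.
    rewrite ep' N0 mul0r add0r; congr (_ * _).
    by rewrite (@derive_val _ _ _ _ _ _ _ (is_derive_entry 0 j DN)).
  rewrite -fct_sumE; exact: is_derive_sum.
have D : is_derive z v (drow (g \o cinv phi))
    (v *m (chart_frame phi p *m hess g p *m (chart_frame phi p)^T)).
  apply: is_derive_mx => i k; rewrite (ord1 i); apply: is_derive_eq (E k) _.
  rewrite !mulmxA (_ : v *m chart_frame phi p = 'D_v th z); last exact: mul_jacobian.
  rewrite [RHS]mxE; apply: eq_bigr => j _; rewrite [X in _ = _ * X]mxE; congr (_ * _).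
  by rewrite /J -(mul_jacobian _ Dth) -rowE mxE.
by rewrite (@derive_val _ _ _ _ _ _ _ D).
Unshelve. all: by end_near. Qed.

Definition metric_pos G :=
  (forall x, (G x)^T = G x) /\ forall x v, v != 0 -> 0 < inner G x v v.

Lemma metric_unit G x : metric_pos G -> G x \in unitmx.
Proof.
move=> [_ pos]; rewrite -row_free_unit -kermx_eq0; apply/rowV0P => v /sub_kermxP vG.
apply/eqP; apply: contraT => v0; have := pos x v v0.
by rewrite /inner vG mul0mx mxE ltxx.
Qed.

(** The inner product of covectors. *)
Definition codot G x (a b : 'rV[R]_m) : R := (a *m invmx (G x) *m b^T) 0 0.

Lemma codot_gt0 G x a : metric_pos G -> a != 0 -> 0 < codot G x a a.
Proof.
move=> Gp a0; have Gu := metric_unit x Gp; pose w := a *m invmx (G x).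
have ea : a = w *m G x by rewrite /w mulmxKV.
have w0 : w != 0 by apply: contraNneq a0 => w0; rewrite ea w0 mul0mx.
have := Gp.2 x w w0; rewrite /inner /codot -/w.
by rewrite (_ : a^T = G x *m w^T) ?mulmxA // ea trmx_mul Gp.1.
Qed.

Lemma codot_ge0 G x a : metric_pos G -> 0 <= codot G x a a.
Proof.
move=> Gp; have [->|a0] := eqVneq a 0; first by rewrite /codot !mul0mx mxE.
exact: ltW (codot_gt0 _ Gp a0).
Qed.

Lemma derive_along_grad G g f c (t : R) : smooth_fun f -> grad_eq_at G g c t ->
  is_derive t (1 : R) (fun s => f (c s)) (- codot G (c t) (dfun g (c t)) (dfun f (c t))).
Proof.
move=> sf /grad_eqP[cc D].
have := derive_along sf (chart_at_smooth (c t)) (chart_at_dom (c t)) cc D.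
by rewrite /grad mulNmx mxE.
Qed.

Lemma codot_flat G f g phi x : smooth_fun f -> smooth_fun g -> flat G phi -> cdom phi x ->
  codot G x (dfun f x) (dfun g x) =
  (drow (f \o cinv phi) (cmap phi x) *m (drow (g \o cinv phi) (cmap phi x))^T) 0 0.
Proof.
move=> sf sg fl dx; rewrite (dfun_chart sf fl.1 dx) (dfun_chart sg fl.1 dx).
by rewrite /codot (flat_metric_inv fl dx) trmx_mul trmxK !mulmxA.
Qed.

Lemma grad_curve_nonincreasing G g c (s t : R) : metric_pos G -> smooth_fun g -> s <= t ->
  (forall u, s <= u <= t -> grad_eq_at G g c u) -> g (c t) <= g (c s).
Proof.
move=> Gp sg st H; rewrite -lerN2.
apply: (is_derive_mono (u := fun u => - g (c u))
  (du := fun u => codot G (c u) (dfun g (c u)) (dfun g (c u)))) => //.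
  move=> u hu; have := is_deriveN (derive_along_grad sg (H u hu)).
  by rewrite opprK.
by move=> u _; exact: codot_ge0.
Qed.

Lemma grad_curve_limit_le G g c p (t : R) : metric_pos G -> smooth_fun g ->
  (forall u, 0 <= u -> grad_eq_at G g c u) -> c u @[u --> +oo] --> p -> 0 <= t ->
  g p <= g (c t).
Proof.
move=> Gp sg H cl t0; rewrite leNgt; apply/negP => lt.
have cg : g (c u) @[u --> +oo] --> g p.
  by apply: (@continuous_cvg _ _ _ _ _ c g) => //; exact: smooth_fun_continuous.
have [r [_ Hr]] : \forall u \near +oo, g (c t) < g (c u).
  exact: (cg [set a | g (c t) < a] (lt_nbhsr lt)).
pose u := Num.max t (r + 1).
have ru : r < u by rewrite /u lt_max ltrDl ltr01 orbT.
have := Hr u ru; rewrite ltNge => /negP; apply.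
apply: (grad_curve_nonincreasing Gp sg); first by rewrite le_max lexx.
by move=> v /andP[tv _]; apply: H; exact: le_trans tv.
Qed.

(** The linear part of the gradient is invertible and the remainder is quadratic. *)
Lemma nondegenerate_bound (F : 'rV[R]_m -> R) (U : set 'rV[R]_m) z0 : open U -> U z0 ->
  smooth_on U F -> drow F z0 = 0 -> hessm F z0 \in unitmx ->
  exists k r : R, [/\ 0 < k, 0 < r, forall z, `|z - z0| <= r -> U z &
    forall z, `|z - z0| <= r -> k * `|z - z0| <= `|drow F z|].
Proof.
move=> oU Uz sF d0 Hu; set H := hessm F z0 in Hu.
have [K K0 HK] := mulmx_norm_bound (invmx H).
have : \forall z \near z0, U z by apply: open_nbhs_nbhs.
move=> /nbhs_ballP[d dd Hd]; have {}dd : 0 < d by exact: dd.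
pose r1 := d / 2; have r10 : 0 < r1 by rewrite divr_gt0.
have sub1 : cball z0 r1 `<=` U.
  move=> z; rewrite /cball /= => h; apply: Hd; rewrite -ball_normE /= distrC.
  by apply: le_lt_trans h _; rewrite /r1 ltr_pdivrMr //; lra.
have sD : Ck 2 U (drow F).
  apply: Ck_mx => // i j; apply: (@Ck_ext _ _ _ _ _ ('D_(delta_mx 0 j) F)) => //.
    by move=> z _; rewrite mxE.
  exact: (smooth_on_derive _ sF).
have [B B0 [_ _ _ HB]] := C2_bounds oU (cball_compact (c := z0) r10) (@cball_convex _ _ z0 r1) sub1 sD.
pose k := (2 * K)^-1; have k0 : 0 < k by rewrite invr_gt0 mulr_gt0.
pose r := Num.min r1 (k / B); have r0 : 0 < r by rewrite lt_min r10 divr_gt0.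
have rr1 : r <= r1 by rewrite /r ge_min lexx.
have rB : B * r <= k by rewrite mulrC -ler_pdivlMr // /r ge_min lexx orbT.
exists k, r; split=> // [z zr|z zr]; first by apply: sub1; exact: le_trans rr1.
have c0 : cball z0 r1 z0 by rewrite /cball /= subrr normr0 ltW.
have cz : cball z0 r1 z by exact: le_trans rr1.
have := HB z0 z c0 cz; rewrite d0 subr0 (derive_drow (z - z0) oU Uz sF).2 -/H => h1.
set w := z - z0 in h1 zr *.
have h2 : `|w| <= K * `|w *m H| by have := HK (w *m H); rewrite mulmxK.
have h3 : `|w *m H| <= `|drow F z| + B * `|w| ^+ 2.
  have -> : w *m H = drow F z - (drow F z - w *m H) by rewrite opprB addrCA subrr addr0.
  apply: le_trans (ler_normB _ _) _; by rewrite lerD2l.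
have h4 : 2 * k * `|w| <= `|w *m H|.
  by rewrite /k invfM mulrA mulfV ?mul1r ?pnatr_eq0 // mulrC ler_pdivrMr // mulrC.
(* By the choice of r the quadratic remainder is at most half of the linear term. *)
have h5 : B * `|w| ^+ 2 <= k * `|w|.
  rewrite expr2 mulrA ler_wpM2r //; apply: le_trans rB; by rewrite ler_wpM2l // ltW.
lra.
Qed.

End StableManifold.

Lemma is_derive_mulmxr (R : realType) (V : normedModType R) n k l (F : V -> 'M[R]_(n, k))
    x v dF (B : 'M[R]_(k, l)) :
  is_derive x v F dF -> is_derive x v (fun y => F y *m B) (dF *m B).
Proof. by move=> D; exact: (is_derive_mxlinear (mulmxr B) D). Qed.

Lemma open_preimage_Ck (R : realType) n k (U : set 'rV[R]_n) (F : 'rV[R]_n -> 'rV[R]_k)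
    (O : set 'rV[R]_k) :
  open U -> Ck 0 U F -> open O -> open [set x | U x /\ O (F x)].
Proof. by move=> oU cF oO; apply: open_preimage_on. Qed.

Section StableSlices.
Context {R : realType} {m : nat} {M : manifold R m}.
Implicit Types (x y p : M) (phi psi chi : chart R m M) (g f : M -> R) (c : R -> M).
Implicit Types (G : M -> 'M[R]_m).

Lemma sqr_norm_le n (v : 'rV[R]_n) : `|v| ^+ 2 <= (v *m v^T) 0 0.
Proof.
have e : (v *m v^T) 0 0 = \sum_i v 0 i ^+ 2.
  by rewrite mxE; apply: eq_bigr => i _; rewrite mxE expr2.
have s0 : 0 <= \sum_i v 0 i ^+ 2 by apply: sumr_ge0 => i _; exact: sqr_ge0.
rewrite e -[leRHS]sqr_sqrtr // ler_sqr ?nnegrE ?sqrtr_ge0 //.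
apply/mx_norm_le; first exact: sqrtr_ge0.
move=> i j; rewrite (ord1 i) -sqrtr_sqr ler_sqrt // (bigD1 j) //= lerDl.
by apply: sumr_ge0 => k _; exact: sqr_ge0.
Qed.

Lemma left_limit_eq c1 c2 (s : R) : 0 < s -> {for s, continuous c1} -> {for s, continuous c2} ->
  (forall v : R, 0 <= v < s -> c1 v = c2 v) -> c1 s = c2 s.
Proof.
move=> s0 k1 k2 e; apply: (@carrier_hausdorff _ _ M) => A B hA hB.
have h1 : \forall v \near s, A (c1 v) by exact: k1.
have h2 : \forall v \near s, B (c2 v) by exact: k2.
have : \forall v \near s, A (c1 v) /\ B (c2 v) by exact: filterI h1 h2.
move=> /nbhs_ballP[d d0 Hd]; have {}d0 : 0 < d by exact: d0.
pose v := Num.max 0 (s - d / 2).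
have v0 : 0 <= v by rewrite /v le_max lexx.
have vs : v < s by rewrite /v gt_max s0 /=; lra.
have sv : s - d / 2 <= v by rewrite /v le_max lexx orbT.
have [Av Bv] : A (c1 v) /\ B (c2 v).
  by apply: Hd; rewrite -ball_normE /= ger0_norm; lra.
by exists (c1 v); split=> //; rewrite e ?v0.
Qed.

Lemma closed_left_limit (K : set M) c (s : R) : 0 < s -> {for s, continuous c} -> closed K ->
  (forall v : R, 0 <= v < s -> K (c v)) -> K (c s).
Proof.
move=> s0 k1 cK e; apply: cK => A hA.
have h1 : \forall v \near s, A (c v) by exact: k1.
move: h1 => /nbhs_ballP[d d0 Hd]; have {}d0 : 0 < d by exact: d0.
pose v := Num.max 0 (s - d / 2).
have v0 : 0 <= v by rewrite /v le_max lexx.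
have vs : v < s by rewrite /v gt_max s0 /=; lra.
have sv : s - d / 2 <= v by rewrite /v le_max lexx orbT.
exists (c v); split; first by apply: e; rewrite v0.
by apply: Hd; rewrite -ball_normE /= ger0_norm; lra.
Qed.

Lemma chart_ball_open phi (z0 : 'rV[R]_m) (r : R) :
  open [set y | cdom phi y /\ `|cmap phi y - z0| < r].
Proof.
apply: (open_preimage_on (O := [set z | `|z - z0| < r])).
- exact: cdom_open.
- exact: cmap_continuous.
- exact: oball_open.
Qed.

Lemma chart_cball_closed phi (z0 : 'rV[R]_m) (r : R) : 0 < r -> cball z0 r `<=` cimg phi ->
  closed [set y | cdom phi y /\ `|cmap phi y - z0| <= r].
Proof.
move=> r0 sub.
have -> : [set y | cdom phi y /\ `|cmap phi y - z0| <= r] = cinv phi @` cball z0 r.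
  apply/seteqP; split=> y; first by move=> [dy h]; exists (cmap phi y) => //; exact: cmapK.
  case=> z hz <-; have i := sub _ hz; split; first exact: cimg_cdom.
  by rewrite cinvK.
apply: compact_closed; first exact: carrier_hausdorff.
apply: continuous_compact; last exact: cball_compact.
apply: continuous_in_subspaceT => z /set_mem hz; apply: cinv_continuous; exact: sub.
Qed.

Lemma grad_eq_continuous G g c (t : R) : grad_eq_at G g c t -> {for t, continuous c}.
Proof. by case. Qed.

(** A trajectory that starts close to its limit p stays close: leaving would
    cost more of the function than is available, since along the trajectory
    (x_i - p_i)^2 + const * g decreases. *)
Lemma no_return G g phi p (r : R) : metric_pos G -> smooth_fun g -> flat G phi ->
  cdom phi p -> crit g p -> hess g p \in unitmx -> 0 < r ->
  exists2 r' : R, 0 < r' & forall c, (forall t, 0 <= t -> grad_eq_at G g c t) ->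
    c t @[t --> +oo] --> p -> cdom phi (c 0) -> `|cmap phi (c 0) - cmap phi p| < r' ->
    forall t, 0 <= t -> cdom phi (c t) /\ `|cmap phi (c t) - cmap phi p| < r.
Proof.
move=> Gp sg fl dp cp Hu r0; have sp := fl.1.
set z0 := cmap phi p; pose F := g \o cinv phi.
have oI := @cimg_open _ _ _ phi; have Iz : cimg phi z0 by exact: cimg_cmap.
have sF : smooth_on (cimg phi) F := smooth_fun_chart sg sp.
have d0 : drow F z0 = 0.
  by rewrite /F /z0 (dfun_chart sg sp dp) (_ : dfun g p = 0) ?mul0mx //; exact: cp.
have hu : hessm F z0 \in unitmx.
  have Fu := chart_frame_unit sp dp.
  by rewrite /F /z0 (hess_chart sg sp dp cp) !unitmx_mul unitmx_tr Fu Hu.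
have [k [r1 [k0 r10 sub1 grow]]] := nondegenerate_bound oI Iz sF d0 hu.
pose r2 := Num.min r r1; have r20 : 0 < r2 by rewrite lt_min r0.
have r2r1 : r2 <= r1 by rewrite /r2 ge_min lexx orbT.
have r2r : r2 <= r by rewrite /r2 ge_min lexx.
(* With this choice q 0 is too small for a to reach r2 / 2. *)
pose de := k * r2 ^+ 2 / 16.
have de0 : 0 < de by rewrite divr_gt0 // mulr_gt0 // exprn_gt0.
have cF : {for z0, continuous F} := Ck_continuous (sF 0%N) Iz.
have /(continuous_epsP F z0) /(_ de de0) [d dd Hd] := cF.
pose r' := Num.min d (r2 / 4).
exists r'; first by rewrite lt_min dd divr_gt0.
move=> c H cl dc0 c0 t t0.
have r'd : r' <= d by rewrite /r' ge_min lexx.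
have r'2 : r' <= r2 / 4 by rewrite /r' ge_min lexx orbT.
pose B := [set y | cdom phi y /\ `|cmap phi y - z0| < r2].
have oB : open B by exact: chart_ball_open.
suff : B (c t) by move=> [h1 h2]; split=> //; exact: lt_le_trans r2r.
apply: contrapT => nB.
have B0 : B (c 0) by split=> //; apply: lt_le_trans c0 _; apply: le_trans r'2 _; lra.
have cc u : 0 <= u <= t -> {for u, continuous c}.
  by move=> /andP[u0 _]; exact: grad_eq_continuous (H u u0).
have [s /andP[s0 st] [nBs Hs]] := first_exit oB cc B0 t0 nB.
have cs : {for s, continuous c} by apply: cc; rewrite ltW.
have cK : closed [set y | cdom phi y /\ `|cmap phi y - z0| <= r2].
  by apply: chart_cball_closed => // z; rewrite /cball /= => h; apply: sub1; exact: le_trans r2r1.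
have [ds zs] : [set y | cdom phi y /\ `|cmap phi y - z0| <= r2] (c s).
  by apply: (closed_left_limit s0 cs cK) => v hv; have [h1 h2] := Hs v hv; split=> //; exact: ltW.
have inK u : 0 <= u <= s -> cdom phi (c u) /\ `|cmap phi (c u) - z0| <= r2.
  move=> /andP[u0]; rewrite le_eqVlt => /orP[/eqP -> //|us].
  by have [|h1 h2] := Hs u; [rewrite u0|split=> //; exact: ltW].
have key i : `|(cmap phi (c s) - z0) 0 i| <= r2 / 2.
  pose a u := cmap phi (c u) 0 i - z0 0 i.
  (* q decreases, because |a'| is bounded by the gradient and |a| by a multiple of it. *)
  pose q u := a u * a u + 2 / k * g (c u).
  pose dr u := drow F (cmap phi (c u)).
  have Da u : 0 <= u <= s -> is_derive u (1 : R) a (- dr u 0 i).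
    move=> hu'; have [du _] := inK u hu'; move: hu' => /andP[u0 us].
    have [_ D] := (grad_eq_flat sg fl du).1 (H u u0).
    have := is_derive_entry 0 i D; rewrite [X in is_derive _ _ _ X]mxE => D1.
    by have := is_deriveB D1 (is_derive_cst (z0 0 i) u (1 : R)); rewrite subr0.
  have Dq u : 0 <= u <= s -> is_derive u (1 : R) (fun u => - q u)
     (2 * (a u * dr u 0 i) + 2 / k * (dr u *m (dr u)^T) 0 0).
    move=> hu'; have D1 := Da u hu'; have [du _] := inK u hu'.
    move: hu' => /andP[u0 us].
    have D2 := derive_along_grad sg (H u u0); rewrite (codot_flat sg sg fl du) in D2.
    have D3 := is_deriveD (is_deriveM D1 D1) (is_deriveZ (2 / k) D2).
    apply: is_derive_eq (is_deriveN D3) _.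
    by rewrite /GRing.scale /=; ring.
  have qs : q s <= q 0.
    rewrite -lerN2; apply: (is_derive_mono (ltW s0) Dq) => u hu'.
    have [du zu] := inK u hu'.
    have h1 : k * `|cmap phi (c u) - z0| <= `|dr u| by apply: grow; exact: le_trans zu r2r1.
    have h2 : `|a u| <= `|cmap phi (c u) - z0|.
      by have := mx_norm_ge (cmap phi (c u) - z0) 0 i; rewrite entryB.
    have h3 : `|dr u 0 i| <= `|dr u| by exact: mx_norm_ge.
    have h4 := sqr_norm_le (dr u).
    have h5 : `|a u * dr u 0 i| <= k^-1 * `|dr u| ^+ 2.
      rewrite normrM expr2 mulrA; apply: ler_pM => //.
      apply: le_trans h2 _; by rewrite mulrC ler_pdivlMr // mulrC.
    have h6 : k^-1 * `|dr u| ^+ 2 <= k^-1 * (dr u *m (dr u)^T) 0 0.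
      by rewrite ler_wpM2l // invr_ge0 ltW.
    have h7 : - (k^-1 * (dr u *m (dr u)^T) 0 0) <= a u * dr u 0 i.
      by rewrite lerNl; apply: le_trans (le_trans h5 h6); rewrite -normrN ler_norm.
    rewrite -mulrA -mulrDr mulr_ge0 //; lra.
  have gs : g p <= g (c s) by apply: (grad_curve_limit_le Gp sg H cl); exact: ltW.
  have g0 : g (c 0) - g p <= de.
    have := Hd (cmap phi (c 0)); rewrite distrC => /(_ (lt_le_trans c0 r'd)).
    rewrite /F /= cmapK // /z0 cmapK // distrC; apply: le_trans; exact: ler_norm.
  have a0 : `|a 0| <= r2 / 4.
    apply: le_trans r'2; apply: le_trans (ltW c0).
    by have := mx_norm_ge (cmap phi (c 0) - z0) 0 i; rewrite entryB.
  have a02 : a 0 * a 0 <= r2 / 4 * (r2 / 4).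
    by rewrite -[leLHS]ger0_norm ?sqr_ge0 -?expr2 ?sqr_ge0 // expr2 normrM ler_pM.
  rewrite entryB -/(a s) -ler_sqr ?nnegrE ?divr_ge0 ?(ltW r20) // -normrX.
  rewrite ger0_norm ?sqr_ge0 // expr2.
  have : 2 / k * (g (c 0) - g (c s)) <= 2 / k * de.
    by rewrite ler_wpM2l ?divr_ge0 ?(ltW k0) //; lra.
  have -> : 2 / k * de = r2 ^+ 2 / 8 by rewrite /de; field; rewrite gt_eqF.
  move: qs; rewrite /q mulrBr expr2 expr2; nra.
apply: nBs; split=> //; apply: (@le_lt_trans _ _ (r2 / 2)); last by lra.
apply/mx_norm_le; first by rewrite divr_ge0 // ltW.
by move=> i j; rewrite (ord1 i); exact: key.
Qed.

(** In coordinates adapted to the eigenvectors of the Hessian the stable set is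
    the graph provided by the local stable manifold theorem. *)
Lemma stable_slice_at G g phi p P mu s : metric_pos G -> smooth_fun g -> flat G phi ->
  cdom phi p -> crit g p -> hess g p \in unitmx ->
  sorted_diagonal (hessm (g \o cinv phi) (cmap phi p)) P mu s ->
  exists chi, cdom chi p /\ slice_chart (Ws G g p) s chi.
Proof.
move=> Gp sg fl dp cp Hu [Pu sm mus mu0 HP]; have sp := fl.1.
set z0 := cmap phi p in HP; pose F := g \o cinv phi.
have oI := @cimg_open _ _ _ phi; have Iz : cimg phi z0 by exact: cimg_cmap.
have sF : smooth_on (cimg phi) F := smooth_fun_chart sg sp.
have d0 : drow F z0 = 0.
  by rewrite /F /z0 (dfun_chart sg sp dp) (_ : dfun g p = 0) ?mul0mx //; exact: cp.
pose Q := invmx P; have Qu : Q \in unitmx by rewrite unitmx_inv.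
(* Coordinates along the eigenvectors, with p at the origin. *)
pose out z := z0 + z *m P; pose inn (w : 'rV[R]_m) := (w - z0) *m Q.
have outK w : out (inn w) = w by rewrite /out /inn mulmxKV // addrC subrK.
have innK z : inn (out z) = z by rewrite /out /inn addrC addKr mulmxK.
have sout k (U : set 'rV[R]_m) : open U -> Ck k U out.
  by move=> oU; apply: Ck_add => //; [exact: Ck_cst|apply: Ck_mulmxr => //; exact: Ck_id].
have sinn k (U : set 'rV[R]_m) : open U -> Ck k U inn.
  move=> oU; apply: Ck_mulmxr => //; apply: Ck_add => //; [exact: Ck_id|exact: Ck_cst].
have cout z : {for z, continuous out} := Ck_continuous (sout 0%N _ openT) I.
have cinn z : {for z, continuous inn} := Ck_continuous (sinn 0%N _ openT) I.
pose U := [set z | setT z /\ cimg phi (out z)].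
have oU : open U by apply: (open_preimage_on openT) => // z _; exact: cout.
have U0 : U 0 by split=> //; rewrite /out mul0mx addr0.
pose Y z := gfield g phi (out z) *m Q.
have sY : smooth_on U Y.
  move=> k; apply: Ck_mulmxr => //.
  apply: (@Ck_compf _ _ _ _ _ _ _ (cimg phi)) => //.
  - exact: sout.
  - by move=> z [].
  - exact: (gfield_smooth sg sp).
have Y0 : Y 0 = 0.
  by rewrite /Y /out mul0mx addr0 /gfield (_ : drow _ _ = 0) ?oppr0 ?mul0mx.
have DY v i : 'D_v Y 0 0 i = - (mu i * v 0 i).
  have D1 : is_derive (0 : R) (1 : R) (fun t : R => Y (0 + t *: v)) ('D_v Y 0).
    have := @is_derive_along_line _ _ _ Y 0 v 0; rewrite scale0r addr0; apply.
    exact: (smooth_on_differentiable sY U0).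
  have [Dd De] := derive_drow (v *m P) oI Iz sF.
  have D2 : is_derive (0 : R) (1 : R) (fun t : R => drow F (z0 + t *: (v *m P)))
      (v *m P *m hessm F z0).
    have := @is_derive_along_line _ _ _ (drow F) z0 (v *m P) 0.
    by rewrite scale0r addr0 De; apply.
  have D3 : is_derive (0 : R) (1 : R) (fun t : R => Y (0 + t *: v))
      (- (v *m P *m hessm F z0) *m Q).
    have := is_derive_mulmxr Q (is_deriveN D2).
    rewrite /= ; congr (is_derive _ _ _ _); apply/funext => t.
    by rewrite /= /Y /gfield /out add0r -scalemxAl.
  rewrite -(@derive_val _ _ _ _ _ _ _ D1) (@derive_val _ _ _ _ _ _ _ D3).
  by rewrite mulNmx mxE HP.
have [rho [gs [rho0 _ [gsm gst gdep gcurve gback]]]] :=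
  local_stable_manifold oU U0 sY Y0 (@ltr01 R) DY mu0.
have [K K0 HK] := mulmx_norm_bound Q.
have [r' r'0 Hret] := no_return Gp sg fl dp cp Hu (divr_gt0 rho0 K0).
pose ro := fun _ : 'I_m => rho.
pose pr : 'M[R]_m := diag_mx (\row_i ((s <= i)%N%:R)).
have prE (z : 'rV[R]_m) i : (z *m pr) 0 i = if (s <= i)%N then z 0 i else 0.
  by rewrite mul_mx_diag !mxE; case: ifP => _; rewrite ?mulr1 ?mulr0.
(* Shearing by the graph of the local stable manifold makes it flat. *)
pose S (z : 'rV[R]_m) : 'rV[R]_m := z - gs z *m pr.
pose T (w : 'rV[R]_m) : 'rV[R]_m := w + gs w *m pr.
have Sst z (i : 'I_m) : (i < s)%N -> S z 0 i = z 0 i.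
  by move=> h; rewrite /S entryB prE leqNgt h subr0.
have Tst z (i : 'I_m) : (i < s)%N -> T z 0 i = z 0 i.
  by move=> h; rewrite /T mxE prE leqNgt h addr0.
have oro : open (obox ro) by exact: obox_open.
have sS k : Ck k (obox ro) S.
  apply: Ck_add => //; [exact: Ck_id|apply: Ck_opp => //; apply: Ck_mulmxr => //; exact: gsm].
have sT k : Ck k (obox ro) T.
  apply: Ck_add => //; [exact: Ck_id|apply: Ck_mulmxr => //; exact: gsm].
pose V1 := [set z : 'rV[R]_m | obox ro z /\ obox ro (S z)].
pose V2 := [set z : 'rV[R]_m | obox ro z /\ obox ro (T z)].
have oV1 : open V1.
  exact: (open_preimage_Ck oro (sS 0%N) oro).
have oV2 : open V2.
  exact: (open_preimage_Ck oro (sT 0%N) oro).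
have ST z : V1 z -> T (S z) = z.
  move=> [h1 h2]; rewrite /T (gdep (S z) z) // ?subrK // => i; rewrite mus; exact: Sst.
have TS z : V2 z -> S (T z) = z.
  move=> [h1 h2]; rewrite /S (gdep (T z) z) // ?addrK // => i; rewrite mus; exact: Tst.
have obz : open [set z | `|z - z0| < r'] by exact: oball_open.
pose near0 := [set w | cimg phi w /\ `|w - z0| < r'].
have onear : open near0 by apply: openI => //.
pose V := [set w | near0 w /\ V1 (inn w)].
have oV : open V by exact: (open_preimage_Ck onear (sinn 0%N _ onear) oV1).
pose V' := [set w | V2 w /\ near0 (out (T w))].
have oV' : open V'.
  apply: (open_preimage_Ck (F := fun w => out (T w)) oV2 _ onear).
  apply: (@Ck_compf _ _ _ _ _ _ _ setT) => //; first exact: openT.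
  by apply: Ck_sub (sT 0%N) => z [].
have [chi [sc dchi mchi]] : exists chi : chart R m M, [/\ smooth_chart chi,
    forall y, cdom chi y <-> cdom phi y /\ V (cmap phi y) &
    forall y, cmap chi y = S (inn (cmap phi y))].
  apply: (@chart_change _ _ _ phi V V' (S \o inn) (out \o T)) => //.
  - by move=> w [[]].
  - move=> k; apply: (@Ck_compf _ _ _ _ _ _ _ (obox ro)) => //.
      exact: sinn.
    by move=> w [_ []].
  - move=> k; apply: (@Ck_compf _ _ _ _ _ _ _ setT) => //; first exact: openT.
      by apply: Ck_sub (sT k) => w [[]].
    exact: sout openT.
  - move=> w [nw v1]; have e := ST _ v1; rewrite /= e outK; split=> //; split.
      by split; [case: v1|rewrite e; case: v1].
    by rewrite e outK.
  - move=> w [v2 nw]; have e := TS _ v2; rewrite /= innK e; split=> //; split=> //.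
    by rewrite innK; split; [case: v2|rewrite e; case: v2].
have b0 : obox ro 0 by move=> i; rewrite mxE normr0.
have g00 : gs 0 = 0.
  apply: (gback (fun=> 0)) => // t _; split; first by rewrite normr0 ltW.
  by rewrite Y0; exact: is_derive_cst.
have fixE z : obox ro z -> (gs z = z <-> forall i : 'I_m, (s <= i)%N -> S z 0 i = 0).
  move=> hz; split=> [e i si|h]; first by rewrite /S entryB prE si e subrr.
  apply/rowP => i; have [si|si] := leqP s i.
    by have := h i si; rewrite /S entryB prE si => /subr0_eq ->.
  by rewrite gst // mus.
exists chi; split.
  apply/dchi; split=> //; split; first by split=> //; rewrite subrr normr0.
  rewrite /inn -/z0 subrr mul0mx; split=> //; by rewrite /S g00 mul0mx subr0.
split=> // y /dchi[dy [[Iy ny] [v1 v1']]]; rewrite mchi -fixE //.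
set z := inn (cmap phi y) in v1 v1' *.
split=> [[c [c0 H cl]]|fix_z].
  have dc0 : cdom phi (c 0) by rewrite c0.
  have nc0 : `|cmap phi (c 0) - z0| < r' by rewrite c0.
  have ret := Hret c H cl dc0 nc0.
  pose q t := inn (cmap phi (c t)).
  have q0 : q 0 = z by rewrite /q c0.
  rewrite -q0; apply: gback; first by rewrite q0.
  move=> t t0; have [dt nt] := ret t t0; split.
    rewrite /q /inn; apply: le_trans (HK _) _.
    by rewrite mulrC -ler_pdivlMr // ltW.
  have [_ D] := (grad_eq_flat sg fl dt).1 (H t t0).
  have D' := is_derive_mulmxr Q (is_deriveB D (is_derive_cst z0 t (1 : R))).
  by apply: is_derive_eq D' _; rewrite /= subr0 /Y /q outK.
have [w [w0 wH wl]] := gcurve z v1 fix_z.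
exists (fun t => cinv phi (out (w t))); split.
- by rewrite w0 /z outK cmapK.
- move=> t t0; have [_ [[_ i] D]] := wH t t0.
  apply: (grad_eq_cinv (z := fun t => out (w t)) sg fl) => //.
  have D' := is_derive_mulmxr P D.
  apply: is_derive_eq (is_deriveD (is_derive_cst z0 t (1 : R)) D') _.
  by rewrite /= add0r /Y mulmxKV.
- have ep : p = cinv phi (out 0) by rewrite /out mul0mx addr0 /z0 cmapK.
  rewrite ep; apply: (@continuous_cvg _ _ _ _ _ w (cinv phi \o out)) => //.
  apply: continuous_comp; first exact: cout.
  by apply: cinv_continuous; case: U0.
Qed.

End StableSlices.

Section StableSubmanifold.
Context {R : realType} {m : nat} {M : manifold R m}.
Implicit Types (x y p : M) (phi psi chi : chart R m M) (g f : M -> R) (c : R -> M).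
Implicit Types (G : M -> 'M[R]_m).

Lemma sorted_diagonal_opp n (H P : 'M[R]_n) mu s : sorted_diagonal H P mu s ->
  exists P' mu', sorted_diagonal (- H) P' mu' (n - s).
Proof.
move=> [Pu sn mus mu0 HP].
pose P' : 'M[R]_n := \matrix_(i, j) P (rev_ord i) j.
pose Q' : 'M[R]_n := \matrix_(i, j) invmx P i (rev_ord j).
have PQ : P' *m Q' = 1%:M.
  apply/matrixP => i j; rewrite mxE.
  have := congr1 (fun A : 'M[R]_n => A (rev_ord i) (rev_ord j)) (mulmxV Pu).
  rewrite mxE => h; rewrite (eq_bigr (fun k => P (rev_ord i) k * invmx P k (rev_ord j))).
    by rewrite h !mxE (inj_eq rev_ord_inj).
  by move=> k _; rewrite !mxE.
have [P'u _] := mulmx1_unit PQ.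
have eQ : invmx P' = Q' by rewrite -[RHS](mulKmx P'u) PQ mulmx1.
exists P', (fun i => - mu (rev_ord i)); split=> //.
- exact: leq_subr.
- move=> i; rewrite oppr_gt0 lt_neqAle mu0 /= leNgt mus /= -leqNgt.
  by rewrite leq_subRL // ltn_subRL addSn addnC.
- by move=> i; rewrite oppr_eq0.
move=> v i; pose v' : 'rV[R]_n := \row_j v 0 (rev_ord j).
have e1 : v *m P' = v' *m P.
  apply/rowP => k; rewrite !mxE (reindex_inj rev_ord_inj) /=.
  by apply: eq_bigr => j _; rewrite !mxE rev_ordK.
have e2 : (v' *m P *m H *m Q') 0 i = (v' *m P *m H *m invmx P) 0 (rev_ord i).
  by rewrite !mxE; apply: eq_bigr => k _; rewrite !mxE.
rewrite eQ e1 mulmxN mulNmx mxE e2 HP mxE rev_ordK.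
by rewrite mulNr.
Qed.

(** The flow of a gradient field between nearby points of a trajectory is a
    diffeomorphism preserving the stable set, so it transports slice charts
    backward. *)
Lemma slice_step G g psi p c (t0 : R) s : smooth_fun g -> 
  (forall t, 0 <= t -> grad_eq_at G g c t) -> 0 <= t0 -> flat G psi -> cdom psi (c t0) ->
  exists2 a : R, 0 < a & forall u u', 0 <= u -> u <= u' -> `|u - t0| < a -> `|u' - t0| < a ->
    (exists chi, cdom chi (c u') /\ slice_chart (Ws G g p) s chi) ->
    (exists chi, cdom chi (c u) /\ slice_chart (Ws G g p) s chi).
Proof.
move=> sg H t00 fl d0; have sp := fl.1; set z0 := cmap psi (c t0).
have oI := @cimg_open _ _ _ psi; have Iz : cimg psi z0 by exact: cimg_cmap.
have sY := gfield_smooth sg sp.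
have [tau [r [r1 [phi [[tau0 r0 rr1] [subI phi0 Hphi sphi [phiD uniq_]]]]]]] := local_flow oI Iz sY.
have ballI z : `|z - z0| < r1 -> cimg psi z by exact: subI.
have near_ : \forall u \near t0, cdom psi (c u) /\ `|cmap psi (c u) - z0| < r.
  have cc := grad_eq_continuous (H t0 t00).
  have o : open [set y | cdom psi y /\ `|cmap psi y - z0| < r] by exact: chart_ball_open.
  apply: (cc [set y | cdom psi y /\ `|cmap psi y - z0| < r]); apply: open_nbhs_nbhs.
  by split=> //; split=> //; rewrite /z0 subrr normr0.
move: near_ => /nbhs_ballP[a1 a10 Ha1]; have {}a10 : 0 < a1 by exact: a10.
pose a := Num.min a1 (tau / 2).
have aa1 : a <= a1 by rewrite /a ge_min lexx.
have at_ : a <= tau / 2 by rewrite /a ge_min lexx orbT.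
exists a; first by rewrite lt_min a10 divr_gt0.
move=> u u' u0 uu' ua u'a [chi [dchi [sc sm sl]]].
have inb v : u <= v <= u' -> cdom psi (c v) /\ `|cmap psi (c v) - z0| < r.
  move=> /andP[h1 h2]; apply: Ha1; rewrite -ball_normE /= distrC.
  move: ua u'a; rewrite !ltr_norml => /andP[h3 h4] /andP[h5 h6].
  by apply/andP; split; lra.
(* The time-b map of the local flow carries the slice chart at c u' back to c u. *)
pose b := u' - u; have b0 : 0 <= b by rewrite subr_ge0.
have bt : `|b| <= tau.
  by rewrite ger0_norm //; move: ua u'a; rewrite !ltr_norml /b => /andP[h3 h4] /andP[h5 h6]; lra.
have bt' : `|- b| <= tau by rewrite normrN.
have [|du nu] := inb u; first by rewrite lexx.
have [|du' nu'] := inb u'; first by rewrite uu' lexx.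
(* Trajectories starting in the ball follow the local flow. *)
have follow w : cdom psi (w 0) -> `|cmap psi (w 0) - z0| < r ->
    (forall t, 0 <= t <= b -> grad_eq_at G g w t) ->
    cdom psi (w b) /\ cmap psi (w b) = phi b (cmap psi (w 0)).
  move=> dw nw Hw; set zw := cmap psi (w 0) in nw *.
  pose B := [set y | cdom psi y /\ `|cmap psi y - z0| < r1].
  have oB : open B by exact: chart_ball_open.
  have B0 : B (w 0) by split=> //; exact: lt_trans rr1.
  have cw v : 0 <= v <= b -> {for v, continuous w}.
    by move=> hv; exact: grad_eq_continuous (Hw v hv).
  have flw v : 0 <= v <= b -> (forall v', 0 <= v' <= v -> B (w v')) ->
      cmap psi (w v) = phi v zw.
    move=> /andP[v0 vb] HB.
    apply: (uniq_ (fun v => cmap psi (w v)) v v0 _ v); last by rewrite v0 lexx.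
    move=> v' hv'; have [dv' nv'] := HB v' hv'; split=> //.
    move: hv' => /andP[v'0 v'v].
    have hv' : 0 <= v' <= b by rewrite v'0 (le_trans v'v).
    by have [_] := (grad_eq_flat sg fl dv').1 (Hw v' hv').
  have allB v : 0 <= v <= b -> B (w v).
    move=> /andP[v0 vb]; apply: contrapT => nB.
    have cw' t : 0 <= t <= v -> {for t, continuous w}.
      by move=> /andP[h1 h2]; apply: cw; rewrite h1 (le_trans h2).
    have [s1 /andP[s10 s1v] [nBs HB]] := first_exit oB cw' B0 v0 nB.
    have s1b : s1 <= b by exact: le_trans vb.
    have s1t : `|s1| <= tau by rewrite gtr0_norm //; apply: le_trans bt; rewrite ger0_norm.
    have [n1 D1] := Hphi zw s1 s1t nw.
    apply: nBs; have -> : w s1 = cinv psi (phi s1 zw).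
      apply: (@left_limit_eq _ _ _ w (fun v => cinv psi (phi v zw)) s1 s10).
      - by apply: cw; rewrite s1b ltW.
      - apply: cinv_curve_continuous; first exact: is_derive_continuous D1.
        exact: ballI.
      - move=> v' hv'; have [h1 h2] := HB v' hv'; move: hv' => /andP[v'0 v's].
        have <- : cmap psi (w v') = phi v' zw.
          apply: flw; first by rewrite v'0 (le_trans (ltW v's)).
          by move=> v2 /andP[h3 h4]; apply: HB; rewrite h3 (le_lt_trans h4).
        by rewrite cmapK.
    by split; [apply: cimg_cdom; exact: ballI|rewrite cinvK //; exact: ballI].
  have bb : 0 <= b <= b by rewrite b0 lexx.
  split; first by case: (allB b bb).
  apply: flw => // v hv; exact: allB.
have Wiff y : cdom psi y -> `|cmap psi y - z0| < r ->
    (Ws G g p y <-> Ws G g p (cinv psi (phi b (cmap psi y)))).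
  move=> dy ny; split.
    move=> [w [w0 wH wl]]; have [] := follow w.
    - by rewrite w0.
    - by rewrite w0.
    - by move=> t /andP[t0' _]; exact: wH.
    rewrite w0 => dwb <-; rewrite cmapK //; exact: Ws_forward.
  pose q v := cinv psi (phi v (cmap psi y)).
  have -> : y = q 0 by rewrite /q phi0 cmapK.
  have -> : cinv psi (phi b (cmap psi (q 0))) = q b by rewrite /q phi0 cmapK.
  apply: Ws_backward => // v /andP[v0 vb].
  have vt : `|v| <= tau by rewrite ger0_norm //; apply: le_trans bt; rewrite ger0_norm.
  have [n1 D1] := Hphi (cmap psi y) v vt ny.
  by apply: (grad_eq_cinv (z := phi ^~ (cmap psi y)) sg fl) => //; exact: ballI.
have fu : phi b (cmap psi (c u)) = cmap psi (c u').
  have [] := follow (fun v => c (v + u)).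
  - by rewrite add0r.
  - by rewrite add0r.
  - by move=> t /andP[t1 _]; apply: grad_eq_shift; apply: H; rewrite addr_ge0.
  by rewrite add0r /b subrK => _ ->.
have rI z : `|z - z0| < r -> cimg psi z by move=> h; apply: ballI; exact: lt_trans rr1.
pose ball0 := [set z : 'rV[R]_m | `|z - z0| < r].
have ob0 : open ball0 by exact: oball_open.
pose th w := cmap psi (cinv chi w).
have sth : smooth_on (overlap chi psi) th by exact: smooth_charts_compatible.
have oov := @overlap_open _ _ _ psi chi; have oov' := @overlap_open _ _ _ chi psi.
pose V := [set z | ball0 z /\ (ball0 `&` overlap psi chi) (phi b z)].
pose V1 := [set w | overlap chi psi w /\ ball0 (th w)].
pose V' := [set w | V1 w /\ ball0 (phi (- b) (th w))].
have oV : open V.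
  apply: (open_preimage_Ck ob0 (sphi b bt 0%N)); exact: openI.
have oV1 : open V1 by exact: (open_preimage_Ck oov' (sth 0%N) ob0).
have sB k : Ck k V1 (fun w => phi (- b) (th w)).
  apply: (@Ck_compf _ _ _ _ _ _ _ ball0) => //.
  - by apply: Ck_sub (sth k) => w [].
  - by move=> w [].
  - exact: sphi.
have oV' : open V' by exact: (open_preimage_Ck oV1 (sB 0%N) ob0).
have inv1 z : phi (- b) (phi b z) = z by rewrite -phiD addNr phi0.
have inv2 z : phi b (phi (- b) z) = z by rewrite -phiD subrr phi0.
have [xi [sx dxi mxi]] : exists xi : chart R m M, [/\ smooth_chart xi,
    forall y, cdom xi y <-> cdom psi y /\ V (cmap psi y) &
    forall y, cmap xi y = cmap chi (cinv psi (phi b (cmap psi y)))].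
  apply: (@chart_change _ _ _ psi V V' (fun z => cmap chi (cinv psi (phi b z)))
     (fun w => phi (- b) (th w)) sp oV _ oV').
  - by move=> z [/rI].
  - move=> k; apply: (@Ck_compf _ _ _ _ _ _ _ (overlap psi chi) _ (cmap chi \o cinv psi)) => //.
    + by apply: Ck_sub (sphi b bt k) => z [].
    + by move=> z [_ []].
    + exact: smooth_charts_compatible.
  - by move=> k; apply: Ck_sub (sB k) => w [].
  - move=> z [bz [bz' /overlapE[i d]]].
    have e : th (cmap chi (cinv psi (phi b z))) = phi b z by rewrite /th cmapK // cinvK.
    rewrite e inv1; split=> //; split; last by rewrite e inv1.
    split; last by rewrite e.
    apply/overlapE; rewrite cmapK //; split; [exact: cimg_cmap|exact: cimg_cdom].
  - move=> w [[/overlapE[i d] b1] b2]; rewrite inv2.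
    have e : cinv psi (th w) = cinv chi w by rewrite /th cmapK.
    split; last by rewrite e cinvK.
    split=> //; rewrite inv2; split=> //; apply/overlapE; split; first exact: rI.
    by rewrite e; exact: cimg_cdom.
exists xi; split.
  apply/dxi; split=> //; split=> //; rewrite fu; split=> //.
  by exists (c u').
split=> // y /dxi[dy [ny [_ /overlapE[i d]]]].
by rewrite mxi -sl //; exact: Wiff.
Qed.

(** The trajectory eventually enters the domain of the slice chart at p; from there
    slice charts are transported backward in time. *)
Lemma Ws_slice G g p c s : smooth_fun g -> (forall t, 0 <= t -> grad_eq_at G g c t) ->
  c t @[t --> +oo] --> p ->
  (forall t, 0 <= t -> exists2 psi, flat G psi & cdom psi (c t)) ->
  (exists chi, cdom chi p /\ slice_chart (Ws G g p) s chi) ->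
  exists chi, cdom chi (c 0) /\ slice_chart (Ws G g p) s chi.
Proof.
move=> sg H cl fl [chi [dp sl]].
apply: (backward_induction (P := fun t => exists chi, cdom chi (c t) /\ slice_chart (Ws G g p) s chi)).
  have [r [_ Hr]] : \forall t \near +oo, cdom chi (c t) by apply: cl; exact: cdom_near.
  exists (Num.max 0 (r + 1)); first by rewrite le_max lexx.
  by exists chi; split=> //; apply: Hr; rewrite lt_max ltrDl ltr01 orbT.
move=> t0 t00; have [psi f0 d0] := fl t0 t00.
by have [a a0 K] := slice_step p s sg H t00 f0 d0; exists a.
Qed.

Lemma unitmx_opp n (H : 'M[R]_n) : H \in unitmx -> - H \in unitmx.
Proof. by move=> Hu; rewrite -scaleN1r unitmxZ // unitrN1. Qed.

Lemma hess_opp g p : smooth_fun g -> hess (fun x => - g x) p = - hess g p.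
Proof.
move=> sg; have sa := chart_at_smooth p; have da := chart_at_dom p.
set a := chart_at p in sa da.
have oI := @cimg_open _ _ _ a.
have sF := smooth_fun_chart sg sa.
apply/matrixP => i j; rewrite mxE [RHS]mxE [in RHS]mxE.
have D z : cimg a z -> 'D_(delta_mx 0 j) ((fun x => - g x) \o cinv a) z =
    - 'D_(delta_mx 0 j) (g \o cinv a) z.
  move=> iz; have dF : differentiable (g \o cinv a) z by exact: smooth_on_differentiable sF iz.
  by rewrite -(deriveN (f := g \o cinv a)) //; exact: diff_derivable.
have Ia : cimg a (cmap a p) by exact: cimg_cmap.
have dD : differentiable ('D_(delta_mx 0 j) (g \o cinv a)) (cmap a p).
  exact: (smooth_on_differentiable (smooth_on_derive _ sF)).
transitivity ('D_(delta_mx 0 i) (fun z => - 'D_(delta_mx 0 j) (g \o cinv a) z) (cmap a p)).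
  apply: near_eq_derive; apply: filterS (cimg_near Ia) => z iz; exact: D.
by rewrite (deriveN (f := 'D_(delta_mx 0 j) (g \o cinv a))) //; exact: diff_derivable.
Qed.

(** The stable set of -g is the unstable set of g, so at a nondegenerate critical
    point the dimensions of both add up to the dimension of the manifold. *)
Lemma stable_dimension G g phi p k : metric_pos G -> smooth_fun g -> flat G phi ->
  cdom phi p -> hess g p \in unitmx -> index_is G g p k ->
  exists s, (s + k = m)%N /\ exists chi, cdom chi p /\ slice_chart (Ws G g p) s chi.
Proof.
move=> Gp sg fl dp Hu [cp ik]; have sp := fl.1.
have oI := @cimg_open _ _ _ phi; have Iz : cimg phi (cmap phi p) by exact: cimg_cmap.
have sF := smooth_fun_chart sg sp.
have Fu := chart_frame_unit sp dp.
have hu : hessm (g \o cinv phi) (cmap phi p) \in unitmx.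
  by rewrite (hess_chart sg sp dp cp) !unitmx_mul unitmx_tr Fu Hu.
have [P [mu [s HP]]] := symmetric_diagonalizable_sorted (hessm_sym oI Iz sF) hu.
have [P' [mu' HP']] := sorted_diagonal_opp HP.
pose g' x := - g x.
have sg' : smooth_fun g' by exact: smooth_funN.
have cp' : crit g' p by rewrite /crit /= /g' dfunN // (_ : dfun g p = 0) ?oppr0.
have Hu' : hess g' p \in unitmx by rewrite (hess_opp p sg); exact: unitmx_opp.
have eH : hessm (g' \o cinv phi) (cmap phi p) = - hessm (g \o cinv phi) (cmap phi p).
  by rewrite (hess_chart sg' sp dp cp') (hess_chart sg sp dp cp) /g' hess_opp // mulmxN mulNmx.
rewrite -eH in HP'.
have [chi [dchi sl]] := stable_slice_at Gp sg fl dp cp Hu HP.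
have [chi' [dchi' sl']] := stable_slice_at Gp sg' fl dp cp' Hu' HP'.
rewrite Wu_opp // in sl'.
have Wp : Wu G g p p by rewrite -Wu_opp //; exact: Ws_self.
have [ps [dps slk]] := ik p Wp.
have e := frame_dim (slice_frame slk Wp dps) (slice_frame sl' Wp dchi').
exists s; split; last by exists chi.
by rewrite e subnKC //; case: HP.
Qed.

End StableSubmanifold.

(** * Geometry of a tubular neighbourhood *)

Lemma chart_frame_same (R : realType) (m : nat) (M : manifold R m) (chi phi : chart R m M) y :
  smooth_chart chi -> smooth_chart phi -> cmap chi = cmap phi -> cdom chi y -> cdom phi y ->
  chart_frame chi y = chart_frame phi y.
Proof.
move=> sc sp e dc dp; rewrite (chart_frame_comp sc sp dc dp).
by rewrite /transition -e -/(transition chi chi y) transition_id // mul1mx.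
Qed.

Section SmoothMaps.
Context {R : realType} {d m : nat} {C : manifold R d} {M : manifold R m}.

Definition map_domain (U : set C) (F : C -> M) (phi : chart R d C) (psi : chart R m M) :=
  cmap phi @` (U `&` cdom phi `&` F @^-1` cdom psi).

Lemma map_domainE U F phi psi z : map_domain U F phi psi z <->
  [/\ cimg phi z, U (cinv phi z) & cdom psi (F (cinv phi z))].
Proof.
split; first by case=> x [[Ux dx] dF] <-; rewrite cmapK //; split=> //; exact: cimg_cmap.
case=> iz Uz dz; exists (cinv phi z); last exact: cinvK.
by split=> //; split=> //; exact: cimg_cdom.
Qed.

Lemma map_domain_open (U : set C) (F : C -> M) phi psi : open U ->
  (forall x, U x -> {for x, continuous F}) -> open (map_domain U F phi psi).
Proof.
move=> oU cF.
have o : open [set x | U x /\ cdom psi (F x)].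
  by apply: open_preimage_on => //; exact: cdom_open.
rewrite (_ : map_domain U F phi psi =
    [set z | cimg phi z /\ [set x | U x /\ cdom psi (F x)] (cinv phi z)]).
  exact: preimage_cinv_open.
apply/seteqP; split=> z; first by case/map_domainE.
by case=> iz [Uz dz]; apply/map_domainE.
Qed.

(** Smoothness of a map is required in the charts of the atlas and follows in all
    smooth charts, near each point by way of the preferred ones. *)
Lemma smooth_map_chart (U : set C) (F : C -> M) phi psi : open U -> smooth_map_on U F ->
  smooth_chart phi -> smooth_chart psi ->
  smooth_on (map_domain U F phi psi) (cmap psi \o F \o cinv phi).
Proof.
move=> oU [cF sF] sp sq k; apply: Ck_locally => _ [x [[Ux dx] dF] <-].
have ha := @chart_at_atlas _ _ _ x; set a := chart_at x in ha.
have da : cdom a x by exact: chart_at_dom.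
have sa : smooth_chart a by exact: chart_at_smooth.
have hb := @chart_at_atlas _ _ _ (F x); set b := chart_at (F x) in hb.
have db : cdom b (F x) by exact: chart_at_dom.
have sb : smooth_chart b by exact: chart_at_smooth.
have o1 : open (map_domain U F a b) by exact: map_domain_open.
have o2 : open (map_domain U F phi psi) by exact: map_domain_open.
have o3 : open (map_domain U F phi b) by exact: map_domain_open.
have o4 := @overlap_open _ _ _ phi a.
pose U' := overlap phi a `&` map_domain U F phi b `&` map_domain U F phi psi.
have oU' : open U' by apply: openI => //; exact: openI.
exists U'; split=> //.
  by split; [split|]; exists x.
apply: (@Ck_ext _ _ _ _ _
  ((cmap psi \o cinv b) \o ((cmap b \o F \o cinv a) \o (cmap a \o cinv phi)))) => //.
  move=> z [[/overlapE[i1 d1] /map_domainE[_ _ d2]] _] /=.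
  by rewrite (cmapK d1) cmapK.
apply: (@Ck_comp _ _ _ _ _ _ _ (overlap b psi)) => //.
- exact: overlap_open.
- apply: (@Ck_comp _ _ _ _ _ _ _ (map_domain U F a b)) => //.
  + by apply: (@Ck_sub _ _ _ _ (overlap phi a)); [move=> z [[]]|exact: smooth_charts_compatible].
  + move=> z [[/overlapE[i1 d1] /map_domainE[_ u2 d2]] _] /=.
    by apply/map_domainE; rewrite /= cmapK //; split=> //; exact: cimg_cmap.
  + exact: sF.
- move=> z [[/overlapE[i1 d1] /map_domainE[_ u2 d2]] /map_domainE[_ _ d3]] /=.
  by rewrite (cmapK d1); exists (F (cinv phi z)).
- exact: smooth_charts_compatible.
Qed.

End SmoothMaps.

Section Blocks.
Context {R : realType} {m : nat}.
Implicit Types (z v : 'rV[R]_m).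

Lemma blockD a b z v : block a b (z + v) = block a b z + block a b v.
Proof. by apply/rowP => i; rewrite !mxE; case: ifP; rewrite ?addr0. Qed.

Lemma blockZ a b (k : R) z : block a b (k *: z) = k *: block a b z.
Proof. by apply/rowP => i; rewrite !mxE; case: ifP; rewrite ?mulr0. Qed.

Lemma block0 a b : block a b (0 : 'rV[R]_m) = 0.
Proof. by apply/rowP => i; rewrite !mxE; case: ifP. Qed.

Definition bdot a b z v : R := \sum_i block a b z 0 i * block a b v 0 i.

Lemma derive_sqnorm_block a b z v :
  differentiable (fun y : 'rV[R]_m => sqnorm (block a b y)) z /\
  'D_v (fun y : 'rV[R]_m => sqnorm (block a b y)) z = 2 * bdot a b z v.
Proof.
have df : differentiable (fun y : 'rV[R]_m => sqnorm (block a b y)) z.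
  suff s : Ck 1 setT (fun y : 'rV[R]_m => sqnorm (block a b y)).
    exact: (Ck_differentiable s).
  apply: (@Ck_ext _ _ _ _ _ (fun y : 'rV[R]_m => \sum_i block a b y 0 i * block a b y 0 i)).
  - exact: openT.
  - by move=> y _; apply: eq_bigr => i _; rewrite expr2.
  apply: Ck_sum => [|i]; first exact: openT.
  have s : Ck 1 setT (fun y : 'rV[R]_m => block a b y 0 i).
    case E : (a <= i < b)%N.
      apply: (@Ck_ext _ _ _ _ _ (fun y : 'rV[R]_m => y 0 i)); first exact: openT.
        by move=> y _; rewrite mxE E.
      by apply: Ck_entry; [exact: openT|exact: Ck_id].
    apply: (@Ck_ext _ _ _ _ _ (fun _ => 0)); first exact: openT.
      by move=> y _; rewrite mxE E.
    exact: Ck_cst.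
  by apply: Ck_mul => //; exact: openT.
split=> //.
apply: (derive_of_quadratic (C := `|sqnorm (block a b v)|) (r := 1) df ltr01) => h _.
have -> : sqnorm (block a b (z + h *: v)) - sqnorm (block a b z) - h *: (2 * bdot a b z v) =
   sqnorm (block a b v) * h ^+ 2.
  rewrite /sqnorm /bdot /GRing.scale /= blockD blockZ mulr_sumr mulr_sumr mulr_suml -!sumrB.
  apply: eq_bigr => i _; rewrite [in LHS]mxE [X in (_ + X) ^+ 2]mxE; ring.
by rewrite normrM (ger0_norm (sqr_ge0 h)).
Qed.

Lemma bdot_row a b z v : bdot a b z v = (v *m (block a b z)^T) 0 0.
Proof.
rewrite /bdot mxE; apply: eq_bigr => i _; rewrite !mxE.
by case: ifP; rewrite ?mul0r ?mulr0 // mulrC.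
Qed.

End Blocks.

Section TubeCharts.
Context {R : realType} {m d : nat} {M : manifold R m} {C : manifold R d}.
Variables (f : M -> R) (iota : C -> M) (lam : nat).
Variables (A : set (chart R m M)) (pi : M -> C) (T : set M).
Hypotheses (emb : embedding iota) (tb : tube f iota lam A pi T).
Variables (G : M -> 'M[R]_m).
Hypothesis iso : forall phi y, A phi -> T y -> cdom phi y -> chart_metric G phi y = 1%:M.
Hypothesis dm : (d <= m)%N.

Notation upart := (@upart R m d).
Notation vpart := (@vpart R m d lam).
Notation wpart := (@wpart R m d lam).

(** The properties of the foot point and of the metric are only known inside the
    tube; restricting the charts of A to it gives them on the whole domain. *)
Definition adapted (chi : chart R m M) := exists2 phi, A phi &
  [/\ smooth_chart chi, forall y, cdom chi y <-> cdom phi y /\ T y & cmap chi = cmap phi].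

Lemma adapted_exists phi y : A phi -> T y -> cdom phi y ->
  exists chi, [/\ adapted chi, cdom chi y & chart_frame chi y = chart_frame phi y].
Proof.
move=> Ap Ty dy; have [sp _ _] := tube_charts tb Ap.
pose V := [set z | cimg phi z /\ T (cinv phi z)].
have oV : open V by apply: preimage_cinv_open; exact: (tube_open tb).
have [|||||chi [sc dchi mchi]] := @chart_change _ _ _ phi V V id id sp oV _ oV.
- by move=> z [].
- by move=> k; exact: Ck_id.
- by move=> k; exact: Ck_id.
- by [].
- by [].
have E y' : cdom chi y' <-> cdom phi y' /\ T y'.
  rewrite dchi; split; first by case=> dy' [_]; rewrite cmapK.
  by case=> dy' Ty'; split=> //; split; rewrite ?cmapK //; exact: cimg_cmap.
have dc : cdom chi y by apply/E.
have mc : cmap chi = cmap phi by apply/funext => y'; exact: mchi.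
exists chi; split; [by exists phi|exact: dc|exact: (chart_frame_same sc sp mc dc dy)].
Qed.

Lemma adapted_at y : T y -> exists2 chi, adapted chi & cdom chi y.
Proof.
move=> Ty; have [phi Ap dy] := tube_cover tb Ty.
by have [chi [h1 h2 _]] := adapted_exists Ap Ty dy; exists chi.
Qed.

Variable chi : chart R m M.
Hypothesis ad : adapted chi.

Lemma adapted_smooth : smooth_chart chi.
Proof. by case: ad => phi _ []. Qed.

Lemma adapted_tube y : cdom chi y -> T y.
Proof. by case: ad => phi _ [_ h _] /h[]. Qed.

Lemma adapted_flat : flat G chi.
Proof.
case: (ad) => phi Ap [sc dc mc]; split=> // y dy.
have [dp Ty] := (dc y).1 dy; have [sp _ _] := tube_charts tb Ap.
rewrite -(iso Ap Ty dp) /chart_metric.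
by rewrite (chart_frame_same sc sp mc dy dp).
Qed.

Lemma adapted_core y : cdom chi y -> range iota y <-> vpart (cmap chi y) = 0 /\ wpart (cmap chi y) = 0.
Proof.
case: ad => phi Ap [_ dc ->] /dc[dp _]; have [_ h _] := tube_charts tb Ap; exact: h.
Qed.

Lemma adapted_fun y x : cdom chi y ->
  f y = f (iota x) - sqnorm (vpart (cmap chi y)) + sqnorm (wpart (cmap chi y)).
Proof.
case: ad => phi Ap [_ dc ->] /dc[dp _]; have [_ _ h] := tube_charts tb Ap; exact: h.
Qed.

Lemma adapted_foot y : cdom chi y ->
  cdom chi (iota (pi y)) /\ cmap chi (iota (pi y)) = upart (cmap chi y).
Proof.
case: ad => phi Ap [_ dc ->] /dc[dp Ty]; have [h1 h2] := tube_foot tb Ap Ty dp.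
by split=> //; apply/dc; split=> //; apply: (tube_core tb); exists (pi y).
Qed.

(** The inclusion of the u-coordinates; [res] is the projection onto them. *)
Definition Emx : 'M[R]_(d, m) := pid_mx d.
Definition ext (u : 'rV[R]_d) : 'rV[R]_m := u *m Emx.
Definition res (z : 'rV[R]_m) : 'rV[R]_d := z *m (pid_mx d : 'M[R]_(m, d)).

Lemma extK u : res (ext u) = u.
Proof.
by rewrite /res /ext -mulmxA mul_pid_mx minnn (minn_idPr dm) pid_mx_1 mulmx1.
Qed.

Lemma Emx_trK : Emx *m Emx^T = 1%:M.
Proof. by rewrite /Emx tr_pid_mx mul_pid_mx minnn (minn_idPr dm) pid_mx_1. Qed.

Lemma resK z : ext (res z) = upart z.
Proof.
rewrite /res /ext -mulmxA mul_pid_mx !minnn; apply/rowP => i.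
rewrite mxE (bigD1 i) //= big1 => [|j ji]; first by rewrite !mxE eqxx /=; case: ifP; rewrite ?mulr1 ?mulr0 addr0.
by rewrite mxE val_eqE (negbTE ji) mulr0.
Qed.

Lemma parts_sum z : (d + lam <= m)%N -> z = upart z + (vpart z + wpart z).
Proof.
move=> dl; apply/rowP => i; rewrite !mxE /=.
case: (ltnP i d) => h1; first by rewrite (ltn_addr _ h1) ltnNge leqNgt (ltn_addr _ h1) /= !addr0.
rewrite add0r; case: (ltnP i (d + lam)) => h2 /=; first by rewrite ?add0r ?addr0.
by rewrite ltn_ord ?add0r.
Qed.

Lemma vpart_ext u : vpart (ext u) = 0.
Proof.
apply/rowP => i; rewrite mxE [RHS]mxE; case: ifP => // /andP[h _].
exact: pid_mx_vanish.
Qed.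

Lemma wpart_ext u : wpart (ext u) = 0.
Proof.
apply/rowP => i; rewrite mxE [RHS]mxE; case: ifP => // /andP[h _].
by apply: pid_mx_vanish; apply: leq_trans h; exact: leq_addr.
Qed.

Lemma upart_core z : vpart z = 0 -> wpart z = 0 -> upart z = z.
Proof.
move=> /rowP v0 /rowP w0; apply/rowP => i; rewrite mxE /=.
case: ifP => // /negbT; rewrite -leqNgt => h.
have := v0 i; rewrite !mxE h /=; have := w0 i; rewrite !mxE ltn_ord andbT.
by case: (ltnP i (d + lam)) => _.
Qed.

Lemma ext_differentiable u : differentiable ext u.
Proof.
have s : Ck 1 setT ext by apply: Ck_mulmxr; [exact: openT|exact: Ck_id].
exact: (Ck_differentiable s).
Qed.

Lemma ext_jacobian u : 'J ext u = Emx.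
Proof.
apply: rV_mul_eq => v; rewrite mul_jacobian; last exact: ext_differentiable.
have := is_derive_mulmxr Emx (is_derive_line u v 0) => D.
have [h1 h2] := is_derive_along_line (v := v) (x := u) (t := 0) (ext_differentiable (u + 0 *: v)).
rewrite scale0r addr0 in h2; rewrite -h2.
by rewrite (@derive_val _ _ _ _ _ _ _ D).
Qed.

Lemma core_dom x : cdom chi (iota x) -> ext (res (cmap chi (iota x))) = cmap chi (iota x).
Proof.
move=> dx; rewrite resK; have [v0 w0] := (adapted_core dx).1 (ex_intro2 _ _ x I erefl).
exact: upart_core.
Qed.

Lemma cinv_ext_core u : cimg chi (ext u) -> exists2 x, cdom chi (iota x) & cinv chi (ext u) = iota x.
Proof.
move=> i; have dy := cimg_cdom i.
have : range iota (cinv chi (ext u)).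
  by apply/(adapted_core dy); rewrite cinvK // vpart_ext wpart_ext.
by case=> x _ e; exists x => //; rewrite e.
Qed.

Lemma iota_continuous : continuous iota.
Proof. by case: emb => [[h _] _ _ _] x; exact: h. Qed.

Lemma pi_continuous y : T y -> {for y, continuous pi}.
Proof. by case: (tube_smooth tb) => h _; exact: h. Qed.

Lemma core_chart_exists : exists phiC : chart R d C,
  [/\ smooth_chart phiC, forall x, cdom phiC x <-> cdom chi (iota x),
      forall x, cmap phiC x = res (cmap chi (iota x)) &
      forall u, cinv phiC u = pi (cinv chi (ext u))].
Proof.
pose D := iota @^-1` cdom chi.
have sc := adapted_smooth.
have oD : open D.
  by apply: open_comp; [move=> x _; exact: iota_continuous|exact: cdom_open].
have eI : (fun x => res (cmap chi (iota x))) @` D = [set u | cimg chi (ext u)].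
  apply/seteqP; split=> u.
    by case=> x dx <- /=; rewrite core_dom //; exact: cimg_cmap.
  move=> i; have [x dx e] := cinv_ext_core i; exists x => //.
  by rewrite -e cinvK // extK.
have cext : continuous ext.
  by move=> u; apply: differentiable_continuous; exact: ext_differentiable.
have oI : open ((fun x => res (cmap chi (iota x))) @` D).
  by rewrite eI; apply: open_comp => [u _|]; [exact: cext|exact: cimg_open].
have K x : D x -> pi (cinv chi (ext (res (cmap chi (iota x))))) = x.
  by move=> dx; rewrite core_dom // cmapK // (tube_retract tb).
have cres : continuous res.
  move=> z; have s : Ck 0 setT res by apply: Ck_mulmxr; [exact: openT|exact: Ck_id].
  exact: (Ck_continuous s).
have c1 x : D x -> {for x, continuous (fun x => res (cmap chi (iota x)))}.
  move=> dx; apply: (@continuous_comp _ _ _ (fun x => cmap chi (iota x)) res).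
    apply: (@continuous_comp _ _ _ iota (cmap chi)); first exact: iota_continuous.
    exact: cmap_continuous.
  exact: cres.
have c2 u : ((fun x => res (cmap chi (iota x))) @` D) u ->
    {for u, continuous (fun u => pi (cinv chi (ext u)))}.
  rewrite eI => i; apply: (@continuous_comp _ _ _ (fun u => cinv chi (ext u)) pi).
    apply: (@continuous_comp _ _ _ ext (cinv chi)); first exact: cext.
    exact: cinv_continuous.
  by apply: pi_continuous; apply: adapted_tube; exact: cimg_cdom.
pose phiC := Chart oD oI K c1 c2.
exists phiC; split=> // psi ha; have sq := atlas_smooth_chart ha.
have oT := tube_open tb; have [is_ _ _ _] := emb.
split=> k.
- have o := @overlap_open _ _ _ phiC psi.
  have od : open (map_domain T pi chi psi).
    apply: map_domain_open => //; exact: pi_continuous.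
  apply: (@Ck_ext _ _ _ _ _ ((cmap psi \o pi \o cinv chi) \o ext)) => //.
  apply: (@Ck_comp _ _ _ _ _ _ _ (map_domain T pi chi psi)) => //.
  + by apply: Ck_mulmxr => //; exact: Ck_id.
  + move=> u /overlapE[i dp]; have {}i : [set u | cimg chi (ext u)] u by rewrite -eI; exact: i.
    by apply/map_domainE; split=> //; apply: adapted_tube; exact: cimg_cdom.
  + exact: (smooth_map_chart oT (tube_smooth tb)).
- have o := @overlap_open _ _ _ psi phiC.
  apply: (@Ck_ext _ _ _ _ _ (fun u => (cmap chi \o iota \o cinv psi) u *m (pid_mx d : 'M_(m, d)))) => //.
  apply: Ck_mulmxr => //.
  apply: Ck_sub (smooth_map_chart openT is_ sq sc k) => u /overlapE[i dp].
  by apply/map_domainE.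
Qed.

End TubeCharts.

Section Dot.
Context {R : realType} {n : nat}.
Implicit Types (v X Y : 'rV[R]_n).

Lemma dotD v X Y : (v *m (X + Y)^T) 0 0 = (v *m X^T) 0 0 + (v *m Y^T) 0 0.
Proof. by rewrite raddfD /= mulmxDr mxE. Qed.

Lemma dotZ v (k : R) X : (v *m (k *: X)^T) 0 0 = k * (v *m X^T) 0 0.
Proof. by rewrite linearZ /= -scalemxAr mxE. Qed.

Lemma dotB v X Y : (v *m (X - Y)^T) 0 0 = (v *m X^T) 0 0 - (v *m Y^T) 0 0.
Proof. by rewrite dotD -scaleN1r dotZ mulN1r. Qed.

End Dot.

Section CoreFlow.
Context {R : realType} {m d : nat} {M : manifold R m} {C : manifold R d}.
Variables (f : M -> R) (iota : C -> M) (lam : nat).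
Variables (A : set (chart R m M)) (pi : M -> C) (T : set M).
Hypotheses (emb : embedding iota) (tb : tube f iota lam A pi T).
Variables (G : M -> 'M[R]_m).
Hypothesis iso : forall phi y, A phi -> T y -> cdom phi y -> chart_metric G phi y = 1%:M.
Hypothesis dm : (d <= m)%N.
Variables (fC : C -> R) (h : M -> R) (eps : R).
Hypotheses (sfC : smooth_fun fC) (sh : smooth_fun h) (eps0 : 0 < eps).
Hypothesis hE : forall y, T y -> h y = f y + eps * fC (pi y).

Notation upart := (@upart R m d).
Notation vpart := (@vpart R m d lam).
Notation wpart := (@wpart R m d lam).
Notation adapted := (adapted A T).
Notation Emx := (@Emx R m d).
Notation ext := (@ext R m d).
Notation res := (@res R m d).
Notation Gc := (pullback_metric iota G).

Definition core_chart chi (phiC : chart R d C) :=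
  [/\ smooth_chart phiC, forall x, cdom phiC x <-> cdom chi (iota x),
      forall x, cmap phiC x = res (cmap chi (iota x)) &
      forall u, cinv phiC u = pi (cinv chi (ext u))].

Lemma core_chart_at x : exists chi phiC,
  [/\ adapted chi, core_chart chi phiC & cdom chi (iota x)].
Proof.
have Tx : T (iota x) by apply: (tube_core tb); exists x.
have [chi ad dx] := adapted_at tb Tx.
by have [phiC h1] := core_chart_exists emb tb dm ad; exists chi, phiC.
Qed.

Section OneChart.
Variables (chi : chart R m M) (phiC : chart R d C).
Hypotheses (ad : adapted chi) (cc : core_chart chi phiC).

Let sc : smooth_chart chi := adapted_smooth ad.
Let spC : smooth_chart phiC. Proof. by case: cc. Qed.
Let dC x : cdom phiC x <-> cdom chi (iota x). Proof. by case: cc. Qed.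
Let mC x : cmap phiC x = res (cmap chi (iota x)). Proof. by case: cc. Qed.

Lemma core_ext x : cdom chi (iota x) -> cmap chi (iota x) = ext (cmap phiC x).
Proof. by move=> dx; rewrite mC (core_dom tb ad dx). Qed.

Lemma core_cinv u : cimg phiC u -> cimg chi (ext u) /\ iota (cinv phiC u) = cinv chi (ext u).
Proof.
case=> x dx <-; have dx' := (dC x).1 dx.
by rewrite cmapK // -core_ext // cmapK //; split=> //; exact: cimg_cmap.
Qed.

(** The adapted chart and the chart of C it induces differ by the linear inclusion
    of the u-coordinates, so that the differential of iota is that inclusion in
    these charts. *)
Lemma core_frame x : cdom chi (iota x) ->
  chart_frame phiC x *m mdiff iota x = Emx *m chart_frame chi (iota x).
Proof.
move=> dx; have dx' := (dC x).2 dx.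
set a := chart_at (iota x); set b := chart_at x.
have sa : smooth_chart a by exact: chart_at_smooth.
have sb : smooth_chart b by exact: chart_at_smooth.
have da : cdom a (iota x) by exact: chart_at_dom.
have db : cdom b x by exact: chart_at_dom.
have [si _ _ _] := emb.
have D1 : differentiable (cmap b \o cinv phiC) (cmap phiC x) by exact: transition_differentiable.
have e1 : (cmap b \o cinv phiC) (cmap phiC x) = cmap b x by rewrite /= cmapK.
have D2 : differentiable (cmap a \o iota \o cinv b) ((cmap b \o cinv phiC) (cmap phiC x)).
  rewrite e1; apply: (smooth_on_differentiable (smooth_map_chart openT si sb sa)).
  by exists x.
have D3 := ext_differentiable (cmap phiC x) : differentiable ext (cmap phiC x).
have e3 : ext (cmap phiC x) = cmap chi (iota x) by rewrite core_ext.
have D4 : differentiable (cmap a \o cinv chi) (ext (cmap phiC x)).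
  by rewrite e3; exact: transition_differentiable.
have -> : chart_frame chi (iota x) = 'J (cmap a \o cinv chi) (ext (cmap phiC x)).
  by rewrite e3.
have -> : chart_frame phiC x *m mdiff iota x = 'J (cmap b \o cinv phiC) (cmap phiC x) *m
    'J (cmap a \o iota \o cinv b) ((cmap b \o cinv phiC) (cmap phiC x)).
  by rewrite e1.
have J2 := jacobian_comp D3 D4; rewrite ext_jacobian in J2; rewrite -J2.
rewrite -(jacobian_comp D1 D2).
apply: jacobian_ext; last exact: differentiable_comp.
near=> u => /=.
have [iu du] : cimg phiC u /\ cdom b (cinv phiC u).
  by apply/overlapE; near: u; apply: overlap_near.
by rewrite cmapK // (core_cinv iu).2.
Unshelve. all: by end_near. Qed.

Lemma core_flat : flat Gc phiC.
Proof.
split=> // x /dC dx; have [_ fl] := adapted_flat tb iso ad.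
rewrite /chart_metric /pullback_metric !mulmxA core_frame //.
rewrite -(mulmxA _ _ (chart_frame phiC x)^T) -trmx_mul core_frame // trmx_mul !mulmxA.
have := fl _ dx; rewrite /chart_metric => e.
rewrite -(mulmxA Emx) -(mulmxA Emx) e mulmx1; exact: Emx_trK.
Qed.

Lemma core_foot y : cdom chi y -> cimg phiC (res (cmap chi y)) /\
  pi y = cinv phiC (res (cmap chi y)).
Proof.
move=> dy; have [d1 e] := adapted_foot tb ad dy.
have d2 := (dC (pi y)).2 d1.
have e2 : cmap phiC (pi y) = res (cmap chi y).
  by rewrite mC e -resK (extK dm).
by rewrite -e2; split; [exact: cimg_cmap|rewrite cmapK].
Qed.

Lemma res_differentiable z : differentiable res z.
Proof.
have s : Ck 1 setT res by apply: Ck_mulmxr; [exact: openT|exact: Ck_id].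
exact: (Ck_differentiable s).
Qed.

Lemma derive_res z v : 'D_v res z = res v.
Proof.
have D := is_derive_mulmxr (pid_mx d : 'M[R]_(m, d)) (is_derive_line z v 0).
have [h1 h2] := is_derive_along_line (v := v) (x := z) (t := 0) (res_differentiable (z + 0 *: v)).
rewrite scale0r addr0 in h2; rewrite -h2.
by rewrite (@derive_val _ _ _ _ _ _ _ D).
Qed.

(** In an adapted chart h is a quadratic form in (v, w) plus a function of u, so
    that its gradient field splits accordingly. *)
Lemma field_split (al be : R) (F : M -> R) y x0 : cdom chi y ->
  (forall y', cdom chi y' -> F y' = al + sqnorm (wpart (cmap chi y')) -
     sqnorm (vpart (cmap chi y')) + be * fC (pi y')) ->
  x0 = cmap chi y ->
  - drow (F \o cinv chi) x0 =
    2 *: vpart x0 - 2 *: wpart x0 + be *: (gfield fC phiC (res x0) *m Emx).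
Proof.
move=> dy FE ex; have [iC _] := core_foot dy; rewrite -ex in iC.
have ix : cimg chi x0 by rewrite ex; exact: cimg_cmap.
rewrite -[RHS]opprK; congr (- _); apply: drow_eq => v.
pose N z := fC (cinv phiC (res z)).
transitivity ('D_v (fun z => al + sqnorm (wpart z) - sqnorm (vpart z) + be * N z) x0).
  apply: near_eq_derive; apply: filterS (cimg_near ix) => z iz /=.
  rewrite FE; last exact: cimg_cdom.
  by rewrite cinvK // (core_foot (cimg_cdom iz)).2 cinvK.
have dfC : differentiable (fC \o cinv phiC) (res x0).
  exact: smooth_on_differentiable (smooth_fun_chart sfC spC) iC.
have dN : differentiable N x0.
  by apply: (@differentiable_comp _ _ _ _ res (fC \o cinv phiC)) => //; exact: res_differentiable.
have eN : 'D_v N x0 = (res v *m (drow (fC \o cinv phiC) (res x0))^T) 0 0.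
  have e3 := @derive_chain _ _ _ _ res (fC \o cinv phiC) x0 v (res_differentiable x0) dfC.
  by rewrite derive_res (drowE _ dfC) in e3; exact: e3.
have [dw ew] := derive_sqnorm_block (d + lam) m x0 v.
have [dv ev] := derive_sqnorm_block d (d + lam) x0 v.
have isd (g : 'rV[R]_m -> R) : differentiable g x0 -> is_derive x0 v g ('D_v g x0).
  by move=> dg; apply: derivableP; exact: diff_derivable.
have D := is_deriveD (is_deriveB (is_deriveD (is_derive_cst al x0 v) (isd _ dw)) (isd _ dv))
   (is_deriveZ be (isd _ dN)).
have -> : 'D_v (fun z => al + sqnorm (wpart z) - sqnorm (vpart z) + be * N z) x0 =
    0 + 2 * bdot (d + lam) m x0 v - 2 * bdot d (d + lam) x0 v + be * 'D_v N x0.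
  by rewrite -ew -ev; exact: (@derive_val _ _ _ _ _ _ _ D).
rewrite add0r eN !bdot_row.
rewrite /gfield mulNmx scalerN opprD opprK opprB.
rewrite dotD dotB !dotZ.
rewrite /Defs.wpart /Defs.vpart; congr (_ + _ * _).
rewrite trmx_mul /res -!mulmxA [Emx^T]tr_pid_mx.
by rewrite mxE.
Qed.

Lemma field_h y : cdom chi y -> gfield h chi (cmap chi y) =
  2 *: vpart (cmap chi y) - 2 *: wpart (cmap chi y) +
    eps *: (gfield fC phiC (res (cmap chi y)) *m Emx).
Proof.
move=> dy; apply: (field_split (al := f (iota (pi y))) dy) => // y' dy'.
rewrite hE; last exact: (adapted_tube ad dy').
congr (_ + _); by rewrite (adapted_fun tb ad (pi y) dy') addrAC.
Qed.

Lemma drow_f y : cdom chi y -> - drow (f \o cinv chi) (cmap chi y) =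
  2 *: vpart (cmap chi y) - 2 *: wpart (cmap chi y).
Proof.
move=> dy; have := @field_split (f (iota (pi y))) 0 f y _ dy _ erefl.
rewrite scale0r addr0; apply => y' dy'.
by rewrite mul0r addr0 (adapted_fun tb ad (pi y) dy') addrAC.
Qed.

Lemma core_parts x : cdom chi (iota x) ->
  vpart (cmap chi (iota x)) = 0 /\ wpart (cmap chi (iota x)) = 0.
Proof. by move=> dx; apply/(adapted_core tb ad dx); exists x. Qed.

Lemma field_h_core x : cdom chi (iota x) ->
  gfield h chi (cmap chi (iota x)) = eps *: ext (gfield fC phiC (cmap phiC x)).
Proof.
move=> dx; rewrite field_h //; have [-> ->] := core_parts dx.
by rewrite !scaler0 subr0 add0r mC.
Qed.

End OneChart.

(** On C the field of h is eps times the field of fC. *)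
Lemma curve_push (ga : R -> C) (t : R) : grad_eq_at Gc fC ga (eps * t) ->
  grad_eq_at G h (fun s => iota (ga (eps * s))) t.
Proof.
move=> H; have [chi [phiC [ad cc dx]]] := core_chart_at (ga (eps * t)).
have fl := adapted_flat tb iso ad; have flC := core_flat ad cc.
have [spC dC mC _] := cc.
have dxC := (dC _).2 dx.
have [cg D] := (grad_eq_flat sfC flC dxC).1 H.
have ce : {for t, continuous (fun s : R => ga (eps * s))}.
  apply: (@continuous_comp _ _ _ (fun s => eps * s) ga) => //.
  by apply: cvgM; [exact: cvg_cst|exact: cvg_id].
have c1 : {for t, continuous (fun s : R => iota (ga (eps * s)))}.
  apply: (@continuous_comp _ _ _ (fun s => ga (eps * s)) iota) => //.
  exact: iota_continuous.
apply/(grad_eq_flat sh fl dx); split=> //.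
have := is_derive_mulmxr Emx (is_derive_comp_scale D).
rewrite -scalemxAl -/(ext _) -(field_h_core ad cc dx).
apply: near_eq_is_derive; near=> s.
have ds : cdom chi (iota (ga (eps * s))) by near: s; exact: curve_in_chart.
by rewrite (core_ext ad cc ds).
Unshelve. all: by end_near. Qed.

Lemma curve_pull (c : R -> M) (t : R) : (\forall s \near t, range iota (c s)) ->
  grad_eq_at G h c t -> grad_eq_at Gc fC (fun s => pi (c (eps^-1 * s))) (eps * t).
Proof.
move=> rc H; have [x _ ex] := nbhs_singleton rc.
have et : eps^-1 * (eps * t) = t by rewrite mulKf // gt_eqF.
have [chi [phiC [ad cc dx]]] := core_chart_at x.
have fl := adapted_flat tb iso ad; have flC := core_flat ad cc.
have [spC dC mC _] := cc.
have dct : cdom chi (c t) by rewrite -ex.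
have [ct D] := (grad_eq_flat sh fl dct).1 H.
have px : pi (c t) = x by rewrite -ex (tube_retract tb).
have dxC : cdom phiC (pi (c (eps^-1 * (eps * t)))) by rewrite et px; apply/dC.
have ce : {for (eps * t), continuous (fun s : R => c (eps^-1 * s))}.
  apply: (@continuous_comp _ _ _ (fun s => eps^-1 * s) c); last by rewrite et.
  by apply: cvgM; [exact: cvg_cst|exact: cvg_id].
apply/(grad_eq_flat sfC flC dxC); split.
  apply: (@continuous_comp _ _ _ (fun s => c (eps^-1 * s)) pi) => //.
  by rewrite et; apply: (pi_continuous tb); exact: (adapted_tube ad dct).
rewrite -{2}et in D.
have := is_derive_comp_scale (a := eps^-1) (t := eps * t) (c := fun s => cmap chi (c s)).
rewrite et => /(_ _ D) D1.
have := is_derive_mulmxr (pid_mx d : 'M[R]_(m, d)) D1.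
have -> : eps^-1 *: gfield h chi (cmap chi (c (eps^-1 * (eps * t)))) *m (pid_mx d : 'M[R]_(m, d)) =
    gfield fC phiC (cmap phiC (pi (c t))).
  rewrite et -{1}ex (field_h_core ad cc dx) scalerA mulVf ?gt_eqF // scale1r px.
  exact: extK.
have ks : (fun s : R => eps^-1 * s) @ (eps * t) --> t.
  by rewrite -[X in _ --> X]et; apply: cvgM; [exact: cvg_cst|exact: cvg_id].
apply: near_eq_is_derive; near=> s.
have : range iota (c (eps^-1 * s)) by near: s; exact: (ks _ rc).
case=> x' _ e'; rewrite -e' (tube_retract tb) mC //.
Unshelve. all: by end_near. Qed.

End CoreFlow.

(** * The Morse-Bott function decreases along the perturbed flow *)

Section Preliminaries.
Context {R : realType} {m : nat} {M : manifold R m}.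
Implicit Types (x y p : M) (g f h : M -> R) (G : M -> 'M[R]_m).

Lemma riemannian_pos G : riemannian G -> metric_pos G.
Proof. by case. Qed.

Lemma derive_at_min (V : normedModType R) (F : V -> R) z v : differentiable F z ->
  (\forall w \near z, F z <= F w) -> 'D_v F z = 0.
Proof.
have pos w : differentiable F z -> (\forall y \near z, F z <= F y) -> 0 <= 'D_w F z.
  move=> dF mn; rewrite leNgt; apply/negP => neg.
  have dF' : differentiable F (z + 0 *: w) by rewrite scale0r addr0.
  have := is_derive_along_line (v := w) dF'; rewrite scale0r addr0 => D.
  have cl : {for (0 : R), continuous (fun s : R => z + s *: w)}.
    exact: is_derive_continuous (is_derive_line z w 0).
  have mn' : \forall s \near (0 : R), F z <= F (z + s *: w).
    by apply: (cl [set y | F z <= F y]); rewrite scale0r addr0.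
  have /is_deriveP/cvgrPdist_lt := D.
  have n0 : 0 < - 'D_w F z by rewrite oppr_gt0.
  move=> /(_ _ n0) /nbhs_ballP [e e0 He]; have {}e0 : 0 < e by exact: e0.
  move: mn' => /nbhs_ballP [e' e'0 He']; have {}e'0 : 0 < e' by exact: e'0.
  pose s := Num.min e e' / 2; have mm : 0 < Num.min e e' by rewrite lt_min e0.
  have s0 : 0 < s by rewrite divr_gt0.
  have sm : s < Num.min e e' by rewrite /s ltr_pdivrMr //; lra.
  move: sm; rewrite lt_min => /andP[se se'].
  have h1 : F z <= F (z + s *: w).
    by apply: He'; rewrite -ball_normE /= sub0r normrN gtr0_norm.
  have := He s; rewrite -ball_normE /= sub0r normrN (gtr0_norm s0) se => /(_ isT).
  have sn : s != 0 by rewrite gt_eqF.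
  move=> /(_ sn); rewrite addr0 scale0r addr0 ltr_norml => /andP[+ _].
  have : 0 <= s^-1 *: (F (z + s *: w) - F z).
    by rewrite /GRing.scale /= mulr_ge0 ?invr_ge0 ?subr_ge0 // ltW.
  set q := _ *: _; lra.
move=> dF mn; apply/eqP; rewrite eq_le pos // andbT -oppr_ge0 -deriveNdir //; exact: pos.
Qed.

Lemma dfun_near g1 g2 y : (\forall x \near y, g1 x = g2 x) -> dfun g1 y = dfun g2 y.
Proof.
move=> e; have da := chart_at_dom y; set a := chart_at y in da *.
rewrite !dfun_drow; apply: drow_ext.
have ci : {for cmap a y, continuous (cinv a)} by apply: cinv_continuous; exact: cimg_cmap.
by apply: (ci [set x | g1 x = g2 x]); rewrite cmapK.
Qed.

Lemma dfun_lin (g1 g2 : M -> R) (k : R) y : smooth_fun g1 -> smooth_fun g2 ->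
  dfun (fun x => k * (g1 x - g2 x)) y = k *: (dfun g1 y - dfun g2 y).
Proof.
move=> s1 s2; rewrite !dfun_drow; set a := chart_at y.
have d1 : differentiable (g1 \o cinv a) (cmap a y).
  by apply: chart_differentiable => //; [exact: chart_at_smooth|exact: chart_at_dom].
have d2 : differentiable (g2 \o cinv a) (cmap a y).
  by apply: chart_differentiable => //; [exact: chart_at_smooth|exact: chart_at_dom].
apply: drow_eq => v; rewrite dotZ dotB -!drowE //.
have isd (g : 'rV[R]_m -> R) : differentiable g (cmap a y) ->
    is_derive (cmap a y) v g ('D_v g (cmap a y)).
  by move=> dg; apply: derivableP; exact: diff_derivable.
have D := is_deriveZ k (is_deriveB (isd _ d1) (isd _ d2)).
exact: (@derive_val _ _ _ _ _ _ _ D).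
Qed.

Lemma inner_grad G g x : metric_pos G -> inner G x (grad G g x) (grad G g x) =
  codot G x (dfun g x) (dfun g x).
Proof.
move=> Gp; rewrite /inner /codot /grad mulmxKV; last exact: metric_unit.
by rewrite trmx_mul trmx_inv Gp.1 mulmxA.
Qed.

Lemma codot_sym G x a b : metric_pos G -> codot G x a b = codot G x b a.
Proof.
move=> Gp; rewrite /codot.
have -> : (a *m invmx (G x) *m b^T) 0 0 = (a *m invmx (G x) *m b^T)^T 0 0 by rewrite [RHS]mxE.
by rewrite !trmx_mul trmxK trmx_inv Gp.1 mulmxA.
Qed.

Lemma codotDr G x a b b' : codot G x a (b + b') = codot G x a b + codot G x a b'.
Proof. exact: dotD. Qed.

Lemma codotZr G x a k b : codot G x a (k *: b) = k * codot G x a b.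
Proof. exact: dotZ. Qed.

(** If a differs from b by less than the norm of b, then a has a positive
    component along b. *)
Lemma codot_gt0_of_close G x a b : metric_pos G ->
  codot G x (a - b) (a - b) < codot G x b b -> 0 < codot G x a b.
Proof.
move=> Gp; have Z k a' b' : codot G x (k *: a') b' = k * codot G x a' b'.
  by rewrite codot_sym // codotZr codot_sym.
have D a1 a2 b' : codot G x (a1 + a2) b' = codot G x a1 b' + codot G x a2 b'.
  by rewrite codot_sym // codotDr !(codot_sym _ b').
rewrite -scaleN1r codotDr !D !codotZr !Z (codot_sym _ b a) //.
have := codot_ge0 x a Gp; lra.
Qed.

Lemma nonincreasing_limits (u : R -> R) (a b : R) : (forall s t, s <= t -> u t <= u s) ->
  u t @[t --> -oo] --> a -> u t @[t --> +oo] --> b -> forall t, b <= u t <= a.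
Proof.
move=> mono la lb t; apply/andP; split; rewrite leNgt; apply/negP => lt.
  have [r [_ Hr]] : \forall s \near +oo, u t < u s.
    exact: (lb [set x | u t < x] (lt_nbhsr lt)).
  pose s := Num.max t (r + 1).
  have rs : r < s by rewrite /s lt_max ltrDl ltr01 orbT.
  have := Hr s rs; rewrite ltNge => /negP; apply.
  by apply: mono; rewrite /s le_max lexx.
have [r [_ Hr]] : \forall s \near -oo, u s < u t.
  exact: (la [set x | x < u t] (lt_nbhsl lt)).
pose s := Num.min t (r - 1).
have rs : s < r by rewrite /s gt_min gtrBl ltr01 orbT.
have := Hr s rs; rewrite ltNge => /negP; apply.
by apply: mono; rewrite /s ge_min lexx.
Qed.

Lemma locally_constant (P : R -> Prop) :
  (forall t0, exists2 a, 0 < a & forall s, `|s - t0| < a -> (P s <-> P t0)) ->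
  forall s t, P s <-> P t.
Proof.
move=> loc.
have back (Q : R -> Prop) s t : (forall t0, exists2 a, 0 < a &
    forall s, `|s - t0| < a -> (Q s <-> Q t0)) -> s <= t -> Q t -> Q s.
  move=> locQ st Qt.
  suff : Q (s + 0) by rewrite addr0.
  apply: (backward_induction (P := fun u => Q (s + u))).
    by exists (t - s); [rewrite subr_ge0|rewrite addrC subrK].
  move=> t0 _; have [a a0 H] := locQ (s + t0); exists a => // u u' _ _ ua u'a.
  have h1 : `|s + u - (s + t0)| < a by rewrite opprD addrACA subrr add0r.
  have h2 : `|s + u' - (s + t0)| < a by rewrite opprD addrACA subrr add0r.
  by rewrite (H _ h1) (H _ h2).
have le s t : s <= t -> (P s <-> P t).
  move=> st; split; last by apply: back.
  move=> Ps; apply: contrapT => nPt.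
  have := back (fun u => ~ P u) s t _ st nPt; apply=> // t0.
  by have [a a0 H] := loc t0; exists a => // u hu; rewrite (H u hu).
move=> s t; have [st|ts] := leP s t; first exact: le.
by have := le t s (ltW ts) => ->.
Qed.

End Preliminaries.

Arguments pc_tube {R m l M d C f iota lam A T Tt pi fC rho eps G0 G} _.
Arguments pc_disjoint {R m l M d C f iota lam A T Tt pi fC rho eps G0 G} _.
Arguments pc_metric0 {R m l M d C f iota lam A T Tt pi fC rho eps G0 G} _.
Arguments pc_isometry {R m l M d C f iota lam A T Tt pi fC rho eps G0 G} _.
Arguments pc_positive {R m l M d C f iota lam A T Tt pi fC rho eps G0 G} _.
Arguments pc_fC {R m l M d C f iota lam A T Tt pi fC rho eps G0 G} _.
Arguments pc_subtube {R m l M d C f iota lam A T Tt pi fC rho eps G0 G} _.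
Arguments pc_bump {R m l M d C f iota lam A T Tt pi fC rho eps G0 G} _.
Arguments pc_eps {R m l M d C f iota lam A T Tt pi fC rho eps G0 G} _.
Arguments pc_dominate {R m l M d C f iota lam A T Tt pi fC rho eps G0 G} _.
Arguments pc_metric {R m l M d C f iota lam A T Tt pi fC rho eps G0 G} _.
Arguments pc_metric_eq {R m l M d C f iota lam A T Tt pi fC rho eps G0 G} _.
Arguments pc_morse_smale {R m l M d C f iota lam A T Tt pi fC rho eps G0 G} _.

Section Perturbed.
Unset Implicit Arguments.
Context {R : realType} {m l : nat} {M : manifold R m}.
Context {d : 'I_l -> nat} {C : forall j, manifold R (d j)}.
Variables (f : M -> R) (iota : forall j, C j -> M) (lam : 'I_l -> nat).
Variables (A : 'I_l -> set (chart R m M)) (T Tt : 'I_l -> set M).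
Variables (pi : forall j, M -> C j) (fC : forall j, C j -> R).
Variables (rho : 'I_l -> M -> R) (eps : R) (G0 G : M -> 'M[R]_m).
Set Implicit Arguments.
Hypothesis mb : morse_bott f iota lam.
Hypothesis pc : perturbation f iota lam A T Tt pi fC rho eps G0 G.

Notation h := (perturbed f pi fC rho eps).
Notation Gc j := (pullback_metric (iota j) G).
Notation bump_ j := (bumped pi fC rho j).

Lemma smooth_h : smooth_fun h. Proof. by case: (pc_morse_smale pc) => [[]]. Qed.
Lemma smooth_f : smooth_fun f. Proof. exact: (mb_smooth mb). Qed.
Lemma smooth_fC j : smooth_fun (fC j). Proof. by case: (pc_fC pc j) => [[]]. Qed.
Lemma pos_G : metric_pos G. Proof. exact: riemannian_pos (pc_metric pc). Qed.
Lemma pos_G0 : metric_pos G0. Proof. exact: riemannian_pos (pc_metric0 pc). Qed.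

Lemma dim_core j : (d j <= m)%N.
Proof.
have [x _] := mb_nonempty mb j; have [_ _ rf _] := mb_embedding mb j.
by rewrite -(eqP (rf x)) rank_leq_col.
Qed.

Lemma subtube j : tube f (iota j) (lam j) (A j) (pi j) (Tt j).
Proof. by case: (pc_subtube pc j). Qed.

Lemma Tt_T j : Tt j `<=` T j.
Proof. by case: (pc_subtube pc j). Qed.

Lemma iso_G j phi y : A j phi -> Tt j y -> cdom phi y -> chart_metric G phi y = 1%:M.
Proof.
move=> Ap Ty dy; rewrite -(pc_isometry pc j phi y Ap dy) /chart_metric.
by rewrite (pc_metric_eq pc j y (Tt_T Ty)).
Qed.

Lemma in_one_tube j k y : T j y -> T k y -> j = k.
Proof.
move=> Tj Tk; apply/eqP; apply: contraT => jk.
by have := pc_disjoint pc j k jk; rewrite predeqE => /(_ y)[/(_ (conj Tj Tk))].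
Qed.

Lemma bumped_out k y : ~ T k y -> bump_ k y = 0.
Proof. by move=> nT; rewrite /bumped (bump_zero (pc_bump pc k) nT) mul0r. Qed.

Lemma h_tube j y : T j y -> h y = f y + eps * bump_ j y.
Proof.
move=> Tj; rewrite /perturbed (bigD1 j) //= big1 ?addr0 // => k kj.
by apply: bumped_out => Tk; rewrite (in_one_tube Tj Tk) eqxx in kj.
Qed.

Lemma h_subtube j y : Tt j y -> h y = f y + eps * fC j (pi j y).
Proof.
move=> Tj; rewrite (h_tube (Tt_T Tj)) /bumped.
by rewrite (bump_one (pc_bump pc j) Tj) mul1r.
Qed.

Lemma f_le_h y : f y <= h y.
Proof.
rewrite /perturbed lerDl mulr_ge0 ?(ltW (pc_eps pc)) // sumr_ge0 // => j _.
by rewrite mulr_ge0 ?(ltW (pc_positive pc j _)) //; case/andP: (bump_range (pc_bump pc j) y).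
Qed.

Lemma h_outside y : (forall j, ~ T j y) -> h y = f y.
Proof.
move=> out; rewrite /perturbed big1 ?mulr0 ?addr0 // => j _; exact: bumped_out.
Qed.

Lemma res_block n a b (z : 'rV[R]_m) : (n <= a)%N -> @res R m n (block a b z) = 0.
Proof.
move=> na; apply/rowP => i; rewrite mxE [RHS]mxE big1 // => k _; rewrite !mxE.
case: ifP => [/andP[ak _]|_]; last by rewrite mul0r.
case: eqP => [e|]; last by rewrite mulr0.
by rewrite ltnNge (leq_trans na ak) mulr0.
Qed.

(** The three regions behave differently: outside the tubes h - f attains its
    minimum 0, between the tubes the domination condition applies, and in the
    inner tubes the gradients of f and of the f_j are orthogonal. *)
Lemma lyapunov y : 0 <= codot G y (dfun h y) (dfun f y) /\
  (codot G y (dfun h y) (dfun f y) = 0 -> crit f y).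
Proof.
have cf0 : codot G y (dfun f y) (dfun f y) = 0 -> crit f y.
  move=> e; apply: contrapT => nz.
  have /negP : dfun f y != 0 by apply/eqP.
  by have := codot_gt0 y pos_G (_ : dfun f y != 0); rewrite e ltxx => H /negP /H.
have [[j Tj]|out] := pselect (exists j, T j y); last first.
  have e : dfun h y = dfun f y.
    apply/eqP; rewrite -subr_eq0 -[_ - _]scale1r -dfun_lin //; [|exact: smooth_h|exact: smooth_f].
    apply/eqP; rewrite dfun_drow; set a := chart_at y.
    have da : cdom a y by exact: chart_at_dom.
    have sa : smooth_chart a by exact: chart_at_smooth.
    apply: drow_eq => v; rewrite trmx0 mulmx0 mxE.
    apply: derive_at_min.
      apply: (@near_eq_differentiable _ _ _ ((h \o cinv a) \- (f \o cinv a))).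
        by near=> z; rewrite /= mul1r.
      apply: differentiableB; apply: chart_differentiable => //.
        exact: smooth_h.
      exact: smooth_f.
    near=> z; rewrite /= cmapK // !mul1r h_outside ?subrr ?subr_ge0 ?f_le_h //.
    by move=> j Tj; apply: out; exists j.
  by rewrite e; split; [apply: codot_ge0; exact: pos_G|].
have [Ttj|nTt] := pselect (Tt j y); last first.
  have dB : dfun (bump_ j) y = eps^-1 *: (dfun h y - dfun f y).
    rewrite -dfun_lin; [|exact: smooth_h|exact: smooth_f].
    apply: dfun_near; have o := tube_open (pc_tube pc j).
    have nT : \forall x \near y, T j x by apply: open_nbhs_nbhs.
    apply: filterS nT => x Tx; rewrite (h_tube Tx) addrC addKr mulKf //.
    by rewrite gt_eqF // (pc_eps pc).
  have lt : eps * Defs.gnorm G0 y (grad G0 (bump_ j) y) < Defs.gnorm G0 y (grad G0 f y).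
    rewrite -lte_fin; apply: le_lt_trans (lt_le_trans (pc_dominate pc j) _).
      by apply: ereal_sup_ubound; exists y.
    by apply: ereal_inf_lbound; exists y.
  set X := codot G0 y (dfun h y - dfun f y) (dfun h y - dfun f y).
  have eG : codot G y (dfun h y) (dfun f y) = codot G0 y (dfun h y) (dfun f y).
    by rewrite /codot (pc_metric_eq pc j y Tj).
  have ltX : X < codot G0 y (dfun f y) (dfun f y).
    move: lt; rewrite /Defs.gnorm !inner_grad; [|exact: pos_G0|exact: pos_G0].
    rewrite dB codotZr (codot_sym _ _ _ pos_G0) codotZr -/X.
    have e0 := pc_eps pc; have X0 : 0 <= X by apply: codot_ge0; exact: pos_G0.
    have f0 : 0 <= codot G0 y (dfun f y) (dfun f y) by apply: codot_ge0; exact: pos_G0.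
    have -> : eps * Num.sqrt (eps^-1 * (eps^-1 * X)) = Num.sqrt X.
      rewrite mulrA -expr2 sqrtrM ?sqr_ge0 // sqrtr_sqr ger0_norm ?invr_ge0 ?(ltW e0) //.
      by rewrite mulVKf // gt_eqF.
    by rewrite ltNge ler_sqrt // -ltNge.
  have pos : 0 < codot G0 y (dfun h y) (dfun f y).
    exact: (codot_gt0_of_close pos_G0 ltX).
  by rewrite eG; split; [exact: ltW|move=> e; rewrite e ltxx in pos].
have tb := subtube j.
have [chi ad dy] := adapted_at tb Ttj.
have [phiC cc] := core_chart_exists (mb_embedding mb j) tb (dim_core j) ad.
have fl := adapted_flat tb (@iso_G j) ad.
have smh := smooth_h; have smf := smooth_f.
rewrite (codot_flat smh smf fl dy).
set z := cmap chi y; set X := 2 *: vpart (d := d j) (lam j) z - 2 *: wpart (d := d j) (lam j) z.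
have ef : drow (f \o cinv chi) z = - X.
  by rewrite /X -(drow_f tb (dim_core j) (@smooth_fC j) ad cc dy) opprK.
(* In an adapted chart grad f only has components v and w, and grad h - grad f only u. *)
have [u eh] : exists u, drow (h \o cinv chi) z = - X + @ext R m (d j) u.
  have := field_h tb (dim_core j) (@smooth_fC j) (@h_subtube j) ad cc dy.
  rewrite /gfield -/z -/X => /(congr1 -%R); rewrite opprK => ->.
  exists (- (eps *: - drow (fC j \o cinv phiC) (res z))); rewrite opprD; congr (_ + _).
  by rewrite /ext (mulNmx (eps *: _)) scalemxAl.
have uX : (@ext R m (d j) u *m X^T) 0 0 = 0.
  rewrite dotB !dotZ.
  have k a b : (d j <= a)%N -> (@ext R m (d j) u *m (block a b z)^T) 0 0 = 0.
    move=> da; rewrite /ext -mulmxA.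
    have -> : @Emx R m (d j) *m (block a b z)^T = (@res R m (d j) (block a b z))^T.
      by rewrite /res trmx_mul tr_pid_mx.
    by rewrite res_block // trmx0 mulmx0 mxE.
  by rewrite !k ?leq_addr // !mulr0 subrr.
have XX : (drow (h \o cinv chi) z *m (drow (f \o cinv chi) z)^T) 0 0 = (X *m X^T) 0 0.
  rewrite eh ef -scaleN1r dotZ mulmxDl mxE uX addr0 scaleN1r mulNmx mxE; ring.
rewrite XX; split; first by apply: le_trans (sqr_norm_le X); exact: sqr_ge0.
move=> e; have X0 : X = 0.
  apply/eqP; rewrite -normr_le0; have := sqr_norm_le X; rewrite e => h2.
  by rewrite leNgt; apply/negP => p; have := exprn_gt0 2 p; rewrite ltNge h2.
have := dfun_chart smf fl.1 dy; rewrite ef X0 oppr0 => e0.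
have Fu := chart_frame_unit fl.1 dy.
have : dfun f y *m (chart_frame chi y)^T *m invmx (chart_frame chi y)^T = 0 by rewrite -e0 mul0mx.
by rewrite mulmxK // unitmx_tr.
Unshelve. all: by end_near. Qed.

Lemma core_tube j x : T j (iota j x).
Proof. by apply: Tt_T; apply: (tube_core (subtube j)); exists x. Qed.

(** Flow lines of h between critical submanifolds never go uphill, and those that
    do not go downhill consist of critical points of f. *)
Lemma flow_curve_core c i j (x : C i) (y : C j) : flow_curve G h c ->
  c t @[t --> -oo] --> iota i x -> c t @[t --> +oo] --> iota j y ->
  f (iota i x) <= f (iota j y) -> i = j /\ forall t, range (iota i) (c t).
Proof.
move=> fc cx cy le.
have smh := smooth_h; have smf := smooth_f.
have D t := derive_along_grad smf (fc t).
have mono s t : s <= t -> f (c t) <= f (c s).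
  move=> st; rewrite -lerN2.
  apply: (is_derive_mono (u := fun t => - f (c t))
    (du := fun t => codot G (c t) (dfun h (c t)) (dfun f (c t))) st) => u _.
    by have := is_deriveN (D u); rewrite opprK.
  by case: (lyapunov (c u)).
have cf := smooth_fun_continuous smf.
have lx : f (c t) @[t --> -oo] --> f (iota i x).
  by apply: (@continuous_cvg _ _ _ _ _ c f) => //; exact: cf.
have ly : f (c t) @[t --> +oo] --> f (iota j y).
  by apply: (@continuous_cvg _ _ _ _ _ c f) => //; exact: cf.
have const t : f (c t) = f (iota i x).
  have /andP[h1 h2] := nonincreasing_limits mono lx ly t.
  by apply/eqP; rewrite eq_le h2 (le_trans le).
have crt t : crit f (c t).
  have [_] := lyapunov (c t); apply.
  have := D t; rewrite (_ : (fun s => f (c s)) = cst (f (iota i x))); last by apply/funext => s; exact: const.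
  move=> D1; have := @derive_val _ _ _ _ _ _ _ D1; rewrite derive_cst.
  by move/eqP; rewrite eq_sym oppr_eq0 => /eqP.
have core t : exists k, range (iota k) (c t).
  by have := crt t; rewrite (mb_crit mb) => -[k _ h1]; exists k.
have Tcore k t : T k (c t) -> range (iota k) (c t).
  by move=> Tk; have [k' [z _ e]] := core t; rewrite -e in Tk *;
    have := in_one_tube Tk (core_tube z) => ek; subst k'; exists z.
(* The tubes are open and disjoint and cover the critical points. *)
have loc k t0 : exists2 a, 0 < a & forall s, `|s - t0| < a -> (T k (c s) <-> T k (c t0)).
  have [k' [z _ e]] := core t0.
  have Tk' : T k' (c t0) by rewrite -e; exact: core_tube.
  have : \forall s \near t0, T k' (c s).
    apply: (grad_eq_continuous (fc t0)); apply: open_nbhs_nbhs.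
    by split=> //; exact: (tube_open (pc_tube pc k')).
  move=> /nbhs_ballP[a a0 Ha]; exists a => // s sa.
  have Ts : T k' (c s) by apply: Ha; rewrite -ball_normE /= distrC.
  by split=> Tk; [rewrite (in_one_tube Tk Ts)|rewrite (in_one_tube Tk Tk')].
have far k (z : C k) (F : set_system R) : ProperFilter F -> c t @[t --> F] --> iota k z ->
    exists t, T k (c t).
  move=> PF cz; have : \forall t \near F, T k (c t).
    apply: cz; apply: open_nbhs_nbhs; split; last exact: core_tube.
    exact: (tube_open (pc_tube pc k)).
  by move=> /filter_ex[t Ht]; exists t.
have [s Ts] := far i x _ _ cx; have [t Tt'] := far j y _ _ cy.
have allT u : T i (c u) by apply/(locally_constant (loc i) u s).
split; first exact: (in_one_tube (allT t) Tt').
by move=> u; exact: Tcore.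
Qed.

End Perturbed.

(** * Flow lines within a critical submanifold and the top part *)

Lemma cvg_scale_pinfty (R : realType) (T : topologicalType) (c : R -> T) (a : R) (p : T) :
  0 < a -> c t @[t --> +oo] --> p -> c (a * t) @[t --> +oo] --> p.
Proof.
move=> a0 h A /h [r [_ Hr]]; exists (r / a); split; first exact: num_real.
by move=> t; rewrite ltr_pdivrMr // mulrC => /Hr.
Qed.

Lemma cvg_scale_ninfty (R : realType) (T : topologicalType) (c : R -> T) (a : R) (p : T) :
  0 < a -> c t @[t --> -oo] --> p -> c (a * t) @[t --> -oo] --> p.
Proof.
move=> a0 h A /h [r [_ Hr]]; exists (r / a); split; first exact: num_real.
by move=> t; rewrite ltr_pdivlMr // mulrC => /Hr.
Qed.

Section FlowLines.
Context {R : realType} {m l : nat} {M : manifold R m}.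
Unset Implicit Arguments.
Context {d : 'I_l -> nat} {C : forall j, manifold R (d j)}.
Variables (f : M -> R) (iota : forall j, C j -> M) (lam : 'I_l -> nat).
Variables (A : 'I_l -> set (chart R m M)) (T Tt : 'I_l -> set M).
Variables (pi : forall j, M -> C j) (fC : forall j, C j -> R).
Variables (rho : 'I_l -> M -> R) (eps : R) (G0 G : M -> 'M[R]_m).
Set Implicit Arguments.
Hypothesis mb : morse_bott f iota lam.
Hypothesis pc : perturbation f iota lam A T Tt pi fC rho eps G0 G.
Hypothesis oh : ordered_by_height f iota.

Notation h := (perturbed f pi fC rho eps).
Notation Gc j := (pullback_metric (iota j) G).

Lemma iota_inj j : injective (iota j).
Proof. by case: (mb_embedding mb j). Qed.

Lemma iota_cont j : continuous (iota j).
Proof. exact: iota_continuous (mb_embedding mb j). Qed.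

Lemma push_curve j (ga : R -> C j) t : grad_eq_at (Gc j) (fC j) ga (eps * t) ->
  grad_eq_at G h (fun s => iota j (ga (eps * s))) t.
Proof.
exact: (curve_push (mb_embedding mb j) (subtube pc j) (@iso_G _ _ _ _ _ _ _ _ _ _ _ _ _ _ _ _ _ _ pc j)
  (dim_core mb j) (smooth_fC pc (j := j)) (smooth_h pc) (h_subtube pc (j := j))).
Qed.

Lemma pull_curve j (c : R -> M) t : (\forall s \near t, range (iota j) (c s)) ->
  grad_eq_at G h c t -> grad_eq_at (Gc j) (fC j) (fun s => pi j (c (eps^-1 * s))) (eps * t).
Proof.
exact: (curve_pull (mb_embedding mb j) (subtube pc j) (@iso_G _ _ _ _ _ _ _ _ _ _ _ _ _ _ _ _ _ _ pc j)
  (dim_core mb j) (smooth_fC pc (j := j)) (smooth_h pc) (pc_eps pc) (h_subtube pc (j := j))).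
Qed.

Lemma flow_lines_empty i j (x : C i) (y : C j) : (i < j)%N ->
  flow_lines G h (iota i x) (iota j y) = set0.
Proof.
move=> ij; apply/seteqP; split=> // L [c [fc cx cy _]].
have [e _] := flow_curve_core mb pc fc cx cy (oh x y (ltnW ij)).
by rewrite e ltnn in ij.
Qed.

(** A flow line of h from C_j to C_j lies in C_j, where the fields of h and f_j are
    proportional. *)
Lemma flow_lines_core j (q p : C j) : flow_lines G h (iota j q) (iota j p) =
  (fun L => iota j @` L) @` flow_lines (Gc j) (fC j) q p.
Proof.
have e0 := pc_eps pc; have e0' : 0 < eps^-1 by rewrite invr_gt0.
have en : eps != 0 by rewrite gt_eqF.
apply/seteqP; split=> L.
  move=> [c [fc cq cp eL]].
  have [_ core] := flow_curve_core mb pc fc cq cp (oh q p (leqnn j)).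
  have ret x : pi j (iota j x) = x by exact: (tube_retract (subtube pc j)).
  pose ga s := pi j (c (eps^-1 * s)).
  have iga s : iota j (ga s) = c (eps^-1 * s).
    by have [x _ ex] := core (eps^-1 * s); rewrite /ga -ex ret.
  exists (range ga); last first.
    rewrite eL; apply/seteqP; split=> y.
      by case=> _ [s _ <-] <-; rewrite iga; exists (eps^-1 * s).
    case=> t _ <-; exists (ga (eps * t)); first by exists (eps * t).
    by rewrite iga mulKf.
  have pc1 x : {for iota j x, continuous (pi j)}.
    by apply: (pi_continuous (subtube pc j)); apply: (tube_core (subtube pc j)); exists x.
  exists ga; split=> //.
  - move=> t; rewrite -[t](mulVKf en); apply: pull_curve => //.
    by apply: filterE => s; exact: core.
  - rewrite -[q in _ --> q]ret.
    apply: (@continuous_cvg _ _ _ _ _ (fun s => c (eps^-1 * s)) (pi j)); first exact: pc1.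
    exact: cvg_scale_ninfty.
  - rewrite -[p in _ --> p]ret.
    apply: (@continuous_cvg _ _ _ _ _ (fun s => c (eps^-1 * s)) (pi j)); first exact: pc1.
    exact: cvg_scale_pinfty.
case=> L' [ga [fg gq gp ->]] <-.
exists (fun s => iota j (ga (eps * s))); split.
- by move=> t; exact: push_curve.
- apply: (@continuous_cvg _ _ _ _ _ (fun s => ga (eps * s)) (iota j)); first exact: iota_cont.
  exact: cvg_scale_ninfty.
- apply: (@continuous_cvg _ _ _ _ _ (fun s => ga (eps * s)) (iota j)); first exact: iota_cont.
  exact: cvg_scale_pinfty.
- apply/seteqP; split=> y.
    by case=> _ [s _ <-] <-; exists (eps^-1 * s); rewrite // mulVKf.
  by case=> t _ <-; exists (ga (eps * t)) => //; exists (eps * t).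
Qed.

Lemma image_iota_inj j (P : set (set (C j))) : set_inj P (fun L => iota j @` L).
Proof.
move=> L1 L2 _ _ e; apply/seteqP; split=> x Lx.
  have : (iota j @` L1) (iota j x) by exists x.
  by rewrite e => -[x' Lx' /iota_inj <-].
have : (iota j @` L2) (iota j x) by exists x.
by rewrite -e => -[x' Lx' /iota_inj <-].
Qed.

Lemma nuF2_core j (q p : C j) : nuF2 G h (iota j q) (iota j p) = nuF2 (Gc j) (fC j) q p.
Proof. by rewrite /nuF2 flow_lines_core fsbig_image //; exact: image_iota_inj. Qed.

Lemma nuF2_up i j (x : C i) (y : C j) : (i < j)%N -> nuF2 G h (iota i x) (iota j y) = 0.
Proof. by move=> ij; rewrite /nuF2 flow_lines_empty // fsbig_set0. Qed.

Hypothesis ish : index_shift f iota lam pi fC rho eps G.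

Lemma index_core j x n : index_is G h (iota j x) n <->
  exists2 k, index_is (Gc j) (fC j) x k & (lam j + k)%N = n.
Proof.
have [cr ix] := ish; split=> [ixn|[k ixk e]].
  have : crit h (iota j x) by case: ixn.
  rewrite cr => -[i _ [y cy e]].
  have ij := mb_disjoint mb e; subst i; rewrite (iota_inj e) in cy.
  by apply/(ix j x n cy).
by apply/(ix j x n); [case: ixk|exists k].
Qed.

Lemma index_in_core q n : index_is G h q n -> exists j (x : C j), q = iota j x.
Proof.
move=> ixn; have : crit h q by case: ixn.
by have [-> _] := ish; move=> -[i _ [y cy e]]; exists i, y.
Qed.

Section TopPart.
Variables (K : nzRingType) (nu : M -> M -> K) (nuC : forall j, C j -> C j -> K).
Hypothesis nu_core : forall j q p k, index_is (Gc j) (fC j) q k.+1 ->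
  index_is (Gc j) (fC j) p k -> nu (iota j q) (iota j p) = nuC q p.
Hypothesis nu_up : forall i j (x : C i) (y : C j), (i < j)%N -> nu (iota i x) (iota j y) = 0.

(** Since no flow line of h goes from a lower to a higher critical submanifold
    and those within C_j are flow lines of f_j, the coefficients of the boundary
    of a on C_j only involve the top part of a when C_j is its highest level. *)
Lemma boundary_top n k (a : M -> K) j : (lam j + k = n)%N -> is_chain G h n a ->
  (forall i (x : C i), a (iota i x) <> 0 -> (i <= j)%N) ->
  (forall p, boundary G h nu n a p = 0) ->
  forall x, boundary (Gc j) (fC j) (nuC (j := j)) k (a \o iota j) x = 0.
Proof.
move=> lk [fin ich] top bd p; rewrite /boundary; case: asboolP => // -[k' [ek ip]].
have ip' : index_is G h (iota j p) (lam j + k') by apply/index_core; exists k'.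
have := bd (iota j p); rewrite /boundary; case: asboolP; last first.
  by case; exists (lam j + k')%N; rewrite -lk ek addnS.
move=> _ bdp; rewrite -[RHS]bdp.
transitivity (\sum_(q \in iota j @` [set q | index_is (Gc j) (fC j) q k]) a q * nu q (iota j p)).
  rewrite fsbig_image; last by move=> x y _ _; exact: iota_inj.
  apply: eq_fsbigr => q /set_mem iq; rewrite ek in iq.
  by rewrite (nu_core iq ip).
apply: fsbig_widen.
  by move=> _ [q iq <-]; apply/index_core; exists k.
move=> q [iq nq] /=.
have [i [x ex]] := index_in_core iq; rewrite ex in iq nq *.
have [->|/eqP a0] := eqVneq (a (iota i x)) 0; first by rewrite mul0r.
have ij := top i x a0.
move: ij; rewrite leq_eqVlt => /orP[/eqP/val_inj ij|ij]; last by rewrite nu_up ?mulr0.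
subst i; exfalso; apply: nq; exists x => //.
by have /index_core[k2 ix2 e2] := iq; rewrite -lk in e2; rewrite /= -(addnI e2).
Qed.

Lemma chain_core n k (a : M -> K) j : (lam j + k = n)%N -> is_chain G h n a ->
  is_chain (Gc j) (fC j) k (a \o iota j).
Proof.
move=> lk [fin ich]; split.
  apply: (finite_preimage (B := [set p | a p <> 0])) fin.
  by move=> x y _ _; exact: iota_inj.
move=> x /ich/index_core[k2 ix2 e2]; rewrite -lk in e2.
by rewrite -(addnI e2).
Qed.

Lemma top_part : top_part_in_kernel f iota lam pi fC rho eps G nu nuC.
Proof.
move=> n a ch [p ap] bd; split.
  pose P j := `[< exists x, a (iota j x) <> 0 >].
  have [j0 [x0 e0]] := index_in_core (ch.2 p ap).
  have Pj0 : P j0 by apply/asboolP; exists x0; rewrite -e0.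
  pose j := [arg max_(i > j0 | P i) (i : nat)].
  have [Pj jmax] : P j /\ forall i, P i -> (i <= j)%N.
    by rewrite /j; case: arg_maxnP => // i Pi mx.
  have tj : top_at iota a j.
    split; first by apply/asboolP.
    by move=> i Hi; apply: jmax; apply/asboolP.
  exists j; split=> //; have [x ax] := tj.1.
  have /index_core[k _ lk] := ch.2 _ ax.
  exists k; split=> //; first exact: chain_core ch.
  apply: (boundary_top lk ch) => // i y ay; apply: tj.2; by exists y.
move=> r js ks as_ mono Has adec.
have mono' (i i' : 'I_r.+1) : js i = js i' -> i = i'.
  move=> e; case: (ltngtP i i') => [/mono|/mono|/val_inj //]; by rewrite e ltnn.
have pushE i y : push (iota (js i)) (as_ i) (iota (js i) y) = as_ i y.
  rewrite /push (_ : [set x | _] = [set y]) ?fsbig_set1 //.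
  by apply/seteqP; split=> z; [move/iota_inj|move=> ->].
have push0 i j (y : C j) : js i <> j -> push (iota (js i)) (as_ i) (iota j y) = 0.
  move=> ne; rewrite /push (_ : [set x | _] = set0) ?fsbig_set0 //.
  by apply/seteqP; split=> // z /(mb_disjoint mb).
have last_ : as_ ord_max = a \o iota (js ord_max).
  apply/funext => y; rewrite /= adec (bigD1 ord_max) //= big1 ?addr0 ?pushE // => i ni.
  by apply: push0 => /mono' ei; rewrite ei eqxx in ni.
have top i (x : C i) : a (iota i x) <> 0 -> (i <= js ord_max)%N.
  move=> ax; apply: contrapT => nle; apply: ax; rewrite adec big1 // => i' _.
  apply: push0 => e; apply: nle; rewrite -e.
  have [->|ne] := eqVneq i' ord_max; first exact: leqnn.
  by apply: ltnW; apply: mono; rewrite ltn_neqAle ne -ltnS ltn_ord.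
have [lk _ _] := Has ord_max.
by move=> x; rewrite last_; exact: (boundary_top lk ch).
Qed.

End TopPart.

Lemma top_part_F2 : top_part_in_kernel f iota lam pi fC rho eps G
  (nuF2 G h) (fun j => nuF2 (Gc j) (fC j)).
Proof.
apply: top_part => [j q p k _ _|i j x y]; first exact: nuF2_core.
exact: nuF2_up.
Qed.

End FlowLines.

(** * Normal directions of stable and unstable manifolds *)

Section FibreDiscs.
Context {R : realType} {m d : nat} {M : manifold R m} {C : manifold R d}.
Variables (f : M -> R) (iota : C -> M) (lam : nat).
Variables (A : set (chart R m M)) (pi : M -> C) (T : set M).
Hypotheses (emb : embedding iota) (tb : tube f iota lam A pi T).
Variables (G : M -> 'M[R]_m).
Hypothesis iso : forall phi y, A phi -> T y -> cdom phi y -> chart_metric G phi y = 1%:M.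
Hypothesis dm : (d <= m)%N.
Hypothesis dl : (d + lam <= m)%N.

Notation upart := (@upart R m d).
Notation vpart := (@vpart R m d lam).
Notation wpart := (@wpart R m d lam).
Notation adapted := (adapted A T).
Notation ext := (@ext R m d).
Notation res := (@res R m d).
Notation Gc := (pullback_metric iota G).

Lemma block_idem a b (z : 'rV[R]_m) : block a b (block a b z) = block a b z.
Proof. by apply/rowP => i; rewrite !mxE; case: ifP => // ->. Qed.

Lemma block_disjoint a b a' b' (z : 'rV[R]_m) : (b <= a')%N || (b' <= a)%N ->
  block a b (block a' b' z) = 0.
Proof.
move=> H; apply/rowP => i; rewrite !mxE; case: ifP => // /andP[h1 h2]; case: ifP => // /andP[h3 h4].
case/orP: H => h5; first by have := leq_trans h5 h3; rewrite leqNgt h2.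
by have := leq_trans h5 h1; rewrite leqNgt h4.
Qed.

(** The coordinates v, or the coordinates w. Stable manifolds involve the latter, and
    the unstable ones, as stable manifolds of - h, the former. *)
Definition normal_block a b := (a = d /\ b = (d + lam)%N) \/ (a = (d + lam)%N /\ b = m).

Lemma upart_normal a b (w : 'rV[R]_m) : normal_block a b -> block a b w = w -> upart w = 0.
Proof.
move=> nb <-; apply: block_disjoint; apply/orP; left.
by case: nb => -[-> _] //; exact: leq_addr.
Qed.

(** Both charts describe the foot point by u, and they are related linearly on the
    fibre over it, so that fibres of one chart go to fibres of the other. *)
Lemma fibre_change a b chi chi' x : normal_block a b -> adapted chi -> adapted chi' ->
  cdom chi (iota x) -> cdom chi' (iota x) ->
  exists K r0 : R, [/\ 0 < K, 0 < r0 & forall w : 'rV[R]_m, block a b w = w -> `|w| < r0 ->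
    cimg chi (cmap chi (iota x) + w) /\
    let z := cinv chi (cmap chi (iota x) + w) in cdom chi' z /\
    exists w', [/\ block a b w' = w', `|w'| <= K * `|w| & cmap chi' z = cmap chi' (iota x) + w']].
Proof.
move=> nb ad ad' dx dx'; set z0 := cmap chi (iota x).
have : \forall z \near z0, overlap chi chi' z by exact: overlap_near.
move=> /nbhs_ballP[r0 r00 Hr]; have {}r00 : 0 < r0 by exact: r00.
have [phi Ap [_ dp mp]] := ad; have [phi' Ap' [_ dp' mp']] := ad'.
(* P and Q act linearly on the fibre coordinates v and w over x. *)
have [P [Q HPQ]] := tube_linear tb x Ap Ap'.
have [K1 K10 HK1] := mulmx_norm_bound P; have [K2 K20 HK2] := mulmx_norm_bound Q.
exists (K1 + K2), r0; split=> //; first exact: addr_gt0.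
move=> w bw wr.
have /overlapE[i dz'] : overlap chi chi' (z0 + w).
  by apply: Hr; rewrite -ball_normE /= opprD addNKr normrN.
split=> //; set z := cinv chi (z0 + w); split=> //.
have dz : cdom chi z by exact: cimg_cdom.
have mz : cmap chi z = z0 + w by rewrite /z cinvK.
have [v0 w0] := core_parts tb ad dx; rewrite -/z0 in v0 w0.
have u0 : upart z0 = z0 by exact: (upart_core v0 w0).
have [d1 e1] := adapted_foot tb ad dz.
have pz : pi z = x.
  have : iota (pi z) = iota x.
    rewrite -(cmapK d1) e1 mz [upart _]blockD -/(upart z0) -/(upart w) u0 (upart_normal nb bw).
    by rewrite addr0 /z0 cmapK.
  by move=> /(congr1 pi); rewrite !(tube_retract tb).
have [d2 e2] := adapted_foot tb ad' dz'; rewrite pz in e2.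
have Tz := adapted_tube ad dz.
have [hv hw] := HPQ z Tz ((dp z).1 dz).1 ((dp' z).1 dz').1 pz.
rewrite -mp -mp' mz in hv hw.
have vw : vpart (z0 + w) = vpart w by rewrite /Defs.vpart blockD -/(vpart z0) v0 add0r.
have ww : wpart (z0 + w) = wpart w by rewrite /Defs.wpart blockD -/(wpart z0) w0 add0r.
rewrite vw in hv; rewrite ww in hw.
have K12 (u : 'rV[R]_m) : K1 * `|u| <= (K1 + K2) * `|u| by rewrite ler_wpM2r // lerDl ltW.
have K21 (u : 'rV[R]_m) : K2 * `|u| <= (K1 + K2) * `|u| by rewrite ler_wpM2r // lerDr ltW.
have ez : cmap chi' z = cmap chi' (iota x) + (vpart (cmap chi' z) + wpart (cmap chi' z)).
  by rewrite e2; exact: parts_sum.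
case: nb => -[ea eb]; subst a b.
- have vE : vpart w = w by exact: bw.
  have wE : wpart w = 0 by rewrite -bw; apply: block_disjoint; rewrite leqnn orbT.
  rewrite wE mul0mx in hw; rewrite hw addr0 in ez.
  exists (vpart (cmap chi' z)); split=> //; first exact: block_idem.
  by rewrite hv vE; apply: le_trans (HK1 w) (K12 w).
- have wE : wpart w = w by exact: bw.
  have vE : vpart w = 0 by rewrite -bw; apply: block_disjoint; rewrite leqnn.
  rewrite vE mul0mx in hv; rewrite hv add0r in ez.
  exists (wpart (cmap chi' z)); split=> //; first exact: block_idem.
  by rewrite hw wE; apply: le_trans (HK2 w) (K21 w).
Qed.

Variables (g : M -> R) (gC : C -> R) (eps : R) (a b : nat).
Hypotheses (sg : smooth_fun g) (sgC : smooth_fun gC) (eps0 : 0 < eps).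
Hypothesis nb : normal_block a b.
Hypothesis contracting : forall chi phiC x w, adapted chi -> core_chart iota pi chi phiC ->
  cdom chi (iota x) -> block a b w = w -> cimg chi (cmap chi (iota x) + w) ->
  gfield g chi (cmap chi (iota x) + w) = eps *: ext (gfield gC phiC (cmap phiC x)) - 2 *: w.

Lemma core_curve_derive chi phiC (ga : R -> C) t : adapted chi -> core_chart iota pi chi phiC ->
  cdom chi (iota (ga (eps * t))) -> grad_eq_at Gc gC ga (eps * t) ->
  is_derive t (1 : R) (fun s => cmap chi (iota (ga (eps * s))))
    (eps *: ext (gfield gC phiC (cmap phiC (ga (eps * t))))).
Proof.
move=> ad cc dx H; have flC := core_flat emb tb iso dm ad cc.
have [spC dC mC _] := cc; have dxC := (dC _).2 dx.
have [cg D] := (grad_eq_flat sgC flC dxC).1 H.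
have ce : {for t, continuous (fun s : R => ga (eps * s))}.
  apply: (@continuous_comp _ _ _ (fun s => eps * s) ga) => //.
  by apply: cvgM; [exact: cvg_cst|exact: cvg_id].
have c1 : {for t, continuous (fun s : R => iota (ga (eps * s)))}.
  apply: (@continuous_comp _ _ _ (fun s => ga (eps * s)) iota) => //.
  exact: iota_continuous.
have := is_derive_mulmxr (@Emx R m d) (is_derive_comp_scale D).
rewrite -scalemxAl -/(ext _).
apply: near_eq_is_derive; near=> s.
have ds : cdom chi (iota (ga (eps * s))) by near: s; exact: curve_in_chart.
by rewrite (core_ext tb ad cc ds).
Unshelve. all: by end_near. Qed.

(** Over a core trajectory the fibre coordinate w satisfies w' = - 2 w. *)
Lemma fibre_trajectory chi phiC (ga : R -> C) (s t : R) w : adapted chi ->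
  core_chart iota pi chi phiC -> block a b w = w ->
  cdom chi (iota (ga (eps * t))) -> grad_eq_at Gc gC ga (eps * t) ->
  cimg chi (cmap chi (iota (ga (eps * t))) + expR (- 2 * (t - s)) *: w) ->
  grad_eq_at G g (fun t => cinv chi (cmap chi (iota (ga (eps * t))) + expR (- 2 * (t - s)) *: w)) t.
Proof.
move=> ad cc bw dx H i; have fl := adapted_flat tb iso ad.
apply: (grad_eq_cinv (z := fun t => cmap chi (iota (ga (eps * t))) + expR (- 2 * (t - s)) *: w) sg fl) => //.
have bw' : block a b (expR (- 2 * (t - s)) *: w) = expR (- 2 * (t - s)) *: w by rewrite blockZ bw.
rewrite (contracting ad cc dx bw' i).
have D1 := core_curve_derive ad cc dx H.
have D2 : is_derive t (1 : R) (fun t => expR (- 2 * (t - s))) (- 2 * expR (- 2 * (t - s))).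
  exact: (is_derive_comp_shift (c := fun u => expR (- 2 * u)) (is_derive_expM (- 2) (t - s))).
have D3 : is_derive t (1 : R) (fun t => expR (- 2 * (t - s)) *: w)
    ((- 2 * expR (- 2 * (t - s))) *: w).
  apply: is_derive_mx => p q; have := is_deriveZ (w p q) D2.
  rewrite [X in is_derive _ _ _ X]/GRing.scale /= [(_ *: w) p q]mxE mulrC.
  rewrite (_ : (fun y : R => (expR (- 2 * (y - s)) *: w) p q) = w p q \*: (fun t0 : R => expR (- 2 * (t0 - s)))) //.
  by apply/funext => u; rewrite /= [LHS]mxE mulrC.
apply: is_derive_eq (is_deriveD D1 D3) _.
by rewrite scalerA -scaleNr mulNr.
Qed.

Definition disc (W : set M) chi x (r : R) := forall w : 'rV[R]_m, block a b w = w -> `|w| < r ->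
  cimg chi (cmap chi (iota x) + w) /\ W (cinv chi (cmap chi (iota x) + w)).

(** A disc in one chart yields a disc in any other, of a smaller radius because the
    linear map between the fibres may expand. *)
Lemma disc_change W chi chi' x r' : adapted chi -> adapted chi' ->
  cdom chi (iota x) -> cdom chi' (iota x) -> 0 < r' -> disc W chi' x r' ->
  exists2 r, 0 < r & disc W chi x r.
Proof.
move=> ad ad' dx dx' r'0 H.
have [K [r0 [K0 r00 Hc]]] := fibre_change nb ad ad' dx dx'.
exists (Num.min r0 (r' / K)); first by rewrite lt_min r00 divr_gt0.
move=> w bw; rewrite lt_min => /andP[h1 h2].
have [i [dz [w' [bw' nw' e]]]] := Hc w bw h1; split=> //.
have w'r : `|w'| < r' by apply: le_lt_trans nw' _; rewrite mulrC -ltr_pdivlMr.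
have [_] := H w' bw' w'r; by rewrite -e cmapK.
Qed.

Lemma expR_le1 (u : R) : 0 <= u -> expR (- 2 * u) <= 1.
Proof. by move=> u0; rewrite expR_le1; lra. Qed.

Lemma exp_scale_lt (u : R) (w : 'rV[R]_m) r : 0 <= u -> `|w| < r -> `|expR (- 2 * u) *: w| < r.
Proof.
move=> u0 wr; rewrite normrZ ger0_norm ?expR_ge0 //; apply: le_lt_trans wr.
by rewrite ler_piMl // expR_le1.
Qed.

(** Near a core trajectory that converges to p, the contracting fibre directions
    lie in the stable set of p: move along the core while shrinking the fibre
    coordinate exponentially. *)
Lemma fibre_disc (ga : R -> C) p chi : (forall t, 0 <= t -> grad_eq_at Gc gC ga t) ->
  ga t @[t --> +oo] --> p -> adapted chi -> cdom chi (iota (ga 0)) ->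
  exists2 r, 0 < r & disc (Ws G g (iota p)) chi (ga 0) r.
Proof.
move=> H cl ad0 d0; set W := Ws G g (iota p).
have H' t : 0 <= t -> grad_eq_at Gc gC ga (eps * t).
  by move=> t0; apply: H; rewrite mulr_ge0 // ltW.
have cg t : 0 <= t -> {for t, continuous (fun s : R => iota (ga (eps * s)))}.
  move=> t0; apply: (@continuous_comp _ _ _ (fun s => ga (eps * s)) iota); last exact: iota_continuous.
  apply: (@continuous_comp _ _ _ (fun s => eps * s) ga).
    by apply: cvgM; [exact: cvg_cst|exact: cvg_id].
  exact: grad_eq_continuous (H' t t0).
pose P t := forall chi, adapted chi -> cdom chi (iota (ga (eps * t))) ->
  exists2 r, 0 < r & disc W chi (ga (eps * t)) r.
suff : P 0 by rewrite /P mulr0; apply.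
(* A margin of width r2 around a point of a chart. *)
have margin chi1 x : adapted chi1 -> cdom chi1 (iota x) -> exists2 r2, 0 < r2 &
    forall y w, cdom chi1 y -> `|cmap chi1 y - cmap chi1 (iota x)| < r2 -> `|w| < r2 ->
      cimg chi1 (cmap chi1 y + w).
  move=> ad dx; have : \forall z \near cmap chi1 (iota x), cimg chi1 z.
    by apply: cimg_near; exact: cimg_cmap.
  move=> /nbhs_ballP[r1 r10 Hr1]; have {}r10 : 0 < r1 by exact: r10.
  exists (r1 / 2); first by rewrite divr_gt0.
  move=> y w dy h1 h2; apply: Hr1; rewrite -ball_normE /=.
  rewrite -normrN opprB addrAC; apply: le_lt_trans (ler_normD _ _) _.
  by rewrite [ltRHS](splitr r1) ltrD.
apply: backward_induction.
- have [chi1 [phiC [ad cc dp]]] := core_chart_at emb tb dm p.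
  have [r2 r20 Hm] := margin chi1 p ad dp.
  have cl' : (fun t => iota (ga (eps * t))) t @[t --> +oo] --> iota p.
    apply: (@continuous_cvg _ _ _ _ _ (fun t => ga (eps * t)) iota); first exact: iota_continuous.
    exact: cvg_scale_pinfty.
  have [T0 [_ HT]] : \forall t \near +oo, cdom chi1 (iota (ga (eps * t))) /\
      `|cmap chi1 (iota (ga (eps * t))) - cmap chi1 (iota p)| < r2.
    apply: (cl' [set y | cdom chi1 y /\ `|cmap chi1 y - cmap chi1 (iota p)| < r2]).
    apply: open_nbhs_nbhs; split; first exact: chart_ball_open.
    by split=> //; rewrite subrr normr0.
  pose t1 := Num.max 0 (T0 + 1).
  have t10 : 0 <= t1 by rewrite /t1 le_max lexx.
  have HT' t : t1 <= t -> T0 < t.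
    by apply: lt_le_trans; rewrite /t1 lt_max ltrDl ltr01 orbT.
  exists t1 => // chi2 ad2 d2.
  have [d1 n1] := HT t1 (HT' t1 (lexx _)).
  apply: (disc_change ad2 ad d2 d1 r20) => w bw wr; split; first exact: Hm.
  pose q t := cinv chi1 (cmap chi1 (iota (ga (eps * t))) + expR (- 2 * (t - t1)) *: w).
  have iq t : t1 <= t -> cimg chi1 (cmap chi1 (iota (ga (eps * t))) + expR (- 2 * (t - t1)) *: w).
    move=> tt; have [dt nt] := HT t (HT' t tt); apply: Hm => //.
    by apply: exp_scale_lt => //; rewrite subr_ge0.
  have -> : cinv chi1 (cmap chi1 (iota (ga (eps * t1))) + w) = q t1.
    by rewrite /q subrr mulr0 expR0 scale1r.
  exists (fun u => q (u + t1)); split; first by rewrite add0r.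
    move=> u u0; apply: grad_eq_shift.
    have ut : t1 <= u + t1 by rewrite lerDr.
    have [dt nt] := HT _ (HT' _ ut).
    apply: (fibre_trajectory (phiC := phiC)) => //; last exact: iq.
    by apply: H'; rewrite addr_ge0.
  apply: cvg_shift_pinfty; rewrite /q.
  have e : iota p = cinv chi1 (cmap chi1 (iota p) + 0) by rewrite addr0 cmapK.
  rewrite e; apply: (@continuous_cvg _ _ _ _ _
    (fun t => cmap chi1 (iota (ga (eps * t))) + expR (- 2 * (t - t1)) *: w) (cinv chi1)).
    by apply: cinv_continuous; rewrite addr0; exact: cimg_cmap.
  apply: cvgD.
    apply: (@continuous_cvg _ _ _ _ _ (fun t => iota (ga (eps * t))) (cmap chi1)) => //.
    exact: cmap_continuous.
  rewrite -[X in _ --> X](scale0r w); apply: cvgZr_tmp.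
  apply/cvgrPdist_le => e' e'0; exists (t1 + e'^-1); split; first exact: num_real.
  move=> t te; rewrite sub0r normrN ger0_norm ?expR_ge0 //.
  have e'i : 0 < e'^-1 by rewrite invr_gt0.
  have u0 : e'^-1 < t - t1 by lra.
  rewrite mulNr expRN -[e']invrK lef_pV2 ?posrE ?expR_gt0 //.
  by apply: le_trans (expR_ge1Dx _); lra.
- move=> t0 t00.
  have [chi1 [phiC [ad cc dp]]] := core_chart_at emb tb dm (ga (eps * t0)).
  have [r2 r20 Hm] := margin chi1 _ ad dp.
  have near_ : \forall t \near t0, cdom chi1 (iota (ga (eps * t))) /\
      `|cmap chi1 (iota (ga (eps * t))) - cmap chi1 (iota (ga (eps * t0)))| < r2.
    apply: (cg t0 t00 [set y | cdom chi1 y /\ `|cmap chi1 y - cmap chi1 (iota (ga (eps * t0)))| < r2]).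
    apply: open_nbhs_nbhs; split; first exact: chart_ball_open.
    by split=> //; rewrite subrr normr0.
  move: near_ => /nbhs_ballP[e e0 He]; exists e => // s s' s0 ss' se s'e Ps' chi2 ad2 d2.
  have inb t : s <= t <= s' -> cdom chi1 (iota (ga (eps * t))) /\
      `|cmap chi1 (iota (ga (eps * t))) - cmap chi1 (iota (ga (eps * t0)))| < r2.
    move=> /andP[h1 h2]; apply: He; rewrite -ball_normE /= distrC.
    move: se s'e; rewrite !ltr_norml => /andP[h3 h4] /andP[h5 h6].
    by apply/andP; split; lra.
  have [|ds ns] := inb s; first by rewrite lexx.
  have [|ds' ns'] := inb s'; first by rewrite lexx andbT.
  have [r' r'0 Hr'] := Ps' chi1 ad ds'.
  have m0 : 0 < Num.min r2 r' by rewrite lt_min r20.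
  apply: (disc_change ad2 ad d2 ds m0) => w bw; rewrite lt_min => /andP[wr2 wr'].
  split; first exact: Hm.
  pose q t := cinv chi1 (cmap chi1 (iota (ga (eps * t))) + expR (- 2 * (t - s)) *: w).
  have -> : cinv chi1 (cmap chi1 (iota (ga (eps * s))) + w) = q s.
    by rewrite /q subrr mulr0 expR0 scale1r.
  apply: (Ws_backward ss').
    move=> t ht; have [dt nt] := inb t ht; move: ht => /andP[st ts'].
    apply: (fibre_trajectory (phiC := phiC)) => //.
      by apply: H'; exact: le_trans st.
    by apply: Hm => //; apply: exp_scale_lt => //; rewrite subr_ge0.
  have B1 : block a b (expR (- 2 * (s' - s)) *: w) = expR (- 2 * (s' - s)) *: w by rewrite blockZ bw.
  have B2 : `|expR (- 2 * (s' - s)) *: w| < r' by apply: exp_scale_lt => //; rewrite subr_ge0.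
  by have [] := Hr' _ B1 B2.
Unshelve. all: by end_near. Qed.

End FibreDiscs.

(** * Tangent frames of the stable and unstable manifolds of h along the core *)

Section NormalBlocks.
Context {R : realType} {m : nat}.
Implicit Types v : 'rV[R]_m.

(** Its rows are the coordinate vectors a, ..., a + n - 1; for a = d and n = lam this
    is the matrix in the definition of [vframe]. *)
Definition nblock a n : 'M[R]_(n, m) :=
  \matrix_(i < n, c < m) ((c == a + i :> nat)%N)%:R.

Lemma nblock_mul_tr a n p (P : 'M[R]_(p, m)) (i : 'I_p) (k : 'I_n) (c : 'I_m) :
  c = (a + k)%N :> nat -> (P *m (nblock a n)^T) i k = P i c.
Proof.
move=> e; rewrite mxE (bigD1 c) //= big1 => [|e' ne].
  by rewrite !mxE e eqxx mulr1 addr0.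
by rewrite !mxE -e val_eqE (negbTE ne) mulr0.
Qed.

Lemma block_nblock a n (u : 'rV[R]_n) : block a (a + n) (u *m nblock a n) = u *m nblock a n.
Proof.
apply/rowP => c; rewrite mxE; case: ifP => // h; rewrite mxE big1 // => i _.
rewrite mxE; case: eqP => [e|_]; last by rewrite mulr0.
by move: h; rewrite e leq_addr ltn_add2l ltn_ord.
Qed.

Lemma nblock_sub a n v : block a (a + n) v = v -> (v <= nblock a n)%MS.
Proof.
move=> bv; suff -> : v = (v *m (nblock a n)^T) *m nblock a n by exact: submxMl.
apply/rowP => c; rewrite mxE.
have [/andP[h1 h2]|h] := boolP (a <= c < a + n)%N.
  have cn : (c - a < n)%N by rewrite ltn_subLR.
  have e (i : 'I_n) : (c == a + i :> nat)%N = (i == Ordinal cn).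
    by rewrite -val_eqE /= -{1}(subnKC h1) eqn_add2l eq_sym.
  rewrite (bigD1 (Ordinal cn)) //= big1 => [|i ne]; last by rewrite [X in _ * X]mxE e (negbTE ne) mulr0.
  rewrite (@nblock_mul_tr _ _ _ _ _ _ c) ?[X in _ * X]mxE ?e ?eqxx ?mulr1 ?addr0 //.
  by rewrite /= subnKC.
have -> : v 0 c = 0 by rewrite -bv mxE (negbTE h).
apply/esym; rewrite big1 // => i _; rewrite [X in _ * X]mxE; case: eqP => [e|_]; last by rewrite mulr0.
by move: h; rewrite e leq_addr ltn_add2l ltn_ord.
Qed.

Lemma nblock_free a n : (a + n <= m)%N -> row_free (nblock a n).
Proof.
move=> am; apply/row_freeP; exists (nblock a n)^T; apply/matrixP => i k.
have h : (a + k < m)%N by rewrite (leq_trans _ am) // ltn_add2l.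
by rewrite (@nblock_mul_tr _ _ _ _ _ _ (Ordinal h)) // !mxE /= eqn_add2l eq_sym val_eqE.
Qed.

Lemma nblock_res d a n : (d <= a)%N -> nblock a n *m (pid_mx d : 'M[R]_(m, d)) = 0.
Proof.
move=> da; apply: rV_mul_eq => u; rewrite mulmx0 mulmxA -(block_nblock a u).
exact: (res_block _ _ da).
Qed.

Lemma row_free_col n1 n2 (P : 'M[R]_(n1, m)) (Q : 'M[R]_(n2, m)) :
  (forall (a : 'rV_n1) (b : 'rV_n2), a *m P + b *m Q = 0 -> a = 0 /\ b = 0) ->
  row_free (col_mx P Q).
Proof.
move=> h; apply: inj_row_free => v; rewrite -[v]hsubmxK mul_row_col => /h[-> ->].
exact: row_mx0.
Qed.

Lemma row_free_inj n (P : 'M[R]_(n, m)) (a : 'rV_n) : row_free P -> a *m P = 0 -> a = 0.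
Proof. by move=> /row_freeP[Q e] h; rewrite -(mulmx1 a) -e mulmxA h mul0mx. Qed.

End NormalBlocks.

Section PushTangent.
Context {R : realType} {m d : nat} {M : manifold R m} {C : manifold R d}.
Variable iota : C -> M.
Hypothesis emb : embedding iota.

Lemma smooth_curve_push (c : R -> C) : smooth_curve c -> smooth_curve (iota \o c).
Proof.
move=> [cc sc]; have ci := iota_continuous emb; have [si _ _ _] := emb.
have cic : continuous (iota \o c) by move=> t; apply: continuous_comp; [exact: cc|exact: ci].
split=> // psi ha k; apply: Ck_locally => t dt.
have hb := @chart_at_atlas _ _ _ (c t); set b := chart_at (c t) in hb.
have db : cdom b (c t) by exact: chart_at_dom.
have sb := atlas_smooth_chart hb; have sa := atlas_smooth_chart ha.
have o1 : open (c @^-1` cdom b) by apply: open_comp => [s _|]; [exact: cc|exact: cdom_open].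
have o2 : open ((iota \o c) @^-1` cdom psi).
  by apply: open_comp => [s _|]; [exact: cic|exact: cdom_open].
exists (c @^-1` cdom b `&` (iota \o c) @^-1` cdom psi).
have o3 : open (c @^-1` cdom b `&` (iota \o c) @^-1` cdom psi) by exact: openI.
split=> //.
apply: (@Ck_ext _ _ _ _ _ ((cmap psi \o iota \o cinv b) \o (cmap b \o c))) => //.
  by move=> s [d1 d2] /=; rewrite cmapK.
apply: (@Ck_comp _ _ _ _ _ _ _ (map_domain setT iota b psi)) => //.
- by apply: map_domain_open => [|x _]; [exact: openT|exact: ci].
- by apply: (@Ck_sub _ _ _ _ (c @^-1` cdom b)); [move=> s []|exact: sc].
- by move=> s [d1 d2]; exists (c s).
- exact: smooth_map_chart openT si sb sa k.
Qed.

Lemma push_tangent (W0 : set C) (W1 : set M) x v : (forall y, W0 y -> W1 (iota y)) ->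
  tangent W0 x v -> tangent W1 (iota x) (v *m mdiff iota x).
Proof.
move=> W01 [c [sc Wc c0 <-]]; have sp := smooth_curve_push sc.
exists (iota \o c); split=> //; [by move=> t; apply: W01|by rewrite /= c0|].
have [cc _] := sc; have [si _ _ _] := emb.
set x' := c 0 in c0; rewrite -c0 /mdiff -/x'.
set a := chart_at (iota x'); set b := chart_at x'.
have sa : smooth_chart a by exact: chart_at_smooth.
have sb : smooth_chart b by exact: chart_at_smooth.
have db : cdom b x' by exact: chart_at_dom.
have D := smooth_curve_derive sc sb db; rewrite transition_id // mulmx1 in D.
have D2 : differentiable (cmap a \o iota \o cinv b) (cmap b x').
  apply: (smooth_on_differentiable (smooth_map_chart openT si sb sa)).
  by exists x' => //; split=> //; exact: chart_at_dom.
have E := is_derive_curve_comp D D2.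
rewrite mul_jacobian // /velocity derive1E -/x' -/a.
apply: (@derive_val _ _ _ _ _ _ _ (near_eq_is_derive _ E)).
near=> s; have ds : cdom b (c s) by near: s; apply: curve_in_chart => //; exact: cc.
by rewrite /= cmapK.
Unshelve. all: by end_near. Qed.

End PushTangent.

Section NormalFrames.
Context {R : realType} {m d : nat} {M : manifold R m} {C : manifold R d}.
Variables (f : M -> R) (iota : C -> M) (lam : nat).
Variables (A : set (chart R m M)) (pi : M -> C) (T : set M).
Hypotheses (emb : embedding iota) (tb : tube f iota lam A pi T).
Hypothesis dm : (d <= m)%N.
Hypothesis dl : (d + lam <= m)%N.

Notation adapted := (adapted A T).
Notation normal_block := (@normal_block m d lam).

Lemma push_normal_free a n chi x s (B : 'M[R]_(s, d)) : (a + n <= m)%N -> (d <= a)%N ->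
  adapted chi -> cdom chi (iota x) -> row_free B -> row_free (col_mx (B *m mdiff iota x) (nblock a n *m chart_frame chi (iota x))).
Proof.
move=> am da ad dx Bf; have [phiC cc] := core_chart_exists emb tb dm ad.
have [sp dC _ _] := cc; have dxC := (dC x).2 dx.
have Fu := chart_frame_unit sp dxC.
have e : B *m mdiff iota x = B *m invmx (chart_frame phiC x) *m Emx *m chart_frame chi (iota x).
  by rewrite -(mulmxA _ Emx) -(core_frame emb tb ad cc dx) !mulmxA mulmxKV.
rewrite e -mul_col_mx /row_free mxrankMfree ?row_free_unit; last first.
  exact: (chart_frame_unit (adapted_smooth ad) dx).
apply: row_free_col => u v uv.
have u0 : u = 0.
  have := congr1 (mulmx^~ (pid_mx d : 'M[R]_(m, d))) uv.
  rewrite mulmxDl -(mulmxA v) nblock_res // mulmx0 addr0 mul0mx !mulmxA.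
  rewrite -[X in X = 0 -> _]/(res (ext (u *m B *m invmx (chart_frame phiC x)))) (extK dm).
  move=> /(congr1 (mulmx^~ (chart_frame phiC x))); rewrite mulmxKV // mul0mx.
  exact: row_free_inj.
by split=> //; move: uv; rewrite u0 mul0mx add0r; exact: row_free_inj (nblock_free am).
Qed.

Section OneBlock.
Variables (a n : nat).
Hypothesis nb : normal_block a (a + n).

Lemma normal_le : (a + n <= m)%N /\ (d <= a)%N.
Proof. by case: nb => -[-> ->]; split=> //; exact: leq_addr. Qed.

Lemma transition_block chi chi' x v : adapted chi -> adapted chi' ->
  cdom chi (iota x) -> cdom chi' (iota x) -> block a (a + n) v = v ->
  block a (a + n) (v *m transition chi chi' (iota x)) = v *m transition chi chi' (iota x).
Proof.
move=> ad ad' dx dx' bv; set z0 := cmap chi (iota x).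
have s1 := adapted_smooth ad; have s2 := adapted_smooth ad'.
have D0 := transition_differentiable s1 s2 dx dx'; rewrite -/z0 in D0.
have [K [r0 [K0 r00 Hc]]] := fibre_change tb dl nb ad ad' dx dx'.
(* The image of the line z0 + s v stays in an affine fibre of the other chart. *)
have D : is_derive (0 : R) (1 : R) (fun s => (cmap chi' \o cinv chi) (z0 + s *: v))
    (v *m transition chi chi' (iota x)).
  rewrite mul_jacobian // -/z0.
  have D0' : differentiable (cmap chi' \o cinv chi) (z0 + 0 *: v) by rewrite scale0r addr0.
  by have := is_derive_along_line D0'; rewrite scale0r addr0.
apply/rowP => i; rewrite mxE; case: ifP => // ab.
have Di := is_derive_entry 0 i D.
have Dc : is_derive (0 : R) (1 : R)
    (fun s => (cmap chi' \o cinv chi) (z0 + s *: v) 0 i) 0.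
  apply: (near_eq_is_derive _ (is_derive_cst (cmap chi' (iota x) 0 i) (0 : R) (1 : R))).
  have cv : {for (0 : R), continuous (fun s : R => s *: v)} by apply: cvgZr_tmp; exact: cvg_id.
  have : \forall s \near (0 : R), `|s *: v| < r0.
    apply: (cv [set u | `|u| < r0]); apply: open_nbhs_nbhs; split; last by rewrite /= scale0r normr0.
    apply: (@open_comp _ _ (fun u : 'rV[R]_m => `|u|) [set y | y < r0]); last exact: open_lt.
    by move=> u _; exact: norm_continuous.
  apply: filterS => s sr; rewrite /cst /=.
  have bs : block a (a + n) (s *: v) = s *: v by rewrite blockZ bv.
  have [_ [_ [w' [bw' _ ->]]]] := Hc _ bs sr.
  by rewrite [RHS]mxE -bw' [X in _ + X]mxE ab addr0.
by rewrite -(@derive_val _ _ _ _ _ _ _ Di) (@derive_val _ _ _ _ _ _ _ Dc).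
Qed.

(** The fibres of the tube are linear in every chart, so that changing the chart
    recombines the normal coordinate vectors of either sign among themselves. *)
Lemma normal_frame_change chi chi' x : adapted chi -> adapted chi' ->
  cdom chi (iota x) -> cdom chi' (iota x) -> exists2 Q : 'M[R]_n, Q \in unitmx &
  nblock a n *m chart_frame chi (iota x) = Q *m (nblock a n *m chart_frame chi' (iota x)).
Proof.
move=> ad ad' dx dx'; have s1 := adapted_smooth ad; have s2 := adapted_smooth ad'.
have /submxP[Q eQ] : (nblock a n *m transition chi chi' (iota x) <= (nblock a n : 'M[R]_(n, m)))%MS.
  apply/row_subP => i; rewrite row_mul; apply: nblock_sub.
  by apply: transition_block => //; rewrite rowE; exact: block_nblock.
exists Q; last by rewrite mulmxA -eQ (chart_frame_comp s1 s2 dx dx') mulmxA.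
have [am _] := normal_le.
rewrite -row_free_unit /row_free -(mxrankMfree Q (nblock_free am)) -eQ.
by rewrite mxrankMfree ?row_free_unit ?transition_unit //; exact: nblock_free.
Qed.

Lemma disc_tangent W chi x r v : adapted chi -> cdom chi (iota x) -> 0 < r ->
  disc iota a (a + n) W chi x r -> block a (a + n) v = v ->
  tangent W (iota x) (v *m chart_frame chi (iota x)).
Proof.
move=> ad dx r0 H bv; have v1 : 0 < 1 + `|v| by rewrite ltr_pwDl.
apply: (line_tangent (r := r / (1 + `|v|)) (adapted_smooth ad) dx).
  exact: divr_gt0.
move=> s; rewrite ltr_pdivlMr // => sr; apply: H; first by rewrite blockZ bv.
rewrite normrZ; apply: le_lt_trans sr.
by rewrite ler_wpM2l // lerDr.
Qed.

(** The two families of tangent vectors are independent and as many as the dimension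
    of W1, so that it is enough to know that they are tangent. *)
Lemma frame_normal (W0 : set C) (W1 : set M) chi x s (B : 'M[R]_(s, d))
    (B1 : 'M[R]_(s + n, m)) r : adapted chi -> cdom chi (iota x) ->
  (forall y, W0 y -> W1 (iota y)) -> 0 < r -> disc iota a (a + n) W1 chi x r ->
  frame W1 (iota x) B1 -> frame W0 x B ->
  frame W1 (iota x) (col_mx (B *m mdiff iota x) (nblock a n *m chart_frame chi (iota x))).
Proof.
move=> ad dx W01 r0 H F1 F; apply: frame_of_dim F1 _ _.
  have [am da] := normal_le; exact: (push_normal_free am da ad dx F.1).
move=> i; case: (split_ordP i) => j ->.
  rewrite rowKu row_mul; apply: (push_tangent emb W01); exact: frame_row.
rewrite rowKd row_mul; apply: (disc_tangent ad dx r0 H).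
by rewrite rowE; exact: block_nblock.
Qed.

End OneBlock.

End NormalFrames.

Section CoreHessian.
Context {R : realType} {m d : nat} {M : manifold R m} {C : manifold R d}.
Variables (f : M -> R) (iota : C -> M) (lam : nat).
Variables (A : set (chart R m M)) (pi : M -> C) (T : set M).
Hypotheses (emb : embedding iota) (tb : tube f iota lam A pi T).
Hypothesis dm : (d <= m)%N.
Hypotheses (sf : smooth_fun f) (cf : forall x, crit f (iota x)).

(** The gradient of f vanishes along C. *)
Lemma core_hess x : mdiff iota x *m hess f (iota x) = 0.
Proof.
have [chi [phiC [ad cc dx]]] := core_chart_at emb tb dm x.
have sc := adapted_smooth ad; have [sp dC mC _] := cc; have dxC := (dC x).2 dx.
have Fu := chart_frame_unit sc dx; have FCu := chart_frame_unit sp dxC.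
have oI := @cimg_open _ _ _ chi; have Iz := cimg_cmap dx.
have sF := smooth_fun_chart sf sc.
set z0 := cmap chi (iota x) in Iz.
have H (u : 'rV[R]_d) : ext u *m hessm (f \o cinv chi) z0 = 0.
  have [df <-] := derive_drow (ext u) oI Iz sF.
  have df' : differentiable (drow (f \o cinv chi)) (z0 + 0 *: (ext u : 'rV[R]_m)).
    by rewrite scale0r addr0.
  have := is_derive_along_line df'; rewrite scale0r addr0 => D.
  have D0 : is_derive (0 : R) (1 : R)
      (fun s => drow (f \o cinv chi) (z0 + s *: (ext u : 'rV[R]_m))) 0.
    apply: (near_eq_is_derive _ (is_derive_cst (0 : 'rV[R]_m) (0 : R) (1 : R))).
    have cl : {for (0 : R), continuous (fun s : R => z0 + s *: (ext u : 'rV[R]_m))}.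
      exact: is_derive_continuous (is_derive_line z0 (ext u) 0).
    have : \forall s \near (0 : R), cimg chi (z0 + s *: (ext u : 'rV[R]_m)).
      by apply: cl; rewrite scale0r addr0; exact: cimg_near.
    apply: filterS => s iz; rewrite /cst; apply/esym.
    have dy := cimg_cdom iz.
    have [v0 w0] := core_parts tb ad dx; rewrite -/z0 in v0 w0.
    have [y _ ey] : range iota (cinv chi (z0 + s *: (ext u : 'rV[R]_m))).
      apply/(adapted_core tb ad dy); rewrite cinvK //.
      have ve : block d (d + lam) (ext u : 'rV[R]_m) = 0 := vpart_ext lam u.
      have we : block (d + lam) m (ext u : 'rV[R]_m) = 0 := wpart_ext lam u.
      split; apply: (etrans (blockD _ _ _ _)); rewrite blockZ.
        by rewrite (v0 : block d (d + lam) z0 = 0) ve scaler0 addr0.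
      by rewrite (w0 : block (d + lam) m z0 = 0) we scaler0 addr0.
    rewrite -(cinvK iz) -ey dfun_chart ?ey //.
    by rewrite -ey (cf y : dfun f (iota y) = 0) mul0mx.
  by rewrite -(@derive_val _ _ _ _ _ _ _ D) (@derive_val _ _ _ _ _ _ _ D0).
have E : Emx *m hessm (f \o cinv chi) z0 = 0 :> 'M[R]_(d, m).
  by apply: rV_mul_eq => u; rewrite mulmx0 mulmxA; exact: H.
rewrite (hess_chart sf sc dx (cf x)) !mulmxA -(core_frame emb tb ad cc dx) in E.
have Ft : (chart_frame chi (iota x))^T \in unitmx by rewrite unitmx_tr.
have := congr1 (fun X => X *m invmx (chart_frame chi (iota x))^T) E.
rewrite mulmxK // mul0mx -mulmxA => /(congr1 (fun X => invmx (chart_frame phiC x) *m X)).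
by rewrite mulKmx // mulmx0.
Qed.

(** The Hessian vanishes on the tangent space of the core, which therefore meets
    every subspace on which it is negative definite in 0. *)
Lemma core_index_le x : neg_index (hess f (iota x)) lam -> (d + lam <= m)%N.
Proof.
move=> [[B neg] _]; have [_ _ Df _] := emb.
suff : row_free (col_mx B (mdiff iota x)).
  by move=> /eqP e; rewrite addnC -e; exact: rank_leq_col.
apply: row_free_col => a b ab.
have a0 : a = 0.
  apply: contrapT => /eqP nz; have := neg a nz.
  have e : a *m B = (- b) *m mdiff iota x by rewrite mulNmx; apply/eqP; rewrite -addr_eq0 ab.
  have z : a *m B *m hess f (iota x) = 0 by rewrite e -mulmxA core_hess mulmx0.
  by rewrite z mul0mx mxE ltxx.
by split=> //; move: ab; rewrite a0 mul0mx add0r; exact: row_free_inj (Df x).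
Qed.

End CoreHessian.

Section CoreFrames.
Context {R : realType} {m d : nat} {M : manifold R m} {C : manifold R d}.
Variables (f : M -> R) (iota : C -> M) (lam : nat).
Variables (A : set (chart R m M)) (pi : M -> C) (T : set M).
Hypotheses (emb : embedding iota) (tb : tube f iota lam A pi T).
Variables (G : M -> 'M[R]_m).
Hypothesis iso : forall phi y, A phi -> T y -> cdom phi y -> chart_metric G phi y = 1%:M.
Hypothesis dm : (d <= m)%N.
Variables (fC : C -> R) (h : M -> R) (eps : R).
Hypotheses (sfC : smooth_fun fC) (sh : smooth_fun h) (eps0 : 0 < eps).
Hypothesis hE : forall y, T y -> h y = f y + eps * fC (pi y).
Variable w : nat.
Hypothesis dlw : (d + lam + w = m)%N.
Hypothesis posG : metric_pos G.

Notation adapted := (adapted A T).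
Notation Gc := (pullback_metric iota G).

Let dl : (d + lam <= m)%N. Proof. by rewrite -dlw leq_addr. Qed.

Lemma wblock_normal : @normal_block m d lam (d + lam) (d + lam + w).
Proof. by right; rewrite dlw. Qed.

Lemma vblock_normal : @normal_block m d lam d (d + lam).
Proof. by left. Qed.

Lemma gfieldN (n : nat) (N : manifold R n) (g : N -> R) phi z : smooth_fun g ->
  smooth_chart phi -> cimg phi z -> gfield (fun y => - g y) phi z = - gfield g phi z.
Proof.
move=> sg sp iz; rewrite /gfield; congr (- _).
apply: drowN; exact: smooth_on_differentiable (smooth_fun_chart sg sp) iz.
Qed.

Lemma field_normal chi phiC x u : adapted chi -> core_chart iota pi chi phiC ->
  cdom chi (iota x) -> res (d := d) u = 0 -> cimg chi (cmap chi (iota x) + u) ->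
  gfield h chi (cmap chi (iota x) + u) =
    2 *: block d (d + lam) u - 2 *: block (d + lam) m u +
    eps *: ext (gfield fC phiC (cmap phiC x)).
Proof.
move=> ad cc dx ru iz; have dy := cimg_cdom iz.
have E := field_h tb dm sfC hE ad cc dy; rewrite (cinvK iz) in E; rewrite E.
have [v0 w0] := core_parts tb ad dx; have [_ _ mC _] := cc.
have -> : res (cmap chi (iota x) + u) = cmap phiC x.
  by rewrite mC -[RHS]addr0 -ru /res mulmxDl.
have -> : vpart (d := d) lam (cmap chi (iota x) + u) = block d (d + lam) u.
  by rewrite -[RHS]add0r -v0; exact: blockD.
have -> : wpart (d := d) lam (cmap chi (iota x) + u) = block (d + lam) m u.
  by rewrite -[RHS]add0r -w0; exact: blockD.
exact: erefl.
Qed.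

Lemma contracting_w chi phiC x u : adapted chi -> core_chart iota pi chi phiC ->
  cdom chi (iota x) -> block (d + lam) (d + lam + w) u = u ->
  cimg chi (cmap chi (iota x) + u) ->
  gfield h chi (cmap chi (iota x) + u) = eps *: ext (gfield fC phiC (cmap phiC x)) - 2 *: u.
Proof.
rewrite dlw => ad cc dx bu iz; rewrite (field_normal ad cc dx _ iz); last first.
  by rewrite -bu; apply: res_block; exact: leq_addr.
have -> : block d (d + lam) u = 0 by rewrite -bu; apply: block_disjoint; rewrite leqnn.
by rewrite bu scaler0 sub0r addrC.
Qed.

Lemma contracting_v chi phiC x u : adapted chi -> core_chart iota pi chi phiC ->
  cdom chi (iota x) -> block d (d + lam) u = u -> cimg chi (cmap chi (iota x) + u) ->
  gfield (fun y => - h y) chi (cmap chi (iota x) + u) =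
    eps *: ext (gfield (fun y => - fC y) phiC (cmap phiC x)) - 2 *: u.
Proof.
move=> ad cc dx bu iz; rewrite (gfieldN sh (adapted_smooth ad) iz).
have [sp dC _ _] := cc; have ix := cimg_cmap ((dC x).2 dx).
rewrite (gfieldN sfC sp ix) (field_normal ad cc dx _ iz); last first.
  by rewrite -bu; exact: res_block.
have -> : block (d + lam) m u = 0 by rewrite -bu; apply: block_disjoint; rewrite leqnn orbT.
have -> : ext (- gfield fC phiC (cmap phiC x)) = - (ext (gfield fC phiC (cmap phiC x)) : 'rV[R]_m).
  exact: mulNmx.
by rewrite bu scaler0 subr0 scalerN opprD addrC.
Qed.

Lemma grad_push x : grad G h (iota x) = eps *: (grad Gc fC x *m mdiff iota x).
Proof.
have [chi [phiC [ad cc dx]]] := core_chart_at emb tb dm x.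
have [sp dC _ _] := cc; have dxC := (dC x).2 dx.
rewrite (grad_flat sh (adapted_flat tb iso ad) dx).
rewrite (grad_flat sfC (core_flat emb tb iso dm ad cc) dxC).
rewrite -mulmxA (core_frame emb tb ad cc dx) mulmxA scalemxAl.
congr (_ *m _); apply: oppr_inj.
have iz : cimg chi (cmap chi (iota x) + 0) by rewrite addr0; exact: cimg_cmap.
have := field_normal ad cc dx (mul0mx _ _) iz.
by rewrite addr0 !block0 !scaler0 subrr add0r /gfield => ->; rewrite /ext mulNmx scalerN.
Qed.

Lemma Gc_pos : metric_pos Gc.
Proof.
case: posG => sym pos; split=> x.
  by rewrite /pullback_metric !trmx_mul trmxK sym mulmxA.
move=> v v0; have [_ _ Df _] := emb.
have := pos (iota x) (v *m mdiff iota x); rewrite /inner /pullback_metric trmx_mul !mulmxA.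
apply; apply: contra v0 => /eqP e; apply/eqP; exact: row_free_inj (Df x) e.
Qed.

Lemma core_flat_at x : exists2 phiC, flat Gc phiC & cdom phiC x.
Proof.
have [chi [phiC [ad cc dx]]] := core_chart_at emb tb dm x.
by exists phiC; [exact: (core_flat emb tb iso dm ad cc)|have [_ dC _ _] := cc; apply/dC].
Qed.

Lemma flat_at_core x : exists2 phi, flat G phi & cdom phi (iota x).
Proof.
have [chi [phiC [ad cc dx]]] := core_chart_at emb tb dm x.
by exists chi => //; exact: (adapted_flat tb iso ad).
Qed.

Lemma Ws_push p x : Ws Gc fC p x -> Ws G h (iota p) (iota x).
Proof.
move=> [c [c0 ceq cl]]; exists (fun t => iota (c (eps * t))); split.
- by rewrite mulr0 c0.
- move=> t t0; apply: (curve_push emb tb iso dm sfC sh hE).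
  by apply: ceq; rewrite mulr_ge0 // ltW.
- apply: (@continuous_cvg _ _ _ _ _ (fun t => c (eps * t)) iota); first exact: iota_continuous.
  exact: cvg_scale_pinfty.
Qed.

Lemma Wu_push p x : Wu Gc fC p x -> Wu G h (iota p) (iota x).
Proof.
move=> [c [c0 ceq cl]]; exists (fun t => iota (c (eps * t))); split.
- by rewrite mulr0 c0.
- move=> t t0; apply: (curve_push emb tb iso dm sfC sh hE).
  by apply: ceq; rewrite mulr_ge0_le0 // ltW.
- apply: (@continuous_cvg _ _ _ _ _ (fun t => c (eps * t)) iota); first exact: iota_continuous.
  exact: cvg_scale_ninfty.
Qed.

Hypotheses (mC : morse fC) (mh : morse h).

Lemma Ws_slices_core p k : index_is Gc fC p k -> exists2 s, (s + k = d)%N &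
  forall x, Ws Gc fC p x -> exists chi, cdom chi x /\ slice_chart (Ws Gc fC p) s chi.
Proof.
move=> ip; have [phi fl dp] := core_flat_at p.
have [s [sk [chi [dc sl]]]] := stable_dimension Gc_pos sfC fl dp (mC.2 _ ip.1) ip.
exists s => // x [c [<- ceq cl]].
apply: (Ws_slice sfC ceq cl); last by exists chi.
by move=> t _; exact: core_flat_at.
Qed.

(** Near C_j the metric is Euclidean in suitable charts, so that the stable manifold
    theorem applies along trajectories in C_j. *)
Lemma Ws_slices p n : index_is G h (iota p) n -> exists2 s, (s + n = m)%N &
  forall x, Ws Gc fC p x ->
    exists chi, cdom chi (iota x) /\ slice_chart (Ws G h (iota p)) s chi.
Proof.
move=> ip; have [phi fl dp] := flat_at_core p.
have [s [sk [chi [dc sl]]]] := stable_dimension posG sh fl dp (mh.2 _ ip.1) ip.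
exists s => // x [c [<- ceq cl]].
have e : iota (c 0) = (fun t => iota (c (eps * t))) 0 by rewrite /= mulr0.
rewrite e; apply: (Ws_slice (c := fun t => iota (c (eps * t))) sh); last by exists chi.
- move=> t t0; apply: (curve_push emb tb iso dm sfC sh hE).
  by apply: ceq; rewrite mulr_ge0 // ltW.
- apply: (@continuous_cvg _ _ _ _ _ (fun t => c (eps * t)) iota); first exact: iota_continuous.
  exact: cvg_scale_pinfty.
- by move=> t _; exact: flat_at_core.
Qed.

Definition vrows chi x : 'M[R]_(lam, m) := nblock d lam *m chart_frame chi (iota x).
Definition wrows chi x : 'M[R]_(w, m) := nblock (d + lam) w *m chart_frame chi (iota x).

Section Frames.
Variables (p : C) (k : nat).
Hypotheses (ip : index_is Gc fC p k) (iip : index_is G h (iota p) (k + lam)).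

Lemma Ws_frame_size x s (B : 'M[R]_(s, d)) : Ws Gc fC p x -> frame (Ws Gc fC p) x B ->
  (s + k = d)%N.
Proof.
move=> Wx F; have [s' e H] := Ws_slices_core ip; have [chi [dc sl]] := H x Wx.
by rewrite (frame_dim F (slice_frame sl Wx dc)).
Qed.

(** The dimensions add up because stable and unstable dimensions are complementary
    and passing from f_j to h raises the index by lam; the normal vectors are
    tangent by [fibre_disc]. *)
Lemma Ws_frame x chi s (B : 'M[R]_(s, d)) : Ws Gc fC p x -> adapted chi ->
  cdom chi (iota x) -> frame (Ws Gc fC p) x B ->
  frame (Ws G h (iota p)) (iota x) (col_mx (B *m mdiff iota x) (wrows chi x)).
Proof.
move=> Wx ad dx F; have e := Ws_frame_size Wx F.
have [s' e' H] := Ws_slices iip; have [psi [dpsi sl]] := H x Wx.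
have es : s' = (s + w)%N.
  by apply/eqP; rewrite -(eqn_add2r (k + lam)) e' -dlw -e -(addnA s k) addnAC.
have F1 := slice_frame sl (Ws_push Wx) dpsi; move: F1; rewrite es => F1.
have [c [c0 ceq cl]] := Wx; have dx' : cdom chi (iota (c 0)) by rewrite c0.
have [r r0 D] := fibre_disc emb tb iso dm dl sh sfC eps0 wblock_normal contracting_w ceq cl ad dx'.
rewrite c0 in D.
exact: (frame_normal emb tb dm dl wblock_normal ad dx (@Ws_push p) r0 D F1 F).
Qed.

Lemma Wu_frame x chi (B : 'M[R]_(k, d)) : Wu Gc fC p x -> adapted chi ->
  cdom chi (iota x) -> frame (Wu Gc fC p) x B ->
  frame (Wu G h (iota p)) (iota x) (col_mx (B *m mdiff iota x) (vrows chi x)).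
Proof.
move=> Wx ad dx F; have [psi [dpsi sl]] := iip.2 _ (Wu_push Wx).
have F1 := slice_frame sl (Wu_push Wx) dpsi.
have : Ws Gc (fun y => - fC y) p x by rewrite Wu_opp.
move=> [c [c0 ceq cl]]; have dx' : cdom chi (iota (c 0)) by rewrite c0.
have [r r0 D] := fibre_disc emb tb iso dm dl (smooth_funN sh) (smooth_funN sfC) eps0
  vblock_normal contracting_v ceq cl ad dx'.
rewrite c0 in D; rewrite Wu_opp // in D.
exact: (frame_normal emb tb dm dl vblock_normal ad dx (@Wu_push p) r0 D F1 F).
Qed.

End Frames.

End CoreFrames.

(** * Orientations *)

Section Bases.
Context {R : realType}.

Lemma row_free_complete s k d (N : 'M[R]_(s, d)) : (s + k)%N = d -> row_free N ->
  exists Nc : 'M[R]_(k, d), row_free (col_mx N Nc).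
Proof.
move=> e /eqP rN.
have rk : \rank (N^C)%MS = k by rewrite mxrank_compl rN -e addKn.
suff [Nc eN] : exists Nc : 'M[R]_(k, d), (Nc :=: N^C)%MS.
  exists Nc; rewrite /row_free -addsmxE (adds_eqmx (eqmx_refl N) eN) e.
  exact: (addsmx_compl_full N).
have E := eq_row_base (N^C)%MS; move: (row_base (N^C)%MS) E; rewrite rk => Nc E.
by exists Nc.
Qed.

Lemma row_free_unitr n d (N : 'M[R]_(n, d)) (P : 'M_d) : P \in unitmx ->
  row_free (N *m P) = row_free N.
Proof. by move=> Pu; rewrite /row_free mxrankMfree // row_free_unit. Qed.

Lemma col_mx_left_inj s k d (S : 'M[R]_(s, d)) (U : 'M[R]_(k, d)) r
    (a : 'M[R]_(r, s)) (b : 'M[R]_(r, k)) : row_free (col_mx S U) ->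
  a *m S + b *m U = 0 -> a = 0 /\ b = 0.
Proof.
move=> F; rewrite -mul_row_col => H.
have : row_mx a b = 0.
  apply/row_matrixP => i; rewrite row0; apply: row_free_inj F _.
  by rewrite -row_mul H row0.
by rewrite -row_mx0 => /eq_row_mx.
Qed.

Lemma block_change s k d (S : 'M[R]_(s, d)) (U : 'M[R]_(k, d)) (P : 'M_s) (X : 'M_(k, s)) (Y : 'M_k) :
  col_mx (P *m S) (X *m S + Y *m U) = block_mx P 0 X Y *m col_mx S U.
Proof. by rewrite mul_block_col mul0mx addr0. Qed.

(** Modulo the span of S both U and U' are bases, whence Y is invertible. *)
Lemma complement_change s k d (S : 'M[R]_(s, d)) (U U' : 'M[R]_(k, d)) (P : 'M_s) :
  (s + k)%N = d -> row_free (col_mx S U) -> row_free (col_mx (P *m S) U') ->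
  exists (X : 'M_(k, s)) (Y : 'M_k), Y \in unitmx /\ U' = X *m S + Y *m U.
Proof.
move=> e F F'.
have /submxP[Z eZ] : (U' <= col_mx S U)%MS.
  by apply: submx_full; rewrite /row_full (eqP F) e.
exists (lsubmx Z), (rsubmx Z).
have eU : U' = lsubmx Z *m S + rsubmx Z *m U by rewrite -mul_row_col hsubmxK.
split=> //; move: F'; rewrite eU block_change /row_free mxrankMfree // => Z1.
have : block_mx P 0 (lsubmx Z) (rsubmx Z) \in unitmx by rewrite -row_free_unit.
by rewrite !unitmxE det_lblock unitrM => /andP[].
Qed.

Lemma complete_row k d (v : 'rV[R]_d) (B : 'M[R]_(1 + k, d)) : v != 0 -> (v <= B)%MS ->
  exists (P : 'M[R]_(1 + k)) (U : 'M[R]_(k, d)), P \in unitmx /\ col_mx v U = P *m B.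
Proof.
move=> v0 /submxP[a ea].
have af : row_free a.
  rewrite /row_free rank_rV; have [a0|//] := eqVneq a 0.
  by move: v0; rewrite ea a0 mul0mx eqxx.
have [Y F] := row_free_complete (erefl (1 + k)%N) af.
by exists (col_mx a Y), (Y *m B); rewrite -row_free_unit mul_col_mx -ea.
Qed.

Lemma row_free_near (X : topologicalType) n d (N : X -> 'M[R]_(n, d)) x :
  (forall i j, {for x, continuous (fun y => N y i j)}) -> row_free (N x) ->
  \forall y \near x, row_free (N y).
Proof.
move=> cN /row_freeP[K e].
have cP i j : {for x, continuous (fun y => (N y *m K) i j)}.
  by apply: mulmx_entry_continuous => // a b; exact: cst_continuous.
have cd := det_continuous cP.
have : \forall y \near x, \det (N y *m K) != 0.
  apply: (cd [set a | a != 0]); apply: open_nbhs_nbhs; split; first exact: open_neq.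
  by rewrite /= e det1 oner_neq0.
apply: filterS => y; rewrite -unitfE -unitmxE => u.
by apply/row_freeP; exists (K *m invmx (N y *m K)); rewrite mulmxA mulmxV.
Qed.

Lemma neg_block s k (P : 'M[R]_s) (X : 'M_(k, s)) (Y : 'M[R]_k) : P \in unitmx -> Y \in unitmx ->
  (\det (block_mx P 0 X Y) < 0) = (\det P < 0) (+) (\det Y < 0).
Proof.
rewrite !unitmxE !unitfE det_lblock => P0 Y0.
have [Pn|Pp|Pe] := ltgtP (\det P) 0; last by rewrite Pe eqxx in P0.
  by rewrite nmulr_rlt0 // addTb -leNgt le_eqVlt eq_sym (negbTE Y0).
by rewrite pmulr_rlt0 // addFb.
Qed.

End Bases.

Section Signs.
Context {R : realType} {m : nat} {M : manifold R m}.
Implicit Types (G : M -> 'M[R]_m) (g : M -> R) (p q x : M) (W : set M) (o : frame_sign M).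

Lemma orientation_block W s k o x (S : 'M[R]_(s, m)) (U : 'M[R]_(k, m)) P X Y :
  orientation W (s + k) o -> W x -> frame W x (col_mx S U) ->
  P \in unitmx -> Y \in unitmx ->
  o (s + k)%N x (col_mx (P *m S) (X *m S + Y *m U)) =
  o (s + k)%N x (col_mx S U) (+) (\det P < 0) (+) (\det Y < 0).
Proof.
move=> [or _] Wx F Pu Yu; rewrite block_change or //; last first.
  by move: Pu Yu; rewrite !unitmxE det_lblock unitrM => -> ->.
by rewrite neg_block // addbA.
Qed.

Lemma frame_setT n x (B : 'M[R]_(n, m)) : n = m -> row_free B -> frame [set: M] x B.
Proof.
move=> e F; split=> // v; split=> _; first by apply: submx_full; rewrite /row_full (eqP F) e.
subst n; have s := chart_at_smooth x; have dx := chart_at_dom x.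
have [|F2 H] := @slice_frame _ _ _ [set: M] m (chart_at x) x _ I dx.
  by split=> // y _; split=> // _ i; rewrite leqNgt ltn_ord.
by apply/H; apply: submx_full; rewrite /row_full (eqP F2).
Qed.

Lemma slice_setT n (phi : chart R m M) : n = m -> smooth_chart phi ->
  slice_chart [set: M] n phi.
Proof. by move=> -> sp; split=> // y _; split=> // _ i; rewrite leqNgt ltn_ord. Qed.

(** A property that is locally constant on a stable manifold propagates from the
    critical point along the trajectories that converge to it. *)
Lemma Ws_constant G g p (Q : M -> Prop) :
  (forall y0, Ws G g p y0 -> \forall y \near y0, Ws G g p y -> (Q y <-> Q y0)) ->
  crit g p -> Q p -> forall y, Ws G g p y -> Q y.
Proof.
move=> loc cp Qp y [c [<- ceq cl]].
have Wc := Ws_forward ceq cl.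
apply: (backward_induction (P := fun t => Q (c t))).
  have [r [_ Hr]] := cl _ (loc p (Ws_self _ cp)).
  have m0 : 0 <= Num.max 0 (r + 1) by rewrite le_max lexx.
  exists (Num.max 0 (r + 1)) => //.
  by apply: (Hr _ _ (Wc _ m0)).2 => //; rewrite lt_max ltrDl ltr01 orbT.
move=> t0 t00; have /(_ _ (loc _ (Wc _ t00))) := grad_eq_continuous (ceq t0 t00).
move=> /nbhs_ballP[a a0 Ha]; exists a => // s s' s0 ss' sa s'a Qs'.
have inb u : `|u - t0| < a -> Ws G g p (c u) -> (Q (c u) <-> Q (c t0)).
  by move=> ua; apply: Ha; rewrite -ball_normE /= distrC.
apply/(inb s sa (Wc _ s0)); apply/(inb s' s'a (Wc _ (le_trans s0 ss'))).
exact: Qs'.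
Qed.

Lemma Wu_constant G g p (Q : M -> Prop) : smooth_fun g ->
  (forall y0, Wu G g p y0 -> \forall y \near y0, Wu G g p y -> (Q y <-> Q y0)) ->
  crit g p -> Q p -> forall y, Wu G g p y -> Q y.
Proof.
move=> sg loc cp Qp y; rewrite -(Wu_opp _ _ sg).
apply: (@Ws_constant G (fun x => - g x) p Q) => //; first by rewrite Wu_opp.
by rewrite /crit /= dfunN // cp oppr0.
Qed.

Lemma flow_curve_Ws G g p c t : flow_curve G g c -> c t @[t --> +oo] --> p -> Ws G g p (c t).
Proof.
move=> fc cl; exists (fun s => c (s + t)); split=> [|s s0|]; first by rewrite add0r.
- exact: grad_eq_shift.
- exact: cvg_shift_pinfty.
Qed.

Lemma flow_curve_Wu G g q c t : smooth_fun g -> flow_curve G g c ->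
  c t @[t --> -oo] --> q -> Wu G g q (c t).
Proof.
move=> sg fc cl; rewrite -(Wu_opp _ _ sg) -[t]opprK.
apply: (@flow_curve_Ws _ _ _ (fun s => c (- s))) => [s|].
  by apply: grad_eq_opp.
exact/cvgNy_compNP.
Qed.

(** The velocity of a flow line that lies in W is tangent to W. *)
Lemma frame_curve G g W c t k (B : 'M[R]_(k, m)) phi : flow_curve G g c ->
  (forall s, W (c s)) -> slice_chart W k phi -> cdom phi (c t) -> frame W (c t) B ->
  (- grad G g (c t) <= B)%MS.
Proof.
move=> fc Wc sl dc F; have /grad_eqP[cc D] := fc t.
have H : (- grad G g (c t) <= (pid_mx k : 'M[R]_(k, m)) *m chart_frame phi (c t))%MS.
  have nW : \forall s \near t, W (c s) by apply: filterE => s; exact: Wc.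
  exact: curve_slice_span sl dc cc nW D.
apply: (submx_trans H); apply: (frame_le F) => i.
exact: frame_row (slice_frame sl (Wc t) dc).
Qed.

Lemma transverse_free G g p q x s k (Bs : 'M[R]_(s, m)) (B : 'M[R]_(k, m)) :
  morse_smale G g -> crit g p -> crit g q -> Wu G g q x -> Ws G g p x ->
  frame (Ws G g p) x Bs -> frame (Wu G g q) x B -> row_full (col_mx Bs B).
Proof.
move=> [_ tr] cp cq Wq Wp Fs F; rewrite -sub1mx; apply/row_subP => i.
have [a [b [/F.2 ha /Fs.2 hb ->]]] := tr p q x cp cq Wq Wp (row i 1%:M).
by rewrite -addsmxE addmx_sub // ?(submx_trans ha (addsmxSr _ _)) // (submx_trans hb (addsmxSl _ _)).
Qed.

(** A change of the basis Bs changes two of the three signs. So does a change of Bu,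
    which is determined up to multiples of v; these do not change the sign of
    (Bs, Bu) because v lies in the span of Bs. *)
Lemma sign_indep G g p q x s k (oM : frame_sign M) (ou os : M -> frame_sign M)
    (Bs Bs' : 'M[R]_(s, m)) (Bu Bu' : 'M[R]_(k, m)) (v : 'rV[R]_m) : (s + k)%N = m ->
  orientation [set: M] (s + k) oM -> orientation (Ws G g p) s (os p) ->
  orientation (Wu G g q) (1 + k) (ou q) -> Ws G g p x -> Wu G g q x ->
  frame (Ws G g p) x Bs -> frame (Ws G g p) x Bs' ->
  frame (Wu G g q) x (col_mx v Bu) -> frame (Wu G g q) x (col_mx v Bu') ->
  (v <= Bs)%MS -> row_free (col_mx Bs Bu) ->
  oM (s + k)%N x (col_mx Bs' Bu') (+) os p s x Bs' (+) ou q (1 + k)%N x (col_mx v Bu') =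
  oM (s + k)%N x (col_mx Bs Bu) (+) os p s x Bs (+) ou q (1 + k)%N x (col_mx v Bu).
Proof.
move=> e orM ors oru Wp Wq Fs Fs' F F' /submxP[a ea] BF.
have [P Pu eP] := frame_change Fs Fs'; have [Z Zu eZ] := frame_change F F'.
move: (eZ); rewrite -{1}(submxK Z) mul_block_col => /eq_col_mx[eZ1 eZ2].
have [u1 u2] : ulsubmx Z - 1%:M = 0 /\ ursubmx Z = 0.
  by apply: (col_mx_left_inj F.1); rewrite mulmxBl mul1mx addrAC -eZ1 subrr.
have Yu : drsubmx Z \in unitmx.
  by move: Zu; rewrite -{1}(submxK Z) u2 !unitmxE det_lblock unitrM => /andP[].
have eU : Bu' = (dlsubmx Z *m a) *m Bs + drsubmx Z *m Bu by rewrite eZ2 {1}ea mulmxA.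
rewrite {1}eU eP (orientation_block _ orM I (frame_setT x e BF) Pu Yu).
rewrite (ors.1 _ _ _ Wp Fs Pu) eZ2 -{1}[v]mul1mx.
rewrite (orientation_block _ oru Wq F (unitmx1 _ _) Yu) det1 ltr10 addbF.
by case: (oM _ _ _); case: (os _ _ _ _); case: (ou _ _ _ _); do 2 case: (_ < 0).
Qed.

End Signs.

Section CoreSigns.
Context {R : realType} {m d : nat} {M : manifold R m} {C : manifold R d}.
Variables (f : M -> R) (iota : C -> M) (lam : nat).
Variables (A : set (chart R m M)) (pi : M -> C) (T : set M).
Hypotheses (emb : embedding iota) (tb : tube f iota lam A pi T).
Variables (G : M -> 'M[R]_m).
Hypothesis iso : forall phi y, A phi -> T y -> cdom phi y -> chart_metric G phi y = 1%:M.
Hypothesis dm : (d <= m)%N.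
Variables (fC : C -> R) (h : M -> R) (eps : R).
Hypotheses (sfC : smooth_fun fC) (sh : smooth_fun h) (eps0 : 0 < eps).
Hypothesis hE : forall y, T y -> h y = f y + eps * fC (pi y).
Variable w : nat.
Hypothesis dlw : (d + lam + w = m)%N.
Hypothesis posG : metric_pos G.
Hypotheses (mC : morse fC) (mh : morse h).
Variable o : C -> 'M[R]_(lam, m) -> bool.
Hypothesis no : nu_orientation iota A o.

Notation adapted := (adapted A T).
Notation Gc := (pullback_metric iota G).
Notation vrow := (vrows iota lam).
Notation wrow := (wrows iota lam w).

Let dl : (d + lam <= m)%N. Proof. by rewrite -dlw leq_addr. Qed.

(** The bases (S, W) and (U, V) of the introduction. *)
Definition srows s (B : 'M[R]_(s, d)) chi x : 'M[R]_(s + w, m) :=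
  col_mx (B *m mdiff iota x) (wrow chi x).
Definition urows k (B : 'M[R]_(k, d)) chi x : 'M[R]_(k + lam, m) :=
  col_mx (B *m mdiff iota x) (vrow chi x).

Lemma adapted_vframe chi : adapted chi -> exists2 phi, A phi &
  forall x, cdom chi (iota x) -> cdom phi (iota x) /\ vrow chi x = vframe iota lam phi x.
Proof.
move=> [phi Ap [sc dc mc]]; exists phi; first exact: Ap.
move=> x dx; have dp := ((dc _).1 dx).1.
have [sp _ _] := tube_charts tb Ap; split; first exact: dp.
by rewrite /vrows (chart_frame_same sc sp mc dx dp).
Qed.

Lemma vrows_change chi chi' x : adapted chi -> adapted chi' ->
  cdom chi (iota x) -> cdom chi' (iota x) -> exists2 Q : 'M[R]_lam, Q \in unitmx &
  vrow chi' x = Q *m vrow chi x.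
Proof.
by rewrite /vrows => ad ad' dx dx'; exact: (normal_frame_change tb dl (@vblock_normal m d lam) ad' ad dx' dx).
Qed.

Lemma wrows_change chi chi' x : adapted chi -> adapted chi' ->
  cdom chi (iota x) -> cdom chi' (iota x) -> exists2 Q : 'M[R]_w, Q \in unitmx &
  wrow chi' x = Q *m wrow chi x.
Proof.
by rewrite /wrows => ad ad' dx dx'; exact: (normal_frame_change tb dl (wblock_normal dlw) ad' ad dx' dx).
Qed.

Lemma nu_change chi x (Q : 'M[R]_lam) : adapted chi -> cdom chi (iota x) -> Q \in unitmx ->
  o x (Q *m vrow chi x) = o x (vrow chi x) (+) (\det Q < 0).
Proof.
move=> ad dx Qu; have [phi Ap H] := adapted_vframe ad; have [dp ->] := H x dx.
by have [-> //] := no Ap dp.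
Qed.

Lemma nu_near chi x0 : adapted chi -> cdom chi (iota x0) ->
  \forall x \near x0, o x (vrow chi x) = o x0 (vrow chi x0).
Proof.
move=> ad d0; have [phi Ap H] := adapted_vframe ad; have [dp ->] := H x0 d0.
have [_ nr] := no Ap dp.
have dn : \forall x \near x0, cdom chi (iota x).
  by apply: (iota_continuous emb (cdom_near d0)).
apply: filterS2 dn nr => x dx e; have [_ ->] := H x dx; exact: e.
Qed.

Lemma srows_change s (B : 'M[R]_(s, d)) chi chi' x (P : 'M_s) (Q : 'M_w) :
  wrow chi' x = Q *m wrow chi x -> srows (P *m B) chi' x = block_mx P 0 0 Q *m srows B chi x.
Proof. by move=> e; rewrite /srows e -block_change mul0mx add0r mulmxA. Qed.

Lemma urows_change s k (Bs : 'M[R]_(s, d)) (B : 'M[R]_(k, d)) chi chi' x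
    (X : 'M_(k, s)) (Y : 'M_k) (Q : 'M_lam) : vrow chi' x = Q *m vrow chi x ->
  urows (X *m Bs + Y *m B) chi' x =
  block_mx X 0 0 0 *m srows Bs chi x + block_mx Y 0 0 Q *m urows B chi x.
Proof.
move=> e; rewrite /urows /srows e !mul_block_col !mul0mx !addr0 !add0r add_col_mx add0r.
by rewrite mulmxDl !mulmxA.
Qed.

Lemma su_free s k (Bs : 'M[R]_(s, d)) (B : 'M[R]_(k, d)) chi x : adapted chi ->
  cdom chi (iota x) -> row_free (col_mx Bs B) ->
  row_free (col_mx (srows Bs chi x) (urows B chi x)).
Proof.
move=> ad dx F; have am : (d + (lam + w) <= m)%N by rewrite addnA dlw.
have F2 := push_normal_free emb tb dm am (leqnn d) ad dx F.
(* Up to the order of the rows this is the frame of C together with all normal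
   coordinate vectors. *)
have e : nblock d (lam + w) = col_mx (nblock d lam) (nblock (d + lam) w) :> 'M[R]_(lam + w, m).
  apply/matrixP => i c; case: (split_ordP i) => j ->; rewrite ?col_mxEu ?col_mxEd !mxE //=.
  by rewrite addnA.
rewrite e mul_col_mx mul_col_mx -/(vrow chi x) -/(wrow chi x) in F2.
apply: row_free_col => a b.
rewrite -[a]hsubmxK -[b]hsubmxK !mul_row_col => H.
set a1 := lsubmx a in H *; set a2 := rsubmx a in H *.
set b1 := lsubmx b in H *; set b2 := rsubmx b in H *.
have [e1 e2] : row_mx a1 b1 = 0 /\ row_mx b2 a2 = 0.
  by apply: (col_mx_left_inj F2); rewrite !mul_row_col -[RHS]H [X in _ + X]addrC addrACA.
by move: e1 e2; rewrite -!row_mx0 => /eq_row_mx[-> ->] /eq_row_mx[-> ->].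
Qed.

Lemma col_mx_entry_continuous (X : topologicalType) n1 n2 l (P : X -> 'M[R]_(n1, l))
    (Q : X -> 'M[R]_(n2, l)) x :
  (forall i j, {for x, continuous (fun y => P y i j)}) ->
  (forall i j, {for x, continuous (fun y => Q y i j)}) ->
  forall i j, {for x, continuous (fun y => col_mx (P y) (Q y) i j)}.
Proof.
move=> cP cQ i j; case: (split_ordP i) => i' ->.
  by rewrite (_ : (fun y => _) = (fun y => P y i' j)) //; apply/funext => y; rewrite col_mxEu.
by rewrite (_ : (fun y => _) = (fun y => Q y i' j)) //; apply/funext => y; rewrite col_mxEd.
Qed.

Lemma push_rows chi phiC x k (N : 'M[R]_(k, d)) : adapted chi -> core_chart iota pi chi phiC ->
  cdom chi (iota x) ->
  N *m chart_frame phiC x *m mdiff iota x = N *m Emx *m chart_frame chi (iota x).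
Proof. by move=> ad cc dx; rewrite -mulmxA (core_frame emb tb ad cc dx) mulmxA. Qed.

Lemma srows_chart chi phiC x s (N : 'M[R]_(s, d)) : adapted chi -> core_chart iota pi chi phiC ->
  cdom chi (iota x) -> srows (N *m chart_frame phiC x) chi x =
    col_mx (N *m Emx) (nblock (d + lam) w) *m chart_frame chi (iota x).
Proof. by move=> ad cc dx; rewrite /srows (push_rows _ ad cc dx) mul_col_mx. Qed.

Lemma urows_chart chi phiC x k (N : 'M[R]_(k, d)) : adapted chi -> core_chart iota pi chi phiC ->
  cdom chi (iota x) -> urows (N *m chart_frame phiC x) chi x =
    col_mx (N *m Emx) (nblock d lam) *m chart_frame chi (iota x).
Proof. by move=> ad cc dx; rewrite /urows (push_rows _ ad cc dx) mul_col_mx. Qed.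

Section Unstable.
Variables (q : C) (k : nat).
Unset Implicit Arguments.
Variables (ouC : frame_sign C) (ou : frame_sign M).
Set Implicit Arguments.
Hypotheses (iq : index_is Gc fC q k) (iiq : index_is G h (iota q) (k + lam)).
Hypotheses (orC : orientation (Wu Gc fC q) k ouC)
  (or : orientation (Wu G h (iota q)) (k + lam) ou).

Definition tau y (B : 'M[R]_(k, d)) chi : bool :=
  ouC k y B (+) ou (k + lam)%N (iota y) (urows B chi y) (+) o y (vrow chi y).

(** Each change of basis enters exactly two of the three signs. *)
Lemma tau_indep y (B B' : 'M[R]_(k, d)) chi chi' : Wu Gc fC q y ->
  frame (Wu Gc fC q) y B -> frame (Wu Gc fC q) y B' -> adapted chi -> adapted chi' ->
  cdom chi (iota y) -> cdom chi' (iota y) -> tau y B chi = tau y B' chi'.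
Proof.
move=> Wy F F' ad ad' dx dx'.
have [P Pu ->] := frame_change F F'; have [Q Qu eQ] := vrows_change ad ad' dx dx'.
have F1 := Wu_frame emb tb iso dm sfC sh eps0 hE dlw iiq Wy ad dx F.
rewrite /tau (orC.1 _ _ _ Wy F Pu) eQ (nu_change ad dx Qu).
have -> : urows (P *m B) chi' y = block_mx P 0 0 Q *m urows B chi y.
  by rewrite /urows eQ -block_change mul0mx add0r mulmxA.
rewrite or.1 //; last first.
- by move: Pu Qu; rewrite !unitmxE det_lblock unitrM => -> ->.
- exact: (Wu_push emb tb iso dm sfC sh eps0 hE Wy).
rewrite neg_block //.
by case: (ouC _ _ _); case: (ou _ _ _); case: (o _ _); do 2 case: (_ < 0).
Qed.

Definition tau_true y := forall (B : 'M[R]_(k, d)) chi, frame (Wu Gc fC q) y B ->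
  adapted chi -> cdom chi (iota y) -> tau y B chi.

Lemma tau_trueE y (B : 'M[R]_(k, d)) chi : Wu Gc fC q y -> frame (Wu Gc fC q) y B ->
  adapted chi -> cdom chi (iota y) -> tau_true y <-> tau y B chi.
Proof.
move=> Wy F ad dx; split=> [H|t B' chi' F' ad' dx']; first exact: H.
by rewrite -(tau_indep Wy F F' ad ad' dx dx').
Qed.

(** Each sign is constant along continuous families of bases, which exist in slice
    charts. *)
Lemma tau_locally y0 : Wu Gc fC q y0 ->
  \forall y \near y0, Wu Gc fC q y -> (tau_true y <-> tau_true y0).
Proof.
move=> W0; have [psi [dpsi sl]] := iq.2 _ W0; have [spsi _ _] := sl.
have [chi [phiC [ad cc dx0]]] := core_chart_at emb tb dm y0.
have [sp dC _ _] := cc; have dp0 := (dC y0).2 dx0.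
have sc := adapted_smooth ad.
pose N y : 'M[R]_(k, d) := pid_mx k *m transition psi phiC y.
have cN i j : {for y0, continuous (fun y => N y i j)}.
  apply: mulmx_entry_continuous => a b; first exact: cst_continuous.
  exact: transition_continuous.
have NE y : cdom psi y -> cdom phiC y -> N y *m chart_frame phiC y = pid_mx k *m chart_frame psi y.
  by move=> d1 d2; rewrite /N -mulmxA -chart_frame_comp.
have nd : \forall y \near y0, [/\ cdom psi y, cdom phiC y & cdom chi (iota y)].
  by near=> y; split; near: y; [exact: cdom_near|exact: cdom_near|
    exact: (iota_continuous emb (cdom_near dx0))].
have fr y : cdom psi y -> cdom phiC y -> Wu Gc fC q y ->
    frame (Wu Gc fC q) y (N y *m chart_frame phiC y).
  by move=> d1 d2 Wy; rewrite NE //; exact: slice_frame.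
have Wpush := @Wu_push _ _ _ _ _ _ _ _ _ _ _ emb tb _ iso dm _ _ _ sfC sh eps0 hE q.
have [psi2 [dpsi2 sl2]] := iiq.2 _ (Wpush _ W0).
have n1 : \forall y \near y0, Wu Gc fC q y -> ouC k y (N y *m chart_frame phiC y) =
    ouC k y0 (N y0 *m chart_frame phiC y0).
  apply: (orientation_transport (j := id) orC sl sp dpsi dp0 _ W0) => //.
  by near=> y => Wy; apply: fr => //; near: y; apply: filterS nd => y [].
pose N2 y : 'M[R]_(k + lam, m) := col_mx (N y *m Emx) (nblock d lam).
have n2 : \forall y \near y0, Wu Gc fC q y ->
    ou (k + lam)%N (iota y) (N2 y *m chart_frame chi (iota y)) =
    ou (k + lam)%N (iota y0) (N2 y0 *m chart_frame chi (iota y0)).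
  apply: (orientation_transport (j := iota) or sl2 sc dpsi2 dx0 _ W0) => //.
  - exact: iota_continuous.
  - apply: col_mx_entry_continuous => i j; last exact: cst_continuous.
    by apply: mulmx_entry_continuous => // a b; exact: cst_continuous.
  - apply: filterS nd => y [d1 d2 d3] Wy; rewrite -(urows_chart _ ad cc d3).
    exact: (Wu_frame emb tb iso dm sfC sh eps0 hE dlw iiq Wy ad d3 (fr y d1 d2 Wy)).
have n3 := nu_near ad dx0.
near=> y => Wy.
have [d1 d2 d3] : [/\ cdom psi y, cdom phiC y & cdom chi (iota y)] by near: y.
have E1 := urows_chart (N y) ad cc d3; have E0 := urows_chart (N y0) ad cc dx0.
have e1 : ouC k y (N y *m chart_frame phiC y) = ouC k y0 (N y0 *m chart_frame phiC y0).
  by move: Wy; near: y.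
have e2 : ou (k + lam)%N (iota y) (N2 y *m chart_frame chi (iota y)) =
    ou (k + lam)%N (iota y0) (N2 y0 *m chart_frame chi (iota y0)) by move: Wy; near: y.
have e3 : o y (vrow chi y) = o y0 (vrow chi y0) by near: y.
have e2' := etrans (congr1 (ou (k + lam)%N (iota y)) E1)
  (etrans e2 (esym (congr1 (ou (k + lam)%N (iota y0)) E0))).
have eT : tau y (N y *m chart_frame phiC y) chi = tau y0 (N y0 *m chart_frame phiC y0) chi.
  exact: (f_equal2 addb (f_equal2 addb e1 e2') e3).
have a := tau_trueE Wy (fr y d1 d2 Wy) ad d3.
have b := tau_trueE W0 (fr y0 dpsi dp0 W0) ad dx0.
rewrite eT in a; exact: (iff_trans a (iff_sym b)).
Unshelve. all: by end_near. Qed.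

End Unstable.

Section Stable.
Variables (p : C) (s k : nat).
Unset Implicit Arguments.
Variables (osC oC : frame_sign C) (os oM : frame_sign M).
Set Implicit Arguments.
Hypothesis sk : (s + k)%N = d.
Hypotheses (ip : index_is Gc fC p k) (iip : index_is G h (iota p) (k + lam)).
Hypotheses (orsC : orientation (Ws Gc fC p) s osC)
  (ors : orientation (Ws G h (iota p)) (s + w) os)
  (orC : orientation [set: C] (s + k) oC)
  (orM : orientation [set: M] ((s + w) + (k + lam)) oM).

Let skm : ((s + w) + (k + lam) = m)%N.
Proof. by rewrite -dlw -sk -(addnA s k) addnAC. Qed.

(** The sign rule that relates the orientations for f_j and h along the stable
    manifold of p. The complement Bc is arbitrary because unstable manifolds are
    not available away from p. *)
Definition rho_sign y (Bs : 'M[R]_(s, d)) (Bc : 'M[R]_(k, d)) chi : bool :=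
  osC s y Bs (+) os (s + w)%N (iota y) (srows Bs chi y) (+)
  oC (s + k)%N y (col_mx Bs Bc) (+)
  oM ((s + w) + (k + lam))%N (iota y) (col_mx (srows Bs chi y) (urows Bc chi y)) (+)
  o y (vrow chi y).

Definition valid y (Bs : 'M[R]_(s, d)) (Bc : 'M[R]_(k, d)) chi :=
  [/\ frame (Ws Gc fC p) y Bs, row_free (col_mx Bs Bc), adapted chi & cdom chi (iota y)].

(** Each of the matrices P, Y, Q and Q' that describe the changes of bases enters an
    even number of the five signs; X enters none. *)
Lemma rho_indep y (Bs Bs' : 'M[R]_(s, d)) (Bc Bc' : 'M[R]_(k, d)) chi chi' :
  Ws Gc fC p y -> valid y Bs Bc chi -> valid y Bs' Bc' chi' ->
  rho_sign y Bs Bc chi = rho_sign y Bs' Bc' chi'.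
Proof.
move=> Wy [F B1 ad dx] [F' B2 ad' dx'].
have [P Pu eP] := frame_change F F'; rewrite eP in B2 *.
have [X [Y [Yu eY]]] := complement_change sk B1 B2.
have [Q Qu eQ] := vrows_change ad ad' dx dx'; have [Q' Q'u eQ'] := wrows_change ad ad' dx dx'.
have Wy' := Ws_push emb tb iso dm sfC sh eps0 hE Wy.
have F1 := Ws_frame emb tb iso dm sfC sh eps0 hE dlw posG mC mh ip iip Wy ad dx F.
have F2 : frame [set: C] y (col_mx Bs Bc) by exact: frame_setT.
have F3 : frame [set: M] (iota y) (col_mx (srows Bs chi y) (urows Bc chi y)).
  by apply: frame_setT => //; exact: su_free.
have Su : block_mx P 0 0 Q' \in unitmx.
  by move: Pu Q'u; rewrite !unitmxE det_lblock unitrM => -> ->.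
have Uu : block_mx Y 0 0 Q \in unitmx.
  by move: Yu Qu; rewrite !unitmxE det_lblock unitrM => -> ->.
have e1 := orsC.1 _ _ _ Wy F Pu.
have e2 := ors.1 _ _ _ Wy' F1 Su.
have e3 := orientation_block X orC I F2 Pu Yu.
have e4 := orientation_block (block_mx X 0 0 0) orM I F3 Su Uu.
have e5 := nu_change ad dx Qu.
have u1 := srows_change Bs P eQ'.
have u2 := urows_change Bs Bc X Y eQ.
rewrite /rho_sign eY eQ u1 u2 e1 e3 e4 e5 -/(srows Bs chi y).
rewrite [os _ _ _ in RHS]e2 !neg_block //.
case: (osC _ _ _); case: (os _ _ _); case: (oC _ _ _); case: (oM _ _ _); case: (o _ _);
  by do 4 case: (_ < 0).
Qed.

Definition rho_true y := forall Bs Bc chi, valid y Bs Bc chi -> rho_sign y Bs Bc chi.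

Lemma rho_trueE y Bs Bc chi : Ws Gc fC p y -> valid y Bs Bc chi ->
  rho_true y <-> rho_sign y Bs Bc chi.
Proof.
move=> Wy v; split=> [H|t Bs' Bc' chi' v']; first exact: H.
by rewrite -(rho_indep Wy v v').
Qed.

(** As in [tau_locally]. The complement is constant in the coordinates of a chart of
    C, and remains one near y0. *)
Lemma rho_locally y0 : Ws Gc fC p y0 ->
  \forall y \near y0, Ws Gc fC p y -> (rho_true y <-> rho_true y0).
Proof.
move=> W0; have [s' sk' Hs] := Ws_slices_core emb tb iso dm sfC posG mC ip.
have es : s' = s by apply: (@addIn k); rewrite sk'.
subst s'; have [psi [dpsi sl]] := Hs _ W0; have [spsi _ _] := sl.
have [chi [phiC [ad cc dx0]]] := core_chart_at emb tb dm y0.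
have [sp dC _ _] := cc; have dp0 := (dC y0).2 dx0.
have sc := adapted_smooth ad.
pose N y : 'M[R]_(s, d) := pid_mx s *m transition psi phiC y.
have cN i j : {for y0, continuous (fun y => N y i j)}.
  apply: mulmx_entry_continuous => a b; first exact: cst_continuous.
  exact: transition_continuous.
have NE y : cdom psi y -> cdom phiC y -> N y *m chart_frame phiC y = pid_mx s *m chart_frame psi y.
  by move=> d1 d2; rewrite /N -mulmxA -chart_frame_comp.
have fr y : cdom psi y -> cdom phiC y -> Ws Gc fC p y ->
    frame (Ws Gc fC p) y (N y *m chart_frame phiC y).
  by move=> d1 d2 Wy; rewrite NE //; exact: slice_frame.
have N0 : row_free (N y0).
  have [F0 _] := fr y0 dpsi dp0 W0.
  by rewrite (row_free_unitr (N y0) (chart_frame_unit sp dp0)) in F0.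
have [Nc BF0] := row_free_complete sk N0.
have cNc i j : {for y0, continuous (fun y => col_mx (N y) Nc i j)}.
  by apply: col_mx_entry_continuous => a b //; exact: cst_continuous.
have nfree := row_free_near cNc BF0.
have vd y : cdom psi y -> cdom phiC y -> cdom chi (iota y) -> Ws Gc fC p y ->
    row_free (col_mx (N y) Nc) ->
    valid y (N y *m chart_frame phiC y) (Nc *m chart_frame phiC y) chi.
  move=> d1 d2 d3 Wy F; split; [exact: fr| |exact: ad|exact: d3].
  by rewrite -mul_col_mx (row_free_unitr _ (chart_frame_unit sp d2)).
have nd : \forall y \near y0, [/\ cdom psi y, cdom phiC y & cdom chi (iota y)].
  by near=> y; split; near: y; [exact: cdom_near|exact: cdom_near|
    exact: (iota_continuous emb (cdom_near dx0))].
have Wpush := @Ws_push _ _ _ _ _ _ _ _ _ _ _ emb tb _ iso dm _ _ _ sfC sh eps0 hE p.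
have [s2 e2 Hs2] := Ws_slices emb tb iso dm sfC sh eps0 hE posG mh iip.
have es2 : s2 = (s + w)%N by apply: (@addIn (k + lam)); rewrite e2 skm.
subst s2; have [psi2 [dpsi2 sl2]] := Hs2 _ W0.
have n1 : \forall y \near y0, Ws Gc fC p y -> osC s y (N y *m chart_frame phiC y) =
    osC s y0 (N y0 *m chart_frame phiC y0).
  apply: (orientation_transport (j := id) orsC sl sp dpsi dp0 _ W0) => //.
  by apply: filterS nd => y [d1 d2 d3] Wy; exact: fr.
pose N2 y : 'M[R]_(s + w, m) := col_mx (N y *m Emx) (nblock (d + lam) w).
have cN2 i j : {for y0, continuous (fun y => N2 y i j)}.
  apply: col_mx_entry_continuous => a b; last exact: cst_continuous.
  by apply: mulmx_entry_continuous => // a' b'; exact: cst_continuous.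
have n2 : \forall y \near y0, Ws Gc fC p y ->
    os (s + w)%N (iota y) (N2 y *m chart_frame chi (iota y)) =
    os (s + w)%N (iota y0) (N2 y0 *m chart_frame chi (iota y0)).
  apply: (orientation_transport (j := iota) ors sl2 sc dpsi2 dx0 _ W0) => //.
  - exact: iota_continuous.
  - apply: filterS nd => y [d1 d2 d3] Wy.
    rewrite -(srows_chart (N y) ad cc d3).
    exact: (Ws_frame emb tb iso dm sfC sh eps0 hE dlw posG mC mh ip iip Wy ad d3 (fr y d1 d2 Wy)).
have n3 : \forall y \near y0, Ws Gc fC p y ->
    oC (s + k)%N y (col_mx (N y) Nc *m chart_frame phiC y) =
    oC (s + k)%N y0 (col_mx (N y0) Nc *m chart_frame phiC y0).
  apply: (orientation_transport (j := id) orC (slice_setT sk sp) sp dp0 dp0 _ W0) => //.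
  apply: filterS2 nd nfree => y [d1 d2 d3] Fy Wy; apply: (frame_setT _ sk).
  by rewrite (row_free_unitr _ (chart_frame_unit sp d2)).
pose N4 y : 'M[R]_((s + w) + (k + lam), m) := col_mx (N2 y) (col_mx (Nc *m Emx) (nblock d lam)).
have E4 y : cdom chi (iota y) -> N4 y *m chart_frame chi (iota y) =
    col_mx (srows (N y *m chart_frame phiC y) chi y) (urows (Nc *m chart_frame phiC y) chi y).
  move=> d3; rewrite mul_col_mx.
  exact: (f_equal2 _ (esym (srows_chart (N y) ad cc d3)) (esym (urows_chart Nc ad cc d3))).
have n4 : \forall y \near y0, Ws Gc fC p y ->
    oM ((s + w) + (k + lam))%N (iota y) (N4 y *m chart_frame chi (iota y)) =
    oM ((s + w) + (k + lam))%N (iota y0) (N4 y0 *m chart_frame chi (iota y0)).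
  apply: (orientation_transport (j := iota) orM (slice_setT skm sc) sc dx0 dx0 _ W0) => //.
  - exact: iota_continuous.
  - by apply: col_mx_entry_continuous => a b //; exact: cst_continuous.
  - apply: filterS2 nd nfree => y [d1 d2 d3] Fy Wy; apply: (frame_setT _ skm).
    have [_ F _ _] := vd y d1 d2 d3 Wy Fy.
    by rewrite (E4 y d3); exact: su_free.
have n5 := nu_near ad dx0.
near=> y => Wy.
have [d1 d2 d3] : [/\ cdom psi y, cdom phiC y & cdom chi (iota y)] by near: y.
have Fy : row_free (col_mx (N y) Nc) by near: y.
have e1 : osC s y (N y *m chart_frame phiC y) = osC s y0 (N y0 *m chart_frame phiC y0).
  by move: Wy; near: y.
have {}e2 : os (s + w)%N (iota y) (N2 y *m chart_frame chi (iota y)) =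
    os (s + w)%N (iota y0) (N2 y0 *m chart_frame chi (iota y0)) by move: Wy; near: y.
have e3 : oC (s + k)%N y (col_mx (N y) Nc *m chart_frame phiC y) =
    oC (s + k)%N y0 (col_mx (N y0) Nc *m chart_frame phiC y0) by move: Wy; near: y.
have e4 : oM ((s + w) + (k + lam))%N (iota y) (N4 y *m chart_frame chi (iota y)) =
    oM ((s + w) + (k + lam))%N (iota y0) (N4 y0 *m chart_frame chi (iota y0)).
  by move: Wy; near: y.
have e5 : o y (vrow chi y) = o y0 (vrow chi y0) by near: y.
have e2' := etrans (congr1 (os (s + w)%N (iota y)) (srows_chart (N y) ad cc d3))
  (etrans e2 (esym (congr1 (os (s + w)%N (iota y0)) (srows_chart (N y0) ad cc dx0)))).
have e3' := etrans (congr1 (oC (s + k)%N y) (esym (mul_col_mx (N y) Nc (chart_frame phiC y))))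
  (etrans e3 (congr1 (oC (s + k)%N y0) (mul_col_mx (N y0) Nc (chart_frame phiC y0)))).
have e4' := etrans (congr1 (oM _ (iota y)) (esym (E4 y d3)))
  (etrans e4 (congr1 (oM _ (iota y0)) (E4 y0 dx0))).
have eT : rho_sign y (N y *m chart_frame phiC y) (Nc *m chart_frame phiC y) chi =
    rho_sign y0 (N y0 *m chart_frame phiC y0) (Nc *m chart_frame phiC y0) chi.
  exact: (f_equal2 addb (f_equal2 addb (f_equal2 addb (f_equal2 addb e1 e2') e3') e4') e5).
have a := rho_trueE Wy (vd y d1 d2 d3 Wy Fy).
have b := rho_trueE W0 (vd y0 dpsi dp0 dx0 W0 BF0).
rewrite eT in a; exact: (iff_trans a (iff_sym b)).
Unshelve. all: by end_near. Qed.

End Stable.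

Section Transfer.
Variables (p q : C) (s k : nat).
Hypothesis sk : (s + k)%N = d.
Hypotheses (ip : index_is Gc fC p k) (iip : index_is G h (iota p) (k + lam)).
Hypotheses (iq : index_is Gc fC q (1 + k)) (iiq : index_is G h (iota q) ((1 + k) + lam)).
Hypothesis trC : morse_smale Gc fC.
Unset Implicit Arguments.
Variables (oM : frame_sign M) (ou os : M -> frame_sign M).
Variables (oC : frame_sign C) (ouC osC : C -> frame_sign C).
Set Implicit Arguments.
Hypotheses (coM : complex_orientation G h oM ou os)
  (coC : complex_orientation Gc fC oC ouC osC).
Hypothesis suit : forall x n (B : 'M[R]_(n, d)) phi,
  index_is Gc fC x n -> frame (Wu Gc fC x) x B -> A phi -> cdom phi (iota x) ->
  ou (iota x) (n + lam)%N (iota x) (col_mx (B *m mdiff iota x) (vframe iota lam phi x)) =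
  (ouC x n x B == o x (vframe iota lam phi x)).

Let skm : ((s + w) + (k + lam) = m)%N.
Proof. by rewrite -dlw -sk -(addnA s k) addnAC. Qed.

Let orsC := os_orientation coC ip sk.
Let ors := os_orientation coM iip skm.
Let orC : orientation [set: C] (s + k) oC.
Proof. by rewrite sk; exact: oM_orientation coC. Qed.
Let orM : orientation [set: M] ((s + w) + (k + lam)) oM.
Proof. by rewrite skm; exact: oM_orientation coM. Qed.
Let oruC := ou_orientation coC iq.
Let oru := ou_orientation coM iiq.

Lemma Wu_self (n : nat) (N : manifold R n) (H : N -> 'M[R]_n) (g : N -> R) x :
  crit g x -> Wu H g x x.
Proof. by move=> cx; exists (fun=> x); split=> // [t _|]; [exact: grad_eq_cst|exact: cvg_cst]. Qed.

Lemma full_free n1 n2 n (B : 'M[R]_(n1, n)) (U : 'M[R]_(n2, n)) : (n1 + n2)%N = n ->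
  row_full (col_mx B U) -> row_free (col_mx B U).
Proof. by move=> e /eqP r; rewrite /row_free r e. Qed.

(** At p the unstable manifolds provide the complement, and the signs are related
    by the rules by which the stable manifolds of f_j and h and the unstable
    manifolds of h are oriented. *)
Lemma rho_critical : rho_true p s k (osC p) oC (os (iota p)) oM p.
Proof.
have Wp := Ws_self Gc ip.1; have Up := @Wu_self _ _ Gc _ _ ip.1.
have [s' sk' Hs] := Ws_slices_core emb tb iso dm sfC posG mC ip.
have es : s' = s by apply: (@addIn k); rewrite sk'.
subst s'; have [psi [dpsi sl]] := Hs _ Wp.
have Fs := slice_frame sl Wp dpsi.
have [psi2 [dpsi2 sl2]] := ip.2 _ Up; have Fu := slice_frame sl2 Up dpsi2.
have [chi [phiC [ad cc dx]]] := core_chart_at emb tb dm p.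
have F := full_free sk (transverse_free trC ip.1 ip.1 Up Wp Fs Fu).
apply/(rho_trueE sk ip iip orsC ors orC orM Wp (And4 Fs F ad dx)).
have F1 := Ws_frame emb tb iso dm sfC sh eps0 hE dlw posG mC mh ip iip Wp ad dx Fs.
have F2 := Wu_frame emb tb iso dm sfC sh eps0 hE dlw iip Up ad dx Fu.
have e1 := os_induced coC ip sk Fs Fu.
have e2 := os_induced coM iip skm F1 F2.
have [phi Ap Hphi] := adapted_vframe ad; have [dp ev] := Hphi p dx.
have e3 := suit ip Fu Ap dp; rewrite -ev in e3.
rewrite /rho_sign e1 [oM _ _ _]e2 /urows [ou _ _ _ _]e3.
by case: (osC _ _ _ _); case: (os _ _ _ _); case: (ouC _ _ _ _); case: (o _ _).
Qed.

(** This is the rule by which the unstable manifold of h at q is oriented. *)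
Lemma tau_critical : tau_true q (1 + k) (ouC q) (ou (iota q)) q.
Proof.
move=> B chi F ad dx; have [phi Ap Hphi] := adapted_vframe ad; have [dp ev] := Hphi q dx.
have e3 := suit iq F Ap dp; rewrite -ev in e3.
rewrite /tau /urows [ou _ _ _ _]e3.
by case: (ouC _ _ _ _); case: (o _ _).
Qed.

Section AtPoint.
Variables (x : C) (Bs : 'M[R]_(s, d)) (Bu : 'M[R]_(k, d)).
Let v := - grad Gc fC x.
Hypotheses (Wp : Ws Gc fC p x) (Wq : Wu Gc fC q x).
Hypotheses (Fs : frame (Ws Gc fC p) x Bs) (Fu : frame (Wu Gc fC q) x (col_mx v Bu)).
Hypothesis vs : (v <= Bs)%MS.
Variable chi : chart R m M.
Hypotheses (ad : adapted chi) (dx : cdom chi (iota x)).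

Lemma point_free : row_free (col_mx Bs Bu).
Proof.
apply: (full_free sk); have := transverse_free trC ip.1 iq.1 Wq Wp Fs Fu.
rewrite -!sub1mx => /submx_trans; apply.
by rewrite !col_mx_sub -!addsmxE addsmxSl addsmxSr (submx_trans vs (addsmxSl _ _)).
Qed.

(** The product of the two sign rules: o cancels. *)
Lemma sign_push :
  oM ((s + w) + (k + lam))%N (iota x) (col_mx (srows Bs chi x) (urows Bu chi x)) (+)
  os (iota p) (s + w)%N (iota x) (srows Bs chi x) (+)
  ou (iota q) ((1 + k) + lam)%N (iota x) (urows (col_mx v Bu) chi x) =
  oC (s + k)%N x (col_mx Bs Bu) (+) osC p s x Bs (+) ouC q (1 + k)%N x (col_mx v Bu).
Proof.
have r := Ws_constant (rho_locally sk ip iip orsC ors orC orM) ip.1 rho_critical Wp.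
have {r} := r _ _ _ (And4 Fs point_free ad dx).
have t := Wu_constant sfC (tau_locally iq iiq oruC oru) iq.1 tau_critical Wq.
have {t} := t _ _ Fu ad dx.
rewrite /tau /rho_sign.
case: (ouC _ _ _ _); case: (ou _ _ _ _); case: (o _ _); case: (osC _ _ _ _);
  case: (os _ _ _ _); case: (oC _ _ _); by case: (oM _ _ _).
Qed.

Let v' := - grad G h (iota x).

Lemma grad_first : v' = eps%:M *m (v *m mdiff iota x).
Proof.
by rewrite /v' /v (grad_push emb tb iso dm sfC sh hE) mul_scalar_mx mulNmx scalerN.
Qed.

Lemma urows_first : col_mx (v *m mdiff iota x) (urows Bu chi x) =
  urows (col_mx v Bu) chi x :> 'M[R]_(1 + (k + lam), m).
Proof. by rewrite /urows mul_col_mx col_mxA castmx_id. Qed.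

Lemma frames_push : frame (Ws G h (iota p)) (iota x) (srows Bs chi x) /\
  frame (Wu G h (iota q)) (iota x) (col_mx v' (urows Bu chi x)).
Proof.
split; first exact: (Ws_frame emb tb iso dm sfC sh eps0 hE dlw posG mC mh ip iip Wp ad dx Fs).
have F := Wu_frame emb tb iso dm sfC sh eps0 hE dlw iiq Wq ad dx Fu.
have F' : frame (Wu G h (iota q)) (iota x) (col_mx (v *m mdiff iota x) (urows Bu chi x)).
  by rewrite urows_first.
have Pu : block_mx (eps%:M : 'M_1) 0 0 (1%:M : 'M_(k + lam)) \in unitmx.
  by rewrite unitmxE det_lblock det_scalar1 det1 mulr1 unitfE gt_eqF.
have := frame_mul Pu F'.
by rewrite -block_change -grad_first mul0mx add0r mul1mx.
Qed.

(** The first vectors of the two bases differ by the factor eps > 0. *)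
Lemma ou_first : ou (iota q) (1 + (k + lam))%N (iota x) (col_mx v' (urows Bu chi x)) =
  ou (iota q) ((1 + k) + lam)%N (iota x) (urows (col_mx v Bu) chi x).
Proof.
have F := Wu_frame emb tb iso dm sfC sh eps0 hE dlw iiq Wq ad dx Fu.
have F' : frame (Wu G h (iota q)) (iota x) (col_mx (v *m mdiff iota x) (urows Bu chi x)).
  by rewrite urows_first.
have Wq' := Wu_push emb tb iso dm sfC sh eps0 hE Wq.
have e1u : (eps%:M : 'M[R]_1) \in unitmx by rewrite unitmxE det_scalar1 unitfE gt_eqF.
have := @orientation_block _ _ _ _ 1 (k + lam) _ _ _ _ eps%:M 0 1%:M oru Wq' F' e1u (unitmx1 _ _).
rewrite -grad_first mul0mx add0r mul1mx det_scalar1 det1 (lt_gtF eps0) (lt_gtF ltr01) !addbF.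
by rewrite urows_first.
Qed.

End AtPoint.

Lemma addb_eqb (a b c : bool) : (a == (b == c)) = a (+) b (+) c.
Proof. by case: a b c => [] [] []. Qed.

(** Both signs are computed at the same point of the flow line. *)
Lemma flow_positive_core L : flow_lines Gc fC q p L ->
  flow_positive G h oM ou os (iota q) (iota p) (iota @` L) <->
  flow_positive Gc fC oC ouC osC q p L.
Proof.
move=> [c [fc cq cp eL]].
have Wp t : Ws Gc fC p (c t) by exact: flow_curve_Ws.
have Wq t : Wu Gc fC q (c t) by exact: flow_curve_Wu.
have [s' sk' Hs] := Ws_slices_core emb tb iso dm sfC posG mC ip.
have es : s' = s by apply: (@addIn k); rewrite sk'.
subst s'.
have vs t (B : 'M[R]_(s, d)) : frame (Ws Gc fC p) (c t) B -> (- grad Gc fC (c t) <= B)%MS.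
  by move=> F; have [psi [dpsi sl]] := Hs _ (Wp t); exact: (frame_curve fc Wp sl dpsi F).
split; last first.
  move=> [x [s1 [k1 [Bs [Bu]]]]] /= [Lx sk1 Fs Fu sg].
  move: Lx Fs Fu sg; rewrite eL => -[t _ <-] Fs Fu sg.
  have [psi2 [dpsi2 sl2]] := iq.2 _ (Wq t).
  have ek : k1 = k by apply: (@addnI 1); exact: frame_dim Fu (slice_frame sl2 (Wq t) dpsi2).
  subst k1; have es : s1 = s by apply: (@addIn k); rewrite sk1.
  subst s1.
  have [chi [phiC [ad cc dx]]] := core_chart_at emb tb dm (c t).
  have vB := vs t Bs Fs.
  have [F1 F2] := frames_push (Wp t) (Wq t) Fs Fu ad dx.
  exists (iota (c t)), (s + w)%N, (k + lam)%N, (srows Bs chi (c t)), (urows Bu chi (c t)).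
  split; [by exists (c t) => //; exists t|exact: skm|exact: F1|exact: F2|].
  apply/eqP; rewrite addb_eqb (ou_first (Wq t) Fu ad dx).
  by rewrite (sign_push (Wp t) (Wq t) Fs Fu vB ad dx) -addb_eqb sg.
move=> [x' [s1 [k1 [Bs' [Bu']]]]] /= [[x Lx <-] sk1 Fs' Fu' sg].
move: Lx Fs' Fu' sg; rewrite eL => -[t _ <-] Fs' Fu' sg.
have [chi [phiC [ad cc dx]]] := core_chart_at emb tb dm (c t).
have [psi [dpsi sl]] := Hs _ (Wp t); have Fs := slice_frame sl (Wp t) dpsi.
have vB := vs t _ Fs.
have [psi2 [dpsi2 sl2]] := iq.2 _ (Wq t); have Fq := slice_frame sl2 (Wq t) dpsi2.
have v0 : - grad Gc fC (c t) != 0.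
  apply/eqP => v0; have := (col_mx_left_inj (a := 1%:M) (b := 0) Fu'.1).
  by rewrite grad_first v0 mul0mx mulmx0 mul0mx mulmx0 addr0 => /(_ erefl)[/eqP]; rewrite oner_eq0.
(* The first vector of the basis is prescribed, so f_j needs a basis starting with
   its own gradient. *)
have [P [Bu [Pu eP]]] := complete_row v0 (frame_curve fc Wq sl2 dpsi2 Fq).
have Fu : frame (Wu Gc fC q) (c t) (col_mx (- grad Gc fC (c t)) Bu).
  by rewrite eP; exact: frame_mul.
set Bs := pid_mx s *m chart_frame psi (c t) in Fs vB.
have [F1 F2] := frames_push (Wp t) (Wq t) Fs Fu ad dx.
have ek : k1 = (k + lam)%N by apply: (@addnI 1); exact: frame_dim Fu' F2.
subst k1; have es := frame_dim Fs' F1; subst s1.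
have v's : (- grad G h (iota (c t)) <= srows Bs chi (c t))%MS.
  rewrite grad_first; apply: submx_trans (submxMl _ _) _.
  by rewrite /srows -addsmxE (submx_trans (submxMr _ vB) (addsmxSl _ _)).
have Fr := point_free (Wp t) (Wq t) Fs Fu vB.
have Wp' := Ws_push emb tb iso dm sfC sh eps0 hE (Wp t).
have Wq' := Wu_push emb tb iso dm sfC sh eps0 hE (Wq t).
have I := sign_indep skm orM ors oru Wp' Wq' F1 Fs' F2 Fu' v's (su_free ad dx Fr).
exists (c t), s, k, Bs, Bu; split; [by exists t|exact: sk|exact: Fs|exact: Fu|].
apply/eqP; rewrite addb_eqb -(sign_push (Wp t) (Wq t) Fs Fu vB ad dx).
by rewrite -(ou_first (Wq t) Fu ad dx) -I -addb_eqb sg.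
Qed.

End Transfer.

End CoreSigns.

(** * Signs of flow lines and the boundary over the integers *)

Section IntegerCoefficients.
Unset Implicit Arguments.
Context {R : realType} {m l : nat} {M : manifold R m}.
Context {d : 'I_l -> nat} {C : forall j, manifold R (d j)}.
Variables (f : M -> R) (iota : forall j, C j -> M) (lam : 'I_l -> nat).
Variables (A : 'I_l -> set (chart R m M)) (T Tt : 'I_l -> set M).
Variables (pi : forall j, M -> C j) (fC : forall j, C j -> R).
Variables (rho : 'I_l -> M -> R) (eps : R) (G0 G : M -> 'M[R]_m).
Variables (oM : frame_sign M) (ou os : M -> frame_sign M).
Variables (oC : forall j, frame_sign (C j)) (ouC osC : forall j, C j -> frame_sign (C j)).
Set Implicit Arguments.
Hypothesis mb : morse_bott f iota lam.
Hypothesis pc : perturbation f iota lam A T Tt pi fC rho eps G0 G.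
Hypothesis oh : ordered_by_height f iota.
Hypothesis ish : index_shift f iota lam pi fC rho eps G.

Notation h := (perturbed f pi fC rho eps).
Notation Gc j := (pullback_metric (iota j) G).

Hypotheses (coM : complex_orientation G h oM ou os)
  (coC : forall j, complex_orientation (Gc j) (fC j) (oC j) (ouC j) (osC j))
  (so : suitable_orientations iota lam A fC G ou ouC).

Lemma core_crit j (x : C j) : crit f (iota j x).
Proof. by rewrite (mb_crit mb); exists j => //; exists x. Qed.

Lemma core_dimension j : (d j + lam j <= m)%N.
Proof.
have [x _] := mb_nonempty mb j.
exact: (core_index_le (mb_embedding mb j) (subtube pc j) (dim_core mb j) (smooth_f mb)
  (@core_crit j) (mb_index mb x)).
Qed.

Lemma core_morse_smale j : morse_smale (Gc j) (fC j).
Proof.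
have -> : Gc j = pullback_metric (iota j) G0; last exact: (pc_fC pc).
apply/funext => x; rewrite /pullback_metric (pc_metric_eq pc j) //.
exact: (core_tube pc).
Qed.

Lemma nuZ_core j (q p : C j) k : index_is (Gc j) (fC j) q k.+1 ->
  index_is (Gc j) (fC j) p k ->
  nuZ G h oM ou os (iota j q) (iota j p) = nuZ (Gc j) (fC j) (oC j) (ouC j) (osC j) q p.
Proof.
move=> iq ip; rewrite /nuZ (flow_lines_core mb pc oh) fsbig_image; last exact: (image_iota_inj mb).
have emb := mb_embedding mb j; have tb := subtube pc j.
have iso := @iso_G _ _ _ _ _ _ _ _ _ _ _ _ _ _ _ _ _ _ pc j; have dm := dim_core mb j.
have sfC := smooth_fC pc (j := j); have sh := smooth_h pc; have e0 := pc_eps pc.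
have hE := h_subtube pc (j := j); have posG := pos_G pc.
have trC := core_morse_smale j;
have [orient no suit] := so j.
have dlw : (d j + lam j + (m - (d j + lam j)))%N = m by rewrite subnKC // core_dimension.
have [s sk _] := Ws_slices_core emb tb iso dm sfC posG trC.1 ip.
have iip : index_is G h (iota j p) (k + lam j).
  by apply/(index_core mb ish); exists k => //; rewrite addnC.
have iiq : index_is G h (iota j q) ((1 + k) + lam j).
  by apply/(index_core mb ish); exists (1 + k)%N => //; rewrite addnC.
apply: eq_fsbigr => L /set_mem HL; rewrite /flow_sign.
have E := flow_positive_core emb tb iso dm sfC sh e0 hE dlw posG trC.1 (pc_morse_smale pc).1 no sk
  ip iip iq iiq trC coM (coC j) suit HL.
by rewrite (propext E).
Qed.

Lemma nuZ_up i j (x : C i) (y : C j) : (i < j)%N ->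
  nuZ G h oM ou os (iota i x) (iota j y) = 0.
Proof. by move=> ij; rewrite /nuZ (flow_lines_empty mb pc oh) // fsbig_set0. Qed.

Lemma top_part_Z : top_part_in_kernel f iota lam pi fC rho eps G (nuZ G h oM ou os)
  (fun j => nuZ (Gc j) (fC j) (oC j) (ouC j) (osC j)).
Proof.
apply: (top_part mb ish) => [j q p k|i j x y]; first exact: nuZ_core.
exact: nuZ_up.
Qed.

End IntegerCoefficients.
Theorem corollary10 (R : realType) (m l : nat) (M : manifold R m) (f : M -> R)
    (d : 'I_l -> nat) (C : forall j, manifold R (d j))
    (iota : forall j, C j -> M) (lam : 'I_l -> nat)
    (A : 'I_l -> set (chart R m M)) (T Tt : 'I_l -> set M)
    (pi : forall j, M -> C j) (fC : forall j, C j -> R)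
    (rho : 'I_l -> M -> R) (eps : R) (G0 G : M -> 'M[R]_m) :
  compact [set: M] ->
  morse_bott f iota lam ->
  ordered_by_height f iota ->
  perturbation f iota lam A T Tt pi fC rho eps G0 G ->
  index_shift f iota lam pi fC rho eps G ->
  let h := perturbed f pi fC rho eps in
  let Gc := fun j => pullback_metric (iota j) G in
  top_part_in_kernel f iota lam pi fC rho eps G
    (nuF2 G h) (fun j => nuF2 (Gc j) (fC j)) /\
  (forall (oM : frame_sign M) (ou os : M -> frame_sign M)
      (oC : forall j, frame_sign (C j))
      (ouC osC : forall j, C j -> frame_sign (C j)),
    complex_orientation G h oM ou os ->
    (forall j, complex_orientation (Gc j) (fC j) (oC j) (ouC j) (osC j)) ->
    suitable_orientations iota lam A fC G ou ouC ->
    top_part_in_kernel f iota lam pi fC rho eps G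
      (nuZ G h oM ou os)
      (fun j => nuZ (Gc j) (fC j) (oC j) (ouC j) (osC j))).

Proof.
move=> _ mb oh pc ish; split; first exact: (top_part_F2 mb pc oh ish).
by move=> oM ou os oC ouC osC coM coC so; exact: (top_part_Z mb pc oh ish coM coC so).
Qed.
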